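(* The algebra $\mathcal A=\varprojlim\mathcal A(\mathbf v)$ is generated by the fundamental monopole operators $\mathsf M_{\mathbf m}(f)$, $\mathbf m\in\mathbb N^I$, $f\in\Lambda^{(1^{\mathbf m})}$; and for each $\mathbf v\in\mathbb N^I$, the kernel of the natural surjection $\mathcal A\twoheadrightarrow\mathcal A(\mathbf v)$ is generated as an ideal by those fundamental monopole operators which lie in the kernel.
   Context: Conventions. $\Bbbk$ is a commutative ring, $\mathbb N=\{0,1,2,\dots\}$, $[n]=\{1,\dots,n\}$. $Q=(I,E)$ is a finite quiver (edge loops and multiple edges allowed) with source and target maps $\mathsf s,\mathsf t:E\to I$; $a_{ij}$ is the number of edges from $i$ to $j$ and $c_{ij}=2\delta_{ij}-a_{ij}-a_{ji}$. On $\mathbb Z^I$, $\mathbf v'\le\mathbf v$ means $v'_i\le v_i$ for all $i$, and $(\mathbf v',\mathbf v)=\sum_{i,j}c_{ij}v'_iv_j$. $R=\Bbbk[\tfrac12\hbar,\theta_e:e\in E]$ is a polynomial ring in variables $\tfrac12\hbar,\theta_e$, with $\hbar=2\cdot\tfrac12\hbar$. Difference operators. For $\mathbf v=(v_i)\in\mathbb N^I$ let $\widetilde\Lambda(\mathbf v)=R[w_{i,r}:i\in I,r\in[v_i]]$, on which $S_{\mathbf v}=\prod_iS_{v_i}$ acts by permuting the $w_{i,r}$ for each $i$, and $\Lambda(\mathbf v)=\widetilde\Lambda(\mathbf v)^{S_{\mathbf v}}$. Let $\widetilde A(\mathbf v)$ be the $R$-algebra generated by $w_{i,r},u_{i,r}$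 ($i\in I,r\in[v_i]$) with relations $u_{i,r}w_{j,s}=(w_{j,s}+\hbar\delta_{ij}\delta_{rs})u_{i,r}$, $[u_{i,r},u_{j,s}]=[w_{i,r},w_{j,s}]=0$, and $\widetilde A(\mathbf v)_{loc}$ its Ore localization at the multiplicative set generated by $w_{i,r}-w_{i,s}+n\hbar$ ($r\ne s$, $n\in\mathbb Z$). Quantized zastava. $\mathcal A(\mathbf v)$ is the Braverman–Finkelberg–Nakajima convolution algebra $H_\bullet^{(\mathbf G_{\mathcal O}\rtimes\mathbb C^\times)\times\mathbf F}(\mathcal R^+_{\mathbf G,\mathbf N},\Bbbk)$ for $\mathbf G=\prod_i\mathbf{GL}_{v_i}$, $\mathbf N=\bigoplus_{e}\mathrm{Hom}(\mathbb C^{v_{\mathsf s(e)}},\mathbb C^{v_{\mathsf t(e)}})$, $\mathbf F=\prod_{e\in E}\mathbb C^\times$ scaling the summands. By known results (GKLO embedding and generation by monopole operators) it is identified with the following subalgebra of $\widetilde A(\mathbf v)_{loc}^{S_{\mathbf v}}$, which may be taken as its definition. For $\mathbf 0\le\mathbf m\le\mathbf v$ let $\Lambda^{(1^{\mathbf m})}(\mathbf v)=\widetilde\Lambda(\mathbf v)^{S_{\mathbf m}\times S_{\mathbf v-\mathbf m}}$, where $S_{\mathbf m}\times S_{\mathbf v-\mathbf m}\subseteq S_{\mathbf v}$ is the subgroup preserving each $[m_i]\subseteq[v_i]$. For $f\in\Lambda^{(1^{\mathbf m})}(\mathbf v)$ the fundamental monopole operator (FMO) is $$\mathsf M_{\mathbf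 m}(f)=\sum_{\Gamma}f|_\Gamma\cdot\frac{\prod_{e\in E}\prod_{r\in\Gamma_{\mathsf s(e)},\,s\in[v_{\mathsf t(e)}]\setminus\Gamma_{\mathsf t(e)}}(w_{\mathsf t(e),s}-w_{\mathsf s(e),r}+\theta_e-\tfrac12\hbar)}{\prod_{i\in I}\prod_{r\in\Gamma_i,\,s\in[v_i]\setminus\Gamma_i}(w_{i,r}-w_{i,s})}\prod_{i\in I}\prod_{r\in\Gamma_i}u_{i,r},$$ the sum over tuples $\Gamma=(\Gamma_i)_{i\in I}$ with $\Gamma_i\subseteq[v_i]$, $\#\Gamma_i=m_i$, where $f|_\Gamma=\sigma(f)$ for any $\sigma\in S_{\mathbf v}$ with $\sigma_i([m_i])=\Gamma_i$. $\mathcal A(\mathbf v)$ is the subring generated by all $\mathsf M_{\mathbf m}(f)$; note $\mathsf M_{\mathbf 0}(f)=f$, so $\Lambda(\mathbf v)\subseteq\mathcal A(\mathbf v)$. Grading. Polynomial rings are graded with $\tfrac12\hbar,\theta_e,w_{i,r}$ in degree $1$. $\mathcal A(\mathbf v)$ is $\mathbb Z^I\times\mathbb Z$-graded with $\deg\mathsf M_{\mathbf m}(f)=(\mathbf m,\deg f+\tfrac12(\mathbf m,\mathbf m))$ for homogeneous $f$. Transition maps. For $\mathbf v\ge\mathbf v'$, $f\mapsto\widetilde f$ is the $R$-algebra map $\widetilde\Lambda(\mathbf v)\to\widetilde\Lambda(\mathbf v')$ setting $w_{i,r}=0$ for $v'_i<r\le v_i$, and $\Phi_{\mathbf v,\mathbf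 v'}:\mathcal A(\mathbf v)\twoheadrightarrow\mathcal A(\mathbf v')$ is the graded ring surjection determined by $\mathsf M_{\mathbf m}(f)\mapsto\mathsf M_{\mathbf m}(\widetilde f)$ if $\mathbf m\le\mathbf v'$ and $\mathsf M_{\mathbf m}(f)\mapsto0$ otherwise. Limits. $\mathcal A=\varprojlim\mathcal A(\mathbf v)$ along the $\Phi_{\mathbf v,\mathbf v'}$ is taken in the category of $\mathbb Z^I\times\mathbb Z$-graded rings, i.e. $\mathcal A=\bigoplus_{(\mathbf k,d)}\varprojlim_{\mathbf v}\mathcal A(\mathbf v)_{(\mathbf k,d)}$. Likewise $\Lambda^{(1^{\mathbf m})}=\varprojlim_{\mathbf v\ge\mathbf m}\Lambda^{(1^{\mathbf m})}(\mathbf v)$ along $f\mapsto\widetilde f$, in graded rings. For $f\in\Lambda^{(1^{\mathbf m})}$, the FMO $\mathsf M_{\mathbf m}(f)\in\mathcal A$ is the element whose image in $\mathcal A(\mathbf v)$ is $\mathsf M_{\mathbf m}$ of the image of $f$ in $\Lambda^{(1^{\mathbf m})}(\mathbf v)$ if $\mathbf m\le\mathbf v$, and $0$ otherwise. ''Ideal'' means two-sided ideal. *)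

(* Defs.v *)
From HB Require Import structures.
From mathcomp Require Import all_boot all_order all_algebra fingroup perm.
From mathcomp Require Import generic_quotient boolp.
From mathcomp Require Import mpoly ring.

Set Implicit Arguments.
Unset Strict Implicit.
Unset Printing Implicit Defensive.

Import Order.TTheory GRing.Theory Num.Theory.

Local Open Scope ring_scope.
Local Open Scope quotient_scope.

(** * Localization of a commutative ring *)

(* The localization of A at the multiplicative set generated by the g d.
   The pair (a, [:: d1; ...; dn]) represents a / (g d1 * ... * g dn). *)
Section Localization.
Variables (A : comPzRingType) (D : choiceType) (g : D -> A).
Implicit Types (x y z : A * seq D).

Definition den (s : seq D) : A := \prod_(d <- s) g d.

Lemma den_cat s t : den (s ++ t) = den s * den t.
Proof. exact: big_cat. Qed.

Lemma den_nil : den [::] = 1.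
Proof. exact: big_nil. Qed.

Lemma den_cons d s : den (d :: s) = g d * den s.
Proof. exact: big_cons. Qed.

Definition loc_rel x y : bool :=
  `[< exists u, den u * (x.1 * den y.2) = den u * (y.1 * den x.2) >].

Lemma loc_relP x y :
  reflect (exists u, den u * (x.1 * den y.2) = den u * (y.1 * den x.2))
    (loc_rel x y).
Proof. exact: asboolP. Qed.

Lemma loc_refl : reflexive loc_rel.
Proof. by move=> x; apply/loc_relP; exists [::]. Qed.

Lemma loc_sym : ssrbool.symmetric loc_rel.
Proof. by move=> x y; apply/loc_relP/loc_relP => -[u e]; exists u. Qed.

Lemma loc_trans : transitive loc_rel.
Proof.
move=> y x z /loc_relP[u e] /loc_relP[u' e']; apply/loc_relP.
exists (u ++ u' ++ y.2); rewrite !den_cat.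
transitivity (den u' * den z.2 * (den u * (x.1 * den y.2))); first by ring.
rewrite e.
transitivity (den u * den x.2 * (den u' * (y.1 * den z.2))); first by ring.
by rewrite e'; ring.
Qed.

Canonical loc_equiv := EquivRel loc_rel loc_refl loc_sym loc_trans.

Definition loc := {eq_quot loc_equiv}.
HB.instance Definition _ := Choice.on loc.
HB.instance Definition _ : EqQuotient _ loc_rel loc := EqQuotient.on loc.

Definition frac (a : A) (s : seq D) : loc := \pi_loc (a, s).

Lemma fracP (a b : A) (s t : seq D) :
  frac a s = frac b t <->
  exists u, den u * (a * den t) = den u * (b * den s).
Proof.
split=> [/eqmodP/loc_relP //|e]; by apply/eqmodP/loc_relP.
Qed.

Lemma frac_eq (a b : A) (s t : seq D) :
  a * den t = b * den s -> frac a s = frac b t.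
Proof. by move=> e; apply/fracP; exists [::]; rewrite e. Qed.

Lemma locW (P : loc -> Prop) : (forall a s, P (frac a s)) -> forall p : loc, P p.
Proof. by move=> h p; rewrite -[p]reprK; case: (repr p). Qed.

(* Operations on pairs, and their descent to the quotient. *)
Let addp x y : A * seq D := (x.1 * den y.2 + y.1 * den x.2, x.2 ++ y.2).
Let mulp x y : A * seq D := (x.1 * y.1, x.2 ++ y.2).

Definition loc_add (p q : loc) : loc := \pi_loc (addp (repr p) (repr q)).
Definition loc_mul (p q : loc) : loc := \pi_loc (mulp (repr p) (repr q)).
Definition loc_opp (p : loc) : loc := \pi_loc (- (repr p).1, (repr p).2).

Lemma frac_repr (a : A) (s : seq D) :
  exists u, den u * ((repr (frac a s)).1 * den s)
          = den u * (a * den (repr (frac a s)).2).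
Proof.
by apply/fracP; rewrite -[RHS]reprK /frac; case: (repr _).
Qed.

Lemma loc_addE a s b t :
  loc_add (frac a s) (frac b t) = frac (a * den t + b * den s) (s ++ t).
Proof.
have [u eu] := frac_repr a s; have [u' eu'] := frac_repr b t.
rewrite /loc_add /addp.
move: (repr _) eu => [a' s'] /= eu; move: (repr _) eu' => [b' t'] /= eu'.
apply/fracP; exists (u ++ u'); rewrite !den_cat.
transitivity (den u' * den t * den t' * (den u * (a' * den s))
              + den u * den s * den s' * (den u' * (b' * den t))); first by ring.
by rewrite eu eu'; ring.
Qed.

Lemma loc_mulE a s b t :
  loc_mul (frac a s) (frac b t) = frac (a * b) (s ++ t).
Proof.
have [u eu] := frac_repr a s; have [u' eu'] := frac_repr b t.
rewrite /loc_mul /mulp.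
move: (repr _) eu => [a' s'] /= eu; move: (repr _) eu' => [b' t'] /= eu'.
apply/fracP; exists (u ++ u'); rewrite !den_cat.
transitivity ((den u * (a' * den s)) * (den u' * (b' * den t))); first by ring.
by rewrite eu eu'; ring.
Qed.

Lemma loc_oppE a s : loc_opp (frac a s) = frac (- a) s.
Proof.
have [u eu] := frac_repr a s; rewrite /loc_opp.
move: (repr _) eu => [a' s'] /= eu.
by apply/fracP; exists u; rewrite !mulNr !mulrN eu.
Qed.

Fact loc_addA : associative loc_add.
Proof.
elim/locW => a s; elim/locW => b t; elim/locW => c u.
by rewrite !loc_addE; apply: frac_eq; rewrite !den_cat; ring.
Qed.

Fact loc_addC : commutative loc_add.
Proof.
elim/locW => a s; elim/locW => b t.
by rewrite !loc_addE; apply: frac_eq; rewrite !den_cat; ring.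
Qed.

Fact loc_add0 : left_id (frac 0 [::]) loc_add.
Proof.
elim/locW => a s; rewrite loc_addE; apply: frac_eq.
by rewrite /= den_nil; ring.
Qed.

Fact loc_addN : left_inverse (frac 0 [::]) loc_opp loc_add.
Proof.
elim/locW => a s; rewrite loc_oppE loc_addE; apply: frac_eq.
by rewrite den_nil; ring.
Qed.

HB.instance Definition _ :=
  GRing.isZmodule.Build loc loc_addA loc_addC loc_add0 loc_addN.

Fact loc_mulA : associative loc_mul.
Proof.
elim/locW => a s; elim/locW => b t; elim/locW => c u.
by rewrite !loc_mulE; apply: frac_eq; rewrite !den_cat; ring.
Qed.

Fact loc_mulC : commutative loc_mul.
Proof.
elim/locW => a s; elim/locW => b t.
by rewrite !loc_mulE; apply: frac_eq; rewrite !den_cat; ring.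
Qed.

Fact loc_mul1 : left_id (frac 1 [::]) loc_mul.
Proof.
by elim/locW => a s; rewrite loc_mulE; apply: frac_eq; rewrite /= mul1r.
Qed.

Fact loc_mulDl : left_distributive loc_mul loc_add.
Proof.
elim/locW => a s; elim/locW => b t; elim/locW => c u.
rewrite !(loc_mulE, loc_addE); apply: frac_eq.
by rewrite !den_cat; ring.
Qed.

HB.instance Definition _ :=
  GRing.Zmodule_isComPzRing.Build loc loc_mulA loc_mulC loc_mul1 loc_mulDl.

Lemma fracD a s b t :
  frac a s + frac b t = frac (a * den t + b * den s) (s ++ t).
Proof. exact: loc_addE. Qed.

Lemma fracM a s b t : frac a s * frac b t = frac (a * b) (s ++ t).
Proof. exact: loc_mulE. Qed.

Lemma fracN a s : - frac a s = frac (- a) s.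
Proof. exact: loc_oppE. Qed.

Lemma frac1E : frac 1 [::] = 1. Proof. by []. Qed.
Lemma frac0E : frac 0 [::] = 0. Proof. by []. Qed.

Lemma loc_nontrivial : (forall s, den s != 0) -> 1 != 0 :> loc.
Proof.
move=> den_neq0; apply/eqP => /fracP[u].
by rewrite den_nil !mulr1 mulr0 => /eqP; rewrite (negbTE (den_neq0 u)).
Qed.

End Localization.

(* A ring endomorphism permuting the inverted elements extends to loc g. *)
Record loc_endo (A : comPzRingType) (D : choiceType) (g : D -> A) := LocEndo {
  endo :> {rmorphism A -> A};
  endo_den : D -> D;
  endoP : forall d, endo (g d) = g (endo_den d) }.

Section LocMap.
Variables (A : comPzRingType) (D : choiceType) (g : D -> A).
Variable (tau : loc_endo g).

Definition loc_map (p : loc g) : loc g :=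
  frac g (tau (repr p).1) (map (endo_den tau) (repr p).2).

Let den_map s : den g (map (endo_den tau) s) = tau (den g s).
Proof.
by rewrite /den big_map rmorph_prod; apply: eq_bigr => d _; rewrite endoP.
Qed.

Lemma loc_mapE a s :
  loc_map (frac g a s) = frac g (tau a) (map (endo_den tau) s).
Proof.
have [u eu] := frac_repr g a s; rewrite /loc_map.
move: (repr _) eu => [a' s'] /= eu.
apply/fracP; exists (map (endo_den tau) u).
by rewrite !den_map -!rmorphM /= eu.
Qed.

Fact loc_map_zmod_morphism : zmod_morphism loc_map.
Proof.
elim/locW => a s; elim/locW => b t.
rewrite fracN fracD !loc_mapE fracN fracD; apply: frac_eq.
by rewrite !map_cat !den_cat !den_map rmorphD !rmorphM rmorphN.
Qed.

Fact loc_map_monoid_morphism : monoid_morphism loc_map.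
Proof.
split; first by rewrite -frac1E loc_mapE rmorph1.
elim/locW => a s; elim/locW => b t.
by rewrite fracM !loc_mapE fracM rmorphM map_cat.
Qed.

HB.instance Definition _ :=
  GRing.isZmodMorphism.Build (loc g) (loc g) loc_map loc_map_zmod_morphism.
HB.instance Definition _ :=
  GRing.isMonoidMorphism.Build (loc g) (loc g) loc_map loc_map_monoid_morphism.

End LocMap.

(* The universal property of the localization. *)
Section LocUniversal.
Variables (A : comPzRingType) (D : choiceType) (g : D -> A).
Variables (T : pzRingType) (phi : {rmorphism A -> T}) (z : D -> T).
Hypothesis gz : forall d, phi (g d) * z d = 1.
Hypothesis zg : forall d, z d * phi (g d) = 1.

Let iden (s : seq D) : T := \prod_(d <- s) z d.

Let z_comm d a : z d * phi a = phi a * z d.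
Proof.
rewrite -[LHS]mulr1 -(gz d) -mulrA (mulrA (phi a)) -rmorphM [a * _]mulrC.
by rewrite rmorphM !mulrA zg mul1r.
Qed.

Let iden_comm s a : iden s * phi a = phi a * iden s.
Proof.
rewrite /iden; elim: s => [|d s IH]; first by rewrite !big_nil mul1r mulr1.
by rewrite !big_cons -mulrA IH !mulrA z_comm.
Qed.

Let den_iden s : phi (den g s) * iden s = 1.
Proof.
rewrite /iden; elim: s => [|d s IH].
  by rewrite den_nil big_nil rmorph1 mul1r.
rewrite den_cons big_cons [g d * _]mulrC rmorphM -mulrA (mulrA (phi (g d))).
by rewrite gz mul1r.
Qed.

Definition loc_lift (p : loc g) : T :=
  phi (repr p).1 * \prod_(d <- (repr p).2) z d.

Fact loc_lift_frac a s : loc_lift (frac g a s) = phi a * \prod_(d <- s) z d.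
Proof.
have [u] := frac_repr g a s; rewrite /loc_lift.
move: (repr _) => [a' s'] /= eu; rewrite -!/(iden _).
have cancel_u b : phi (den g u * b) * iden u = phi b.
  by rewrite mulrC rmorphM -mulrA den_iden mulr1.
have {}eu : phi (a' * den g s) = phi (a * den g s').
  by rewrite -cancel_u eu cancel_u.
have -> : phi a' = phi (a' * den g s) * iden s.
  by rewrite rmorphM -mulrA den_iden mulr1.
rewrite eu rmorphM -!mulrA; congr (_ * _).
have -> : phi (den g s') * (iden s * iden s') = iden s * 1.
  by rewrite mulrA -iden_comm -mulrA den_iden.
by rewrite mulr1.
Qed.

Let lift_add a s b t : phi (a * den g t + b * den g s) * iden (s ++ t) =
  phi a * iden s + phi b * iden t.
Proof.
have -> : iden (s ++ t) = iden s * iden t by apply: big_cat.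
rewrite rmorphD !rmorphM mulrDl -!mulrA; congr (_ * _ + _ * _).
  by rewrite mulrA -iden_comm -mulrA den_iden mulr1.
by rewrite mulrA den_iden mul1r.
Qed.

Fact loc_lift_zmod_morphism : zmod_morphism loc_lift.
Proof.
elim/locW => a s; elim/locW => b t.
by rewrite fracN fracD !loc_lift_frac lift_add rmorphN mulNr.
Qed.

Fact loc_lift_monoid_morphism : monoid_morphism loc_lift.
Proof.
split; first by rewrite -frac1E loc_lift_frac big_nil rmorph1 mulr1.
elim/locW => a s; elim/locW => b t.
rewrite fracM !loc_lift_frac big_cat rmorphM -!/(iden _) -!mulrA.
by congr (_ * _); rewrite !mulrA iden_comm.
Qed.

HB.instance Definition _ :=
  GRing.isZmodMorphism.Build (loc g) T loc_lift loc_lift_zmod_morphism.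
HB.instance Definition _ :=
  GRing.isMonoidMorphism.Build (loc g) T loc_lift loc_lift_monoid_morphism.

Lemma loc_universal :
  exists F : {rmorphism loc g -> T},
    forall a s, F (frac g a s) = phi a * \prod_(d <- s) z d.
Proof. by exists loc_lift; apply: loc_lift_frac. Qed.

End LocUniversal.

Lemma frac_den (A : comPzRingType) (D : choiceType) (g : D -> A) d :
  frac g (g d) [::] * frac g 1 [:: d] = 1.
Proof.
by rewrite fracM -frac1E; apply: frac_eq; rewrite !den_cons !den_nil !mulr1 mul1r.
Qed.

Lemma fracE (A : comPzRingType) (D : choiceType) (g : D -> A) a s :
  frac g a s = frac g a [::] * \prod_(d <- s) frac g 1 [:: d].
Proof.
elim: s a => [|d s IH] a; first by rewrite big_nil mulr1.
by rewrite big_cons mulrCA -IH fracM mul1r.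
Qed.

Lemma loc_lift_unique (A : comPzRingType) (D : choiceType) (g : D -> A)
    (T : pzRingType) (F G : {rmorphism loc g -> T}) :
  (forall a, F (frac g a [::]) = G (frac g a [::])) -> F =1 G.
Proof.
move=> FG; elim/locW => a s; rewrite fracE !rmorphM FG !rmorph_prod.
congr (_ * _); apply: eq_bigr => d _.
rewrite -[LHS]mulr1 -(rmorph1 G) -(frac_den g d) rmorphM -FG mulrA -rmorphM.
by rewrite [_ * frac g (g d) _]mulrC frac_den rmorph1 mul1r.
Qed.


(** * Skew monoid rings over N^n *)

(* An action of the additive monoid N^n of multinomials on a ring, by ring
   endomorphisms. *)
Record monom_action (B : nzRingType) (n : nat) := MonomAction {
  mact :> 'X_{1..n} -> {rmorphism B -> B};
  mact0 : forall b, mact 0%MM b = b;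
  mactD : forall k l b, mact (k + l)%MM b = mact k (mact l b) }.

(* The free left B-module on the monomials u^k, with u^k b = tau_k(b) u^k.
   Only the additive group of {mpoly B[n]} is used: the product is twisted. *)
Definition skew (B : nzRingType) (n : nat) (tau : monom_action B n) :=
  {mpoly B[n]}.

(* Stated over an abstract group, so that rewriting does not unfold mpoly. *)
Lemma skew_assoc_aux (B : nzRingType) (n : nat)
    (tau : monom_action B n) (V : zmodType) (U : 'X_{1..n} -> B -> V)
    (mul : V -> V -> V) :
    (forall P : V -> Prop, (forall k b, P (U k b)) -> P 0 ->
      (forall p q, P p -> P q -> P (p + q)) -> forall p, P p) ->
    left_distributive mul +%R -> right_distributive mul +%R ->
    left_zero 0 mul -> right_zero 0 mul ->
    (forall k b l c, mul (U k b) (U l c) = U (k + l)%MM (b * tau k c)) ->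
  [/\ associative mul, left_id (U 0%MM 1) mul & right_id (U 0%MM 1) mul].
Proof.
move=> ind mDl mDr m0l m0r mU; split=> [p q r|p|p].
- elim/ind: p => [k b||p p' IH IH'].
  + elim/ind: q => [l c||q q' IH IH'].
    * elim/ind: r => [o d||r r' IH IH'].
      - by rewrite !mU rmorphM mactD mulrA addmA.
      - by rewrite !m0r.
      - by rewrite !mDr IH IH'.
    * by rewrite m0l m0r m0l.
    * by rewrite mDl !mDr mDl IH IH'.
  + by rewrite !m0l.
  + by rewrite !mDl IH IH'.
- elim/ind: p => [k b||p p' IH IH']; rewrite ?m0r ?mDr ?IH ?IH' //.
  by rewrite mU mul1r add0m mact0.
- elim/ind: p => [k b||p p' IH IH']; rewrite ?m0l ?mDl ?IH ?IH' //.
  by rewrite mU rmorph1 mulr1 addm0.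
Qed.

Lemma msupp_sumD (B : nzRingType) (n : nat) (V : zmodType)
    (F : 'X_{1..n} -> B -> V) (p q : {mpoly B[n]}) :
    (forall k b c, F k (b + c) = F k b + F k c) ->
  \sum_(k <- msupp (p + q)) F k (p + q)@_k =
    \sum_(k <- msupp p) F k p@_k + \sum_(k <- msupp q) F k q@_k.
Proof.
move=> FD; have F0 k : F k 0 = 0.
  by apply: (addIr (F k 0)); rewrite -FD !add0r.
have widen (r : seq 'X_{1..n}) (s : {mpoly B[n]}) :
    uniq r -> {subset msupp s <= r} ->
    \sum_(k <- msupp s) F k s@_k = \sum_(k <- r) F k s@_k.
  move=> r_uniq s_r; rewrite [RHS](bigID (mem (msupp s))) /= [X in _ + X]big1 ?addr0.
    rewrite -[RHS]big_filter; apply: perm_big; apply: uniq_perm; rewrite ?filter_uniq //.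
    by move=> k; rewrite mem_filter; case: (boolP (k \in msupp s)) => // /s_r ->.
  by move=> k /memN_msupp_eq0 ->; apply: F0.
pose r := undup (msupp p ++ msupp q).
have r_uniq : uniq r := undup_uniq _.
rewrite (widen r (p + q)) // => [|k /msuppD_le]; last by rewrite mem_undup.
rewrite (widen r p) // => [|k kp]; last by rewrite mem_undup mem_cat kp.
rewrite (widen r q) // => [|k kq]; last by rewrite mem_undup mem_cat kq orbT.
by rewrite -big_split; apply: eq_bigr => k _; rewrite mcoeffD FD.
Qed.

Section Skew.
Variables (B : nzRingType) (n : nat) (tau : monom_action B n).
Local Notation S := (skew tau).
Implicit Types (p q r : S) (k l : 'X_{1..n}).

HB.instance Definition _ := GRing.Zmodule.on S.

Definition skewm (b : B) k : S := b *: 'X_[k].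

Definition skew_mul p q : S :=
  \sum_(k <- msupp p) \sum_(l <- msupp q)
    skewm (p@_k * tau k q@_l) (k + l)%MM.

Let skewmD b c k : skewm (b + c) k = skewm b k + skewm c k.
Proof. exact: scalerDl. Qed.

Lemma skew_ind (P : S -> Prop) :
    (forall b k, P (skewm b k)) -> P 0 ->
    (forall p q, P p -> P q -> P (p + q)) ->
  forall p, P p.
Proof.
by move=> PU P0 PD p; rewrite [p]mpolyE; elim/big_ind: _ => // k _; apply: PU.
Qed.

Fact skew_mulDl : left_distributive skew_mul +%R.
Proof.
move=> p q r.
rewrite /skew_mul (msupp_sumD (V := S) (F := fun k b =>
  \sum_(l <- msupp r) skewm (b * tau k r@_l) (k + l)%MM)) // => k b c.
by rewrite -big_split; apply: eq_bigr => l _; rewrite mulrDl skewmD.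
Qed.

Fact skew_mulDr : right_distributive skew_mul +%R.
Proof.
move=> r p q; rewrite /skew_mul -big_split; apply: eq_bigr => k _.
rewrite (msupp_sumD (V := S) (F := fun l b =>
  skewm (r@_k * tau k b) (k + l)%MM)) // => l b c.
by rewrite rmorphD mulrDr skewmD.
Qed.

Fact skew_mul0l : left_zero 0 skew_mul.
Proof. by move=> p; rewrite /skew_mul msupp0 big_nil. Qed.

Fact skew_mul0r : right_zero 0 skew_mul.
Proof. by move=> p; rewrite /skew_mul msupp0 big1 // => k _; rewrite big_nil. Qed.

Fact skew_mulUU k b l c :
  skew_mul (skewm b k) (skewm c l) = skewm (b * tau k c) (k + l)%MM.
Proof.
have skewm0 m : skewm 0 m = 0 by apply: scale0r.
have [->|b0] := eqVneq b 0; first by rewrite mul0r !skewm0 skew_mul0l.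
have [->|c0] := eqVneq c 0; first by rewrite rmorph0 mulr0 !skewm0 skew_mul0r.
by rewrite /skew_mul {1 2}/skewm !msuppMCX // !big_seq1 !mcoeffZ !mcoeffX !eqxx !mulr1.
Qed.

Fact skew_ring_axioms :
  [/\ associative skew_mul, left_id (skewm 1 0%MM) skew_mul
     & right_id (skewm 1 0%MM) skew_mul].
Proof.
apply: (skew_assoc_aux (tau := tau) (V := S) (U := fun k b => skewm b k) _
  skew_mulDl skew_mulDr skew_mul0l skew_mul0r).
  by move=> P PU; apply: skew_ind => b m; apply: PU.
by move=> k b l c; apply: skew_mulUU.
Qed.

HB.instance Definition _ := GRing.Zmodule_isPzRing.Build S
  (let: And3 a _ _ := skew_ring_axioms in a)
  (let: And3 _ l _ := skew_ring_axioms in l)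
  (let: And3 _ _ r := skew_ring_axioms in r) skew_mulDl skew_mulDr.

Definition skewC (b : B) : S := skewm b 0%MM.
Definition skewU (i : 'I_n) : S := skewm 1 U_(i)%MM.

Lemma skewmM b k c l : skewm b k * skewm c l = skewm (b * tau k c) (k + l)%MM.
Proof. exact: skew_mulUU. Qed.

Fact skewC_zmod_morphism : zmod_morphism skewC.
Proof. by move=> b c; apply: scalerBl. Qed.

Fact skewC_monoid_morphism : monoid_morphism skewC.
Proof. by split=> // b c; rewrite /skewC skewmM mact0 addm0. Qed.

HB.instance Definition _ :=
  GRing.isZmodMorphism.Build B S skewC skewC_zmod_morphism.
HB.instance Definition _ :=
  GRing.isMonoidMorphism.Build B S skewC skewC_monoid_morphism.

Lemma skewUC i b : skewU i * skewC b = skewC (tau U_(i)%MM b) * skewU i.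
Proof. by rewrite /skewU /skewC !skewmM mul1r mact0 mulr1 addm0 add0m. Qed.

Lemma skewUU i j : skewU i * skewU j = skewU j * skewU i.
Proof. by rewrite /skewU !skewmM !mul1r !rmorph1 addmC. Qed.

End Skew.

(* The universal property of skew tau. *)
Section SkewUniversal.
Variables (B : nzRingType) (n : nat) (tau : monom_action B n).
Variables (T : pzRingType) (phi : {rmorphism B -> T}) (U : 'I_n -> T).
Hypothesis U_comm : forall i j, U i * U j = U j * U i.
Hypothesis U_phi : forall i b, U i * phi b = phi (tau U_(i)%MM b) * U i.
Local Notation S := (skew tau).

Let Upow (k : 'X_{1..n}) : T := \prod_(i < n) U i ^+ k i.

Let Upow0 : Upow 0%MM = 1.
Proof. by rewrite /Upow big1 // => i _; rewrite mnm0E. Qed.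

Let UpowD k l : Upow (k + l)%MM = Upow k * Upow l.
Proof.
rewrite /Upow -prodrM_comm => [|i j _ _]; last first.
  by apply: commrX; apply: commr_sym; apply: commrX; apply: U_comm.
by apply: eq_bigr => i _; rewrite mnmDE exprD.
Qed.

Let UpowU i : Upow U_(i)%MM = U i.
Proof.
rewrite /Upow -[RHS](big_pred1_eq *%R i U) [RHS]big_mkcond /=.
by apply: eq_bigr => j _; rewrite mnm1E eq_sym; case: eqP => // ->.
Qed.

Let Upow_phi k b : Upow k * phi b = phi (tau k b) * Upow k.
Proof.
have [d] := ubnP (mdeg k); elim: d => // d IH in k b *; rewrite ltnS => kd.
have [->|k0] := eqVneq k 0%MM; first by rewrite Upow0 mact0 mul1r mulr1.
have /existsP[i ki] : [exists i, k i != 0%N].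
  apply: contra_neqT k0 => /existsPn k0; apply/mnmP => i.
  by rewrite mnm0E; apply/eqP; rewrite -[_ == _]negbK k0.
have ik : (U_(i) <= k)%MM by rewrite lep1mP.
have kE : k = (U_(i) + (k - U_(i)))%MM by rewrite addmC submK.
rewrite kE UpowD UpowU -mulrA IH; last first.
  by apply: leq_trans kd; rewrite [in X in (_ < X)%N]kE mdegD mdeg1.
by rewrite mulrA U_phi -mulrA -mactD.
Qed.

Definition skew_lift (p : S) : T :=
  \sum_(k <- msupp p) phi p@_k * \prod_(i < n) U i ^+ k i.

Fact skew_liftD p q : skew_lift (p + q) = skew_lift p + skew_lift q.
Proof.
rewrite /skew_lift (msupp_sumD (F := fun k b => phi b * Upow k)) //.
by move=> k b c; rewrite rmorphD mulrDl.
Qed.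

Fact skew_lift0 : skew_lift 0 = 0.
Proof. by rewrite /skew_lift msupp0 big_nil. Qed.

Fact skew_lift_skewm b k :
  skew_lift (skewm tau b k) = phi b * \prod_(i < n) U i ^+ k i.
Proof.
have [->|b0] := eqVneq b 0.
  by rewrite rmorph0 mul0r /skewm scale0r skew_lift0.
rewrite /skew_lift /skewm msuppMCX // big_seq1.
by rewrite mcoeffZ mcoeffX eqxx mulr1.
Qed.

Fact skew_lift_zmod_morphism : zmod_morphism skew_lift.
Proof.
move=> p q; apply: (addIr (skew_lift q)).
by rewrite -skew_liftD !subrK.
Qed.

Fact skew_lift_monoid_morphism : monoid_morphism skew_lift.
Proof.
split; first by rewrite [skew_lift 1]skew_lift_skewm rmorph1 mul1r [\prod_i _]Upow0.
have lift0 := skew_lift0; have liftD := skew_liftD.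
elim/skew_ind => [b k q||p p' IH IH' q]; last first.
- by rewrite mulrDl !liftD mulrDl IH IH'.
- by move=> q; rewrite mul0r lift0 mul0r.
elim/skew_ind: q => [c l||q q' IH IH']; last first.
- by rewrite mulrDr !liftD mulrDr IH IH'.
- by rewrite mulr0 lift0 mulr0.
rewrite skewmM !skew_lift_skewm -!/(Upow _) rmorphM UpowD.
by rewrite -!mulrA; congr (_ * _); rewrite !mulrA Upow_phi.
Qed.

HB.instance Definition _ :=
  GRing.isZmodMorphism.Build S T skew_lift skew_lift_zmod_morphism.
HB.instance Definition _ :=
  GRing.isMonoidMorphism.Build S T skew_lift skew_lift_monoid_morphism.

Lemma skew_universal :
  exists F : {rmorphism S -> T},
    (forall b, F (skewC tau b) = phi b) /\ (forall i, F (skewU tau i) = U i).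
Proof.
exists skew_lift; split=> [b|i] /=; rewrite skew_lift_skewm.
- by rewrite [\prod_i _]Upow0 mulr1.
- by rewrite [\prod_i _]UpowU rmorph1 mul1r.
Qed.

End SkewUniversal.

Lemma skewmE (B : nzRingType) n (tau : monom_action B n) b k :
  skewm tau b k = skewC tau b * \prod_(i < n) skewU tau i ^+ k i.
Proof.
have m1D l l' : skewm tau 1 (l + l')%MM = skewm tau 1 l * skewm tau 1 l'.
  by rewrite skewmM rmorph1 mul1r.
have -> : \prod_(i < n) skewU tau i ^+ k i = skewm tau 1 k.
  rewrite [in RHS](multinomUE_id k) (big_morph _ m1D (erefl 1)).
  apply: eq_bigr => i _; elim: (k i) => [|d IH]; first by rewrite mulm0n.
  by rewrite exprS IH mulmS m1D.
by rewrite skewmM mact0 mulr1 add0m.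
Qed.

Lemma skew_lift_unique (B : nzRingType) n (tau : monom_action B n)
    (T : pzRingType) (F G : {rmorphism skew tau -> T}) :
    (forall b, F (skewC tau b) = G (skewC tau b)) ->
    (forall i, F (skewU tau i) = G (skewU tau i)) ->
  F =1 G.
Proof.
move=> FGC FGU; elim/skew_ind => [b k||p q IH IH'].
- rewrite skewmE !rmorphM FGC !rmorph_prod; congr (_ * _).
  by apply: eq_bigr => i _; rewrite !rmorphXn FGU.
- by rewrite !rmorph0.
- by rewrite !rmorphD IH IH'.
Qed.

(** * Subrings, ideals, products of rings *)

Inductive subring_gen (T : pzRingType) (G : T -> Prop) : T -> Prop :=
  | subring_gen_in a of G a : subring_gen G a
  | subring_gen1 : subring_gen G 1
  | subring_genB a b of subring_gen G a & subring_gen G b :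
      subring_gen G (a - b)
  | subring_genM a b of subring_gen G a & subring_gen G b :
      subring_gen G (a * b).

(* The two-sided ideal of the subring A of T generated by G. *)
Inductive ideal_gen (T : pzRingType) (A G : T -> Prop) : T -> Prop :=
  | ideal_gen_in a b g of A a & G g & A b : ideal_gen A G (a * g * b)
  | ideal_gen0 : ideal_gen A G 0
  | ideal_genD a b of ideal_gen A G a & ideal_gen A G b :
      ideal_gen A G (a + b).

(* The additive subgroup generated by G, for G closed under opposite. *)
Inductive sum_gen (T : zmodType) (G : T -> Prop) : T -> Prop :=
  | sum_gen_in a of G a : sum_gen G a
  | sum_gen0 : sum_gen G 0
  | sum_genD a b of sum_gen G a & sum_gen G b : sum_gen G (a + b).

Definition family_ring (T : Type) (R : T -> pzRingType) := forall t, R t.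

Section FamilyRing.
Variables (T : Type) (R : T -> pzRingType).
Local Notation F := (family_ring R).
Implicit Types a b c : F.

HB.instance Definition _ := gen_eqMixin F.
HB.instance Definition _ := gen_choiceMixin F.

Let add a b : F := fun t => a t + b t.
Let mul a b : F := fun t => a t * b t.
Let opp a : F := fun t => - a t.
Let zero : F := fun t => 0.
Let one : F := fun t => 1.

Fact family_addA : associative add.
Proof. by move=> a b c; apply: functional_extensionality_dep => t; apply: addrA. Qed.
Fact family_addC : commutative add.
Proof. by move=> a b; apply: functional_extensionality_dep => t; apply: addrC. Qed.
Fact family_add0 : left_id zero add.
Proof. by move=> a; apply: functional_extensionality_dep => t; apply: add0r. Qed.
Fact family_addN : left_inverse zero opp add.
Proof. by move=> a; apply: functional_extensionality_dep => t; apply: addNr. Qed.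

HB.instance Definition _ :=
  GRing.isZmodule.Build F family_addA family_addC family_add0 family_addN.

Fact family_mulA : associative mul.
Proof. by move=> a b c; apply: functional_extensionality_dep => t; apply: mulrA. Qed.
Fact family_mul1l : left_id one mul.
Proof. by move=> a; apply: functional_extensionality_dep => t; apply: mul1r. Qed.
Fact family_mul1r : right_id one mul.
Proof. by move=> a; apply: functional_extensionality_dep => t; apply: mulr1. Qed.
Fact family_mulDl : left_distributive mul add.
Proof. by move=> a b c; apply: functional_extensionality_dep => t; apply: mulrDl. Qed.
Fact family_mulDr : right_distributive mul add.
Proof. by move=> a b c; apply: functional_extensionality_dep => t; apply: mulrDr. Qed.

HB.instance Definition _ := GRing.Zmodule_isPzRing.Build F
  family_mulA family_mul1l family_mul1r family_mulDl family_mulDr.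
End FamilyRing.

(** * Quivers *)

Record quiver := Quiver {
  vert : finType;
  edge : finType;
  src : edge -> vert;
  tgt : edge -> vert }.

Arguments src {q}.
Arguments tgt {q}.

Section Quiver.
Variable Q : quiver.
Implicit Types i j : vert Q.

Definition nedges i j : nat := #|[set e : edge Q | (src e == i) && (tgt e == j)]|.

Definition cartan i j : int :=
  2 * (i == j)%:R - (nedges i j)%:Z - (nedges j i)%:Z.

Definition cform (a b : {ffun vert Q -> int}) : int :=
  \sum_i \sum_j cartan i j * a i * b j.

Definition dimvec := {ffun vert Q -> nat}.

Definition dimvec_le (v' v : dimvec) : bool := [forall i, v' i <= v i]%N.

Definition dimZ (v : dimvec) : {ffun vert Q -> int} := [ffun i => (v i)%:Z].

(* The grading group Z^I x Z. *)
Definition deg := ({ffun vert Q -> int} * int)%type.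

(* (m, m) is even, so the division by 2 is exact. *)
Definition degM (m : dimvec) (d : nat) : deg :=
  (dimZ m, d%:Z + (cform (dimZ m) (dimZ m) %/ 2)%Z).
End Quiver.

(** * Polynomial rings *)

Section Zastava.
Variables (k : comNzRingType) (Q : quiver).
Implicit Types (v m : dimvec Q).

(* The index set of the w_{i,r} and u_{i,r}; [n] is encoded by 'I_n. *)
Definition widx v : finType := {i : vert Q & 'I_(v i)}.

Definition wpos v (x : widx v) : nat := nat_of_ord (tagged x).

(* The variables: inl None is hbar / 2, inl (Some e) is theta_e and
   inr (i, r) is w_{i,r}. *)
Definition var v : finType := (option (edge Q) + widx v)%type.

(* The ring Lambda~(v) = R[w_{i,r}], flattened to a polynomial ring over k. *)
Definition tLam v := {mpoly k[#|var v|]}.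
HB.instance Definition _ v := GRing.ComNzRing.on (tLam v).

Definition pvar v (z : var v) : tLam v := 'X_(enum_rank z).
Definition hbar2 v : tLam v := pvar (inl None).
Definition hbar v : tLam v := 2%:R * hbar2 v.
Definition theta v (e : edge Q) : tLam v := pvar (inl (Some e)).
Definition wvar v (x : widx v) : tLam v := pvar (inr x).

Definition psubst v v' (h : var v -> tLam v') : tLam v -> tLam v' :=
  mmap (@mpolyC #|var v'| k) (h \o enum_val).
HB.instance Definition _ v v' (h : var v -> tLam v') :=
  GRing.RMorphism.copy (psubst h) (mmap (@mpolyC #|var v'| k) (h \o enum_val)).

(* The R-algebra map sending w_x to h x. *)
Definition wsubst v v' (h : widx v -> tLam v') : tLam v -> tLam v' :=
  psubst (fun z => match z with inl b => pvar (inl b) | inr x => h x end).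
HB.instance Definition _ v v' (h : widx v -> tLam v') :=
  GRing.RMorphism.on (wsubst h).

Lemma psubst_pvar v v' (h : var v -> tLam v') z : psubst h (pvar z) = h z.
Proof. by rewrite /psubst /pvar mmapX mmap1U /= enum_rankK. Qed.

Lemma psubst_ext v (R : nzRingType) (f g : {rmorphism tLam v -> R}) :
  (forall c, f c%:MP = g c%:MP) -> (forall z, f (pvar z) = g (pvar z)) ->
  f =1 g.
Proof.
move=> fgC fgX; elim/mpolyind => [|c m p _ _ IH]; first by rewrite !rmorph0.
rewrite !rmorphD IH -mul_mpolyC !rmorphM; congr (_ * _ + _); first exact: fgC.
rewrite mpolyXE_id !rmorph_prod; apply: eq_bigr => i _.
rewrite !rmorphXn; congr (_ ^+ _).
by have := fgX (enum_val i); rewrite /pvar enum_valK.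
Qed.

Definition isHomog v (d : nat) (f : tLam v) : bool := f \is d.-homog.

(** Symmetric group actions. *)

Definition Sv v (s : {perm widx v}) : bool := [forall x, tag (s x) == tag x].

Definition wperm v (s : {perm widx v}) : tLam v -> tLam v :=
  wsubst (fun x => wvar (s x)).

(* The union of the subsets [m_i] of [v_i]. *)
Definition initial v m : {set widx v} :=
  [set x | (wpos x < m (tag x))%N].

(* Lambda^{(1^m)}(v) *)
Definition inLam1 v m (f : tLam v) : Prop :=
  forall s, Sv s -> s @: initial v m = initial v m -> wperm s f = f.

(* f |-> f~ *)
Definition wzero v v' : tLam v -> tLam v' :=
  wsubst (fun x => if insub (wpos x) is Some r
                   then wvar (Tagged (fun i => 'I_(v' i)) (r : 'I_(v' (tag x))))
                   else 0).

(** * Difference operators *)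

(* (x, y, n) indexes the inverted element w_x - w_y + n hbar; the indices which
   do not occur in the definition of the localization are sent to 1. *)
Definition wdiff v (d : widx v * widx v * int) : tLam v :=
  let: (x, y, n) := d in
  if (tag x == tag y) && (x != y) then wvar x - wvar y + n%:~R * hbar v else 1.

Definition LamLoc v := loc (@wdiff v).
HB.instance Definition _ v := GRing.ComPzRing.on (LamLoc v).

Lemma wdiff_neq0 v (s : seq (widx v * widx v * int)) : den (@wdiff v) s != 0.
Proof.
pose f : {rmorphism tLam v -> tLam v} :=
  psubst (fun z => if z is inr x then wvar x else 0).
have fE z : f (pvar z) = if z is inr x then wvar x else 0.
  exact: psubst_pvar.
suff: f (den (@wdiff v) s) != 0 by apply: contraNneq => ->; rewrite rmorph0.
apply: lreg_neq0; rewrite /den rmorph_prod; apply: big_ind => [||d _].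
- exact: lreg1.
- exact: lregM.
case: d => [[x y] n] /=; case: ifP => [/andP[_ xy]|_]; last by rewrite rmorph1; apply: lreg1.
rewrite !rmorphD rmorphN !rmorphM [f (hbar2 v)]fE !mulr0 addr0 !fE.
rewrite /wvar /pvar.
set i := enum_rank (inr x : var v); set j := enum_rank (inr y : var v).
have ij : i != j by rewrite (inj_eq enum_rank_inj).
have Uij : U_(i)%MM != U_(j)%MM :> 'X_{1..#|var v|}.
  apply: contra ij => /eqP/mnmP/(_ i); rewrite !mnm1E eqxx.
  by case: (eqVneq j i) => // ->.
have Uji : (U_(j)%MM == U_(i)%MM :> 'X_{1..#|var v|}) = false.
  by rewrite eq_sym (negbTE Uij).
have cE (u : 'X_{1..#|var v|}) : ('X_i - 'X_j : {mpoly k[#|var v|]})@_u =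
    (U_(i)%MM == u)%:R - (U_(j)%MM == u)%:R.
  by rewrite mcoeffB !mcoeffX.
apply: lreg_mleadc; rewrite cE.
have: ('X_i - 'X_j : {mpoly k[#|var v|]}) != 0.
  apply/eqP => /(congr1 (mcoeff U_(i)%MM)); rewrite cE mcoeff0 eqxx.
  by rewrite Uji => /eqP; rewrite subr0 oner_eq0.
move/mlead_supp; rewrite mcoeff_msupp cE.
case: (U_(i)%MM =P _) => [<-|_].
  by rewrite Uji subr0 => _; apply: lreg1.
case: (U_(j)%MM =P _) => _; rewrite sub0r ?oppr0 ?eqxx // => _.
by apply: lregN; apply: lreg1.
Qed.

HB.instance Definition _ v :=
  GRing.PzSemiRing_isNonZero.Build (LamLoc v) (loc_nontrivial (@wdiff_neq0 v)).

Lemma wsubst_pvar v v' (h : widx v -> tLam v') b :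
  wsubst h (pvar (inl b)) = pvar (inl b).
Proof. exact: psubst_pvar. Qed.

Lemma wsubst_wvar v v' (h : widx v -> tLam v') x : wsubst h (wvar x) = h x.
Proof. exact: psubst_pvar. Qed.

Lemma wsubst_const v v' (h : widx v -> tLam v') c : wsubst h c%:MP = c%:MP.
Proof. exact: mmapC. Qed.

Lemma wsubst_hbar v v' (h : widx v -> tLam v') : wsubst h (hbar v) = hbar v'.
Proof. by rewrite /hbar rmorphM rmorph_nat /= /hbar2 wsubst_pvar. Qed.

(* u^a f = (wshift a f) u^a *)
Definition wshift v (a : 'X_{1..#|widx v|}) : tLam v -> tLam v :=
  wsubst (fun x => wvar x + (a (enum_rank x))%:R * hbar v).
HB.instance Definition _ v a := GRing.RMorphism.on (@wshift v a).

Lemma wshift_wvar v a x :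
  @wshift v a (wvar x) = wvar x + (a (enum_rank x))%:R * hbar v.
Proof. exact: wsubst_wvar. Qed.

Lemma wshift_hbar v a : @wshift v a (hbar v) = hbar v.
Proof. exact: wsubst_hbar. Qed.

Definition wshift_den v (a : 'X_{1..#|widx v|}) (d : widx v * widx v * int) :=
  let: (x, y, n) := d in
  (x, y, n + (a (enum_rank x))%:Z - (a (enum_rank y))%:Z).

Fact wshiftP v a d : wshift a (@wdiff v d) = @wdiff v (wshift_den a d).
Proof.
case: d => [[x y] n] /=; case: ifP => _; last exact: rmorph1.
rewrite rmorphD rmorphB rmorphM rmorph_int /= !wshift_wvar wshift_hbar.
by rewrite !intrD rmorphN /= -!pmulrn; ring.
Qed.

Definition wshift_endo v a : loc_endo (@wdiff v) :=
  LocEndo (fun d => @wshiftP v a d).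

Definition lshift v (a : 'X_{1..#|widx v|}) : LamLoc v -> LamLoc v :=
  loc_map (wshift_endo a).
HB.instance Definition _ v a := GRing.RMorphism.on (@lshift v a).

Fact lshift0 v b : @lshift v 0%MM b = b.
Proof.
elim/locW: b => f s; rewrite /lshift loc_mapE; congr (frac _ _ _).
  pose g : {rmorphism tLam v -> tLam v} := idfun.
  apply: (psubst_ext (f := @wshift v 0%MM) (g := g)) => [c|[b|x]].
  - exact: wsubst_const.
  - exact: wsubst_pvar.
  - by rewrite [LHS]wshift_wvar mnm0E mul0r addr0.
by rewrite -[RHS]map_id; apply: eq_map => -[[x y] n] /=; rewrite !mnm0E addr0 subr0.
Qed.

Fact lshiftD v a a' b : @lshift v (a + a')%MM b = lshift a (lshift a' b).
Proof.
elim/locW: b => f s; rewrite /lshift !loc_mapE; congr (frac _ _ _).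
  pose g : {rmorphism tLam v -> tLam v} := @wshift v a \o @wshift v a'.
  apply: (psubst_ext (f := @wshift v (a + a')%MM) (g := g)) => [c|[b|x]] /=.
  - by rewrite /wshift !wsubst_const.
  - by rewrite /wshift !wsubst_pvar.
  - rewrite -/(wvar x) !wshift_wvar rmorphD rmorphM rmorph_nat /=.
    by rewrite wshift_wvar wshift_hbar mnmDE natrD; ring.
rewrite -map_comp; apply: eq_map => -[[x y] n] /=.
by rewrite !mnmDE !PoszD; congr (_, _, _); ring.
Qed.

Definition lshift_action v : monom_action (LamLoc v) #|widx v| :=
  MonomAction (@lshift0 v) (@lshiftD v).

(* The localization of A~(v), in normal form: the free left module over the
   localization of Lambda~(v) on the monomials in the u_x; see Aloc_universal. *)
Definition Aloc v := skew (lshift_action v).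
HB.instance Definition _ v := GRing.PzRing.on (Aloc v).

Definition Apoly v (f : tLam v) : Aloc v :=
  skewC (lshift_action v) (frac (@wdiff v) f [::]).
Definition Afrac v (f : tLam v) (s : seq (widx v * widx v * int)) : Aloc v :=
  skewC (lshift_action v) (frac (@wdiff v) f s).
Definition uvar v (x : widx v) : Aloc v :=
  skewU (lshift_action v) (enum_rank x).

(** Aloc v is the ring obtained from tLam v by adjoining the u_x, subject to the
    defining relations of A~(v), and inverting the w_x - w_y + n hbar. *)

Fact Apoly_zmod_morphism v : zmod_morphism (@Apoly v).
Proof.
move=> f f'; rewrite /Apoly -[RHS]rmorphB fracN fracD; congr skewC.
by apply: frac_eq; rewrite !den_nil !mulr1.
Qed.

Fact Apoly_monoid_morphism v : monoid_morphism (@Apoly v).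
Proof.
split=> [|f f']; first by rewrite /Apoly frac1E rmorph1.
by rewrite /Apoly -[RHS]rmorphM fracM.
Qed.

HB.instance Definition _ v := GRing.isZmodMorphism.Build (tLam v) (Aloc v)
  (@Apoly v) (@Apoly_zmod_morphism v).
HB.instance Definition _ v := GRing.isMonoidMorphism.Build (tLam v) (Aloc v)
  (@Apoly v) (@Apoly_monoid_morphism v).

Lemma uvarC v (x y : widx v) : uvar x * uvar y = uvar y * uvar x.
Proof. exact: skewUU. Qed.

Lemma uvar_Apoly v (x : widx v) f :
  uvar x * Apoly f = Apoly (wshift U_(enum_rank x)%MM f) * uvar x.
Proof.
rewrite /uvar /Apoly skewUC; congr (skewC _ _ * _).
by rewrite [LHS]loc_mapE.
Qed.

Lemma uvar_wvar v (x y : widx v) :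
  uvar x * Apoly (wvar y) = (Apoly (wvar y) + (x == y)%:R * Apoly (hbar v)) * uvar x.
Proof.
rewrite uvar_Apoly wshift_wvar rmorphD rmorphM rmorph_nat mnm1E.
by rewrite (inj_eq enum_rank_inj).
Qed.

Lemma uvar_pvar v (x : widx v) b :
  uvar x * Apoly (pvar (inl b)) = Apoly (pvar (inl b)) * uvar x.
Proof. by rewrite uvar_Apoly [wshift _ _]wsubst_pvar. Qed.

Lemma uvar_const v (x : widx v) c :
  uvar x * Apoly c%:MP = Apoly c%:MP * uvar x.
Proof. by rewrite uvar_Apoly [wshift _ _]wsubst_const. Qed.

Lemma AfracE v f s :
  @Afrac v f s = Apoly f * \prod_(d <- s) Afrac 1 [:: d].
Proof. by rewrite /Afrac fracE rmorphM rmorph_prod. Qed.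

Lemma Afrac_den v d :
  Apoly (wdiff d) * @Afrac v 1 [:: d] = 1 /\
  @Afrac v 1 [:: d] * Apoly (wdiff d) = 1.
Proof.
split; rewrite /Apoly /Afrac -[LHS]rmorphM; last rewrite mulrC;
  by rewrite frac_den rmorph1.
Qed.

Theorem Aloc_universal v (T : pzRingType) (phi : {rmorphism tLam v -> T})
    (U : widx v -> T) :
    (forall x y, U x * U y = U y * U x) ->
    (forall x c, U x * phi c%:MP = phi c%:MP * U x) ->
    (forall x b, U x * phi (pvar (inl b)) = phi (pvar (inl b)) * U x) ->
    (forall x y, U x * phi (wvar y) =
                 (phi (wvar y) + (x == y)%:R * phi (hbar v)) * U x) ->
    (forall d, exists z, phi (wdiff d) * z = 1 /\ z * phi (wdiff d) = 1) ->
  exists F : {rmorphism Aloc v -> T},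
    [/\ forall f, F (Apoly f) = phi f, forall x, F (uvar x) = U x
      & forall G : {rmorphism Aloc v -> T}, (forall f, G (Apoly f) = phi f) ->
          (forall x, G (uvar x) = U x) -> G =1 F].
Proof.
move=> UC Uconst Upvar Uwvar /choice[z zP].
have gz d : phi (wdiff d) * z d = 1 by case: (zP d).
have zg d : z d * phi (wdiff d) = 1 by case: (zP d).
pose V (i : 'I_#|widx v|) : T := U (enum_val i).
have VC i j : V i * V j = V j * V i by apply: UC.
have Vphi i f : V i * phi f = phi (wshift U_(i)%MM f) * V i.
  pose P (f : tLam v) := V i * phi f = phi (wshift U_(i)%MM f) * V i.
  have PM f1 f2 : P f1 -> P f2 -> P (f1 * f2).
    by rewrite /P !rmorphM mulrA => -> /=; rewrite -!mulrA => ->.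
  have PC c : P c%:MP by rewrite /P [wshift _ _]wsubst_const; apply: Uconst.
  have PX y : P (pvar y).
    case: y => [b|y]; rewrite /P.
      by rewrite [wshift _ _]wsubst_pvar; apply: Upvar.
    rewrite -/(wvar y) wshift_wvar rmorphD rmorphM rmorph_nat mnm1E.
    have -> : (i == enum_rank y) = (enum_val i == y).
      by rewrite -{2}(enum_rankK y) (inj_eq enum_val_inj).
    exact: Uwvar.
  elim/mpolyind: f => [|c m p _ _ IH]; first by rewrite !rmorph0 mulr0 mul0r.
  rewrite !rmorphD mulrDr mulrDl IH; congr (_ + _); rewrite -mul_mpolyC.
  apply: (PM) => //; rewrite mpolyXE_id; apply: big_ind => [|?? |j _].
  - by rewrite -mpolyC1; apply: (PC).
  - exact: (PM).
  rewrite -[j]enum_valK; elim: (m _) => [|d IHd].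
    by rewrite expr0 -mpolyC1; apply: (PC).
  by rewrite exprS; apply: (PM) => //; apply: (PX).
have Vz i d : V i * z d = z (wshift_den U_(i)%MM d) * V i.
  rewrite -[LHS]mul1r -(zg (wshift_den U_(i)%MM d)) -wshiftP.
  by rewrite -!mulrA; congr (_ * _); rewrite mulrA -Vphi -mulrA gz mulr1.
have [phi' phi'E] := loc_universal gz zg.
have Vphi' i (b : LamLoc v) : V i * phi' b = phi' (lshift U_(i)%MM b) * V i.
  elim/locW: b => f s; rewrite [lshift _ _]loc_mapE !phi'E big_map.
  rewrite mulrA Vphi -!mulrA; congr (_ * _).
  elim: s => [|d s IH]; first by rewrite !big_nil mulr1 mul1r.
  by rewrite !big_cons mulrA Vz -!mulrA IH.
have [F [FC FU]] := skew_universal (tau := lshift_action v)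
  (phi := (phi' : {rmorphism LamLoc v -> T})) VC Vphi'.
have FE f : F (Apoly f) = phi f by rewrite FC phi'E big_nil mulr1.
exists F; split=> // [x|G GE GU].
  by rewrite FU /V enum_rankK.
apply: skew_lift_unique => [b|i]; last first.
  by have := GU (enum_val i); rewrite /uvar enum_valK FU.
pose H1 : {rmorphism LamLoc v -> T} := G \o skewC (lshift_action v).
pose H2 : {rmorphism LamLoc v -> T} := F \o skewC (lshift_action v).
apply: (loc_lift_unique (g := @wdiff v) (F := H1) (G := H2)) => f.
by rewrite [LHS]GE [RHS]FE.
Qed.

(** * Fundamental monopole operators and the algebras A(v) *)

(* The tuples of subsets Gamma_i of [v_i] with #Gamma_i = m_i, as subsets of
   widx v. *)
Definition isGamma v m (G : {set widx v}) : bool :=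
  [forall i, #|[set x in G | tag x == i]| == m i].

(* f|_Gamma; the default value is not used when isGamma m G. *)
Definition restr v m (G : {set widx v}) (f : tLam v) : tLam v :=
  wperm (odflt 1%g [pick s | Sv s && (s @: initial v m == G)]) f.

Definition FMOnum v (G : {set widx v}) : tLam v :=
  \prod_(e : edge Q)
    \prod_(x in G | tag x == src e) \prod_(y in ~: G | tag y == tgt e)
      (wvar y - wvar x + theta v e - hbar2 v).

(* The indices of the factors w_x - w_y of the denominator. *)
Definition FMOden v (G : {set widx v}) : seq (widx v * widx v * int) :=
  [seq (xy, 0) | xy : widx v * widx v in
    [set xy | [&& xy.1 \in G, xy.2 \notin G & tag xy.1 == tag xy.2]]].

Definition FMO v m (f : tLam v) : Aloc v :=
  \sum_(G : {set widx v} | isGamma m G)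
    Afrac (restr m G f * FMOnum G) (FMOden G) * \prod_(x in G) uvar x.

Definition inA v : Aloc v -> Prop :=
  subring_gen (fun a => exists m f,
    [/\ dimvec_le m v, inLam1 m f & a = FMO m f]).

(* A(v)_(k,d), for the grading with deg M_m(f) = (m, deg f + (m,m)/2). *)
Inductive homogA v : deg Q -> Aloc v -> Prop :=
  | homogA_FMO m d f of dimvec_le m v & inLam1 m f & isHomog d f :
      homogA (degM m d) (FMO m f)
  | homogA1 : homogA 0 1
  | homogA0 kd : homogA kd 0
  | homogAB kd a b of homogA kd a & homogA kd b : homogA kd (a - b)
  | homogAM kd kd' a b of homogA kd a & homogA kd' b :
      homogA (kd + kd') (a * b).

(* The graph of Phi_{v,v'}: the ring homomorphism determined by its values on
   the generators M_m(f) has as graph the subring of A(v) x A(v') generated by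
   the pairs (M_m(f), Phi_{v,v'}(M_m(f))). *)
Definition Phi v v' (a : Aloc v) (b : Aloc v') : Prop :=
  subring_gen (T := (Aloc v * Aloc v')%type) (fun ab => exists m f,
    [/\ dimvec_le m v, inLam1 m f &
        ab = (FMO m f, if dimvec_le m v' then FMO m (wzero v' f) else 0)])
    (a, b).

(** * Limits *)

(* Elements of the graded limits are represented in the product over all v.
   As the Phi_{v,v'} are graded, the direct sum over the degrees (k,d) of the
   limits of the A(v)_(k,d) is the set of finite sums of families which are
   homogeneous and compatible. *)
Definition Afam := family_ring (fun v : dimvec Q => Aloc v).
HB.instance Definition _ := GRing.PzRing.on Afam.

Definition homogAlim (kd : deg Q) (a : Afam) : Prop :=
  (forall v, homogA kd (a v)) /\
  (forall v v', dimvec_le v' v -> Phi (a v) (a v')).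

Definition inAlim : Afam -> Prop :=
  sum_gen (fun a => exists kd, homogAlim kd a).

(* Lambda^{(1^m)}; only the components f v with m <= v matter. *)
Definition Lamfam := family_ring (fun v : dimvec Q => tLam v).
HB.instance Definition _ := GRing.PzRing.on Lamfam.

Definition homogLam1lim m (d : nat) (f : Lamfam) : Prop :=
  (forall v, dimvec_le m v -> inLam1 m (f v) /\ isHomog d (f v)) /\
  (forall v v', dimvec_le m v' -> dimvec_le v' v -> wzero v' (f v) = f v').

Definition inLam1lim m : Lamfam -> Prop :=
  sum_gen (fun f => exists d, homogLam1lim m d f).

Definition FMOlim m (f : Lamfam) : Afam :=
  fun v => if dimvec_le m v then FMO m (f v) else 0.

Definition isFMO (a : Afam) : Prop :=
  exists m f, inLam1lim m f /\ a = FMOlim m f.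

Definition inKer v (a : Afam) : Prop := inAlim a /\ a v = 0.

End Zastava.

(* Main.v *)
(* A product of operators M_m(f) is expanded on the monomials u^a with coefficients in
   the localized polynomial ring.  For a sum of words of bounded polynomial degree, the
   coefficient of u^a splits as a factor depending on a only times a fraction whose
   numerator is symmetric, of bounded degree, in the variables outside the support of a;
   hence a relation which holds for one large v holds for all v, and homogeneous elements
   of the limit are polynomials in the M_m(f) in the limit.

   For the kernel, a product M_m(f) M_n(g) is straightened: modulo products
   M_m'(f') M_n'(g') with m' + n' = m + n and |n'| < |n|, it is zero unless n <= m, and
   then equals sum_l M_m(theta_l(h)) M_n(beta_l) where h = sum_l theta_l(h) beta_l is the
   leading numerator, decomposed on S_n-invariants beta_l with S_m-invariant
   coefficients.  So modulo words of smaller weight sum_j j |m_j|, a word is zero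
   unless m_1 >= m_2 >= ..., and then it is a combination of words M_(m_1)(Theta) B with B
   fixed and Theta linear in the leading numerator, that is in the coefficient of
   u^(sum_j 1_[m_j]).  If a combination of words vanishes at v, the leading numerators
   cancel at v, the operators M_(m_1)(Theta) are in the kernel, and one concludes by
   induction on the weight. *)

From HB Require Import structures.
From mathcomp Require Import all_boot all_order all_algebra fingroup perm.
From mathcomp Require Import boolp.
From mathcomp Require Import mpoly ring zify.
Require Import Defs.

Set Implicit Arguments.
Unset Strict Implicit.
Unset Printing Implicit Defensive.

Import Order.TTheory GRing.Theory Num.Theory.

Local Open Scope ring_scope.

(** * Coefficients of fundamental monopole operators *)

(** Since k may have zero divisors, cancellation rests on explicit regular elements. Divisibility is
    proved over the integers, where 2 is regular and polynomials form a domain, and it reaches k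
    because the integral orbit sums span the invariants. The obstacle in straightening is the
    denominators. Put B = G ∩ H and let T be the symmetric difference of the subsets G, H chosen in
    the two factors. At w_s = w_r + hbar the numerator for (B, T) becomes, up to a factor, the one
    for (B + r, T - {r, s}). So once the larger B are cleared, the numerator for (B, T) is divisible
    by the whole denominator, and the quotient is the leading numerator h to which the decomposition
    applies. The coordinates theta_l come from interpolation: sums over the subsets of the m-block
    with a Vandermonde-type denominator. They are linear, commute with setting variables to 0, and
    raise degrees by a constant independent of v. This uniformity is essential: a product is
    straightened at a single v0, which must be large compared with the degrees of the outcome. *)

Section SkewCoef.
Variables (B : nzRingType) (n : nat) (tau : monom_action B n).
Local Notation S := (skew tau).
Implicit Types (p q : S) (l m : 'X_{1..n}).

Definition scoef l p : B := mcoeff l (p : {mpoly B[n]}).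

Fact scoef_is_zmod_morphism l : zmod_morphism (scoef l).
Proof. by move=> p q; apply: mcoeffB. Qed.
HB.instance Definition _ l :=
  GRing.isZmodMorphism.Build S B (scoef l) (@scoef_is_zmod_morphism l).

Lemma scoef_skewm l b m : scoef l (skewm tau b m) = b * (m == l)%:R.
Proof. by rewrite /scoef /skewm mcoeffZ mcoeffX. Qed.

Lemma skewP p q : (forall l, scoef l p = scoef l q) -> p = q.
Proof. by move=> h; apply/mpolyP. Qed.

Lemma scoef_skewmM l b m q :
  scoef l (skewm tau b m * q) =
  if (m <= l)%MM then b * tau m (scoef (l - m)%MM q) else 0.
Proof.
elim/skew_ind: q => [c k||q q' IH IH'].
- rewrite skewmM !scoef_skewm rmorphM rmorph_nat mulrA.
  case: ifP => ml; last first.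
    case: eqP ml => [<-|]; last by rewrite mulr0.
    by rewrite lem_addr.
  congr (_ * _%:R); congr nat_of_bool; apply/eqP/eqP => [<-|->].
    by rewrite addmC addmK.
  by rewrite addmC submK.
- by rewrite mulr0 !raddf0 mulr0; case: ifP.
- by rewrite mulrDr !raddfD /= IH IH'; case: ifP => _; rewrite ?addr0 // mulrDr.
Qed.

Lemma skewm_prod (I : finType) (G : {set I}) (f : I -> 'I_n) :
  \prod_(x in G) skewU tau (f x) = skewm tau 1 (\sum_(x in G) U_(f x))%MM.
Proof.
apply: (big_rec2 (fun (a : S) m => a = skewm tau 1 m)) => // x m a _ ->.
by rewrite /skewU skewmM rmorph1 mul1r.
Qed.

End SkewCoef.

Section Fmo.
Variables (k : comNzRingType) (Q : quiver).
Implicit Types (v m : dimvec Q).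

Notation "''W_' v" := 'X_{1..#|widx v|} (at level 8, v at level 2).

Definition indm v (G : {set widx v}) : 'W_v := [multinom (enum_val i \in G : nat) | i < _].

Lemma indmE v (G : {set widx v}) x : indm G (enum_rank x) = (x \in G).
Proof. by rewrite mnmE enum_rankK. Qed.

Lemma wmnmP v (a b : 'W_v) : (forall x, a (enum_rank x) = b (enum_rank x)) <-> a = b.
Proof.
split=> [ab|-> //]; apply/mnmP => i; rewrite -(enum_valK i); exact: ab.
Qed.

Lemma wmnm_lepP v (a b : 'W_v) :
  reflect (forall x, a (enum_rank x) <= b (enum_rank x))%N (a <= b)%MM.
Proof.
apply: (iffP mnm_lepP) => ab x //; rewrite -(enum_valK x); exact: ab.
Qed.

Lemma prod_uvar v (G : {set widx v}) :
  \prod_(x in G) uvar k x = skewm (lshift_action k v) 1 (indm G).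
Proof.
rewrite skewm_prod; congr (skewm _ _ _); apply/wmnmP => x.
rewrite indmE mnm_sumE (eq_bigr (fun y => (x == y : nat))); last first.
  by move=> y _; rewrite mnm1E (inj_eq enum_rank_inj) eq_sym.
case: (boolP (x \in G)) => xG.
  rewrite (bigD1 x) //= eqxx big1 ?addn0 // => y /andP[_ yx].
  by rewrite eq_sym (negbTE yx).
rewrite big1 // => y yG; case: eqP => // xy; by rewrite xy yG in xG.
Qed.

Definition fcoef v m (f : tLam k v) (G : {set widx v}) : LamLoc k v :=
  frac (@wdiff k Q v) (restr m G f * FMOnum k G) (FMOden G).

Lemma FMO_skewm v m (f : tLam k v) :
  FMO m f = \sum_(G : {set widx v} | isGamma m G)
    skewm (lshift_action k v) (fcoef m f G) (indm G).
Proof.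
apply: eq_bigr => G _; rewrite prod_uvar /Afrac /skewC skewmM rmorph1 mulr1.
by rewrite add0m.
Qed.

Definition acoef v l (p : Aloc k v) : LamLoc k v := scoef (tau := lshift_action k v) l p.
HB.instance Definition _ v l := GRing.isZmodMorphism.Build (Aloc k v) (LamLoc k v)
  (@acoef v l) (@scoef_is_zmod_morphism _ _ (lshift_action k v) l).

Lemma acoefP v (p q : Aloc k v) : (forall l, acoef l p = acoef l q) -> p = q.
Proof. exact: skewP. Qed.

Lemma acoef_skewm v l b (a : 'W_v) :
  acoef l (skewm (lshift_action k v) b a) = b * (a == l)%:R.
Proof. exact: scoef_skewm. Qed.

Lemma acoef1 v l : acoef l (1 : Aloc k v) = (l == 0%MM)%:R.
Proof. by rewrite [LHS]acoef_skewm mul1r eq_sym. Qed.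

Lemma acoef_FMOM v m (f : tLam k v) (q : Aloc k v) l :
  acoef l (FMO m f * q) =
  \sum_(G : {set widx v} | isGamma m G && (indm G <= l)%MM)
     fcoef m f G * lshift (indm G) (acoef (l - indm G)%MM q).
Proof.
rewrite FMO_skewm mulr_suml raddf_sum big_mkcondr /=.
by apply: eq_bigr => G _; rewrite [LHS]scoef_skewmM.
Qed.

(** The sum over Gamma is empty. Operators with m not below v can thus stay in words as zero
    letters. *)
Lemma FMO0 v m (f : tLam k v) : ~~ dimvec_le m v -> FMO m f = 0.
Proof.
move=> /forallPn[i]; rewrite -ltnNge => vm; rewrite /FMO big_pred0 // => G.
apply/negbTE/forallPn; exists i; rewrite neq_ltn; apply/orP; left.
apply: leq_ltn_trans vm.
apply: (@leq_trans #|[set Tagged (fun i => 'I_(v i)) r | r : 'I_(v i)]|).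
  apply: subset_leq_card; apply/subsetP => -[j r]; rewrite !inE /= => /andP[_ /eqP ji].
  by subst j; apply/imsetP; exists r.
by apply: leq_trans (leq_imset_card _ _) _; rewrite card_ord.
Qed.

End Fmo.

(** * Monomials, permutations, setting variables to 0, and regular elements *)

Section Poly.
Variables (k : comNzRingType) (Q : quiver).
Implicit Types (v m : dimvec Q).

Notation "''V_' v" := 'X_{1..#|var v|} (at level 8, v at level 2).

Definition mvar v (a : var v -> nat) : 'V_v := [multinom a (enum_val i) | i < _].

Lemma mvarE v (a : var v -> nat) z : mvar a (enum_rank z) = a z.
Proof. by rewrite mnmE enum_rankK. Qed.

Lemma vmnmP v (a b : 'V_v) : (forall z, a (enum_rank z) = b (enum_rank z)) <-> a = b.
Proof.
split=> [ab|-> //]; apply/mnmP => i; rewrite -(enum_valK i); exact: ab.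
Qed.

Lemma mpolyX_pvar v (a : 'V_v) :
  'X_[k, a] = \prod_z pvar k z ^+ a (enum_rank z) :> tLam k v.
Proof.
rewrite mpolyXE_id (reindex_onto (@enum_rank (var v)) enum_val) /=; last first.
  by move=> i _; rewrite enum_valK.
by apply: eq_bigl => z; rewrite enum_rankK eqxx.
Qed.

Lemma prod_pvar v (a : var v -> nat) :
  \prod_z pvar k z ^+ a z = 'X_[k, mvar a] :> tLam k v.
Proof. by rewrite mpolyX_pvar; apply: eq_bigr => z _; rewrite mvarE. Qed.

Lemma psubstX v v' (h : var v -> tLam k v') (a : 'V_v) :
  psubst h 'X_[a] = \prod_z h z ^+ a (enum_rank z).
Proof.
rewrite mpolyX_pvar rmorph_prod; apply: eq_bigr => z _.
by rewrite rmorphXn /= psubst_pvar.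
Qed.

Lemma psubstZ v v' (h : var v -> tLam k v') c (f : tLam k v) :
  psubst h (c *: f) = c *: psubst h f.
Proof. by rewrite /psubst mmapZ mul_mpolyC. Qed.

(** Reduces a coefficient of a substituted polynomial to monomials, for substitutions where only the
    exponent b contributes to a. *)
Lemma mcoeff_psubst v v' (h : var v -> tLam k v') a b :
  (forall d : 'V_v, (psubst h 'X_[d])@_a = (d == b)%:R) ->
  forall f, (psubst h f)@_a = f@_b.
Proof.
move=> hX; elim/mpolyind => [|c d p _ _ IH]; first by rewrite rmorph0 !mcoeff0.
by rewrite rmorphD /= !mcoeffD IH psubstZ !mcoeffZ hX mcoeffX.
Qed.

Definition vperm v (s : {perm widx v}) (z : var v) : var v :=
  match z with inl b => inl b | inr x => inr (s x) end.

Lemma vpermK v (s : {perm widx v}) : cancel (vperm s) (vperm s^-1).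
Proof. by case=> //= x; rewrite permK. Qed.

Lemma vpermKV v (s : {perm widx v}) : cancel (vperm s^-1) (vperm s).
Proof. by case=> //= x; rewrite permKV. Qed.

Lemma wperm_pvar v (s : {perm widx v}) z : wperm s (pvar k z) = pvar k (vperm s z).
Proof. by rewrite /wperm /wsubst psubst_pvar; case: z. Qed.

Lemma mcoeff_wperm v (s : {perm widx v}) (f : tLam k v) (a : 'V_v) :
  (wperm s f)@_a = f@_(mvar (fun z => a (enum_rank (vperm s z)))).
Proof.
apply: mcoeff_psubst => d; rewrite psubstX.
rewrite (reindex_inj (can_inj (@vpermKV _ s))) /=.
rewrite (eq_bigr (fun z => pvar k z ^+ d (enum_rank (vperm s^-1 z)))); last first.
  by case=> //= x _; rewrite permKV.
rewrite prod_pvar mcoeffX; congr (nat_of_bool _)%:R; apply/eqP/eqP => [<-|->].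
  by apply/vmnmP => z; rewrite !mvarE vpermK.
by apply/vmnmP => z; rewrite !mvarE vpermKV.
Qed.

Lemma wperm_comp v (s t : {perm widx v}) (f : tLam k v) :
  wperm s (wperm t f) = wperm (t * s)%g f.
Proof.
apply/mpolyP => a; rewrite !mcoeff_wperm; congr (f@_ _); apply/vmnmP => z.
by rewrite !mvarE; case: z => //= x; rewrite permM.
Qed.

Lemma wperm1 v (f : tLam k v) : wperm 1%g f = f.
Proof.
apply/mpolyP => a; rewrite !mcoeff_wperm; congr (f@_ _); apply/vmnmP => z.
by rewrite !mvarE; case: z => //= x; rewrite perm1.
Qed.

Lemma Sv1 v : Sv (1%g : {perm widx v}).
Proof. by apply/forallP => x; rewrite perm1. Qed.

Lemma SvM v (s t : {perm widx v}) : Sv s -> Sv t -> Sv (s * t)%g.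
Proof.
move=> /forallP hs /forallP ht; apply/forallP => x.
by rewrite permM (eqP (ht _)) (eqP (hs _)).
Qed.

Lemma SvV v (s : {perm widx v}) : Sv s -> Sv (s^-1)%g.
Proof.
by move=> /forallP hs; apply/forallP => x; have := hs (s^-1 x)%g; rewrite permKV eq_sym.
Qed.

Lemma Sv_tag v (s : {perm widx v}) x : Sv s -> tag (s x) = tag x.
Proof. by move=> /forallP/(_ x)/eqP. Qed.

Definition wemb v' v (le : dimvec_le v' v) (x : widx v') : widx v :=
  Tagged (fun i => 'I_(v i)) (widen_ord (forallP le (tag x)) (tagged x)).

(** Partial inverse of [wemb]; it mirrors the [insub] of [wzero], so it takes no proof of v' <=
    v. *)
Definition wpre v' v (x : widx v) : option (widx v') :=
  if insub (wpos x) is Some r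
  then Some (Tagged (fun i => 'I_(v' i)) (r : 'I_(v' (tag x)))) else None.

Lemma widxP v (x y : widx v) : tag x = tag y -> wpos x = wpos y -> x = y.
Proof.
case: x y => [i r] [j s] /= ij; subst j; rewrite /wpos /= => /val_inj -> //.
Qed.

Lemma wposP v (x : widx v) : (wpos x < v (tag x))%N.
Proof. by rewrite /wpos. Qed.

Lemma wpos_emb v' v (le : dimvec_le v' v) x : wpos (wemb le x) = wpos x.
Proof. by []. Qed.

Lemma wembK v' v (le : dimvec_le v' v) : pcancel (wemb le) (@wpre v' v).
Proof.
move=> x; rewrite /wpre; case: insubP => [u _ ur|]; last by rewrite wpos_emb (wposP x).
by congr (Some _); apply: widxP.
Qed.

Lemma wemb_inj v' v (le : dimvec_le v' v) : injective (wemb le).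
Proof. exact: pcan_inj (wembK le). Qed.

Lemma wpre_some v' v (le : dimvec_le v' v) x y : wpre v' x = Some y -> wemb le y = x.
Proof.
rewrite /wpre; case: insubP => [u _ ur [<-]|//]; exact: widxP.
Qed.

Lemma wpre_none v' v (x : widx v) : wpre v' x = None -> (v' (tag x) <= wpos x)%N.
Proof. by rewrite /wpre; case: insubP => // h _; rewrite leqNgt. Qed.

Lemma wzero_wvar v' v x : @wzero k Q v v' (wvar k x) = oapp (@wvar k Q v') 0 (wpre v' x).
Proof. by rewrite /wzero wsubst_wvar /wpre; case: insub. Qed.

Lemma wzero_emb v' v (le : dimvec_le v' v) x : wzero v' (wvar k (wemb le x)) = wvar k x.
Proof. by rewrite wzero_wvar wembK. Qed.

Lemma wzero_inl v' v b : wzero v' (pvar k (inl b : var v)) = pvar k (inl b).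
Proof. exact: wsubst_pvar. Qed.

HB.instance Definition _ v v' := GRing.RMorphism.on (@wzero k Q v v').
HB.instance Definition _ v s := GRing.RMorphism.on (@wperm k Q v s).

Definition mext v' v (a : 'V_v') : 'V_v := mvar (fun z : var v =>
  match z with
  | inl b => a (enum_rank (inl b))
  | inr x => oapp (fun y => a (enum_rank (inr y))) 0%N (wpre v' x)
  end).

(** A monomial survives exactly when it avoids the killed variables, so [wzero] reads the
    coefficients at exponents extended by 0. *)
Lemma mcoeff_wzero v' v (le : dimvec_le v' v) (f : tLam k v) (a : 'V_v') :
  (wzero v' f)@_a = f@_(mext v a).
Proof.
rewrite /wzero /wsubst; apply: mcoeff_psubst => d; rewrite psubstX.
pose F (z : var v) : tLam k v' := match z with inl b => pvar k (inl b)
    | inr x => oapp (@wvar k Q v') 0 (wpre v' x) end.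
rewrite (eq_bigr (fun z => F z ^+ d (enum_rank z))); last first.
  by case=> [b|x] _ //; rewrite /F /wpre; case: insub.
have [/forallP nz|] := boolP [forall x : widx v, (wpre v' x == None) ==> (d (enum_rank (inr x)) == 0%N)].
  have -> : \prod_z F z ^+ d (enum_rank z) = 'X_[k, mvar (fun z : var v' =>
     match z with inl b => d (enum_rank (inl b))
      | inr x => d (enum_rank (inr (wemb le x))) end)].
    rewrite -prod_pvar !big_sumType /=; congr (_ * _).
    rewrite (bigID (fun x => wpre v' x == None)) /= [X in X * _]big1 ?mul1r; last first.
      by move=> x h; have := nz x; rewrite h => /eqP ->; rewrite expr0.
    rewrite (reindex_omap (wemb le) (@wpre v' v)) /=; last first.
      by move=> x; case E: (wpre v' x) => [y|] //= _; rewrite (wpre_some le E).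
    apply: eq_big => [x|x _]; first by rewrite wembK eqxx.
    by rewrite /F wembK.
  rewrite mcoeffX; congr (nat_of_bool _)%:R; apply/eqP/eqP => [<-|->].
    apply/vmnmP => -[b|x]; rewrite !mvarE //.
    case E: (wpre v' x) => [y|] /=; first by rewrite mvarE (wpre_some le E).
    by have := nz x; rewrite E => /eqP.
  by apply/vmnmP => -[b|x]; rewrite !mvarE // wembK.
rewrite negb_forall => /existsP[x]; rewrite negb_imply => /andP[/eqP hx dx].
rewrite (bigD1 (inr x)) //= hx /= expr0n (negbTE dx) mul0r mcoeff0.
by case: (d =P mext v a) dx => // ->; rewrite mvarE hx eqxx.
Qed.

Definition updv v z (r : tLam k v) : tLam k v -> tLam k v :=
  psubst (fun z' => if z' == z then r else pvar k z').
HB.instance Definition _ v z r := GRing.RMorphism.on (@updv v z r).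

Lemma updv_pvar v z r z' : @updv v z r (pvar k z') = if z' == z then r else pvar k z'.
Proof. exact: psubst_pvar. Qed.

Lemma updvC v z r c : @updv v z r c%:MP = c%:MP.
Proof. exact: mmapC. Qed.

Lemma updvK v z (r r' : tLam k v) : updv z r' r = pvar k z -> cancel (updv z r) (updv z r').
Proof.
move=> e f; pose g : {rmorphism tLam k v -> tLam k v} := updv z r' \o updv z r.
pose i : {rmorphism tLam k v -> tLam k v} := idfun.
apply: (psubst_ext (f := g) (g := i)) => [c|z'] /=; first by rewrite !updvC.
rewrite updv_pvar; case: eqP => [->|/eqP h] //; by rewrite updv_pvar (negbTE h).
Qed.

Lemma lreg_pvar v z : GRing.lreg (pvar k z : tLam k v).
Proof.
by apply: lreg_mleadc; rewrite /pvar mleadXm mcoeffX eqxx; apply: lreg1.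
Qed.

(** The substitution of z - q for z is an automorphism carrying z + q to the variable z, which is
    regular because its leading coefficient is 1. *)
Lemma lreg_affine v z (q : tLam k v) : (forall r, updv z r q = q) -> GRing.lreg (pvar k z + q).
Proof.
move=> hq p p' e; have updp r : updv z r (pvar k z) = r by rewrite updv_pvar eqxx.
have inj : injective (updv z (pvar k z - q)).
  by apply: (can_inj (g := updv z (pvar k z + q))); apply: updvK; rewrite rmorphB /= updp hq addrK.
apply: inj; apply: (@lreg_pvar v z).
by move/(congr1 (updv z (pvar k z - q))): e; rewrite !rmorphM !rmorphD /= updp hq subrK.
Qed.

Lemma lreg_wdiff v d : GRing.lreg (@wdiff k Q v d).
Proof.
case: d => [[x y] n] /=; case: ifP => [/andP[_ xy]|_]; last exact: lreg1.
rewrite -addrA; apply: (@lreg_affine v (inr x)) => r.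
rewrite rmorphD rmorphN !rmorphM rmorph_int rmorph_nat /= /hbar2 !updv_pvar /=.
by rewrite ifF //; apply/negbTE; rewrite eq_sym; apply: contra xy => /eqP[->].
Qed.

Lemma lreg_den v s : GRing.lreg (den (@wdiff k Q v) s).
Proof.
rewrite /den; apply: big_ind => [||d _]; [exact: lreg1|exact: lregM|exact: lreg_wdiff].
Qed.

(** Regular denominators remove the auxiliary multiplier from the equality of fractions. *)
Lemma LamLoc_eq v (a b : tLam k v) s t : frac (@wdiff k Q v) a s = frac (@wdiff k Q v) b t <->
  a * den (@wdiff k Q v) t = b * den (@wdiff k Q v) s.
Proof.
split=> [/fracP[u]|]; [exact: lreg_den|exact: frac_eq].
Qed.

Lemma LamLoc_eq0 v (a : tLam k v) s : frac (@wdiff k Q v) a s = 0 <-> a = 0.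
Proof.
rewrite -frac0E LamLoc_eq den_nil mulr1 mul0r; split=> //.
Qed.

Lemma lreg_frac v (a : tLam k v) s : GRing.lreg a -> GRing.lreg (frac (@wdiff k Q v) a s).
Proof.
move=> ra; elim/locW => b t; elim/locW => c u; rewrite !fracM => /LamLoc_eq e.
apply/LamLoc_eq; apply: ra; apply: (@lreg_den v s); move: e; rewrite !den_cat => e.
transitivity (a * b * (den (@wdiff k Q v) s * den (@wdiff k Q v) u)); first by ring.
by rewrite e; ring.
Qed.

End Poly.

(** The element of rank j in a fibre of a goes to the element of rank j in the corresponding fibre
    of b. Permutations moving a subset or a monomial to another are obtained from this by choosing
    labels a and b. *)
Lemma perm_fibers (X : finType) (Y : eqType) (a b : X -> Y) :
  (forall y, #|[set x | a x == y]| = #|[set x | b x == y]|) ->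
  exists s : {perm X}, forall x, b (s x) = a x.
Proof.
move=> ab; pose fib (f : X -> Y) y := enum [set x | f x == y].
have mfib f y x : (x \in fib f y) = (f x == y) by rewrite mem_enum inE.
have szfib y : size (fib a y) = size (fib b y) by rewrite -!cardE.
pose g x := nth x (fib b (a x)) (index x (fib a (a x))).
have ltg x : (index x (fib a (a x)) < size (fib b (a x)))%N.
  by rewrite -szfib index_mem mfib.
have bg x : b (g x) = a x by apply/eqP; rewrite -mfib mem_nth.
have g_inj : injective g.
  move=> x x' e; have axx' : a x = a x' by rewrite -bg e bg.
  move: e (ltg x) (ltg x'); rewrite /g axx' => + l l'.
  rewrite (@set_nth_default _ _ x' x _ l) => /eqP; rewrite nth_uniq ?enum_uniq // => /eqP e.
  have := @nth_index _ x x (fib a (a x')); rewrite mfib axx' eqxx => <- //.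
  by rewrite e nth_index // mfib.
by exists (perm g_inj) => x; rewrite permE.
Qed.

(** * Subsets up to permutation, and the pair factors of a coefficient *)

Section Coefficients.
Variables (k : comNzRingType) (Q : quiver).
Implicit Types (v m c : dimvec Q).
Local Notation "''W_' v" := 'X_{1..#|widx v|} (at level 8, v at level 2).
Local Notation "''V_' v" := 'X_{1..#|var v|} (at level 8, v at level 2).
Local Notation frc := (frac (@wdiff k Q _)).

Lemma card_block v i (P : pred (widx v)) :
  #|[set x : widx v | (tag x == i) && P x]| =
  #|[set r : 'I_(v i) | P (Tagged (fun i => 'I_(v i)) r)]|.
Proof.
have inj : injective (fun r : 'I_(v i) => Tagged (fun i => 'I_(v i)) r : widx v).
  by move=> r r' /(congr1 (@wpos Q v)) /val_inj.
rewrite -[RHS](card_imset _ inj).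
apply: eq_card => x; rewrite !inE; apply/idP/imsetP => [/andP[/eqP xi Px]|[r]].
  by case: x xi Px => j r /= ji; subst j => Px; exists r; rewrite ?inE.
by rewrite inE => Pr ->; rewrite eqxx.
Qed.

Lemma card_blockT v i : #|[set x : widx v | tag x == i]| = v i.
Proof.
rewrite (eq_card (B := [set x : widx v | (tag x == i) && true])); last first.
  by move=> x; rewrite !inE andbT.
rewrite card_block (eq_card (B := {: 'I_(v i)})) ?card_ord // => x; by rewrite !inE.
Qed.

Lemma card_ltn (n m : nat) : (m <= n)%N -> #|[set r : 'I_n | (r < m)%N]| = m.
Proof.
move=> mn; have widen_inj : injective (widen_ord mn) by move=> x y /(congr1 val)/= /val_inj.
rewrite -[RHS]card_ord -(card_imset _ widen_inj); apply: eq_card => r.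
rewrite !inE; apply/idP/imsetP => [rm|[x _ -> //=]].
by exists (Ordinal rm) => //; apply: val_inj.
Qed.

Lemma isGamma_initial v m : dimvec_le m v -> isGamma m (initial v m).
Proof.
move=> /forallP mv; apply/forallP => i; apply/eqP.
rewrite -[RHS](card_ltn (mv i)) -(card_block i (fun x : widx v => wpos x < m i)%N); apply: eq_card => x; rewrite !inE andbC.
by case: eqP => //= ->.
Qed.

Lemma isGamma_le v m (G : {set widx v}) : isGamma m G -> dimvec_le m v.
Proof.
move=> /forallP h; apply/forallP => i; rewrite -(eqP (h i)) -(card_blockT v i).
by apply: subset_leq_card; apply/subsetP => x; rewrite !inE => /andP[].
Qed.

Lemma card_tagC v (G : {set widx v}) i :
  #|[set x in ~: G | tag x == i]| = (v i - #|[set x in G | tag x == i]|)%N.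
Proof.
rewrite -(card_blockT v i) -(cardsID G [set x | tag x == i]).
rewrite (eq_card (A := [set x in G | _]) (B := [set x | tag x == i] :&: G)); last first.
  by move=> x; rewrite !inE andbC.
rewrite addKn; apply: eq_card => x; by rewrite !inE.
Qed.

Lemma imset_perm_mem (X : finType) (s : {perm X}) (A : {set X}) x : (s x \in s @: A) = (x \in A).
Proof. by rewrite mem_imset //; apply: perm_inj. Qed.

Lemma isGamma_perm v m (G : {set widx v}) s : Sv s -> isGamma m (s @: G) = isGamma m G.
Proof.
move=> hs; apply: eq_forallb => i; congr (_ == _).
rewrite -[RHS](card_imset _ (@perm_inj _ s)); apply: eq_card => x.
by rewrite -(permKV s x) imset_perm_mem !inE imset_perm_mem Sv_tag.
Qed.

Lemma isGamma_exists v m (G H : {set widx v}) : isGamma m G -> isGamma m H ->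
  exists s, Sv s /\ s @: G = H.
Proof.
move=> /forallP hG /forallP hH.
have [[i b]|s hs] := @perm_fibers _ _ (fun x : widx v => (tag x, x \in G)) (fun x => (tag x, x \in H)).
  have cE (A : {set widx v}) : #|[set x | (tag x, x \in A) == (i, b)]| =
      if b then #|[set x in A | tag x == i]| else #|[set x in ~: A | tag x == i]|.
    by case: b; apply: eq_card => x; rewrite !inE -pair_eqE /= andbC; case: (x \in A).
  by rewrite !cE !card_tagC (eqP (hG i)) (eqP (hH i)).
exists s; split; first by apply/forallP => x; case: (hs x) => ->.
by apply/setP => x; rewrite -(permKV s x) imset_perm_mem; case: (hs (s^-1 x)%g).
Qed.

(** Two admissible permutations differ by one that preserves the m-block, which fixes f: the choice
    made in [restr] is immaterial. *)
Lemma restrE v m (f : tLam k v) (G : {set widx v}) s :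
  inLam1 m f -> Sv s -> s @: initial v m = G -> restr m G f = wperm s f.
Proof.
move=> hf hs sG; rewrite /restr; case: pickP => [t /andP[ht /eqP tG]|/(_ s)]; last by rewrite hs sG eqxx.
rewrite /= -[in RHS](mulgKV t s) -wperm_comp (hf (s * t^-1)%g) //.
  by apply: SvM => //; apply: SvV.
apply/setP => x; set y := ((s * t^-1)^-1 x)%g.
have xE : x = (s * t^-1)%g y by rewrite permKV.
have e : t x = s y by rewrite xE permM permKV.
rewrite {1}xE imset_perm_mem -(imset_perm_mem s) sG -tG -e.
by rewrite imset_perm_mem.
Qed.

Lemma restr_wperm v m (f : tLam k v) (G : {set widx v}) s :
  inLam1 m f -> isGamma m G -> Sv s -> wperm s (restr m G f) = restr m (s @: G) f.
Proof.
move=> hf hG hs.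
have [t [ht tG]] := isGamma_exists (isGamma_initial (isGamma_le hG)) hG.
rewrite (restrE hf ht tG) wperm_comp (@restrE _ _ _ (s @: G) (t * s)%g) //; first exact: SvM.
by rewrite -tG -imset_comp; apply: eq_imset => x; rewrite /= permM.
Qed.

Lemma ext_perm v' v (le : dimvec_le v' v) (s0 : {perm widx v'}) : Sv s0 ->
  exists s : {perm widx v}, [/\ Sv s, forall x, s (wemb le x) = wemb le (s0 x)
    & forall x, wpre v' x = None -> s x = x].
Proof.
move=> hs0; pose g (x : widx v) := oapp (fun y => wemb le (s0 y)) x (wpre v' x).
have ge y : g (wemb le y) = wemb le (s0 y) by rewrite /g wembK.
have gn x : wpre v' x = None -> g x = x by rewrite /g => ->.
have g_inj : injective g.
  move=> x y; case Ex: (wpre v' x) => [x'|]; case Ey: (wpre v' y) => [y'|].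
  - rewrite -(wpre_some le Ex) -(wpre_some le Ey) !ge => /wemb_inj/perm_inj -> //.
  - rewrite -(wpre_some le Ex) ge (gn _ Ey) => e; by rewrite -e wembK in Ey.
  - rewrite -(wpre_some le Ey) ge (gn _ Ex) => e; by rewrite e wembK in Ex.
  - by rewrite !gn.
exists (perm g_inj); split=> [|x|x hx]; rewrite ?permE //; last by rewrite gn.
apply/forallP => x; rewrite permE; case Ex: (wpre v' x) => [x'|]; last by rewrite gn.
by rewrite -(wpre_some le Ex) ge /= (Sv_tag _ hs0).
Qed.

Lemma wzero_wperm v' v (le : dimvec_le v' v) (s0 : {perm widx v'}) (s : {perm widx v}) (f : tLam k v) :
  (forall x, s (wemb le x) = wemb le (s0 x)) -> (forall x, wpre v' x = None -> s x = x) ->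
  wzero v' (wperm s f) = wperm s0 (wzero v' f).
Proof.
move=> hs hn; pose F : {rmorphism tLam k v -> tLam k v'} := @wzero k Q v v' \o wperm s.
pose G : {rmorphism tLam k v -> tLam k v'} := wperm s0 \o @wzero k Q v v'.
apply: (psubst_ext (f := F) (g := G)) => [c0|[b|x]] /=.
- by rewrite /wperm /wzero /wsubst /psubst !mmapC.
- by rewrite wperm_pvar !wzero_inl wperm_pvar.
rewrite wperm_pvar /= -!/(wvar k _) !wzero_wvar.
case Ex: (wpre v' x) => [y|] /=; last by rewrite hn // Ex rmorph0.
by rewrite -(wpre_some le Ex) hs wembK /= [RHS]wperm_pvar.
Qed.

Lemma initial_emb v' v (le : dimvec_le v' v) m : dimvec_le m v' ->
  wemb le @: initial v' m = initial v m.
Proof.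
move=> mv; apply/setP => x; apply/imsetP/idP => [[y + ->]|]; rewrite !inE //.
move=> xm; case Ex: (wpre v' x) => [y|].
  by exists y; rewrite ?(wpre_some le Ex) // inE -(wpos_emb le) (wpre_some le Ex) -(wpre_some le Ex) in xm *.
by have := wpre_none Ex; rewrite leqNgt (leq_trans xm) // (forallP mv).
Qed.

Lemma inLam1_wzero v' v (le : dimvec_le v' v) m (f : tLam k v) :
  dimvec_le m v' -> inLam1 m f -> inLam1 m (wzero v' f).
Proof.
move=> mv hf s0 hs0 s0m; have [s [hs se sn]] := ext_perm le hs0.
rewrite -(wzero_wperm _ se sn) hf // -(initial_emb le mv) -imset_comp.
by rewrite (eq_imset _ (g := wemb le \o s0)) // imset_comp s0m.
Qed.

Lemma restr_wzero v' v (le : dimvec_le v' v) m (f : tLam k v) (G : {set widx v'}) :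
  inLam1 m f -> isGamma m G -> wzero v' (restr m (wemb le @: G) f) = restr m G (wzero v' f).
Proof.
move=> hf hG; have mv := isGamma_le hG.
have [s0 [hs0 s0G]] := isGamma_exists (isGamma_initial mv) hG.
have [s [hs se sn]] := ext_perm le hs0.
have sG : s @: initial v m = wemb le @: G.
  rewrite -(initial_emb le mv) -s0G -!imset_comp; exact: eq_imset.
rewrite (restrE hf hs sG) (restrE _ hs0 s0G) ?(wzero_wperm _ se sn) //.
exact: inLam1_wzero.
Qed.

(* [pairf x y 0] is the factor of the pair (x in Gamma, y notin Gamma) in the
   coefficient of an FMO; t records the shift of w_y - w_x by t hbar. *)
Definition pairn v (x y : widx v) (t : int) : tLam k v :=
  \prod_(e : edge Q | (src e == tag x) && (tgt e == tag y))
    (wvar k y - wvar k x + theta k v e - hbar2 k v + t%:~R * hbar k v).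

Definition pairf v (x y : widx v) (t : int) : LamLoc k v :=
  frc (pairn x y t) (if tag x == tag y then [:: (x, y, - t)] else [::]).

Lemma lshift_frac v a (f : tLam k v) s :
  lshift a (frc f s) = frc (wshift a f) (map (wshift_den a) s).
Proof. exact: loc_mapE. Qed.

Lemma wshift_pvar v a z : wshift a (pvar k z : tLam k v) =
  match z with inl b => pvar k (inl b) | inr x => wvar k x + (a (enum_rank x))%:R * hbar k v end.
Proof. by case: z => [b|x]; [exact: wsubst_pvar|exact: wshift_wvar]. Qed.

Lemma wshift_pairn v a (x y : widx v) t : wshift a (pairn x y t) =
  pairn x y (t + (a (enum_rank y))%:Z - (a (enum_rank x))%:Z).
Proof.
rewrite rmorph_prod; apply: eq_bigr => e _.
rewrite !rmorphD !rmorphN rmorphM rmorph_int /= !wshift_wvar wshift_hbar.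
rewrite [wshift a (theta _ _ _)]wshift_pvar [wshift a (hbar2 _ _)]wshift_pvar.
by rewrite -!pmulrn /theta /hbar2; ring.
Qed.

Lemma lshift_pairf v a (x y : widx v) t : lshift a (pairf x y t) =
  pairf x y (t + (a (enum_rank y))%:Z - (a (enum_rank x))%:Z).
Proof.
rewrite lshift_frac wshift_pairn /pairf; case: ifP => // _ /=; congr (frc _ [:: (_, _, _)]); lia.
Qed.

Definition lfrac v (f : tLam k v) : LamLoc k v := frc f [::].

Fact lfrac_zmod v : zmod_morphism (@lfrac v).
Proof. by move=> f g; rewrite /lfrac fracN fracD; apply: frac_eq; rewrite !den_nil !mulr1. Qed.
Fact lfrac_monoid v : monoid_morphism (@lfrac v).
Proof. by split=> // f g; rewrite /lfrac fracM. Qed.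
HB.instance Definition _ v := GRing.isZmodMorphism.Build (tLam k v) (LamLoc k v) (@lfrac v) (@lfrac_zmod v).
HB.instance Definition _ v := GRing.isMonoidMorphism.Build (tLam k v) (LamLoc k v) (@lfrac v) (@lfrac_monoid v).

Lemma frac_split v (f : tLam k v) s : frc f s = lfrac f * frc 1 s.
Proof. by rewrite fracM mulr1. Qed.

Lemma frac1_prod v s : frc 1 s = \prod_(d <- s) (frc 1 [:: d] : LamLoc k v).
Proof. by rewrite fracE -frac1E mul1r. Qed.

Lemma pairfE v (x y : widx v) t : pairf x y t = lfrac (pairn x y t) *
  (if tag x == tag y then frc 1 [:: (x, y, - t)] else 1).
Proof. by rewrite /pairf frac_split; case: ifP. Qed.

(** Numerator and denominator are both products over pairs (x in Gamma, y outside). Joining them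
    pair by pair lets shifts, permutations and splittings be handled factor by factor. *)
Lemma fcoefE v m (f : tLam k v) (G : {set widx v}) :
  fcoef m f G = lfrac (restr m G f) * \prod_(x in G) \prod_(y in ~: G) pairf x y 0.
Proof.
rewrite /fcoef frac_split rmorphM -mulrA; congr (_ * _).
transitivity (\prod_(x in G) \prod_(y in ~: G) lfrac (pairn x y 0) *
   \prod_(x in G) \prod_(y in ~: G) (if tag x == tag y then frc 1 [:: (x, y, 0)] else 1 : LamLoc k v)); last first.
  rewrite -big_split; apply: eq_bigr => x _; rewrite -big_split; apply: eq_bigr => y _.
  by rewrite pairfE oppr0.
congr (_ * _).
  rewrite /FMOnum rmorph_prod.
  transitivity (\prod_(e : edge Q) \prod_(x in G) \prod_(y in ~: G)
    (if (src e == tag x) && (tgt e == tag y) then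
     lfrac (wvar k y - wvar k x + theta k v e - hbar2 k v + 0%:~R * hbar k v) else 1)).
    apply: eq_bigr => e _; rewrite rmorph_prod big_mkcondr /=; apply: eq_bigr => x _.
    rewrite rmorph_prod big_mkcondr /=; case: (eqVneq (tag x)) => _; last by rewrite big1.
    apply: eq_bigr => y _; rewrite eq_sym; case: eqP => // _; by rewrite mul0r addr0.
  rewrite exchange_big; apply: eq_bigr => x _; rewrite exchange_big; apply: eq_bigr => y _.
  by rewrite rmorph_prod [RHS]big_mkcond.
rewrite frac1_prod /FMOden big_image /= pair_big_dep /=.
rewrite big_mkcond [RHS]big_mkcond /=. apply: eq_bigr => -[x y] _ /=; rewrite !inE.
by case: (x \in G); case: (y \in G); case: (tag x == tag y).
Qed.

End Coefficients.

(** * Words of operators: equivariance of coefficients and degree bounds *)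

Section Coefficients.
Variables (k : comNzRingType) (Q : quiver).
Implicit Types (v m c : dimvec Q).
Local Notation "''W_' v" := 'X_{1..#|widx v|} (at level 8, v at level 2).
Local Notation "''V_' v" := 'X_{1..#|var v|} (at level 8, v at level 2).
Local Notation frc := (frac (@wdiff k Q _)).

Definition word v := seq (dimvec Q * tLam k v).
Definition good v (w : word v) := forall p, p \in w -> inLam1 p.1 p.2.
Definition pword v (w : word v) : Aloc k v := \prod_(p <- w) FMO p.1 p.2.

Lemma good_cons v p (w : word v) : good (p :: w) <-> inLam1 p.1 p.2 /\ good w.
Proof.
split=> [h|[h h'] q]; first by split=> [|q qw]; apply: h; rewrite inE ?eqxx ?qw ?orbT.
by rewrite inE => /orP[/eqP ->|/h'].
Qed.

Lemma pword_cons v p (w : word v) : pword (p :: w) = FMO p.1 p.2 * pword w.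
Proof. exact: big_cons. Qed.

Definition wperm_den v (s : {perm widx v}) (d : widx v * widx v * int) :=
  let: (x, y, n) := d in (s x, s y, n).

Lemma wperm_wvar v (s : {perm widx v}) x : wperm s (wvar k x) = wvar k (s x).
Proof. by rewrite [LHS]wperm_pvar. Qed.

Lemma wperm_hbar v (s : {perm widx v}) : wperm s (hbar k v) = hbar k v.
Proof. exact: wsubst_hbar. Qed.

Fact wperm_denP v (s : {perm widx v}) (hs : Sv s) d :
  wperm s (wdiff k d) = wdiff k (wperm_den s d).
Proof.
case: d => [[x y] n] /=; rewrite !(Sv_tag _ hs) (inj_eq perm_inj).
case: ifP => _; last exact: rmorph1.
by rewrite rmorphD rmorphB rmorphM rmorph_int /= !wperm_wvar wperm_hbar.
Qed.

Definition wperm_endo v (s : {perm widx v}) (hs : Sv s) : loc_endo (@wdiff k Q v) :=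
  @LocEndo _ _ _ (@wperm k Q v s) (wperm_den s) (wperm_denP hs).

Definition lperm v (s : {perm widx v}) (hs : Sv s) : LamLoc k v -> LamLoc k v :=
  loc_map (wperm_endo hs).
HB.instance Definition _ v s hs := GRing.RMorphism.on (@lperm v s hs).

Lemma lperm_frac v (s : {perm widx v}) (hs : Sv s) f t :
  lperm hs (frc f t) = frc (wperm s f) (map (wperm_den s) t).
Proof. exact: loc_mapE. Qed.

Lemma lperm_pairf v (s : {perm widx v}) (hs : Sv s) x y t :
  lperm hs (pairf k x y t) = pairf k (s x) (s y) t.
Proof.
rewrite /pairf lperm_frac !(Sv_tag _ hs); congr (frc _ _); last by case: ifP.
rewrite rmorph_prod; apply: eq_big => [e|e _]; rewrite ?(Sv_tag _ hs) //.
rewrite !rmorphD !rmorphN rmorphM rmorph_int /= !wperm_wvar wperm_hbar.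
by rewrite /theta /hbar2 !wperm_pvar.
Qed.

Definition pmnm v (s : {perm widx v}) (a : 'W_v) : 'W_v :=
  [multinom a (enum_rank (s^-1 (enum_val i))%g) | i < _].

Lemma pmnmE v (s : {perm widx v}) (a : 'W_v) x :
  pmnm s a (enum_rank x) = a (enum_rank (s^-1 x)%g).
Proof. by rewrite mnmE enum_rankK. Qed.

Lemma wperm_wshift v (s : {perm widx v}) a (f : tLam k v) :
  wperm s (wshift a f) = wshift (pmnm s a) (wperm s f).
Proof.
pose F : {rmorphism tLam k v -> tLam k v} := wperm s \o wshift a.
pose G : {rmorphism tLam k v -> tLam k v} := wshift (pmnm s a) \o wperm s.
apply: (psubst_ext (f := F) (g := G)) => [d|[b|x]] /=.
- by rewrite /wperm /wshift !wsubst_const.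
- by rewrite wshift_pvar !wperm_pvar wshift_pvar.
rewrite wshift_pvar wperm_pvar wshift_pvar rmorphD rmorphM rmorph_nat /=.
by rewrite wperm_wvar wperm_hbar pmnmE permK.
Qed.

Lemma lperm_lshift v (s : {perm widx v}) (hs : Sv s) a b :
  lperm hs (lshift a b) = lshift (pmnm s a) (lperm hs b).
Proof.
elim/locW: b => f t; rewrite lshift_frac !lperm_frac lshift_frac wperm_wshift.
congr (frc _ _); rewrite -!map_comp; apply: eq_map => -[[x y] n] /=.
by rewrite !pmnmE !permK.
Qed.

Lemma lperm_fcoef v (s : {perm widx v}) (hs : Sv s) m (f : tLam k v) (G : {set widx v}) :
  inLam1 m f -> isGamma m G -> lperm hs (fcoef m f G) = fcoef m f (s @: G).
Proof.
move=> hf hG; rewrite !fcoefE rmorphM rmorph_prod; congr (_ * _).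
  by rewrite [LHS]lperm_frac (restr_wperm hf hG).
have imC : s @: (~: G) = ~: (s @: G).
  by apply/setP => x; rewrite -(permKV s x) imset_perm_mem !inE imset_perm_mem.
rewrite big_imset /=; last by move=> ????; apply: perm_inj.
apply: eq_bigr => x _; rewrite rmorph_prod -imC big_imset /=; last by move=> ????; apply: perm_inj.
by apply: eq_bigr => y _; rewrite lperm_pairf.
Qed.

Lemma pmnm_indm v (s : {perm widx v}) (G : {set widx v}) : pmnm s (indm G) = indm (s @: G).
Proof.
by apply/wmnmP => x; rewrite pmnmE !indmE -{2}(permKV s x) imset_perm_mem.
Qed.

Lemma pmnmB v (s : {perm widx v}) (a b : 'W_v) : pmnm s (a - b)%MM = (pmnm s a - pmnm s b)%MM.
Proof. by apply/wmnmP => x; rewrite !(mnmBE, pmnmE). Qed.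

Lemma pmnm_le v (s : {perm widx v}) (a b : 'W_v) : (pmnm s a <= pmnm s b)%MM = (a <= b)%MM.
Proof.
apply/wmnm_lepP/wmnm_lepP => h x; last by rewrite !pmnmE.
by have := h (s x); rewrite !pmnmE permK.
Qed.

(** Every operator is S_v-invariant. Hence a coefficient may be studied after moving the support of
    its exponent to a standard position. *)
Lemma lperm_acoef v (s : {perm widx v}) (hs : Sv s) (w : word v) a : good w ->
  lperm hs (acoef a (pword w)) = acoef (pmnm s a) (pword w).
Proof.
elim: w a => [|[m f] w IH] a.
  move=> _; rewrite /pword big_nil !acoef1 rmorph_nat; congr (nat_of_bool _)%:R.
  apply/eqP/eqP => [->|/wmnmP e]; apply/wmnmP => x; rewrite ?pmnmE !mnm0E //.
  by have := e (s x); rewrite pmnmE permK mnm0E.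
move=> /good_cons[/= hf hw]; rewrite pword_cons !acoef_FMOM rmorph_sum.
rewrite [RHS](reindex_inj (imset_inj (@perm_inj _ s))) /=.
apply: eq_big => [G|G /andP[hG _]].
  by rewrite isGamma_perm // -pmnm_indm pmnm_le.
transitivity (lperm hs (fcoef m f G) *
  lperm hs (lshift (indm G) (acoef (a - indm G)%MM (pword w)))); first exact: rmorphM.
rewrite (lperm_fcoef hs hf hG) lperm_lshift pmnm_indm; congr (_ * lshift _ _).
rewrite (IH _ hw).
congr (acoef _ _).
by rewrite pmnmB pmnm_indm.
Qed.

(** Weight 1 everywhere gives the total degree; the weight [Wout c] counts only the variables w_x
    outside the block c. *)
Definition wdeg v (W : var v -> nat) (a : 'V_v) : nat := \sum_z W z * a (enum_rank z).
Definition wbound v (W : var v -> nat) (n : nat) (f : tLam k v) : Prop :=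
  forall a, a \in msupp f -> (wdeg W a <= n)%N.

Section WBound.
Variables (v : dimvec Q) (W : var v -> nat).
Implicit Types (f g : tLam k v) (n : nat).

Lemma wdegD a b : wdeg W (a + b)%MM = (wdeg W a + wdeg W b)%N.
Proof. by rewrite -big_split; apply: eq_bigr => z _; rewrite mnmDE mulnDr. Qed.

Lemma wbound_le n n' f : (n <= n')%N -> wbound W n f -> wbound W n' f.
Proof. by move=> nn h a /h /leq_trans ->. Qed.

Lemma wbound0 n : wbound W n 0.
Proof. by move=> a; rewrite msupp0. Qed.

Lemma wboundD n f g : wbound W n f -> wbound W n g -> wbound W n (f + g).
Proof. by move=> hf hg a /msuppD_le; rewrite mem_cat => /orP[/hf|/hg]. Qed.

Lemma wboundN n f : wbound W n f -> wbound W n (- f).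
Proof. by move=> hf a; rewrite (perm_mem (msuppN f)) => /hf. Qed.

Lemma wboundB n f g : wbound W n f -> wbound W n g -> wbound W n (f - g).
Proof. by move=> hf hg; apply: wboundD => //; apply: wboundN. Qed.

Lemma wboundM n n' f g : wbound W n f -> wbound W n' g -> wbound W (n + n') (f * g).
Proof.
by move=> hf hg a /msuppM_le /allpairsP[[b c]] /= [/hf hb /hg hc ->]; rewrite wdegD leq_add.
Qed.

Lemma wboundZ n (d : k) f : wbound W n f -> wbound W n (d *: f).
Proof. by move=> hf a /msuppZ_le/hf. Qed.

Lemma wboundC n (d : k) : wbound W n d%:MP.
Proof.
move=> a; rewrite msuppC; case: ifP => //; rewrite inE => _ /eqP ->.
by rewrite /wdeg big1 // => z _; rewrite mnm0E muln0.
Qed.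

Lemma wbound1 n : wbound W n 1.
Proof. by rewrite -mpolyC1; apply: wboundC. Qed.

Lemma wbound_sum (I : Type) (r : seq I) (P : pred I) (F : I -> tLam k v) n :
  (forall i, P i -> wbound W n (F i)) -> wbound W n (\sum_(i <- r | P i) F i).
Proof. by move=> h; elim/big_ind: _ => //; [exact: wbound0|move=> *; exact: wboundD]. Qed.

Lemma wbound_prod (I : Type) (r : seq I) (P : pred I) (F : I -> tLam k v) (n : I -> nat) :
  (forall i, P i -> wbound W (n i) (F i)) ->
  wbound W (\sum_(i <- r | P i) n i) (\prod_(i <- r | P i) F i).
Proof. by move=> h; elim/big_ind2: _ => // [|*]; [exact: wbound1|exact: wboundM]. Qed.

Lemma wboundX n f d : wbound W n f -> wbound W (n * d) (f ^+ d).
Proof.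
move=> hf; elim: d => [|d IH]; first exact: wbound1.
by rewrite exprS mulnS; apply: wboundM.
Qed.

Lemma wbound_mon (a : 'V_v) n : (wdeg W a <= n)%N -> wbound W n ('X_[k, a]).
Proof. by move=> h b; rewrite msuppX inE => /eqP ->. Qed.

Lemma wbound_pvar n z : (W z <= n)%N -> wbound W n (pvar k z).
Proof.
move=> h; apply: wbound_mon; rewrite /wdeg (bigD1 z) //= mnm1E eqxx muln1 big1 ?addn0 //.
by move=> z' h'; rewrite mnm1E (inj_eq enum_rank_inj) eq_sym (negbTE h') muln0.
Qed.

Lemma wbound_nat n d : wbound W n d%:R.
Proof. by rewrite -mpolyC_nat; apply: wboundC. Qed.

Lemma wbound_int n (d : int) : wbound W n d%:~R.
Proof. by case: d => d; rewrite ?NegzE ?mulrNz -?pmulrn; [|apply: wboundN]; apply: wbound_nat. Qed.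

Lemma wboundMc n f g : wbound W n f -> wbound W 0 g -> wbound W n (f * g).
Proof. by move=> hf hg; rewrite -[n]addn0; apply: wboundM. Qed.

Lemma wbound_prod0 (I : Type) (r : seq I) (P : pred I) (F : I -> tLam k v) :
  (forall i, P i -> wbound W 0 (F i)) -> wbound W 0 (\prod_(i <- r | P i) F i).
Proof.
by move=> h; elim/big_ind: _ => // [|*]; [exact: wbound1|exact: wboundMc].
Qed.

Hypothesis W0 : forall b, W (inl b) = 0%N.

Lemma wbound_hbar n : wbound W n (hbar k v).
Proof.
by apply: wbound_le (leq0n n) _; apply: wboundMc; [exact: wbound_nat|apply: wbound_pvar; rewrite W0].
Qed.

End WBound.

Lemma wbound_psubst v v' (W : var v -> nat) (W' : var v' -> nat) (h : var v -> tLam k v') n f :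
  (forall z, wbound W' (W z) (h z)) -> wbound W n f -> wbound W' n (psubst h f).
Proof.
move=> hz hf; rewrite [f]mpolyE rmorph_sum /= big_seq.
apply: wbound_sum => a /hf ha; rewrite psubstZ; apply: wboundZ; rewrite psubstX.
apply: wbound_le ha _; apply: wbound_prod => z _; exact: wboundX.
Qed.

Definition Wout v c (z : var v) : nat :=
  match z with inl _ => 0 | inr x => x \notin initial v c end.

Lemma wbound_wshift v c a n (f : tLam k v) :
  wbound (Wout c) n f -> wbound (Wout c) n (wshift a f).
Proof.
apply: wbound_psubst => -[b|x]; first exact: wbound_pvar.
apply: wboundD; first exact: wbound_pvar.
apply: wbound_le (leq0n _) _; apply: wboundMc; [exact: wbound_nat|exact: wbound_hbar].
Qed.

(* The part of the coefficient of u^a coming from the pairs (x, y) with y outside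
   [initial v c], when a is supported in [initial v c]: it depends on a only. *)
Definition cfac v c (a : 'W_v) : LamLoc k v :=
  \prod_(x in initial v c) \prod_(t < a (enum_rank x)) \prod_(y in ~: initial v c) pairf k x y (- t%:Z).

Lemma cfac0 v c : cfac c (0%MM : 'W_v) = 1.
Proof. by rewrite /cfac big1 // => x _; rewrite mnm0E big_ord0. Qed.

(** A cocycle rule: passing u^(1_G) over the factors sends index t to t + 1 at each x in G, and the
    freed index 0 is filled by the pairs of the new letter. The y are outside G, hence not
    shifted. *)
Lemma cfacD v c (G : {set widx v}) (a : 'W_v) : G \subset initial v c ->
  cfac c (indm G + a)%MM =
  (\prod_(x in G) \prod_(y in ~: initial v c) pairf k x y 0) * lshift (indm G) (cfac c a).
Proof.
move=> GC; rewrite /cfac rmorph_prod.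
have yG y : y \in ~: initial v c -> y \in G = false.
  by rewrite inE => h; apply/negbTE; apply: contra h; apply: subsetP.
rewrite big_mkcond [X in _ = X * _]big_mkcond [X in _ = _ * X]big_mkcond /= -big_split /=.
apply: eq_bigr => x _; rewrite mnmDE indmE; case: ifP => xC; last first.
  case: (boolP (x \in G)) => [/(subsetP GC)|_]; first by rewrite xC.
  by rewrite mulr1.
case: ifP => xG /=.
  rewrite add1n big_ord_recl; congr (_ * _); rewrite rmorph_prod; apply: eq_bigr => t _.
  rewrite rmorph_prod; apply: eq_bigr => y yC; rewrite [RHS]lshift_pairf !indmE xG (yG y yC).
  by congr (pairf k x y _); rewrite lift0; lia.
rewrite add0n mul1r rmorph_prod; apply: eq_bigr => t _.
rewrite rmorph_prod; apply: eq_bigr => y yC; rewrite [RHS]lshift_pairf !indmE xG (yG y yC).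
by congr (pairf k x y _); lia.
Qed.

End Coefficients.

(** * Comparison of coefficients for two dimension vectors *)

Section Coefficients.
Variables (k : comNzRingType) (Q : quiver).
Implicit Types (v m c : dimvec Q).
Local Notation "''W_' v" := 'X_{1..#|widx v|} (at level 8, v at level 2).
Local Notation "''V_' v" := 'X_{1..#|var v|} (at level 8, v at level 2).
Local Notation frc := (frac (@wdiff k Q _)).

Definition zword v' v (w : word k v) : word k v' := [seq (p.1, wzero v' p.2) | p <- w].
Definition wsize v (w : word k v) : nat := \sum_(p <- w) (msize p.2).-1.

Lemma fcoef_split v c m (f : tLam k v) (G : {set widx v}) : G \subset initial v c ->
  fcoef m f G = lfrac (restr m G f) * (\prod_(x in G) \prod_(y in initial v c :\: G) pairf k x y 0)
    * (\prod_(x in G) \prod_(y in ~: initial v c) pairf k x y 0).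
Proof.
move=> GC; rewrite fcoefE -mulrA; congr (_ * _); rewrite -big_split /=.
apply: eq_bigr => x _; rewrite (bigID (mem (initial v c))) /=; congr (_ * _).
  by apply: eq_bigl => y; rewrite !inE andbC andbC andbC.
apply: eq_bigl => y; rewrite !in_setC andbC; case: (boolP (y \in initial v c)) => //= yC.
by apply: contra yC; apply: (subsetP GC).
Qed.

Section Rel.
Variables (c v0 v : dimvec Q) (le : dimvec_le v0 v) (hc : dimvec_le c v0).

Definition embD (d : widx v0 * widx v0 * int) : widx v * widx v * int :=
  let: (x, y, n) := d in (wemb le x, wemb le y, n).

Definition inC (d : widx v0 * widx v0 * int) : bool :=
  (d.1.1 \in initial v0 c) && (d.1.2 \in initial v0 c).

(* b0 is b after setting the variables outside v0 to 0; the numerator of b has degree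
   at most n in the variables outside c. *)
Definition frac_rel n (b : LamLoc k v) (b0 : LamLoc k v0) :=
  exists N s0, [/\ all inC s0, b = frc N (map embD s0), b0 = frc (wzero v0 N) s0
    & wbound (Wout c) n N].

Lemma wzero_hbar : wzero v0 (hbar k v) = hbar k v0.
Proof. exact: wsubst_hbar. Qed.

Lemma wzero_wdiff d : wzero v0 (wdiff k (embD d)) = wdiff k d.
Proof.
case: d => [[x y] n] /=; rewrite (inj_eq (@wemb_inj _ _ _ le)).
case: ifP => _; last exact: rmorph1.
by rewrite rmorphD rmorphB rmorphM rmorph_int /= !wzero_emb wzero_hbar.
Qed.

Lemma wzero_den s0 : wzero v0 (den (@wdiff k Q v) (map embD s0)) = den (@wdiff k Q v0) s0.
Proof.
rewrite /den big_map rmorph_prod; apply: eq_bigr => d _; exact: wzero_wdiff.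
Qed.

Lemma emb_initial x : (wemb le x \in initial v c) = (x \in initial v0 c).
Proof. by rewrite !inE. Qed.

Lemma wbound_den s0 : all inC s0 -> wbound (Wout c) 0 (den (@wdiff k Q v) (map embD s0)).
Proof.
move=> /allP h; rewrite /den big_map big_seq; apply: wbound_prod0 => -[[x y] n] /h /andP[/= xC yC].
case: ifP => _; last exact: wbound1.
apply: wboundD; first by apply: wboundB; apply: wbound_pvar; rewrite /= emb_initial ?xC ?yC.
by apply: wboundMc; [exact: wbound_int|exact: wbound_hbar].
Qed.

Lemma frac_rel0 n : frac_rel n 0 0.
Proof. by exists 0, [::]; split; rewrite ?rmorph0 //; apply: wbound0. Qed.

Lemma frac_relD n b b0 d d0 : frac_rel n b b0 -> frac_rel n d d0 -> frac_rel n (b + d) (b0 + d0).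
Proof.
move=> [N [s [hs -> -> hN]]] [M [t [ht -> -> hM]]].
exists (N * den (@wdiff k Q v) (map embD t) + M * den (@wdiff k Q v) (map embD s)), (s ++ t); split.
- by rewrite all_cat hs.
- by rewrite map_cat fracD.
- by rewrite fracD rmorphD !rmorphM /= !wzero_den.
- by apply: wboundD; apply: wboundMc => //; apply: wbound_den.
Qed.

Lemma frac_relM n n' b b0 d d0 : frac_rel n b b0 -> frac_rel n' d d0 -> frac_rel (n + n') (b * d) (b0 * d0).
Proof.
move=> [N [s [hs -> -> hN]]] [M [t [ht -> -> hM]]].
exists (N * M), (s ++ t); split.
- by rewrite all_cat hs.
- by rewrite map_cat fracM.
- by rewrite fracM rmorphM.
- exact: wboundM.
Qed.

Lemma frac_rel_lfrac n N : wbound (Wout c) n N -> frac_rel n (lfrac N) (lfrac (wzero v0 N)).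
Proof. by move=> hN; exists N, [::]; split. Qed.

Lemma frac_rel1 : frac_rel 0 1 1.
Proof. by rewrite -[X in frac_rel _ _ X](rmorph1 (@lfrac k Q v0)) -(rmorph1 (@wzero k Q v v0));
  apply: frac_rel_lfrac; apply: wbound1. Qed.

Lemma frac_rel_prod (I : Type) (r : seq I) (P : pred I) F F0 :
  (forall i, P i -> frac_rel 0 (F i) (F0 i)) ->
  frac_rel 0 (\prod_(i <- r | P i) F i) (\prod_(i <- r | P i) F0 i).
Proof. by move=> h; elim/big_ind2: _ => // [|*]; [exact: frac_rel1|exact: (@frac_relM 0 0)]. Qed.

Lemma frac_rel_Rs x y t : x \in initial v0 c -> y \in initial v0 c ->
  frac_rel 0 (pairf k (wemb le x) (wemb le y) t) (pairf k x y t).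
Proof.
move=> xC yC; exists (pairn k (wemb le x) (wemb le y) t), (if tag x == tag y then [:: (x, y, - t)] else [::]).
split.
- by case: ifP => //= _; rewrite /inC /= xC yC.
- by rewrite /pairf /=; congr (frc _ _); case: ifP.
- rewrite /pairf; congr (frc _ _); rewrite rmorph_prod; apply: eq_bigr => e _.
  rewrite !rmorphD !rmorphN rmorphM rmorph_int /= !wzero_emb wzero_hbar.
  by rewrite /theta /hbar2 !wzero_inl.
- apply: wbound_prod0 => e _.
  apply: wboundD; last by apply: wboundMc; [exact: wbound_int|exact: wbound_hbar].
  apply: wboundB; last exact: wbound_pvar.
  apply: wboundD; last exact: wbound_pvar.
  by apply: wboundB; apply: wbound_pvar; rewrite /= emb_initial ?xC ?yC.
Qed.

Definition wext (a : 'W_v0) : 'W_v :=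
  [multinom oapp (fun y => a (enum_rank y)) 0%N (wpre v0 (enum_val i)) | i < _].

Lemma wextE a x : wext a (enum_rank (wemb le x)) = a (enum_rank x).
Proof. by rewrite mnmE enum_rankK wembK. Qed.

Lemma wextE_none a x : wpre v0 x = None -> wext a (enum_rank x) = 0%N.
Proof. by rewrite mnmE enum_rankK => ->. Qed.

Lemma wzero_wshift (a : 'W_v0) (N : tLam k v) : wzero v0 (wshift (wext a) N) = wshift a (wzero v0 N).
Proof.
pose F : {rmorphism tLam k v -> tLam k v0} := @wzero k Q v v0 \o wshift (wext a).
pose G : {rmorphism tLam k v -> tLam k v0} := wshift a \o @wzero k Q v v0.
apply: (psubst_ext (f := F) (g := G)) => [d|[b|x]] /=.
- by rewrite /wzero /wshift !wsubst_const.
- by rewrite wshift_pvar !wzero_inl wshift_pvar.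
rewrite wshift_pvar -/(wvar k x) rmorphD rmorphM rmorph_nat /= wzero_hbar wzero_wvar.
case Ex: (wpre v0 x) => [y|] /=; last by rewrite wextE_none // mul0r addr0 rmorph0.
by rewrite wshift_wvar -(wpre_some le Ex) wextE.
Qed.

Lemma frac_rel_lshift a n b b0 : frac_rel n b b0 -> frac_rel n (lshift (wext a) b) (lshift a b0).
Proof.
move=> [N [s [hs -> -> hN]]]; exists (wshift (wext a) N), (map (wshift_den a) s); split.
- by apply/allP => d /mapP[[[x y] t] /(allP hs) h ->].
- rewrite lshift_frac; congr (frc _ _); rewrite -!map_comp; apply: eq_map => -[[x y] t] /=.
  by rewrite !wextE.
- by rewrite lshift_frac wzero_wshift.
- exact: wbound_wshift.
Qed.

Lemma frac_rel_eq0 n b b0 : frac_rel n b b0 -> b = 0 -> b0 = 0.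
Proof. by move=> [N [s [hs -> -> _]]] /LamLoc_eq0 ->; apply/LamLoc_eq0; rewrite rmorph0. Qed.

(** The factors [cfac] run over all y outside the block, and these sets differ for v and v0, so they
    are not related by setting variables to 0. Only the cofactors are compared. *)
Definition coef_rel n (a0 : 'W_v0) (X : LamLoc k v) (Y : LamLoc k v0) :=
  exists b b0, [/\ X = b * cfac k c (wext a0), Y = b0 * cfac k c a0 & frac_rel n b b0].

Lemma coef_rel0 n a0 : coef_rel n a0 0 0.
Proof. by exists 0, 0; rewrite !mul0r; split=> //; apply: frac_rel0. Qed.

Lemma coef_relD n a0 X Y X' Y' : coef_rel n a0 X Y -> coef_rel n a0 X' Y' -> coef_rel n a0 (X + X') (Y + Y').
Proof.
move=> [b [b0 [-> -> h]]] [d [d0 [-> -> h']]]; exists (b + d), (b0 + d0).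
by rewrite !mulrDl; split=> //; apply: frac_relD.
Qed.

Lemma frac_rel_le n n' b b0 : (n <= n')%N -> frac_rel n b b0 -> frac_rel n' b b0.
Proof. by move=> nn [N [s [? ? ? h]]]; exists N, s; split=> //; apply: wbound_le h. Qed.

(** Pairs inside c have degree 0 in the outer variables and pairs leaving c are absorbed in [cfac],
    so a letter raises the bound by the degree of f only. *)
Lemma coef_rel_step n m (f : tLam k v) (G : {set widx v0}) a0 X Y :
  inLam1 m f -> isGamma m G -> G \subset initial v0 c -> coef_rel n a0 X Y ->
  coef_rel ((msize f).-1 + n) (indm G + a0)%MM
    (fcoef m f (wemb le @: G) * lshift (indm (wemb le @: G)) X)
    (fcoef m (wzero v0 f) G * lshift (indm G) Y).
Proof.
move=> hf hG GC [b [b0 [-> -> h]]].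
have GC' : wemb le @: G \subset initial v c.
  by apply/subsetP => x /imsetP[y /(subsetP GC) yC ->]; rewrite emb_initial.
have iE : indm (wemb le @: G) = wext (indm G).
  apply/wmnmP => x; rewrite indmE; case Ex: (wpre v0 x) => [y|].
    by rewrite -(wpre_some le Ex) wextE indmE mem_imset //; apply: wemb_inj.
  rewrite wextE_none //; case: imsetP => // -[y _ xy]; by rewrite xy wembK in Ex.
have wD : wext (indm G + a0)%MM = (indm (wemb le @: G) + wext a0)%MM.
  by apply/wmnmP => x; rewrite iE !(mnmE, mnmDE); case: (wpre _ _) => //= y; rewrite mnmDE mnmE.
have shM (u : dimvec Q) (a : 'W_u) (p q : LamLoc k u) : lshift a (p * q) = lshift a p * lshift a q.
  exact: rmorphM.
rewrite /coef_rel (fcoef_split _ _ GC') (fcoef_split _ _ GC) !shM wD (cfacD _ _ GC') (cfacD _ _ GC).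
exists (lfrac (restr m (wemb le @: G) f) *
   (\prod_(x in wemb le @: G) \prod_(y in initial v c :\: wemb le @: G) pairf k x y 0) *
   lshift (wext (indm G)) b).
exists (lfrac (restr m G (wzero v0 f)) *
   (\prod_(x in G) \prod_(y in initial v0 c :\: G) pairf k x y 0) * lshift (indm G) b0).
split; first by rewrite -iE; ring.
  by ring.
apply: frac_relM; last exact: frac_rel_lshift.
rewrite -[X in frac_rel X]addn0; apply: frac_relM.
  rewrite -(restr_wzero le hf hG); apply: frac_rel_lfrac.
  have [s [hs sG]] : exists s, Sv s /\ s @: initial v m = wemb le @: G.
    have := isGamma_le hG => mv0; have mv : dimvec_le m v.
      apply/forallP => i; exact: leq_trans (forallP mv0 i) (forallP le i).
    apply: isGamma_exists (isGamma_initial mv) _; apply/forallP => i.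
    rewrite -(eqP (forallP hG i)) -[X in _ == X](card_imset _ (@wemb_inj _ _ _ le)); apply/eqP/eq_card => x.
    rewrite !inE; apply/andP/imsetP => [[/imsetP[y yG ->] yi]|[y]].
      by exists y => //; rewrite inE yG.
    by rewrite inE => /andP[yG yi] ->; split=> //; apply/imsetP; exists y.
  rewrite (restrE hf hs sG).
  have : wbound (fun=> 1%N) (msize f).-1 f.
    move=> a /msize_mdeg_lt; case: (msize f) => // n'; rewrite ltnS /wdeg mdegE => /(leq_trans _); apply.
    rewrite (reindex_onto (@enum_rank (var v)) enum_val) /=; last by move=> i _; rewrite enum_valK.
    rewrite [X in (_ <= X)%N](eq_bigl predT); last by move=> z; rewrite enum_rankK eqxx.
    by apply: leq_sum => z _; rewrite mul1n.
  apply: wbound_psubst => -[b'|x]; apply: wbound_pvar => //=; exact: leq_b1.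
rewrite big_imset /=; last by move=> ????; apply: wemb_inj.
apply: frac_rel_prod => x xG.
have -> : initial v c :\: wemb le @: G = wemb le @: (initial v0 c :\: G).
  rewrite -(initial_emb le hc); apply/setP => y; rewrite !inE.
  apply/andP/imsetP => [[yG /imsetP[z zC yz]]|[z]].
    exists z => //; rewrite inE zC andbT; apply: contra yG => zG; rewrite yz; exact: imset_f.
  rewrite inE => /andP[zG zC] ->; split; last exact: imset_f.
  by rewrite mem_imset //; apply: wemb_inj.
rewrite big_imset /=; last by move=> ????; apply: wemb_inj.
apply: frac_rel_prod => y; rewrite inE => /andP[_ yC]; apply: frac_rel_Rs => //; exact: (subsetP GC).
Qed.

(** A subset G with [indm G <= wext a0] lies in the image of [wemb], so the expansions for v and v0
    run over the same index set and can be compared term by term. *)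
Lemma acoef_stable (w : word k v) (a0 : 'W_v0) : good w -> (forall x, x \notin initial v0 c -> a0 (enum_rank x) = 0%N) ->
  coef_rel (wsize w) a0 (acoef (wext a0) (pword w)) (acoef a0 (pword (zword v0 w))).
Proof.
elim: w a0 => [|[m f] w IH] a0 hw ha0.
  rewrite /pword !big_nil !acoef1.
  have -> : (wext a0 == 0%MM) = (a0 == 0%MM).
    apply/eqP/eqP => [/wmnmP e|->]; apply/wmnmP => x.
      by have := e (wemb le x); rewrite wextE !mnm0E.
    by rewrite mnmE mnm0E; case: (wpre _ _) => //= y; rewrite mnm0E.
  case: eqP => [->|_]; last exact: coef_rel0.
  have w0 : wext 0%MM = 0%MM.
    by apply/wmnmP => x; rewrite mnmE mnm0E; case: (wpre _ _) => //= y; rewrite mnm0E.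
  exists 1, 1; rewrite w0 !cfac0 !mulr1; split=> //; rewrite /wsize big_nil; exact: frac_rel1.
move/good_cons: hw => [/= hf hw]; rewrite [zword _ _]/= !pword_cons !acoef_FMOM /=.
rewrite (reindex_onto (fun G : {set widx v0} => wemb le @: G)
  (fun G => wemb le @^-1: G)) /=; last first.
  move=> G /andP[_ /wmnm_lepP GC]; apply/setP => x; apply/imsetP/idP => [[y + ->]|xG].
    by rewrite inE.
  have := GC x; rewrite indmE xG mnmE enum_rankK; case Ex: (wpre v0 x) => [y|] //= _.
  by exists y; rewrite ?inE (wpre_some le Ex).
rewrite (eq_bigl (fun G : {set widx v0} => isGamma m G && (indm G <= a0)%MM)); last first.
  move=> G; rewrite [X in _ && X](_ : _ = true) ?andbT; last first.
    by apply/eqP/setP => x; rewrite inE mem_imset //; apply: wemb_inj.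
  congr (_ && _); last first.
    apply/wmnm_lepP/wmnm_lepP => h x.
      have := h (wemb le x); rewrite wextE !indmE mem_imset //; exact: wemb_inj.
    rewrite indmE; case: imsetP => // -[y yG ->]; rewrite wextE.
    by have := h y; rewrite indmE yG.
  apply: eq_forallb => i; congr (_ == _).
  rewrite -[RHS](card_imset _ (@wemb_inj _ _ _ le)); apply: eq_card => x.
  rewrite !inE; apply/andP/imsetP => [[/imsetP[y yG ->] yi]|[y]].
    by exists y => //; rewrite inE yG.
  by rewrite inE => /andP[yG yi] ->; split=> //; apply/imsetP; exists y.
elim/big_ind2: _ => [|????|G /andP[hG Ga]]; [exact: coef_rel0|exact: coef_relD|].
have GC : G \subset initial v0 c.
  apply/subsetP => x xG; apply: contraTT isT => /ha0 e.
  by have := elimT (wmnm_lepP _ _) Ga x; rewrite indmE xG e.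
have -> : (wext a0 - indm (wemb le @: G))%MM = wext (a0 - indm G)%MM.
  apply/wmnmP => x; rewrite mnmBE indmE; case Ex: (wpre v0 x) => [y|].
    rewrite -(wpre_some le Ex) !wextE mnmBE indmE mem_imset //; exact: wemb_inj.
  by rewrite !wextE_none.
have aE : a0 = (indm G + (a0 - indm G))%MM by rewrite addmC submK.
rewrite [X in coef_rel _ X]aE /wsize big_cons /=; apply: coef_rel_step => //.
by apply: IH => // x /ha0; rewrite mnmBE => ->.
Qed.

End Rel.
End Coefficients.

(** * Dependence on the dimension vector *)

Section Stable.
Variables (k : comNzRingType) (Q : quiver).
Implicit Types (v m c : dimvec Q).
Local Notation "''W_' v" := 'X_{1..#|widx v|} (at level 8, v at level 2).
Local Notation "''V_' v" := 'X_{1..#|var v|} (at level 8, v at level 2).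
Local Notation frc := (frac (@wdiff k Q _)).

Definition sumw v (ws : seq (word k v)) : Aloc k v := \sum_(w <- ws) pword w.

Definition lgood v (ws : seq (word k v)) := forall w, w \in ws -> good w.

Lemma lgood_cons v w (ws : seq (word k v)) : lgood (w :: ws) <-> good w /\ lgood ws.
Proof.
split=> [h|[h h'] q]; first by split=> [|q qw]; apply: h; rewrite inE ?eqxx ?qw ?orbT.
by rewrite inE => /orP[/eqP ->|/h'].
Qed.

Lemma sumw_cons v w (ws : seq (word k v)) : sumw (w :: ws) = pword w + sumw ws.
Proof. exact: big_cons. Qed.

(** The variable theta_e occurs once in the factor of e, which is therefore of the form variable
    plus the rest. *)
Lemma lreg_pairf v (x y : widx v) t : GRing.lreg (pairf k x y t).
Proof.
apply: lreg_frac; apply: big_ind => [||e _]; [exact: lreg1|exact: lregM|].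
have -> : wvar k y - wvar k x + theta k v e - hbar2 k v + t%:~R * hbar k v =
  pvar k (inl (Some e)) + (wvar k y - wvar k x - hbar2 k v + t%:~R * hbar k v).
  by rewrite /theta; ring.
apply: lreg_affine => r; rewrite !rmorphD !rmorphN rmorphM rmorph_int rmorphM rmorph_nat /= !updv_pvar //.
Qed.

Lemma lreg_cfac v c (a : 'W_v) : GRing.lreg (cfac k c a).
Proof.
do 3![apply: big_ind => [||? _]; [exact: lreg1|exact: lregM|]]; exact: lreg_pairf.
Qed.

Lemma lreg_eq0 (R : pzRingType) (a b : R) : GRing.lreg a -> a * b = 0 -> b = 0.
Proof. by move=> h e; apply: h; rewrite e mulr0. Qed.

Section Rel.
Variables (c v0 v : dimvec Q) (le : dimvec_le v0 v) (hc : dimvec_le c v0).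

Lemma acoef_stable_sum n (ws : seq (word k v)) (a0 : 'W_v0) : lgood ws ->
  (forall w, w \in ws -> (wsize w <= n)%N) ->
  (forall x, x \notin initial v0 c -> a0 (enum_rank x) = 0%N) ->
  coef_rel c le n a0 (acoef (wext v a0) (sumw ws)) (acoef a0 (sumw (map (@zword _ _ v0 v) ws))).
Proof.
move=> hws hn ha; elim: ws hws hn => [|w ws IH].
  by rewrite /sumw !big_nil !raddf0 => _ _; apply: coef_rel0.
move=> /lgood_cons[hw hws] hn; rewrite /= !sumw_cons !raddfD /=.
apply: coef_relD; last by apply: IH => // w' h; apply: hn; rewrite inE h orbT.
have [b [b0 [-> -> h]]] := acoef_stable le hc hw ha; exists b, b0; split=> //.
by apply: frac_rel_le h; apply: hn; rewrite inE eqxx.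
Qed.

End Rel.

Lemma dimvec_refl v : dimvec_le v v.
Proof. exact/forallP. Qed.

Lemma dimvec_trans v1 v2 v3 : dimvec_le v1 v2 -> dimvec_le v2 v3 -> dimvec_le v1 v3.
Proof. by move=> /forallP h /forallP h'; apply/forallP => i; apply: leq_trans (h i) (h' i). Qed.

(** With c = v0 every exponent for v0 is supported in the block, so relations descend from v to v0.
    This is what makes the transition maps single-valued. *)
Lemma sumw_zword0 v0 v (ws : seq (word k v)) : dimvec_le v0 v -> lgood ws ->
  sumw ws = 0 -> sumw (map (@zword _ _ v0 v) ws) = 0.
Proof.
move=> le hws e; apply: acoefP => a0; rewrite raddf0.
have iT x : x \in initial v0 v0 by rewrite inE wposP.
pose n := \sum_(w <- ws) wsize w.
have hn w : w \in ws -> (wsize w <= n)%N.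
  by move=> h; rewrite /n (big_rem w) //= leq_addr.
have [|b [b0 [e1 -> hZ]]] := @acoef_stable_sum v0 _ _ le (dimvec_refl v0) n _ a0 hws hn.
  by move=> x; rewrite iT.
have b_0 : b = 0.
  by apply: (lreg_eq0 (@lreg_cfac _ v0 (wext v a0))); rewrite mulrC -e1 e raddf0.
by rewrite (frac_rel_eq0 hZ b_0) mul0r.
Qed.

Lemma acoef_total v (w : word k v) (a : 'W_v) i :
  (\sum_(x : widx v | tag x == i) a (enum_rank x) != \sum_(p <- w) p.1 i)%N ->
  acoef a (pword w) = 0.
Proof.
elim: w a => [|[m f] w IH] a.
  rewrite /pword !big_nil acoef1; case: (a =P 0%MM) => // ->.
  by rewrite big1 ?eqxx // => x _; rewrite mnm0E.
rewrite big_cons /= pword_cons acoef_FMOM => ne; rewrite big1 // => G /andP[hG Ga].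
rewrite IH ?rmorph0 ?mulr0 //; apply: contra ne => /eqP e.
rewrite -e -(eqP (forallP hG i)) -sum1_card [X in (X + _)%N](eq_bigl (fun x => (tag x == i) && (x \in G))); last first.
  by move=> x; rewrite inE andbC.
rewrite big_mkcondr -big_split /=; apply/eqP/eq_bigr => x _; rewrite mnmBE indmE.
have := elimT (wmnm_lepP _ _) Ga x; rewrite indmE; case: (x \in G) => h; last by rewrite subn0.
by rewrite /= subnKC.
Qed.

Lemma gamma_fix v (C S T : {set widx v}) :
  [disjoint C & S] -> [disjoint C & T] ->
  (forall i, #|[set x in S | tag x == i]| = #|[set x in T | tag x == i]|) ->
  exists s, [/\ Sv s, forall x, x \in C -> s x = x & s @: S = T].
Proof.
move=> CS CT ST.
(* An element of C carries itself as a label, so the permutation must fix it. *)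
pose lab (A : {set widx v}) x := (tag x, if x \in C then Some x else None, x \in A).
have [[[i o] b]|s hs] := @perm_fibers _ _ (lab S) (lab T).
  case: o => [z|].
    apply: eq_card => x; rewrite !inE /lab; case: (boolP (x \in C)) => xC.
      by rewrite (disjointFr CS xC) (disjointFr CT xC).
    by rewrite -!pair_eqE /= -!pair_eqE /= !andbF.
  have cE (A : {set widx v}) : [disjoint C & A] -> #|[set x | lab A x == (i, None, b)]| =
      if b then #|[set x in A | tag x == i]| else
      (v i - (#|[set x in C | tag x == i]| + #|[set x in A | tag x == i]|))%N.
    move=> CA; case: b.
      apply: eq_card => x; rewrite !inE /lab -!pair_eqE /= -!pair_eqE /=.
      case: (boolP (x \in C)) => xC; first by rewrite (disjointFr CA xC) andbF.
      by rewrite andbT eqb_id andbC.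
    have -> : (#|[set x in C | tag x == i]| + #|[set x in A | tag x == i]|)%N =
              #|[set x in C :|: A | tag x == i]|.
      have cap0 : [set x in C | tag x == i] :&: [set x in A | tag x == i] = set0.
        by apply/setP => x; rewrite !inE; case: (boolP (x \in C)) => //= /(disjointFr CA) ->; rewrite andbF.
      by rewrite -cardsUI cap0 cards0 addn0; apply: eq_card => x; rewrite !inE andb_orl.
    transitivity #|[set x in ~: (C :|: A) | tag x == i]|; last exact: card_tagC. 
    apply: eq_card => x; rewrite !inE /lab -!pair_eqE /= -!pair_eqE /=.
    by case: (boolP (x \in C)) => xC /=; rewrite ?andbF // andbT andbC; case: (x \in A).
  by rewrite !cE // ST.
have sC x : x \in C -> s x = x.
  by move=> xC; have := hs x; rewrite /lab xC => -[_]; case: ifP => // _ [->].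
exists s; split=> //; first by apply/forallP => x; have := hs x => -[->].
by apply/setP => x; rewrite -{1}(permKV s x) imset_perm_mem; have := hs (s^-1 x)%g; rewrite permKV => -[_ _ ->].
Qed.

Lemma move_inside v c v0 (S : {set widx v}) : dimvec_le v0 v -> dimvec_le c v0 ->
  [disjoint initial v c & S] ->
  (forall i, c i + #|[set x in S | tag x == i]| <= v0 i)%N ->
  exists s : {perm widx v}, [/\ Sv s, forall x, x \in initial v c -> s x = x
    & s @: S \subset initial v v0].
Proof.
move=> le hc CS hS; pose d : dimvec Q := [ffun i => c i + #|[set x in S | tag x == i]|]%N.
have dv : dimvec_le d v.
  by apply/forallP => i; rewrite ffunE; apply: leq_trans (hS i) (forallP le i).
have cd : dimvec_le c d by apply/forallP => i; rewrite ffunE leq_addr.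
have cI : initial v c \subset initial v d.
  by apply/subsetP => x; rewrite !inE => /leq_trans ->//; apply: (forallP cd).
have [|i|s [hs sC sS]] := @gamma_fix v (initial v c) S (initial v d :\: initial v c) CS.
- by rewrite -setI_eq0; apply/eqP/setP => x; rewrite !inE; case: (wpos x < c (tag x))%N.
- have := isGamma_initial dv => /forallP/(_ i)/eqP; rewrite ffunE.
  rewrite -(cardsID (initial v c) [set x in initial v d | tag x == i]).
  have -> : [set x in initial v d | tag x == i] :&: initial v c = [set x in initial v c | tag x == i].
    apply/setP => x; rewrite [LHS]inE [X in X && _]inE [RHS]inE andbAC; congr (_ && _).
    by case: (boolP (x \in initial v c)) => h; rewrite ?andbF // (subsetP cI).
  rewrite (eqP (forallP (isGamma_initial (dimvec_trans hc le)) i)) => /addnI <-.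
  by apply: eq_card => x; rewrite !inE andbA.
exists s; split=> //; rewrite sS; apply/subsetP => x; rewrite in_setD => /andP[_].
by rewrite !inE => /leq_trans -> //; rewrite ffunE.
Qed.

Lemma mext_exists v0 v (le : dimvec_le v0 v) (a : 'V_v) :
  (forall x, x \notin initial v v0 -> a (enum_rank (inr x)) = 0%N) ->
  exists b : 'V_v0, a = mext v b.
Proof.
move=> ha; exists (mvar (fun z : var v0 => match z with
   inl b => a (enum_rank (inl b)) | inr x => a (enum_rank (inr (wemb le x))) end)).
apply/vmnmP => -[b|x]; rewrite !mvarE //.
case Ex: (wpre v0 x) => [y|] /=; first by rewrite mvarE (wpre_some le Ex).
by rewrite ha // inE -leqNgt (wpre_none Ex).
Qed.

(** A monomial of N involves at most n variables outside c. A permutation fixing the block moves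
    them inside v0, where [wzero] does not lose the coefficient. *)
Lemma symmetric_eq0 v c v0 n (N : tLam k v) : dimvec_le v0 v -> dimvec_le c v0 ->
  (forall i, c i + n <= v0 i)%N -> wbound (Wout c) n N ->
  (forall s, Sv s -> (forall x, x \in initial v c -> s x = x) -> wperm s N = N) ->
  wzero v0 N = 0 -> N = 0.
Proof.
move=> le hc cn hN sN zN; apply/mpolyP => a; rewrite mcoeff0.
have [aN|/memN_msupp_eq0 //] := boolP (a \in msupp N).
pose S := [set x : widx v | (x \notin initial v c) && (a (enum_rank (inr x)) != 0%N)].
have [||s [hs sC sS]] := @move_inside v c v0 S le hc.
- by rewrite -setI_eq0; apply/eqP/setP => x; rewrite !inE; case: (_ < _)%N.
- move=> i; apply: leq_trans (cn i); rewrite leq_add2l; apply: leq_trans (hN _ aN).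
  rewrite /wdeg big_sumType /= -sum1_card; apply: leq_trans (leq_addl _ _).
  rewrite big_mkcond; apply: leq_sum => x _; rewrite !inE /=.
  by case: (_ < _)%N => //=; rewrite mul1n; case: (tag x == i); rewrite ?andbF // andbT -lt0n; case: ifP.
rewrite -(sN _ (SvV hs)); last first.
  by move=> x xC; apply: (@perm_inj _ s); rewrite permKV sC.
rewrite mcoeff_wperm; set b := mvar _.
have [|b' bE] := @mext_exists _ _ le b.
  move=> x xv; rewrite mvarE /=; apply: contraNeq xv => ne.
  have [xC|xC] := boolP ((s^-1)%g x \in initial v c).
    move: xC (xC) => /sC; rewrite permKV => {1}<-; rewrite !inE => /leq_trans -> //; exact: (forallP hc).
  by apply: (subsetP sS); rewrite -(permKV s x) imset_perm_mem inE xC.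
by rewrite bE -mcoeff_wzero // zN mcoeff0.
Qed.

Lemma lperm_cfac v c (s : {perm widx v}) (hs : Sv s) (a : 'W_v) :
  (forall x, x \in initial v c -> s x = x) -> lperm hs (cfac k c a) = cfac k c a.
Proof.
move=> sC; rewrite /cfac rmorph_prod; apply: eq_bigr => x xC.
rewrite rmorph_prod; apply: eq_bigr => t _.
have sI : s @: (~: initial v c) = ~: initial v c.
  apply/setP => y; rewrite -{1}(permKV s y) imset_perm_mem !in_setC; congr (~~ _).
  apply/idP/idP => [h|/[dup] h]; first by have := sC _ h; rewrite permKV => ->.
  by move/sC => e; rewrite -{1}e permK.
rewrite rmorph_prod -[in RHS]sI big_imset /=; last by move=> ????; apply: perm_inj.
by apply: eq_bigr => y _; rewrite [LHS]lperm_pairf sC.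
Qed.

Lemma wext_exists v0 v c (le : dimvec_le v0 v) (hc : dimvec_le c v0) (a : 'W_v) :
  (forall x, x \notin initial v c -> a (enum_rank x) = 0%N) ->
  exists a0 : 'W_v0, a = wext v a0 /\ (forall x, x \notin initial v0 c -> a0 (enum_rank x) = 0%N).
Proof.
move=> ha; exists [multinom a (enum_rank (wemb le (enum_val i))) | i < _].
split; last by move=> x xC; rewrite mnmE enum_rankK ha // emb_initial.
apply/wmnmP => x; case Ex: (wpre v0 x) => [y|].
  by rewrite -(wpre_some le Ex) wextE mnmE enum_rankK.
by rewrite wextE_none // ha // inE -leqNgt (leq_trans (forallP hc _)) // wpre_none.
Qed.

(* The coefficient of u^a, moved by symmetry so that a is supported in [initial v K],
   is a regular factor times a fraction whose numerator has degree at most n in the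
   other variables and is symmetric in them: if it vanishes once all but n of these
   are set to 0, it is zero. *)
Lemma stable_sumw v0 v (K : dimvec Q) n (ws : seq (word k v)) :
  dimvec_le v0 v -> (forall i, K i + n <= v0 i)%N -> lgood ws ->
  (forall w, w \in ws -> (wsize w <= n)%N) ->
  (forall w i, w \in ws -> (\sum_(p <- w) p.1 i = K i)%N) ->
  sumw (map (@zword _ _ v0 v) ws) = 0 -> sumw ws = 0.
Proof.
move=> le Kn hws hn hK e0; apply: acoefP => a; rewrite raddf0.
have hc : dimvec_le K v0 by apply/forallP => i; apply: leq_trans (Kn i); apply: leq_addr.
have [/forallP aK|] := boolP [forall i, (\sum_(x : widx v | tag x == i) a (enum_rank x) == K i)%N]; last first.
  move=> /forallPn[i ne]; rewrite /sumw raddf_sum big_seq big1 // => w hw.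
  by apply: (@acoef_total _ _ _ i); rewrite hK.
pose S := [set x : widx v | a (enum_rank x) != 0%N].
(* The block to be fixed is empty here: the permutation only has to bring the support of a into
   [initial v K]. *)
pose z : dimvec Q := [ffun=> 0%N].
have z0 : initial v z = set0 by apply/setP => x; rewrite !inE ffunE.
have [||||s [hs _ sS]] := @move_inside v z K S.
- exact: dimvec_trans hc le.
- by apply/forallP => i; rewrite ffunE.
- by rewrite z0 disjoints_subset sub0set.
- move=> i; rewrite ffunE add0n -(eqP (aK i)) -sum1_card.
  rewrite (eq_bigl (fun x => (tag x == i) && (x \in S))); last by move=> x; rewrite inE andbC.
  by rewrite big_mkcondr; apply: leq_sum => x _; rewrite inE -lt0n; case: ifP.
pose a' := pmnm s a.
have ha' x : x \notin initial v K -> a' (enum_rank x) = 0%N.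
  move=> xK; rewrite pmnmE; apply: contraNeq xK => ne.
  by apply: (subsetP sS); rewrite -(permKV s x) imset_perm_mem inE.
suff e : acoef a' (sumw ws) = 0.
  have aE : a = pmnm (s^-1)%g a' by apply/wmnmP => x; rewrite !pmnmE invgK permK.
  rewrite aE -(rmorph0 (lperm (SvV hs))) -e /sumw !raddf_sum /= big_seq [RHS]big_seq.
  by apply: eq_bigr => w hw; rewrite lperm_acoef //; apply: hws.
have [a0 [a'E ha0]] := wext_exists le hc ha'.
have [b [b0 [eb eb0 [N [s0 [hs0 bE b0E hN]]]]]] := acoef_stable_sum le hc hws hn ha0.
have b00 : b0 = 0.
  by apply: (lreg_eq0 (@lreg_cfac _ K a0)); rewrite mulrC -eb0 e0 raddf0.
rewrite a'E eb bE (_ : N = 0) ?(introT (LamLoc_eq0 _ _)) //.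
  by rewrite (_ : frc 0 _ = 0) ?mul0r //; apply/LamLoc_eq0.
apply: (@symmetric_eq0 v K v0 n) => //; last by apply/(LamLoc_eq0 _ s0); rewrite -b0E b00.
move=> t ht theta_deg.
(* The permutation fixes the exponent and [cfac], and [cfac] is regular, so equivariance passes to
   b. The denominator of b involves the block only, hence it is fixed too and cancels, leaving the
   invariance of N. *)
have tb : lperm ht b = b.
  apply: (@lreg_cfac _ K (wext v a0)); rewrite -{1}(lperm_cfac ht (wext v a0) theta_deg) -rmorphM mulrC.
  rewrite -eb /sumw !raddf_sum /= big_seq [RHS]big_seq; apply: eq_bigr => w hw.
  rewrite (lperm_acoef ht); last exact: hws.
  congr (acoef _ _); apply/wmnmP => x; rewrite pmnmE -a'E.
  have [xC|xC] := boolP (x \in initial v K).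
    by rewrite -{1}(theta_deg _ xC) permK.
  rewrite !ha' //; apply: contra xC => h; have := theta_deg _ h; rewrite permKV => e; by rewrite e.
move: tb; rewrite bE lperm_frac => /LamLoc_eq.
have -> : map (wperm_den t) (map (embD le) s0) = map (embD le) s0.
  rewrite -map_comp; apply/eq_in_map => -[[x y] d] /(allP hs0)/andP[/= xC yC].
  by rewrite !theta_deg ?emb_initial.
by rewrite ![_ * den _ _]mulrC => /lreg_den.
Qed.

End Stable.

(** * Lifting invariant polynomials *)

Section Types.
Variables (k : comNzRingType) (Q : quiver) (L : eqType) (lab : vert Q -> nat -> L).
Implicit Types (v m c : dimvec Q).
Local Notation "''V_' v" := 'X_{1..#|var v|} (at level 8, v at level 2).

Definition wlab v (x : widx v) : L := lab (tag x) (wpos x).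

(** One notion serves for S_m x S_(v-m), where the label tells whether a position is below m, and
    for the two nested blocks met in products of two operators. *)
Definition labinv (R : comNzRingType) v (f : tLam R v) : Prop :=
  forall s, Sv s -> (forall x, wlab (s x) = wlab x) -> wperm s f = f.

(* The orbit of a monomial under the permutations preserving the labels: the
   exponents of the parameters, and the number of variables with a given label
   and a given nonzero exponent. It does not depend on v. *)
Definition mtype := ((option (edge Q) -> nat) * (vert Q * L * nat -> nat))%type.

Definition mtp v (a : 'V_v) : mtype :=
  (fun b => a (enum_rank (inl b)),
   fun t => #|[set x : widx v | (tag x, wlab x, a (enum_rank (inr x))) == (t.1, t.2.+1)]|).

Lemma mtp_perm v (a b : 'V_v) : mtp a = mtp b ->
  exists s, [/\ Sv s, forall x, wlab (s x) = wlab x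
    & a = mvar (fun z => b (enum_rank (vperm s z)))].
Proof.
move=> [eb ew].
(* A type records nonzero exponents only, to be independent of v. The number of variables of
   exponent 0 is recovered as the complement. *)
have cnt M (c : 'V_v) i l : (mdeg c <= M)%N -> #|[set x : widx v | (tag x, wlab x, c (enum_rank (inr x))) == (i, l, 0%N)]| =
   (#|[set x : widx v | (tag x, wlab x) == (i, l)]| -
    \sum_(e < M.+1) (mtp c).2 (i, l, e : nat))%N.
  move=> cM; rewrite -(cardsID [set x | c (enum_rank (inr x)) != 0%N] [set x : widx v | (tag x, wlab x) == (i, l)]).
  rewrite [X in (X + _ - _)%N](_ : _ = \sum_(e < M.+1) (mtp c).2 (i, l, e : nat))%N; last first.
    rewrite /= (eq_bigr (fun e : 'I__ => \sum_x (((tag x, wlab x, c (enum_rank (inr x))) == (i, l, e.+1)) : nat)%N)); last first.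
      by move=> e _; rewrite -sum1_card big_mkcond; apply: eq_bigr => x _; rewrite inE /=; case: eqP.
    rewrite exchange_big /= -sum1_card big_mkcond /=; apply: eq_bigr => x _; rewrite !inE.
    have cx : (c (enum_rank (inr x)) <= M)%N.
      by apply: leq_trans cM; rewrite mdegE (bigD1 (enum_rank (inr x : var v))) //= leq_addr.
    case: (eqVneq (c (enum_rank (inr x))) 0%N) => [->|c0].
      by rewrite andbF big1 // => e _; rewrite -pair_eqE /= andbF.
    have ltc : ((c (enum_rank (inr x))).-1 < M.+1)%N by lia.
    rewrite (bigD1 (Ordinal ltc)) //= prednK ?lt0n // -[in RHS]pair_eqE /= eqxx andbT big1 ?addn0 => [|e].
      by case: (_ == _).
    rewrite -val_eqE /= => ne; rewrite -pair_eqE /= andbC; case: eqP => // ce.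
    by move: ne; rewrite ce eqxx.
  rewrite addKn; apply: eq_card => x; rewrite !inE -pair_eqE /= negbK andbC.
  by case: (_ == 0%N) => //=; rewrite ?andbF ?andbT.
have abE t : (mtp a).2 t = (mtp b).2 t := congr1 (fun f => f t) ew.
have [[[i l] [|e]]|s hs] := @perm_fibers _ _
    (fun x : widx v => (tag x, wlab x, a (enum_rank (inr x))))
    (fun x => (tag x, wlab x, b (enum_rank (inr x)))).
- rewrite !(cnt (mdeg a + mdeg b)%N) ?leq_addl ?leq_addr //; congr (_ - _)%N.
  by apply: eq_bigr => e _; apply: abE.
- by have := abE (i, l, e).
exists s; split; [by apply/forallP => x; have := hs x => -[->]|by move=> x; have := hs x => -[]|].
apply/vmnmP => -[o|x]; rewrite mvarE /=; first by have := congr1 (fun f => f o) eb.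
by have := hs x => -[].
Qed.

Lemma mtp_wperm v (s : {perm widx v}) (a : 'V_v) : Sv s -> (forall x, wlab (s x) = wlab x) ->
  mtp (mvar (fun z => a (enum_rank (vperm s z)))) = mtp a.
Proof.
move=> hs sl; congr pair; apply: functional_extensionality_dep => t.
  by rewrite mvarE.
rewrite -[RHS](card_imset _ (@perm_inj _ s^-1)); apply: eq_card => x.
rewrite -[x in RHS](permK s) imset_perm_mem !inE mvarE /= sl Sv_tag //.
Qed.

Lemma mtp_mext v0 v (le : dimvec_le v0 v) (a : 'V_v0) : mtp (mext v a) = mtp a.
Proof.
congr pair; apply: functional_extensionality_dep => t; first by rewrite mvarE.
rewrite -[RHS](card_imset _ (@wemb_inj _ _ _ le)); apply: eq_card => x; rewrite !inE mvarE.
apply/eqP/imsetP => [|[y + ->]]; last first.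
  by rewrite inE => /eqP <-; rewrite wembK.
case Ex: (wpre v0 x) => [y|] //= e; exists y; last by rewrite (wpre_some le Ex).
by rewrite inE -e -(wpre_some le Ex).
Qed.

Lemma labinv_mcoeff v (f : tLam k v) (a b : 'V_v) : labinv f -> mtp a = mtp b -> f@_a = f@_b.
Proof. by move=> hf /mtp_perm[s [hs sl ->]]; rewrite -mcoeff_wperm hf. Qed.

(** Prescribing coefficients on types defines compatible polynomials for all v at once; this is how
    an invariant at one v is lifted to the limit. *)
Definition mfam (d : nat) (phi : mtype -> k) v : tLam k v :=
  \sum_(a : 'X_{1..#|var v| < d.+1} | mdeg a == d) phi (mtp a) *: 'X_[a].

Lemma mcoeff_mfam d phi v (a : 'V_v) :
  (mfam d phi v)@_a = if mdeg a == d then phi (mtp a) else 0.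
Proof.
rewrite /mfam raddf_sum /=; case: eqP => ad; last first.
  rewrite big1 // => b /eqP bd; rewrite mcoeffZ mcoeffX; case: eqP => [ba|_]; last by rewrite mulr0.
  by rewrite -ba in ad.
have lta : (mdeg a < d.+1)%N by rewrite ad.
rewrite (bigD1 (BMultinom lta)) /= ?ad // mcoeffZ mcoeffX eqxx mulr1 big1 ?addr0 // => b /andP[_ ne].
rewrite mcoeffZ mcoeffX; case: eqP => [ba|_]; last by rewrite mulr0.
by case/eqP: ne; apply: val_inj.
Qed.

Lemma mfam_homog d phi v : mfam d phi v \is d.-homog.
Proof.
apply/dhomogP => a; rewrite mcoeff_msupp mcoeff_mfam; case: (mdeg a =P d) => // _; by rewrite eqxx.
Qed.

Lemma mfam_labinv d phi v : labinv (mfam d phi v).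
Proof.
move=> s hs sl; apply/mpolyP => a; rewrite mcoeff_wperm !mcoeff_mfam mtp_wperm //.
congr (if _ == _ then _ else _); rewrite !mdegE.
rewrite (reindex_onto (@enum_rank (var v)) enum_val) /=; last by move=> i _; rewrite enum_valK.
rewrite [RHS](reindex_onto (@enum_rank (var v)) enum_val) /=; last by move=> i _; rewrite enum_valK.
rewrite (eq_bigl predT); last by move=> z; rewrite enum_rankK eqxx.
rewrite [RHS](eq_bigl predT); last by move=> z; rewrite enum_rankK eqxx.
rewrite [RHS](reindex_inj (can_inj (@vpermK _ _ s))) /=; apply: eq_bigr => z _.
by rewrite mvarE.
Qed.

Lemma mdeg_mext v0 v (le : dimvec_le v0 v) (a : 'V_v0) : mdeg (mext v a) = mdeg a.
Proof.
rewrite !mdegE.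
rewrite (reindex_onto (@enum_rank (var v)) enum_val) /=; last by move=> i _; rewrite enum_valK.
rewrite [RHS](reindex_onto (@enum_rank (var v0)) enum_val) /=; last by move=> i _; rewrite enum_valK.
rewrite (eq_bigl predT); last by move=> z; rewrite enum_rankK eqxx.
rewrite [RHS](eq_bigl predT); last by move=> z; rewrite enum_rankK eqxx.
rewrite !big_sumType /=; congr (_ + _)%N; first by apply: eq_bigr => b _; rewrite mvarE.
rewrite (bigID (fun x => wpre v0 x == None)) /= [X in (X + _)%N]big1 ?add0n; last first.
  by move=> x /eqP h; rewrite mvarE h.
rewrite (reindex_omap (wemb le) (@wpre _ v0 v)) /=; last first.
  by move=> x; case E: (wpre v0 x) => [y|] //= _; rewrite (wpre_some le E).
by apply: eq_big => [x|x _]; rewrite ?mvarE wembK ?eqxx.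
Qed.

Lemma mfam_wzero d phi v0 v : dimvec_le v0 v -> wzero v0 (mfam d phi v) = mfam d phi v0.
Proof.
by move=> le; apply/mpolyP => a; rewrite mcoeff_wzero // !mcoeff_mfam mtp_mext // mdeg_mext.
Qed.

Lemma mfam_exists d v (f : tLam k v) : f \is d.-homog -> labinv f -> exists phi, mfam d phi v = f.
Proof.
move=> hd hf.
have /choice[phi hphi] (t : mtype) : exists c : k, forall a : 'V_v, mtp a = t -> f@_a = c.
  have [[a <-]|h] := pselect (exists a : 'V_v, mtp a = t).
    by exists f@_a => b e; apply: labinv_mcoeff.
  (* A type without monomials for this v gets the coefficient 0, an arbitrary choice: lifts are not
     unique. *)
  by exists 0 => a e; case: h; exists a.
exists phi; apply/mpolyP => a; rewrite mcoeff_mfam -(hphi _ a) //.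
case: eqP => // ne; apply/esym/memN_msupp_eq0; apply/negP => /(dhomogP _ _ _ hd)/ne; by [].
Qed.

End Types.

(** * Words with letters in the limit, and lifting of homogeneous words *)

Section Families.
Variables (k : comNzRingType) (Q : quiver).
Implicit Types (v m : dimvec Q).
Local Notation "''W_' v" := 'X_{1..#|widx v|} (at level 8, v at level 2).
Local Notation "''V_' v" := 'X_{1..#|var v|} (at level 8, v at level 2).

Definition mlab m : vert Q -> nat -> bool := fun i p => (p < m i)%N.

Lemma inLam1_labinv v m (f : tLam k v) : inLam1 m f <-> labinv (mlab m) f.
Proof.
have h (s : {perm widx v}) : s @: initial v m = initial v m <->
    (forall x, wlab (mlab m) (s x) = wlab (mlab m) x).
  have wE x : wlab (mlab m) x = (x \in initial v m) by rewrite inE.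
  split=> [e x|e]; first by rewrite !wE -{1}e imset_perm_mem.
  by apply/setP => x; rewrite -(permKV s x) imset_perm_mem -!wE e.
by split=> hf s hs /h; apply: hf.
Qed.

Lemma inLam1D v m (f g : tLam k v) : inLam1 m f -> inLam1 m g -> inLam1 m (f + g).
Proof. by move=> hf hg s h1 h2; rewrite rmorphD /= hf ?hg. Qed.
Lemma inLam1N v m (f : tLam k v) : inLam1 m f -> inLam1 m (- f).
Proof. by move=> hf s h1 h2; rewrite rmorphN /= hf. Qed.
Lemma inLam1_0 v m : inLam1 m (0 : tLam k v).
Proof. by move=> s _ _; rewrite rmorph0. Qed.
Lemma inLam1_C v m c : inLam1 m (c%:MP : tLam k v).
Proof. by move=> s _ _; rewrite /wperm wsubst_const. Qed.
Lemma inLam1_sum v m (I : Type) (r : seq I) (P : pred I) (F : I -> tLam k v) :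
  (forall i, P i -> inLam1 m (F i)) -> inLam1 m (\sum_(i <- r | P i) F i).
Proof. by move=> h; elim/big_ind: _ => //; [exact: inLam1_0|exact: inLam1D]. Qed.

Lemma pihomog_mcoeff v d (g : tLam k v) a : (pihomog mdeg d g)@_a = if mdeg a == d then g@_a else 0.
Proof.
rewrite pihomogE raddf_sum /=.
have [ag|ag] := boolP (a \in msupp g); last first.
  rewrite (memN_msupp_eq0 ag) if_same big_seq_cond big1 // => b /andP[bg _].
  by rewrite mcoeffZ mcoeffX; case: eqP ag => [<-|]; rewrite ?bg // mulr0.
rewrite big_mkcond (bigD1_seq a) //= big1 ?addr0 => [|b ne].
  by case: ifP => _; rewrite ?mcoeffZ ?mcoeffX ?eqxx ?mulr1 ?mcoeff0.
by case: ifP => _; rewrite ?mcoeff0 // mcoeffZ mcoeffX (negbTE ne) mulr0.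
Qed.

Lemma inLam1_pihomog v m d (f : tLam k v) : inLam1 m f -> inLam1 m (pihomog mdeg d f).
Proof.
move=> hf s hs sm; apply/mpolyP => a; rewrite mcoeff_wperm !pihomog_mcoeff -mcoeff_wperm hf //.
congr (if _ == _ then _ else _); rewrite !mdegE.
rewrite (reindex_onto (@enum_rank (var v)) enum_val) /=; last by move=> i _; rewrite enum_valK.
rewrite [RHS](reindex_onto (@enum_rank (var v)) enum_val) /=; last by move=> i _; rewrite enum_valK.
rewrite (eq_bigl predT); last by move=> z; rewrite enum_rankK eqxx.
rewrite [RHS](eq_bigl predT); last by move=> z; rewrite enum_rankK eqxx.
rewrite [RHS](reindex_inj (can_inj (@vpermK _ _ s))) /=; apply: eq_bigr => z _.
by rewrite mvarE.
Qed.

Lemma FMOD v m (f g : tLam k v) : FMO m (f + g) = FMO m f + FMO m g.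
Proof.
rewrite !FMO_skewm -big_split; apply: eq_bigr => G _ /=.
have -> : fcoef m (f + g) G = fcoef m f G + fcoef m g G.
  have rD : restr m G (f + g) = restr m G f + restr m G g by exact: rmorphD.
  by rewrite !fcoefE rD rmorphD mulrDl.
exact: scalerDl.
Qed.

Lemma FMO_0 v m : FMO m (0 : tLam k v) = 0.
Proof. by apply: (addIr (FMO m 0)); rewrite -FMOD !add0r. Qed.

Lemma FMON v m (f : tLam k v) : FMO m (- f) = - FMO m f.
Proof. by apply: (addIr (FMO m f)); rewrite -FMOD !addNr FMO_0. Qed.

Lemma FMO_sum v m (I : Type) (r : seq I) (P : pred I) (F : I -> tLam k v) :
  FMO m (\sum_(i <- r | P i) F i) = \sum_(i <- r | P i) FMO m (F i).
Proof. by apply: (big_morph _ (@FMOD v m) (FMO_0 v m)). Qed.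

Definition dim0 : dimvec Q := [ffun=> 0%N].

Lemma dim0_le v : dimvec_le dim0 v.
Proof. by apply/forallP => i; rewrite ffunE. Qed.

Lemma initial0 v : initial v dim0 = set0.
Proof. by apply/setP => x; rewrite !inE ffunE. Qed.

Lemma FMO_dim0 v (f : tLam k v) : inLam1 dim0 f -> FMO dim0 f = Apoly f.
Proof.
move=> hf; rewrite FMO_skewm (big_pred1 set0) => [|G]; last first.
  apply/forallP/eqP => [h|-> i]; last by rewrite ffunE; apply/eqP/eq_card0 => x; rewrite !inE.
  apply/setP => x; rewrite inE; apply/negP => xG.
  have := eqP (h (tag x)); rewrite ffunE => /eqP; rewrite cards_eq0 => /eqP/setP/(_ x).
  by rewrite !inE xG eqxx.
rewrite fcoefE big_set0 mulr1 (@restrE _ _ _ _ _ _ 1%g) ?wperm1 //; last 2 first.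
- exact: Sv1.
- by rewrite initial0 imset0.
by congr (skewm _ _ _); apply/wmnmP => x; rewrite indmE inE mnm0E.
Qed.

Lemma FMO1 v : FMO dim0 (1 : tLam k v) = 1.
Proof. by rewrite FMO_dim0 ?rmorph1 //; rewrite -mpolyC1; apply: inLam1_C. Qed.

Lemma pword_cat v (w w' : word k v) : pword (w ++ w') = pword w * pword w'.
Proof. exact: big_cat. Qed.

(** The sign is a letter of dimension 0, so that differences of products remain sums of words. *)
Definition negw v (w : word k v) : word k v := (dim0, -1) :: w.

Lemma pword_neg v (w : word k v) : pword (negw w) = - pword w.
Proof. by rewrite pword_cons /= FMON FMO1 mulN1r. Qed.

Definition fword := seq (dimvec Q * Lamfam k Q).

(** Components of a family at v not above its dimension are arbitrary; they are replaced by 0, and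
    the operator vanishes there in any case. *)
Definition fev v (w : fword) : word k v :=
  [seq (p.1, if dimvec_le p.1 v then p.2 v else 0) | p <- w].

Definition pfword (w : fword) : Afam k Q := \prod_(p <- w) FMOlim p.1 p.2.
Definition sumf (ws : seq fword) : Afam k Q := \sum_(w <- ws) pfword w.

Lemma FMOlimE m (f : Lamfam k Q) v : FMOlim m f v = FMO m (f v).
Proof. by rewrite /FMOlim; case: ifP => // /negbT/FMO0 ->. Qed.

Lemma famM (a b : Afam k Q) v : (a * b) v = a v * b v. Proof. by []. Qed.
Lemma famD (a b : Afam k Q) v : (a + b) v = a v + b v. Proof. by []. Qed.

Lemma pfwordE w v : pfword w v = pword (fev v w).
Proof.
elim: w => [|p w IH]; first by rewrite /pfword /pword !big_nil.
rewrite [fev _ _]/= pword_cons -IH [pfword _]big_cons famM FMOlimE.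
case: (boolP (dimvec_le p.1 v)) => h /=; first by [].
by rewrite FMO_0 (FMO0 _ h).
Qed.

Lemma sumfE ws v : sumf ws v = sumw (map (fev v) ws).
Proof.
rewrite /sumf /sumw; elim: ws => [|w ws IH]; first by rewrite !big_nil.
by rewrite big_cons famD IH /= big_cons pfwordE.
Qed.

Lemma sumf_cons w ws : sumf (w :: ws) = pfword w + sumf ws.
Proof. exact: big_cons. Qed.

Lemma pfword_cons p w : pfword (p :: w) = FMOlim p.1 p.2 * pfword w.
Proof. exact: big_cons. Qed.

Fixpoint hword v (w : word k v) (kd : deg Q) : Prop :=
  match w with
  | [::] => kd = 0
  | p :: w' => exists d kd', [/\ dimvec_le p.1 v, inLam1 p.1 p.2, isHomog d p.2,
       kd = degM p.1 d + kd' & hword w' kd']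
  end.

Fixpoint hfword (w : fword) (kd : deg Q) : Prop :=
  match w with
  | [::] => kd = 0
  | p :: w' => exists d kd', [/\ homogLam1lim p.1 d p.2,
       kd = degM p.1 d + kd' & hfword w' kd']
  end.

Lemma hword_cat v (w w' : word k v) kd kd' :
  hword w kd -> hword w' kd' -> hword (w ++ w') (kd + kd').
Proof.
elim: w kd => [|p w IH] kd /=; first by move=> ->; rewrite add0r.
move=> [d [kd1 [h1 h2 h3 -> hw]]] hw'; exists d, (kd1 + kd'); split=> //; first by rewrite addrA.
exact: IH.
Qed.

Lemma degM0 : degM dim0 0 = 0.
Proof.
rewrite /degM; congr pair; first by apply/ffunP => i; rewrite !ffunE.
by rewrite /cform big1 // => i _; rewrite big1 // => j _; rewrite !ffunE mulr0.
Qed.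

Lemma hword_neg v (w : word k v) kd : hword w kd -> hword (negw w) kd.
Proof.
move=> hw; exists 0%N, kd; rewrite degM0 add0r; split=> //; first exact: dim0_le.
- by rewrite /= -[1]mpolyC1 -mpolyCN; apply: inLam1_C.
- by rewrite /isHomog /= dhomogN dhomog1.
Qed.

Lemma sumw_cat v (ws ws' : seq (word k v)) : sumw (ws ++ ws') = sumw ws + sumw ws'.
Proof. exact: big_cat. Qed.

Lemma homogA_words v kd (b : Aloc k v) : homogA kd b ->
  exists ws, (forall w, w \in ws -> hword w kd) /\ b = sumw ws.
Proof.
elim=> [m d f mv hf hd||kd'|kd' a b' _ [ws [h1 ->]] _ [ws' [h2 ->]]|kd1 kd2 a b' _ [ws [h1 ->]] _ [ws' [h2 ->]]].
- exists [:: [:: (m, f)]]; split; last by rewrite /sumw big_seq1 /pword big_seq1.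
  by move=> w; rewrite inE => /eqP ->; exists d, 0; rewrite addr0.
- exists [:: [::]]; split; last by rewrite /sumw big_seq1 /pword big_nil.
  by move=> w; rewrite inE => /eqP ->.
- by exists [::]; split=> //; rewrite /sumw big_nil.
- exists (ws ++ map (@negw v) ws'); split.
    by move=> w; rewrite mem_cat => /orP[/h1 //|/mapP[w' /h2 h ->]]; apply: hword_neg.
  rewrite sumw_cat; congr (_ + _); rewrite /sumw big_map -sumrN.
  by apply: eq_bigr => w _; rewrite pword_neg.
- exists [seq w ++ w' | w <- ws, w' <- ws']; split.
    by move=> w /allpairsP[[w1 w2] /= [/h1 h /h2 h' ->]]; apply: hword_cat.
  rewrite /sumw big_allpairs_dep /= mulr_suml; apply: eq_bigr => w _.
  by rewrite mulr_sumr; apply: eq_bigr => w' _; rewrite pword_cat.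
Qed.

Lemma lift_lam1 v m d (f : tLam k v) : dimvec_le m v -> inLam1 m f -> isHomog d f ->
  exists F : Lamfam k Q, homogLam1lim m d F /\ F v = f.
Proof.
move=> mv /inLam1_labinv hf hd; have [phi hphi] := mfam_exists hd hf.
exists (fun u => mfam (mlab m) d phi u); split=> //; split=> [u mu|u u' mu uu].
  by split; [apply/inLam1_labinv; exact: mfam_labinv|exact: mfam_homog].
exact: mfam_wzero.
Qed.

Lemma lift_word v (w : word k v) kd : hword w kd ->
  exists F, hfword F kd /\ fev v F = w.
Proof.
elim: w kd => [|[m f] w IH] kd /=; first by move=> ->; exists [::].
move=> [d [kd' [mv hf hd -> /IH[F [hF <-]]]]].
have [f' [hf' <-]] := lift_lam1 mv hf hd.
by exists ((m, f') :: F); split; [exists d, kd'|rewrite /= mv].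
Qed.

Lemma lift_words v (ws : seq (word k v)) kd : (forall w, w \in ws -> hword w kd) ->
  exists Fs, [/\ (forall F, F \in Fs -> hfword F kd) & map (fev v) Fs = ws].
Proof.
elim: ws => [|w ws IH] h; first by exists [::].
have [|Fs [hFs <-]] := IH; first by move=> w' h'; apply: h; rewrite inE h' orbT.
have [|F [hF <-]] := @lift_word v w kd; first by apply: h; rewrite inE eqxx.
by exists (F :: Fs); split=> // F'; rewrite inE => /orP[/eqP ->|/hFs].
Qed.

Definition goodf (w : fword) := forall p, p \in w -> exists d, homogLam1lim p.1 d p.2.

Lemma goodf_cons p w : goodf (p :: w) <-> (exists d, homogLam1lim p.1 d p.2) /\ goodf w.
Proof.
split=> [h|[h h'] q]; first by split=> [|q qw]; apply: h; rewrite inE ?eqxx ?qw ?orbT.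
by rewrite inE => /orP[/eqP ->|/h'].
Qed.

Lemma hfword_good w kd : hfword w kd -> goodf w.
Proof.
elim: w kd => [|p w IH] kd //= [d [kd' [h1 _ /IH h2]]]; apply/goodf_cons; split=> //; by exists d.
Qed.

Lemma goodf_hfword w : goodf w -> exists kd, hfword w kd.
Proof.
elim: w => [|p w IH]; first by exists 0.
by move=> /goodf_cons[[d hd] /IH[kd h]]; exists (degM p.1 d + kd), d, kd.
Qed.

Definition compfam m (F : Lamfam k Q) :=
  (forall v, dimvec_le m v -> inLam1 m (F v)) /\
  (forall v v', dimvec_le m v' -> dimvec_le v' v -> wzero v' (F v) = F v').

Definition compf (w : fword) := forall p, p \in w -> compfam p.1 p.2.

Lemma compf_cons p w : compf (p :: w) <-> compfam p.1 p.2 /\ compf w.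
Proof.
split=> [h|[h h'] q]; first by split=> [|q qw]; apply: h; rewrite inE ?eqxx ?qw ?orbT.
by rewrite inE => /orP[/eqP ->|/h'].
Qed.

Lemma goodf_compf w : goodf w -> compf w.
Proof. by move=> hw p /hw[d [h h']]; split=> // v /h[]. Qed.

Lemma good_fev v w : compf w -> good (fev v w).
Proof.
move=> hw p /mapP[q /hw[h _] ->] /=; case: ifP => [/h//|_]; exact: inLam1_0.
Qed.

Lemma pword_zword_fev v0 v w : dimvec_le v0 v -> compf w ->
  pword (zword v0 (fev v w)) = pword (fev v0 w).
Proof.
move=> le; elim: w => [|p w IH] hw; first by [].
have [[_ hz] hw'] := (compf_cons p w).1 hw.
rewrite [fev v _]/= [fev v0 _]/= [zword _ _]/= !pword_cons -(IH hw').
case: (boolP (dimvec_le p.1 v0)) => h; last by rewrite (FMO0 _ h) (FMO0 _ h).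
by rewrite (dimvec_trans h le) (hz _ _ h le).
Qed.

Lemma sumw_zword_fev v0 v ws : dimvec_le v0 v -> (forall w, w \in ws -> compf w) ->
  sumw (map (@zword _ _ v0 v) (map (fev v) ws)) = sumw (map (fev v0) ws).
Proof.
move=> le h; rewrite /sumw !big_map big_seq [RHS]big_seq.
by apply: eq_bigr => w /h hw; apply: pword_zword_fev.
Qed.

Lemma sumf_restr v0 v ws : dimvec_le v0 v -> (forall w, w \in ws -> compf w) ->
  sumf ws v = 0 -> sumf ws v0 = 0.
Proof.
move=> le h; rewrite !sumfE -(sumw_zword_fev le h); apply: sumw_zword0 => // w /mapP[w' /h hw ->].
exact: good_fev.
Qed.

End Families.

(** * Generation of the limit by the operators, and surjectivity *)

Section PartOne.
Variables (k : comNzRingType) (Q : quiver).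
Implicit Types (v m : dimvec Q).

Definition dsize m : nat := \sum_i m i.
Definition cartan_size : nat := \sum_(i : vert Q) \sum_j `|cartan i j|%N.

Lemma cform_ge m : - (cartan_size * dsize m ^ 2)%N%:Z <= (cform (dimZ m) (dimZ m) %/ 2)%Z.
Proof.
rewrite lez_divRL //.
have h : `|cform (dimZ m) (dimZ m)| <= (cartan_size * dsize m ^ 2)%N%:Z.
  rewrite /cform /cartan_size big_distrl /= (big_morph Posz (id1 := 0%:Z) (op1 := +%R)) //.
  apply: le_trans (ler_norm_sum _ _ _) _; apply: ler_sum => i _.
  rewrite big_distrl /= (big_morph Posz (id1 := 0%:Z) (op1 := +%R)) //.
  apply: le_trans (ler_norm_sum _ _ _) _; apply: ler_sum => j _.
  rewrite !ffunE !normrM -!abszE /= -!PoszM lez_nat -mulnA leq_mul2l; apply/orP; right.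
  have hm l : (m l <= dsize m)%N by rewrite /dsize (bigD1 l) //= leq_addr.
  by rewrite expnS expn1; apply: leq_mul.
have := ler_norm (- cform (dimZ m) (dimZ m)); rewrite normrN => h2; lia.
Qed.

(** The degree of a word is the sum of deg f + (m, m)/2 over its letters. The lower bound for (m,
    m)/2 thus bounds the total polynomial degree in terms of kd alone, the sum of the |kd.1 i| being
    the total dimension of the word. *)
Definition deg_bound (kd : deg Q) : nat :=
  `|kd.2|%N + cartan_size * (\sum_i `|kd.1 i|%N) ^ 2.

Lemma hfword_dim (w : fword k Q) (kd : deg Q) : hfword w kd -> forall i, kd.1 i = (\sum_(p <- w) p.1 i)%N%:Z.
Proof.
elim: w kd => [|p w IH] kd /=; first by move=> -> i; rewrite big_nil /= ffunE.
by move=> [d [kd' [_ -> /IH h]]] i; rewrite big_cons /= ffunE h ffunE PoszD.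
Qed.

Lemma hfword_size (w : fword k Q) (kd : deg Q) v : hfword w kd -> (wsize (fev v w) <= deg_bound kd)%N.
Proof.
move=> hw.
have [D [eD hD]] : exists D : nat, (wsize (fev v w) <= D)%N /\
    (D%:Z <= kd.2 + (cartan_size * (\sum_(p <- w) dsize p.1 ^ 2))%N%:Z).
  elim: w kd hw => [|p w IH] kd /=; first by move=> ->; exists 0%N; rewrite /wsize !big_nil muln0.
  move=> [d [kd' [[h _] -> /IH[D [h1 h2]]]]]; exists (d + D)%N; split; last first.
    by have := cform_ge p.1; rewrite big_cons mulnDr /=; lia.
  rewrite /wsize big_cons /= leq_add //; case: ifP => [/h[_ /dhomogP hd]|_]; last by rewrite msize0.
  case E: (msize (p.2 v)) => [//|n] /=; have nz : p.2 v != 0 by rewrite -msize_poly_eq0 E.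
  have e : mdeg (mlead (p.2 v)) = d := hd _ (mlead_supp nz); by rewrite -e -ltnS mlead_deg // E.
apply: leq_trans eD _.
have hs : (\sum_(p <- w) dsize p.1 ^ 2 <= (\sum_(p <- w) dsize p.1) ^ 2)%N.
  elim: (w) => [|p w' IH]; first by rewrite !big_nil.
  by rewrite !big_cons; nia.
have -> : deg_bound kd = (`|kd.2| + cartan_size * (\sum_(p <- w) dsize p.1) ^ 2)%N.
  congr (_ + _ * _ ^ _)%N; rewrite exchange_big /=; apply: eq_bigr => i _.
  by rewrite (hfword_dim hw).
have : (cartan_size * \sum_(p <- w) dsize p.1 ^ 2 <= cartan_size * (\sum_(p <- w) dsize p.1) ^ 2)%N.
  by rewrite leq_mul2l hs orbT.
lia.
Qed.

Lemma stable_sumf v0 v (K : dimvec Q) n (ws : seq (fword k Q)) :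
  dimvec_le v0 v -> (forall i, K i + n <= v0 i)%N -> (forall w, w \in ws -> compf w) ->
  (forall w, w \in ws -> (wsize (fev v w) <= n)%N) ->
  (forall w i, w \in ws -> (\sum_(p <- w) p.1 i = K i)%N) ->
  sumf ws v0 = 0 -> sumf ws v = 0.
Proof.
move=> le Kn hg hn hK; rewrite !sumfE -(sumw_zword_fev le hg).
apply: (stable_sumw le Kn); first by move=> w /mapP[w' /hg/good_fev h ->].
  by move=> w /mapP[w' /hn h ->].
by move=> w i /mapP[w' /hK <- ->]; rewrite big_map.
Qed.

Lemma PhiB v v' (a b : Aloc k v) (a' b' : Aloc k v') : Phi a a' -> Phi b b' -> Phi (a - b) (a' - b').
Proof. exact: subring_genB. Qed.
Lemma PhiM v v' (a b : Aloc k v) (a' b' : Aloc k v') : Phi a a' -> Phi b b' -> Phi (a * b) (a' * b').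
Proof. exact: subring_genM. Qed.
Lemma Phi1 v v' : Phi (1 : Aloc k v) (1 : Aloc k v').
Proof. exact: subring_gen1. Qed.
Lemma Phi0 v v' : Phi (0 : Aloc k v) (0 : Aloc k v').
Proof. by have := PhiB (Phi1 v v') (Phi1 v v'); rewrite !subrr. Qed.

(** A pair in the graph consists of two evaluations of one sum of words, so that the stability of
    relations shows that the graph is the graph of a map. *)
Lemma Phi_words v v' (a : Aloc k v) (a' : Aloc k v') : dimvec_le v' v -> Phi a a' ->
  exists ws, [/\ lgood ws, a = sumw ws & a' = sumw (map (@zword _ _ v' v) ws)].
Proof.
move=> le h; suff : exists ws, [/\ lgood ws, (a, a').1 = sumw ws &
  (a, a').2 = sumw (map (@zword _ _ v' v) ws)] by [].
elim: h => {a a'} [_ [m [f [mv hf ->]]]||a b _ [ws [h1 e1 e1']] _ [ws' [h2 e2 e2']]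
  |a b _ [ws [h1 e1 e1']] _ [ws' [h2 e2 e2']]] /=.
- exists [:: [:: (m, f)]]; split.
  + by move=> w; rewrite inE => /eqP -> p; rewrite inE => /eqP ->.
  + by rewrite /sumw big_seq1 /pword big_seq1.
  + by rewrite /sumw big_seq1 /pword big_seq1 /=; case: ifP => // /negbT/FMO0 ->.
- exists [:: [::]]; split; rewrite /sumw ?big_seq1 /pword ?big_nil //.
  by move=> w; rewrite inE => /eqP -> p.
- exists (ws ++ map (@negw k Q v) ws'); split.
  + move=> w; rewrite mem_cat => /orP[/h1 //|/mapP[w' /h2 h ->]]; apply/good_cons; split=> //.
    by rewrite /= -[1]mpolyC1 -mpolyCN; apply: inLam1_C.
  + rewrite sumw_cat e1 e2; congr (_ + _); rewrite /sumw big_map -sumrN.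
    by apply: eq_bigr => w _; rewrite pword_neg.
  + rewrite map_cat sumw_cat e1' e2'; congr (_ + _); rewrite /sumw !big_map -sumrN.
    apply: eq_bigr => w _; rewrite /= rmorphN rmorph1.
    exact: (esym (pword_neg (zword v' w))).
- exists [seq w ++ w' | w <- ws, w' <- ws']; split.
  + move=> w /allpairsP[[w1 w2] /= [/h1 h /h2 h' ->]] p; rewrite mem_cat => /orP[/h|/h'] //.
  + rewrite e1 e2 /sumw big_allpairs_dep /= mulr_suml; apply: eq_bigr => w _.
    by rewrite mulr_sumr; apply: eq_bigr => w' _; rewrite pword_cat.
  + rewrite e1' e2' /sumw !big_map big_allpairs_dep /= mulr_suml; apply: eq_bigr => w _.
    rewrite mulr_sumr; apply: eq_bigr => w' _; by rewrite /zword map_cat pword_cat.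
Qed.

Lemma Phi_eq0 v v' (a : Aloc k v) (a' : Aloc k v') : dimvec_le v' v -> Phi a a' -> a = 0 -> a' = 0.
Proof. by move=> le /(Phi_words le)[ws [h -> ->]]; apply: sumw_zword0. Qed.

Lemma Phi_fun v v' (a : Aloc k v) (b b' : Aloc k v') : dimvec_le v' v -> Phi a b -> Phi a b' -> b = b'.
Proof.
by move=> le h h'; apply/eqP; rewrite -subr_eq0; apply/eqP/(Phi_eq0 le (PhiB h h')); rewrite subrr.
Qed.

Lemma homogAlim_FMOlim m d (f : Lamfam k Q) : homogLam1lim m d f -> homogAlim (degM m d) (FMOlim m f).
Proof.
move=> [h hz]; split=> [v|v v' le]; rewrite !FMOlimE.
  case: (boolP (dimvec_le m v)) => mv; last by rewrite FMO0 //; apply: homogA0.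
  by have [] := h _ mv; apply: homogA_FMO.
case: (boolP (dimvec_le m v)) => mv; last first.
  rewrite !FMO0 //; first exact: Phi0.
  by apply: contra mv => mv; apply: dimvec_trans le.
apply: subring_gen_in; exists m, (f v); split=> //; first by have [] := h _ mv.
case: (boolP (dimvec_le m v')) => mv'; last by rewrite (FMO0 _ mv').
by rewrite (hz _ _ mv' le).
Qed.

Lemma homogAlim1 : homogAlim 0 (1 : Afam k Q).
Proof. by split=> [v|v v' _]; [exact: homogA1|exact: Phi1]. Qed.
Lemma homogAlim0 kd : homogAlim kd (0 : Afam k Q).
Proof. by split=> [v|v v' _]; [exact: homogA0|exact: Phi0]. Qed.
Lemma homogAlimB kd (a b : Afam k Q) : homogAlim kd a -> homogAlim kd b -> homogAlim kd (a - b).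
Proof.
by move=> [h1 h2] [h1' h2']; split=> [v|v v' le]; [apply: homogAB|apply: PhiB; [apply: h2|apply: h2']].
Qed.
Lemma homogAlimM kd kd' (a b : Afam k Q) : homogAlim kd a -> homogAlim kd' b -> homogAlim (kd + kd') (a * b).
Proof.
by move=> [h1 h2] [h1' h2']; split=> [v|v v' le]; [apply: homogAM|apply: PhiM; [apply: h2|apply: h2']].
Qed.

Lemma homogAlim_pfword (w : fword k Q) kd : hfword w kd -> homogAlim kd (pfword w).
Proof.
elim: w kd => [|p w IH] kd /=; first by move=> ->; rewrite /pfword big_nil; apply: homogAlim1.
move=> [d [kd' [h -> hw]]]; rewrite pfword_cons; apply: homogAlimM; last exact: IH.
exact: homogAlim_FMOlim.
Qed.

Lemma homogAlim_sumf (ws : seq (fword k Q)) kd : (forall w, w \in ws -> hfword w kd) -> homogAlim kd (sumf ws).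
Proof.
move=> h; rewrite /sumf big_seq; elim/big_ind: _ => [|a b ha hb|w /h]; [exact: homogAlim0| |exact: homogAlim_pfword].
by rewrite -[b]opprK; apply: homogAlimB => //; rewrite -[- b]add0r; apply: homogAlimB => //; apply: homogAlim0.
Qed.

Lemma sumf_cat (ws ws' : seq (fword k Q)) : sumf (ws ++ ws') = sumf ws + sumf ws'.
Proof. exact: big_cat. Qed.

Definition negf (w : fword k Q) : fword k Q := (dim0 Q, -1) :: w.

Lemma pfword_neg w : pfword (negf w) = - pfword w.
Proof.
rewrite pfword_cons -[RHS]mulN1r; congr (_ * _); apply: functional_extensionality_dep => v.
by rewrite /= FMOlimE FMON FMO1.
Qed.

Lemma homogLam1lim_N1 : homogLam1lim (dim0 Q) 0 (-1 : Lamfam k Q).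
Proof.
split=> [v _|v v' _ _]; last by rewrite -[RHS](rmorphN1 (@wzero k Q v v')).
split; first by rewrite -[(-1 : Lamfam k Q) v]/(-1) -[1]mpolyC1 -mpolyCN; apply: inLam1_C.
by rewrite /isHomog /= dhomogN dhomog1.
Qed.

Lemma hfword_neg w kd : hfword w kd -> hfword (negf w) kd.
Proof. by move=> hw; exists 0%N, kd; rewrite degM0 add0r; split=> //; apply: homogLam1lim_N1. Qed.

Lemma sumf_neg ws : sumf (map negf ws) = - sumf ws.
Proof. by rewrite /sumf big_map -sumrN; apply: eq_bigr => w _; apply: pfword_neg. Qed.

(** Words are found for the component at one v0. At a common upper bound V of v0 and v, other words
    represent the component; the difference vanishes at v0, hence at V by stability, and the
    transition map brings the equality down to v. *)
Lemma homogAlim_words kd (a : Afam k Q) : homogAlim kd a ->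
  exists ws, (forall w, w \in ws -> hfword w kd) /\ a = sumf ws.
Proof.
move=> [ha hPhi].
pose K : dimvec Q := [ffun i => `|kd.1 i|%N].
(* Every word of degree kd has total dimension [K] and polynomial degree at most [deg_bound kd]:
   this is the margin required by stability. *)
pose v0 : dimvec Q := [ffun i => K i + deg_bound kd]%N.
have lifts v : exists ws, (forall w, w \in ws -> hfword w kd) /\ a v = sumf ws v.
  have [ws [hws ->]] := homogA_words (ha v).
  have [Fs [hFs <-]] := lift_words hws; by exists Fs; rewrite sumfE.
have [ws [hws e]] := lifts v0; exists ws; split=> //.
apply: functional_extensionality_dep => v.
pose V : dimvec Q := [ffun i => maxn (v0 i) (v i)].
have v0V : dimvec_le v0 V by apply/forallP => i; rewrite [V i]ffunE leq_maxl.
have vV : dimvec_le v V by apply/forallP => i; rewrite [V i]ffunE leq_maxr.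
have [ws' [hws' e']] := lifts V.
have [_ hP] := homogAlim_sumf hws; have [_ hP'] := homogAlim_sumf hws'.
suff eV : a V = sumf ws V by apply: (Phi_fun vV (hPhi _ _ vV)); rewrite eV; apply: hP.
apply/eqP; rewrite -subr_eq0 e' -[_ - _]/((sumf ws' - sumf ws) V) -sumf_neg -sumf_cat; apply/eqP.
have hall w : w \in ws' ++ map negf ws -> hfword w kd.
  by rewrite mem_cat => /orP[/hws' //|/mapP[w' /hws h ->]]; apply: hfword_neg.
apply: (@stable_sumf v0 V K (deg_bound kd)) => //.
- by move=> i; rewrite [v0 i]ffunE.
- by move=> w /hall/hfword_good/goodf_compf.
- by move=> w /hall h; apply: hfword_size.
- by move=> w i /hall h; rewrite [K i]ffunE (hfword_dim h).
have -> : sumf (ws' ++ map negf ws) v0 = sumf ws' v0 - sumf ws v0 by rewrite sumf_cat sumf_neg.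
apply/eqP; rewrite subr_eq0 -e; apply/eqP; apply: (Phi_fun v0V (hP' _ _ v0V)); rewrite -e'; exact: hPhi.
Qed.

Lemma inAlim_words (a : Afam k Q) : inAlim a <-> exists ws, (forall w, w \in ws -> goodf w) /\ a = sumf ws.
Proof.
split=> [|[ws [h ->]]].
  elim=> {a} [a [kd /homogAlim_words[ws [h ->]]]||a b _ [ws [h ->]] _ [ws' [h' ->]]].
  - by exists ws; split=> // w /h/hfword_good.
  - by exists [::]; rewrite /sumf big_nil.
  - exists (ws ++ ws'); split; last by rewrite sumf_cat.
    by move=> w; rewrite mem_cat => /orP[/h|/h'].
rewrite /sumf big_seq; elim/big_ind: _ => [|a' b|w /h/goodf_hfword[kd hw]].
- exact: sum_gen0.
- exact: sum_genD.
- by apply: sum_gen_in; exists kd; apply: homogAlim_pfword.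
Qed.

Lemma FMOlimD m (f g : Lamfam k Q) : FMOlim m (f + g) = FMOlim m f + FMOlim m g.
Proof.
apply: functional_extensionality_dep => v; rewrite -[RHS]/(FMOlim m f v + FMOlim m g v).
by rewrite !FMOlimE -FMOD.
Qed.

Lemma FMOlim0 m : FMOlim m (0 : Lamfam k Q) = 0.
Proof. by apply: (addIr (FMOlim m 0)); rewrite -FMOlimD !add0r. Qed.

Lemma isFMO_words (a : Afam k Q) : isFMO a -> exists ws, (forall w, w \in ws -> goodf w) /\ a = sumf ws.
Proof.
move=> [m [f [hf ->]]]; elim: hf => {f} [f [d hd]||f g _ [ws [h e]] _ [ws' [h' e']]].
- exists [:: [:: (m, f)]]; split; last by rewrite /sumf big_seq1 /pfword big_seq1.
  by move=> w; rewrite inE => /eqP -> p; rewrite inE => /eqP ->; exists d.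
- by exists [::]; rewrite FMOlim0 /sumf big_nil.
- exists (ws ++ ws'); split; last by rewrite FMOlimD sumf_cat e e'.
  by move=> w; rewrite mem_cat => /orP[/h|/h'].
Qed.

Lemma inAlim1 : inAlim (1 : Afam k Q).
Proof. by apply: sum_gen_in; exists 0; apply: homogAlim1. Qed.

Lemma inAlimN (a : Afam k Q) : inAlim a -> inAlim (- a).
Proof.
move=> /inAlim_words[ws [h ->]]; apply/inAlim_words; exists (map negf ws); rewrite sumf_neg; split=> //.
move=> w /mapP[w' /h hw ->]; apply/goodf_cons; split=> //; exists 0%N; exact: homogLam1lim_N1.
Qed.

Lemma inAlimD (a b : Afam k Q) : inAlim a -> inAlim b -> inAlim (a + b).
Proof. exact: sum_genD. Qed.

Lemma inAlimM (a b : Afam k Q) : inAlim a -> inAlim b -> inAlim (a * b).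
Proof.
move=> /inAlim_words[ws [h ->]] /inAlim_words[ws' [h' ->]]; apply/inAlim_words.
exists [seq w ++ w' | w <- ws, w' <- ws']; split.
  move=> w /allpairsP[[w1 w2] /= [/h h1 /h' h2 ->]] p; rewrite mem_cat => /orP[/h1|/h2] //.
rewrite /sumf big_allpairs_dep /= mulr_suml; apply: eq_bigr => w _.
by rewrite mulr_sumr; apply: eq_bigr => w' _; rewrite /pfword big_cat.
Qed.

Lemma inAlim_FMO (a : Afam k Q) : isFMO a -> inAlim a.
Proof. by move=> /isFMO_words/inAlim_words. Qed.

Lemma isFMO_homog m d (f : Lamfam k Q) : homogLam1lim m d f -> isFMO (FMOlim m f).
Proof. by move=> h; exists m, f; split=> //; apply: sum_gen_in; exists d. Qed.

Lemma inAlim_subring_gen (a : Afam k Q) : inAlim a <-> subring_gen (@isFMO k Q) a.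
Proof.
split; last first.
  elim=> {a} [a /inAlim_FMO //||a b _ ha _ hb|a b _ ha _ hb].
  - exact: inAlim1.
  - by apply: inAlimD => //; apply: inAlimN.
  - exact: inAlimM.
move=> /inAlim_words[ws [h ->]].
have sD (x y : Afam k Q) : subring_gen (@isFMO k Q) x -> subring_gen (@isFMO k Q) y ->
    subring_gen (@isFMO k Q) (x + y).
  move=> hx hy; rewrite -[y]opprK -[- y]add0r -(subrr (1 : Afam k Q)).
  by do 2![apply: subring_genB => //]; apply: subring_genB; apply: subring_gen1.
rewrite /sumf big_seq; elim/big_ind: _ => [|x y|w /h hw]; [|exact: sD|].
  by rewrite -(subrr 1); apply: subring_genB; apply: subring_gen1.
elim: w hw => [|p w IH] hw; first by rewrite /pfword big_nil; apply: subring_gen1.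
move: hw => /goodf_cons[[d hd] hw]; rewrite pfword_cons; apply: subring_genM; last exact: IH.
by apply: subring_gen_in; apply: isFMO_homog hd.
Qed.

Lemma inA_inAlim v (b : Aloc k v) : inA b <-> exists2 a : Afam k Q, inAlim a & a v = b.
Proof.
split.
  elim=> {b} [_ [m [f [mv hf ->]]]||a b _ [x hx <-] _ [y hy <-]|a b _ [x hx <-] _ [y hy <-]].
  (* Only homogeneous invariants have been lifted, so f is split into homogeneous parts. *)
  - have fE : f = \sum_(d < msize f) pihomog mdeg d f by rewrite -pihomog_partitionE.
    rewrite fE FMO_sum; elim/big_ind: _ => [|_ _ [x hx <-] [y hy <-]|d _].
    + by exists 0 => //; apply: sum_gen0.
    + by exists (x + y) => //; apply: inAlimD.
    have [F [hF <-]] := lift_lam1 mv (inLam1_pihomog d hf) (pihomogP _ _ _).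
    by exists (FMOlim m F); rewrite ?FMOlimE //; apply: inAlim_FMO; apply: isFMO_homog hF.
  - by exists 1 => //; apply: inAlim1.
  - by exists (x - y) => //; apply: inAlimD => //; apply: inAlimN.
  - by exists (x * y) => //; apply: inAlimM.
move=> [a /inAlim_words[ws [h ->]] <-]; rewrite /sumf.
have i1 : inA (1 : Aloc k v) := subring_gen1 _.
have i0 : inA (0 : Aloc k v) by rewrite -(subrr 1); apply: subring_genB.
have iD (x y : Aloc k v) : inA x -> inA y -> inA (x + y).
  move=> hx hy; rewrite -[y]opprK -[- y]add0r.
  by do 2![apply: subring_genB => //].
rewrite -/(sumf ws) sumfE /sumw big_map big_seq; elim/big_ind: _ => [|x y|w /h hw]; [exact: i0|exact: iD|].
elim: w hw => [|p w IH] hw; first by rewrite /pword big_nil.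
move: hw => /goodf_cons[[d [hd _]] hw]; rewrite /= pword_cons; apply: subring_genM; last exact: IH.
case: (boolP (dimvec_le p.1 v)) => pv /=; last by rewrite FMO0.
by apply: subring_gen_in; exists p.1, (p.2 v); split=> //; have [] := hd _ pv.
Qed.

End PartOne.

(** * Base change and divisibility over the integers *)

Lemma inv_unique (R : pzRingType) (a b c : R) : a * b = 1 -> c * a = 1 -> b = c.
Proof. by move=> ab ca; rewrite -[b]mul1r -ca -mulrA ab mulr1. Qed.

Section BaseChange.
Variables (k : comNzRingType) (Q : quiver).
Implicit Types (v m : dimvec Q).
Local Notation "''V_' v" := 'X_{1..#|var v|} (at level 8, v at level 2).

Definition bc v : tLam int v -> tLam k v := map_mpoly (intr : int -> k).
HB.instance Definition _ v := GRing.RMorphism.on (@bc v).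

Lemma mcoeff_bc v (f : tLam int v) a : (bc f)@_a = (f@_a)%:~R.
Proof. exact: mcoeff_map_mpoly. Qed.

Lemma bc_pvar v z : bc (pvar int z : tLam int v) = pvar k z.
Proof. exact: map_mpolyX. Qed.

Lemma bcC v c : bc (c%:MP : tLam int v) = c%:~R%:MP.
Proof. exact: map_mpolyC. Qed.

Lemma bc_hbar v : bc (hbar int v) = hbar k v.
Proof. by rewrite rmorphM rmorph_nat /= /hbar2 bc_pvar. Qed.

Lemma bc_wdiff v d : bc (@wdiff int Q v d) = wdiff k d.
Proof.
case: d => [[x y] n] /=; case: ifP => _; last exact: rmorph1.
by rewrite rmorphD rmorphB rmorphM rmorph_int /= /wvar !bc_pvar bc_hbar.
Qed.

Lemma bc_wperm v (s : {perm widx v}) f : bc (wperm s f) = wperm s (bc f).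
Proof. by apply/mpolyP => a; rewrite mcoeff_bc !mcoeff_wperm mcoeff_bc. Qed.

Lemma bc_wshift v a (f : tLam int v) : bc (wshift a f) = wshift a (bc f).
Proof.
pose F : {rmorphism tLam int v -> tLam k v} := @bc v \o wshift a.
pose G : {rmorphism tLam int v -> tLam k v} := wshift a \o @bc v.
apply: (psubst_ext (f := F) (g := G)) => [c|[b|x]] /=.
- by rewrite /wshift wsubst_const bcC wsubst_const.
- by rewrite wshift_pvar !bc_pvar wshift_pvar.
by rewrite wshift_pvar rmorphD rmorphM rmorph_nat /= bc_hbar /wvar !bc_pvar wshift_pvar.
Qed.

Lemma bc_FMOnum v (G : {set widx v}) : bc (FMOnum int G) = FMOnum k G.
Proof.
rewrite /FMOnum rmorph_prod; apply: eq_bigr => e _; rewrite rmorph_prod; apply: eq_bigr => x _.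
rewrite rmorph_prod; apply: eq_bigr => y _.
by rewrite !rmorphD !rmorphN /= /wvar /hbar2 /theta !bc_pvar.
Qed.

Lemma bc_restr v m (G : {set widx v}) f : bc (restr m G f) = restr m G (bc f).
Proof. exact: bc_wperm. Qed.

(** The universal property gives the ring morphism; the images of the fractions are then forced by
    uniqueness of inverses. *)
Lemma bcA_exists v : exists F : {rmorphism Aloc int v -> Aloc k v},
  forall m f, F (FMO m f) = FMO m (bc f).
Proof.
pose phi : {rmorphism tLam int v -> Aloc k v} := @Apoly k Q v \o @bc v.
have [||||d|F [FP FU _]] := @Aloc_universal int Q v (Aloc k v) phi (@uvar k Q v).
- exact: uvarC.
- by move=> x c /=; rewrite bcC uvar_const.
- by move=> x b /=; rewrite bc_pvar uvar_pvar.
- by move=> x y /=; rewrite /wvar bc_pvar bc_hbar uvar_wvar.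
- by exists (Afrac 1 [:: d]); rewrite /= bc_wdiff; apply: Afrac_den.
exists F => m f; rewrite /FMO rmorph_sum; apply: eq_bigr => G _.
rewrite rmorphM rmorph_prod; congr (_ * _); last by apply: eq_bigr => x _; apply: FU.
rewrite AfracE [RHS]AfracE rmorphM [F (Apoly _)]FP /= rmorphM /= bc_restr bc_FMOnum; congr (_ * _).
rewrite rmorph_prod; apply: eq_bigr => d _.
have [i1 i2] := @Afrac_den int Q v d; have [j1 j2] := @Afrac_den k Q v d.
have e : F (Apoly (wdiff int d)) = Apoly (wdiff k d).
  by apply: etrans (FP _) _; congr (Apoly _); apply: bc_wdiff.
have h : F (Apoly (wdiff int d)) * F (Afrac 1 [:: d]) = 1.
  by apply: etrans (esym (rmorphM F _ _)) _; apply: etrans (congr1 F i1) (rmorph1 F).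
apply: (inv_unique (a := Apoly (wdiff k d))) j2.
exact: etrans (congr1 (fun x => x * _) (esym e)) h.
Qed.

Definition tdeg (R : comNzRingType) v n (f : tLam R v) := wbound (fun=> 1%N) n f.

Lemma wdeg1 v (a : 'V_v) : wdeg (fun=> 1%N) a = mdeg a.
Proof.
rewrite /wdeg mdegE (reindex_onto (@enum_rank (var v)) enum_val) /=; last by move=> i _; rewrite enum_valK.
by apply: eq_big => z; rewrite ?enum_rankK ?eqxx // => _; rewrite mul1n.
Qed.

(* Orbit sums have integral coefficients: statements linear in f reduce to the
   coefficient ring int, over which polynomials have no zero divisors. *)
Lemma labinv_span (L : eqType) (lab : vert Q -> nat -> L) v D (f : tLam k v) :
  labinv lab f -> tdeg D f ->
  exists cs : seq (k * tLam int v), (forall c, c \in cs -> labinv lab c.2 /\ tdeg D c.2) /\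
    f = \sum_(c <- cs) c.1 *: bc c.2.
Proof.
have [n] := ubnP (size (msupp f)); elim: n f => // n IH f; rewrite ltnS => sf hf hD.
have [->|nz] := eqVneq f 0; first by exists [::]; rewrite big_nil.
pose a := mlead f; have af : a \in msupp f := mlead_supp nz.
(* The orbit of the leading monomial is subtracted: invariance makes f constant on it, and the
   support shrinks. *)
pose P (b : 'V_v) : bool := `[< mtp lab b = mtp lab a >].
pose o : tLam int v := \sum_(b <- msupp f | P b) 'X_[b].
have oE b : o@_b = ((b \in msupp f) && P b)%:R.
  rewrite /o raddf_sum /= -big_filter.
  have [bf|bf] := boolP (_ && _).
    rewrite (bigD1_seq b) ?filter_uniq ?msupp_uniq ?mem_filter 1?andbC //= mcoeffX eqxx big1_seq ?addr0 //.
    by move=> c /andP[ne _]; rewrite mcoeffX (negbTE ne).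
  rewrite big1_seq // => c /andP[_]; rewrite mem_filter mcoeffX => h.
  by case: eqP => // cb; rewrite -cb andbC h in bf.
have fE b : P b -> f@_b = f@_a by move=> /asboolP; apply: labinv_mcoeff.
have o_inv : labinv lab o.
  move=> s hs sl; apply/mpolyP => b; rewrite mcoeff_wperm !oE; congr (nat_of_bool _)%:R.
  have -> : P (mvar (fun z => b (enum_rank (vperm s z)))) = P b.
    by rewrite /P mtp_wperm.
  by congr (_ && _); rewrite !mcoeff_msupp -mcoeff_wperm hf.
have o_deg : tdeg D o.
  by move=> b; rewrite mcoeff_msupp oE => h; apply: hD; move: h; case: (b \in msupp f); rewrite // eqxx.
pose f' := f - f@_a *: bc o.
have f'E b : f'@_b = if P b then 0 else f@_b.
  rewrite /f' mcoeffB mcoeffZ mcoeff_bc oE; case: (boolP (P b)) => Pb; last by rewrite andbF mulr0 subr0.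
  rewrite andbT fE //; case: (boolP (b \in msupp f)) => bf; first by rewrite mulr1 subrr.
  by rewrite mulr0 subr0 -(fE _ Pb) memN_msupp_eq0.
have sub : {subset msupp f' <= rem a (msupp f)}.
  move=> b; rewrite mcoeff_msupp f'E; case: ifP => Pb; first by rewrite eqxx.
  rewrite -mcoeff_msupp => bf; rewrite (rem_filter _ (msupp_uniq _)) mem_filter bf andbT /=.
  by apply/eqP => ba; move: Pb; rewrite ba /P => /asboolP; apply.
have [|||cs [hcs e]] := IH f'.
- apply: leq_ltn_trans (uniq_leq_size (msupp_uniq _) sub) _.
  by rewrite size_rem //; case: (msupp f) af sf.
- move=> s hs sl; rewrite /f' rmorphB /= hf // -mul_mpolyC rmorphM /= -bc_wperm o_inv //.
  by rewrite [wperm s _%:MP]wsubst_const.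
- move=> b; rewrite mcoeff_msupp f'E; case: ifP => _; first by rewrite eqxx.
  by rewrite -mcoeff_msupp; apply: hD.
exists ((f@_a, o) :: cs); split; last by rewrite big_cons -e /= /f' addrC subrK.
by move=> c; rewrite inE => /orP[/eqP ->|/hcs].
Qed.

Lemma FMOZ v m c (f : tLam k v) : FMO m (c *: f) = Apoly c%:MP * FMO m f.
Proof.
have hc : inLam1 (dim0 Q) (c%:MP : tLam k v) by apply: inLam1_C.
rewrite !FMO_skewm mulr_sumr; apply: eq_bigr => G _.
rewrite /Apoly /skewC skewmM mact0 add0m -/(lfrac _); congr (skewm _ _ _).
rewrite !fcoefE mulrA -rmorphM; congr (lfrac _ * _).
rewrite mul_mpolyC; exact: psubstZ.
Qed.

Lemma FMO_Apoly v m c (f : tLam k v) : FMO m f * Apoly c%:MP = Apoly c%:MP * FMO m f.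
Proof.
rewrite !FMO_skewm mulr_sumr mulr_suml; apply: eq_bigr => G _.
rewrite /Apoly /skewC !skewmM mact0 add0m addm0 mulrC; congr (skewm _ (_ * _) _).
rewrite [LHS]lshift_frac; congr (frac _ _ _); exact: wsubst_const.
Qed.

End BaseChange.

Lemma antisym_eq (R : comPzRingType) (w a b c d : R) :
  - w * c * d = w * a * b -> w * (a * b + c * d) = 0.
Proof. by move=> e; rewrite mulrDr mulrA -e; ring. Qed.

Lemma double_eq (R R' : comPzRingType) (f : {rmorphism R -> R'}) (a b c d : R) :
  f c = f a -> f d = f b -> a * b + c * d = 0 -> f a * (2%:R * f b) = 0.
Proof. by move=> ca db /(congr1 f); rewrite rmorphD !rmorphM ca db rmorph0 => <-; ring. Qed.

Section Divide.
Variables (k : comNzRingType) (Q : quiver).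
Implicit Types (v m : dimvec Q).

Definition vtriple v := (widx v * widx v * int)%type.
Definition wvalid v (d : vtriple v) : bool := (tag d.1.1 == tag d.1.2) && (d.1.1 != d.1.2).

(** Substitution of w_y - n hbar for w_x: reduction modulo the linear form [wdiff (x, y, n)]. *)
Definition wev v (d : vtriple v) : tLam k v -> tLam k v :=
  updv (inr d.1.1) (wvar k d.1.2 - d.2%:~R * hbar k v).
HB.instance Definition _ v d := GRing.RMorphism.on (@wev v d).

Lemma wev_wvar v (d : vtriple v) x : wev d (wvar k x) =
  if x == d.1.1 then wvar k d.1.2 - d.2%:~R * hbar k v else wvar k x.
Proof. by rewrite /wev updv_pvar; congr (if _ then _ else _); apply/eqP/eqP => [[]|->]. Qed.

Lemma wev_inl v (d : vtriple v) b : wev d (pvar k (inl b)) = pvar k (inl b).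
Proof. by rewrite /wev updv_pvar. Qed.

Lemma wev_hbar v (d : vtriple v) : wev d (hbar k v) = hbar k v.
Proof. by rewrite rmorphM rmorph_nat /= wev_inl. Qed.

Lemma wev_wdiff v (d : vtriple v) : wvalid d -> wev d (wdiff k d) = 0.
Proof.
case: d => [[x y] n] /andP[/= xy ne]; rewrite xy ne /=.
rewrite rmorphD rmorphB rmorphM rmorph_int /= !wev_wvar /= eqxx wev_hbar.
by rewrite eq_sym (negbTE ne); ring.
Qed.

(** The f congruent to [wev d f] modulo the linear form are stable under sums and products and
    include constants and variables, hence are all polynomials. *)
Lemma wev_factor v (d : vtriple v) (p : tLam k v) : wvalid d -> wev d p = 0 ->
  exists q, p = wdiff k d * q.
Proof.
move=> hd; suff h : forall f : tLam k v, exists q, f = wev d f + wdiff k d * q.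
  by have [q e] := h p; move=> e0; exists q; rewrite {1}e e0 add0r.
pose P (f : tLam k v) := exists q, f = wev d f + wdiff k d * q.
have PD f g : P f -> P g -> P (f + g).
  by move=> [q e] [q' e']; exists (q + q'); rewrite {1}e {1}e' rmorphD /=; ring.
have PM f g : P f -> P g -> P (f * g).
  move=> [q e] [q' e']; exists (q * wev d g + wev d f * q' + wdiff k d * q * q').
  by rewrite {1}e {1}e' rmorphM /=; ring.
have PC c : P c%:MP by exists 0; rewrite mulr0 addr0 /wev updvC.
have PX z : P (pvar k z).
  case: z => [b|x]; first by exists 0; rewrite wev_inl mulr0 addr0.
  rewrite -/(wvar k x); rewrite /P wev_wvar; case: eqP => [->|_]; last by exists 0; rewrite mulr0 addr0.
  exists 1; case: d hd {PD PM PC P} => [[x' y] n] /andP[/= xy ne]; rewrite xy ne /=; ring.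
elim/mpolyind => [|c a f _ _ IH]; first by exists 0; rewrite rmorph0 mulr0 addr0.
apply: (PD) IH; rewrite -mul_mpolyC; apply: (PM) => //; rewrite mpolyX_pvar.
apply: big_ind => [||z _]; [by rewrite -mpolyC1; apply: (PC)|exact: (PM)|].
elim: (a _) => [|e IHe]; first by rewrite expr0 -mpolyC1; apply: (PC).
by rewrite exprS; apply: (PM) => //; apply: (PX).
Qed.

End Divide.

Section DivideInt.
Variables (Q : quiver).
Implicit Types (v m : dimvec Q).

Lemma tLam_mul0 v (p q : tLam int v) : p * q = 0 -> p = 0 \/ q = 0.
Proof.
move=> h; have : ((p : {mpoly int[#|var v|]}) * q == 0) by apply/eqP.
by rewrite mulf_eq0 => /orP[/eqP|/eqP]; [left|right].
Qed.

Lemma lreg_neq0_int v (p : tLam int v) : GRing.lreg p -> p <> 0.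
Proof. by move=> h e; have := h 1 0; rewrite e !mul0r => /(_ erefl)/eqP; rewrite oner_eq0. Qed.

Lemma int_hbar_neq0 v (n : int) : n != 0 -> n%:~R * hbar int v <> 0.
Proof.
move=> n0 /tLam_mul0[|/tLam_mul0[]].
- by move/eqP; rewrite -(rmorph_int (@mpolyC #|var v| int)) /= mpolyC_eq0 intr_eq0 (negbTE n0).
- by move/eqP; rewrite -mpolyC_nat mpolyC_eq0.
- by apply: lreg_neq0_int; apply: lreg_pvar.
Qed.

(** The excluded triple (y, x, -n) defines the opposite form. Any other form remains nonzero on the
    hyperplane of d, possibly as a nonzero integer multiple of hbar, whence the coefficient ring. *)
Lemma wev_neq0 v (d d' : vtriple v) : wvalid d -> wvalid d' -> d' <> d ->
  d' <> (d.1.2, d.1.1, - d.2) -> wev d (wdiff int d') <> 0.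
Proof.
case: d d' => [[x y] n] [[x' y'] n'] /andP[/= /eqP txy xy] /andP[/= /eqP txy' xy'] ne1 ne2.
have tr : wev (x, y, n) (wdiff int (x', y', n')) =
  wev (x, y, n) (wvar int x') - wev (x, y, n) (wvar int y') + n'%:~R * hbar int v.
  by rewrite /= txy' eqxx xy' /= rmorphD rmorphB rmorphM rmorph_int /= wev_hbar.
have wd (a b : widx v) (c : int) : tag a = tag b -> a != b -> wvar int a - wvar int b + c%:~R * hbar int v <> 0.
  move=> ab ne; have := lreg_neq0_int (@lreg_wdiff int Q v (a, b, c)).
  by rewrite /= ab eqxx ne.
rewrite tr !wev_wvar /=; case: (eqVneq x' x) => [ex|nx].
  rewrite -ex eq_sym (negbTE xy'); case: (eqVneq y' y) => [ey|ny].
    have nn : n' - n != 0 by apply/eqP => h; apply: ne1; rewrite ex ey; congr (_, _, _); lia.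
    by move=> h; apply: (@int_hbar_neq0 v _ nn); rewrite -h ey rmorphB /=; ring.
  move=> h; apply: (wd y y' (n' - n)); first by rewrite -txy -ex.
    by rewrite eq_sym.
  by rewrite -h rmorphB /=; ring.
case: (eqVneq y' x) => [ey|ny]; last exact: wd.
case: (eqVneq x' y) => [ex|nxy].
  have nn : n' + n != 0 by apply/eqP => h; apply: ne2; rewrite ex ey; congr (_, _, _); lia.
  by move=> h; apply: (@int_hbar_neq0 v _ nn); rewrite -h ex rmorphD /=; ring.
move=> h; apply: (wd x' y (n' + n)) => //; first by rewrite txy' ey.
by rewrite -h rmorphD /=; ring.
Qed.

Lemma wev_prod_neq0 v (d : vtriple v) (s : seq (vtriple v)) (F : vtriple v -> tLam int v) :
  (forall d', d' \in s -> wev d (F d') <> 0) -> wev d (\prod_(d' <- s) F d') <> 0.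
Proof.
elim: s => [|d' s IH] h; first by rewrite big_nil rmorph1 => /eqP; rewrite oner_eq0.
rewrite big_cons rmorphM => /tLam_mul0[]; first by apply: h; rewrite inE eqxx.
by apply: IH => d'' h''; apply: h; rewrite inE h'' orbT.
Qed.

Definition unassoc v (d d' : vtriple v) : bool := (d' != d) && (d' != (d.1.2, d.1.1, - d.2)).

(** Each form divides the quotient left by the others: on its hyperplane their product is nonzero,
    and there are no zero divisors over the integers. *)
Lemma coprime_product v (s : seq (vtriple v)) (p : tLam int v) : uniq s ->
  (forall d, d \in s -> wvalid d) ->
  (forall d d', d \in s -> d' \in s -> d != d' -> unassoc d d') ->
  (forall d, d \in s -> wev d p = 0) ->
  exists q, p = (\prod_(d <- s) wdiff int d) * q.
Proof.
elim: s => [|d s IH]; first by exists p; rewrite big_nil mul1r.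
move=> /= /andP[ds us] hv hu he.
have sub d' : d' \in s -> d' \in d :: s by rewrite inE orbC => ->.
have [||||q e] := IH => //; try by move=> *; (apply: hv||apply: hu||apply: he); rewrite ?sub.
have dd : d \in d :: s by rewrite inE eqxx.
have : wev d q = 0.
  have e2 : wev d (\prod_(d' <- s) wdiff int d') * wev d q = 0.
    by rewrite -(he d dd) e [RHS]rmorphM.
  case: (tLam_mul0 e2) => [h|h]; last exact: h.
  exfalso; move: h; apply: wev_prod_neq0 => d' d's; have ne : d != d' by apply: contra ds => /eqP ->.
  have /andP[/eqP u1 /eqP u2] := hu d d' dd (sub _ d's) ne.
  by apply: wev_neq0 u1 u2; apply: hv => //; apply: sub.
move=> h; have [q' e3] := wev_factor (hv d dd) h; exists q'.
by rewrite big_cons e e3; ring.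
Qed.

Lemma wev_tperm v (x y : widx v) (f : tLam int v) : tag x = tag y ->
  wev (x, y, 0) (wperm (tperm x y) f) = wev (x, y, 0) f.
Proof.
move=> t; pose F : {rmorphism tLam int v -> tLam int v} := wev (x, y, 0) \o wperm (tperm x y).
apply: (psubst_ext (f := F) (g := wev (x, y, 0))) => [c|[b|z]] /=.
- by rewrite [wperm _ _]wsubst_const.
- by rewrite wperm_pvar wev_inl.
rewrite wperm_pvar /= -!/(wvar _ _) !wev_wvar /= mul0r subr0.
by case: tpermP => [->|->|]; rewrite ?eqxx //; case: eqP => // ->.
Qed.

Lemma Sv_tperm v (x y : widx v) : tag x = tag y -> Sv (tperm x y).
Proof. by move=> t; apply/forallP => z; case: tpermP => [->|->|] //; rewrite t. Qed.

(* Symmetry doubles the order of vanishing along each diagonal: this is why both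
   [wdiff (x, y, 0)] and [wdiff (y, x, 0)] divide p. *)
Lemma diag_product v (I : {set widx v}) (p : tLam int v) :
  (forall x y, x \in I -> y \in I -> tag x = tag y -> x != y -> wev (x, y, 0) p = 0) ->
  (forall x y, x \in I -> y \in I -> tag x = tag y -> x != y -> wperm (tperm x y) p = p) ->
  exists q, p = (\prod_(x in I) \prod_(y in I) wdiff int (x, y, 0)) * q.
Proof.
move=> hz hs.
pose s : seq (vtriple v) := [seq (xy, 0) | xy <- enum [set xy : widx v * widx v |
  [&& xy.1 \in I, xy.2 \in I, tag xy.1 == tag xy.2 & (enum_rank xy.1 < enum_rank xy.2)%N]]].
have ms d : d \in s -> [/\ d.1.1 \in I, d.1.2 \in I, tag d.1.1 = tag d.1.2, d.1.1 != d.1.2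
   & (enum_rank d.1.1 < enum_rank d.1.2)%N /\ d.2 = 0].
  move=> /mapP[[x y]]; rewrite mem_enum inE /= => /and4P[xI yI /eqP t l] -> /=; split=> //.
  by apply/eqP => xy; rewrite xy ltnn in l.
have us : uniq s by rewrite map_inj_uniq ?enum_uniq // => a b [].
have vs d : d \in s -> wvalid d by move=> /ms[_ _ t ne _]; rewrite /wvalid t eqxx.
have ns d d' : d \in s -> d' \in s -> d != d' -> unassoc d d'.
  move=> /ms[_ _ _ _ [l e]] /ms[_ _ _ _ [l' e']] ne; rewrite /unassoc eq_sym ne /=.
  by apply: contraTneq l' => ->; rewrite -leqNgt /= ltnW.
have es d : d \in s -> d = (d.1.1, d.1.2, 0) by move=> /ms[_ _ _ _ [_ e]]; case: d e => [[x y] n] /= ->.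
have zs d : d \in s -> wev d p = 0.
  by move=> ds; have [xI yI t ne _] := ms d ds; rewrite (es d ds); apply: hz.
have [q pq] := coprime_product us vs ns zs.
set V := \prod_(d <- s) _ in pq.
have zq d : d \in s -> wev d q = 0.
  move=> ds; have [xI yI t ne _] := ms d ds; set x := d.1.1 in xI t ne; set y := d.1.2 in yI t ne.
  have dE : d = (x, y, 0) := es d ds.
  pose V' := \prod_(d' <- rem d s) wdiff int d'.
  have VE : V = wdiff int d * V' by rewrite /V (perm_big _ (perm_to_rem ds)) big_cons.
  have eV' : wev d V' <> 0.
    apply: wev_prod_neq0 => d'; rewrite mem_rem_uniq // inE => /andP[ne' d's].
    have := ns d d' ds d's; rewrite eq_sym => /(_ ne')/andP[/eqP u1 /eqP u2].
    by apply: wev_neq0; rewrite ?vs.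
  have sw : wperm (tperm x y) (wdiff int d) = - wdiff int d.
    rewrite (wperm_denP _ (Sv_tperm t)) dE /= tpermL tpermR -t eqxx eq_sym ne /=; ring.
  have d0 := lreg_neq0_int (@lreg_wdiff int Q v d).
  (* The swap of x and y fixes p and changes the sign of the form, so V' q is antisymmetric. On the
     diagonal the swap is invisible, so twice the value of V' q is 0 there. *)
  have := hs x y xI yI t ne; rewrite pq VE !rmorphM /= sw => e1.
  have : wdiff int d * (V' * q + wperm (tperm x y) V' * wperm (tperm x y) q) = 0.
    exact: antisym_eq e1.
  move=> /tLam_mul0[//|e2].
  have : wev d V' * (2%:R * wev d q) = 0.
    apply: (double_eq (f := wev d)) e2; rewrite {1 3}dE; exact: wev_tperm.
  case/tLam_mul0 => [/eV' []|/tLam_mul0[/eqP|h]]; last exact: h.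
  by rewrite -mpolyC_nat mpolyC_eq0.
have [q' qq'] := coprime_product us vs ns zq.
(* V takes one ordered pair from each unordered one; the reversed pairs give the opposite forms,
   whose signs are collected in [sg]. *)
pose sg : tLam int v := \prod_(d <- s) (-1).
have sg2 : sg * sg = 1 by rewrite -big_split /= big1 // => d _; rewrite mulrNN mulr1.
suff -> : \prod_(x in I) \prod_(y in I) wdiff int (x, y, 0) = sg * V * V.
  exists (sg * q'); rewrite pq {1}qq' -/V.
  transitivity (sg * sg * (V * V * q')); first by rewrite sg2; ring.
  by ring.
rewrite pair_big_dep /= (bigID (fun xy : widx v * widx v => wvalid (xy, 0))) /= [X in _ * X]big1 ?mulr1; last first.
  by move=> [x y] /andP[_]; rewrite /wvalid /= => /negbTE ->.
rewrite (bigID (fun xy : widx v * widx v => enum_rank xy.1 < enum_rank xy.2)%N) /=.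
have VE : V = \prod_(xy : widx v * widx v | ((xy.1 \in I) && (xy.2 \in I) && wvalid (xy, 0)) &&
    (enum_rank xy.1 < enum_rank xy.2)%N) wdiff int (xy, 0).
  rewrite /V big_map big_enum; apply: eq_bigl => -[x y]; rewrite inE /wvalid /=.
  case: (eqVneq x y) => [->|_]; first by rewrite ltnn !andbF.
  by rewrite andbT !andbA.
rewrite mulrC; congr (_ * _); last by rewrite VE; apply: eq_bigr => -[x y] _.
have sgE : sg = \prod_(xy : widx v * widx v | ((xy.1 \in I) && (xy.2 \in I) && wvalid (xy, 0)) &&
    (enum_rank xy.1 < enum_rank xy.2)%N) (-1).
  rewrite /sg big_map big_enum; apply: eq_bigl => -[x y]; rewrite inE /wvalid /=.
  case: (eqVneq x y) => [->|_]; first by rewrite ltnn !andbF.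
  by rewrite andbT !andbA.
rewrite (reindex_inj (h := fun xy : widx v * widx v => (xy.2, xy.1))) /=; last by move=> [x y] [x' y'] [-> ->].
rewrite sgE VE -big_split /=; apply: eq_big => [[x y]|[x y] /andP[/andP[_]]].
  rewrite /wvalid /= eq_sym [y == x]eq_sym [(y \in I) && _]andbC.
  case: (eqVneq x y) => [->|ne] /=; first by rewrite !andbF.
  congr (_ && _); rewrite -leqNgt leq_eqVlt; case: eqP => // /val_inj/enum_rank_inj e.
  by rewrite e eqxx in ne.
rewrite /wvalid /= => /andP[/eqP t ne] _; rewrite t eqxx ne [x == y]eq_sym ne /=; ring.
Qed.

End DivideInt.

(** * Decomposition of partial invariants over invariants *)

Section Transfer.
Variables (Q : quiver) (n m : dimvec Q) (nm : dimvec_le n m).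
Implicit Types (k : comNzRingType) (v : dimvec Q).

Definition lab2 : vert Q -> nat -> bool * bool := fun i p => (p < n i, p < m i)%N.

Lemma initial_sub v : initial v n \subset initial v m.
Proof. by apply/subsetP => x; rewrite !inE => /leq_trans -> //; apply: (forallP nm). Qed.

Lemma labinv2 k v (F : tLam k v) : labinv lab2 F <->
  forall s, Sv s -> s @: initial v n = initial v n -> s @: initial v m = initial v m -> wperm s F = F.
Proof.
have wE x : wlab lab2 x = (x \in initial v n, x \in initial v m) by rewrite !inE.
split=> hF s hs.
  by move=> e1 e2; apply: hF => // x; rewrite !wE -{1}e1 -{1}e2 !imset_perm_mem.
move=> sl; have h x : (s x \in initial v n) = (x \in initial v n) /\ (s x \in initial v m) = (x \in initial v m).
  by have := sl x; rewrite !wE => -[].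
apply: hF => //; apply/setP => x; rewrite -(permKV s x) imset_perm_mem.
  by have [-> _] := h (s^-1 x)%g.
by have [_ ->] := h (s^-1 x)%g.
Qed.

Definition isSub v (G : {set widx v}) : bool := (G \subset initial v m) && isGamma n G.

Definition sub_perm v (G : {set widx v}) : {perm widx v} :=
  odflt 1%g [pick s | [&& Sv s, s @: initial v m == initial v m & s @: initial v n == G]].
Notation rs2 G F := (wperm (sub_perm G) F).

Lemma sub_permE k v (G : {set widx v}) (F : tLam k v) s : labinv lab2 F -> Sv s ->
  s @: initial v m = initial v m -> s @: initial v n = G -> rs2 G F = wperm s F.
Proof.
move=> /labinv2 hF hs sm sn; rewrite /sub_perm; case: pickP => [t /and3P[ht /eqP tm /eqP tn]|/(_ s)]; last by rewrite hs sm sn !eqxx.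
have tr (A B : {set widx v}) : s @: A = B -> t @: A = B -> (s * t^-1)%g @: A = A.
  move=> sA tB; apply/setP => x; set y := ((s * t^-1)^-1 x)%g.
  have xE : x = (s * t^-1)%g y by rewrite permKV.
  have e : t x = s y by rewrite xE permM permKV.
  by rewrite {1}xE imset_perm_mem -(imset_perm_mem s) sA -tB -e imset_perm_mem.
rewrite /= -[in RHS](mulgKV t s) -wperm_comp (hF (s * t^-1)%g) //; first by apply: SvM => //; apply: SvV.
  exact: tr sn tn.
exact: tr sm tm.
Qed.

(** Permutations of the m-block alone. The subsets G can be reached by such permutations, which
    matters for relations whose multipliers are invariant under these only. *)
Definition fixout v (s : {perm widx v}) := Sv s /\ forall x, x \notin initial v m -> s x = x.

Lemma fixout_initial v (s : {perm widx v}) : fixout s -> s @: initial v m = initial v m.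
Proof.
move=> [hs so]; apply/setP => x; rewrite -{1}(permKV s x) imset_perm_mem.
have [xm|xm] := boolP (x \in initial v m).
  by apply: contraTT xm => h; rewrite -(permKV s x) so.
by apply: contraNF xm => h; apply: contraT => xm; move: (h); rewrite -(so _ xm) permK (negbTE xm).
Qed.

Lemma isSub_exists v (G : {set widx v}) : dimvec_le m v -> isSub G ->
  exists s : {perm widx v}, fixout s /\ s @: initial v n = G.
Proof.
move=> mv /andP[Gm hG]; have [|||s [hs so sn]] := @gamma_fix Q v (~: initial v m) (initial v n) G.
- by rewrite disjoint_sym disjoints_subset setCK initial_sub.
- by rewrite disjoint_sym disjoints_subset setCK.
- by move=> i; rewrite (eqP (forallP hG i)) (eqP (forallP (isGamma_initial (dimvec_trans nm mv)) i)).
by exists s; split=> //; split=> // x xm; apply: so; rewrite inE.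
Qed.

(* [gamma_coef l Y] and [beta_mon 0 l] are chosen so that
   prod_(y in Y) prod_(x in initial n, tag x = tag y) (w_x - w_y) = sum_l beta_mon l * gamma_coef l Y:
   each inner product is a polynomial in w_y, whose coefficients do not involve Y. *)
Definition van_size := (dsize n).+1.
(** For Y inside the m-block [gamma_gen] is homogeneous of degree |Y| <= |m|, so exponents l of
    degree below this size suffice. *)
Definition gamma_size := (dsize m).+1.
Definition beta_idx : finType := (vert Q * 'I_van_size)%type.

Definition gamma_gen k v (Y : {set widx v}) : {mpoly (tLam k v)[#|beta_idx|]} :=
  \prod_(y in Y) \sum_(a < van_size) (wvar k y ^+ a) *: 'X_(enum_rank ((tag y, a) : beta_idx)).

Definition gamma_coef k v (l : 'X_{1..#|beta_idx|}) (Y : {set widx v}) : tLam k v := (gamma_gen k Y)@_l.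

(** Its value at w_y for t = 0 is the Vandermonde-type product to be expanded. The parameter t
    compensates in advance the shift that the first operator of a product imposes on the second. *)
Definition van_poly k v t i : {poly tLam k v} :=
  \prod_(x in initial v n | tag x == i) ((wvar k x - t%:R * hbar k v)%:P - 'X).

Definition beta_mon k v t (l : 'X_{1..#|beta_idx|}) : tLam k v :=
  mmap1 (fun j : 'I_#|beta_idx| => let c : beta_idx := enum_val j in (van_poly k v t c.1)`_c.2) l.

Lemma dsize_card v (Y : {set widx v}) : Y \subset initial v m -> (#|Y| <= dsize m)%N.
Proof.
move=> Ym; rewrite -sum1_card (partition_big (fun x : widx v => tag x) predT) //=.
apply: leq_sum => i _; rewrite sum1_card -[m i]card_ord.
apply: leq_trans (_ : #|[set r : 'I_(v i) | (r < m i)%N]| <= _)%N; last first.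
  rewrite card_ord; have [le|lt] := leqP (m i) (v i); first by rewrite card_ltn.
  by apply: leq_trans (max_card _) _; rewrite card_ord ltnW.
rewrite -(card_block i (fun x : widx v => wpos x < m i)%N); apply: subset_leq_card; apply/subsetP => x.
by rewrite !inE => /andP[/(subsetP Ym) + /eqP <-]; rewrite inE eqxx.
Qed.

Lemma size_van_poly k v t i : (size (van_poly k v t i) <= van_size)%N.
Proof.
pose f (x : widx v) : {poly tLam k v} := (wvar k x - t%:R * hbar k v)%:P - 'X.
have h (s : seq (widx v)) (P : pred (widx v)) : (size (\prod_(x <- s | P x) f x)%R <= (count P s).+1)%N.
  elim: s => [|x s IH]; first by rewrite big_nil size_poly1.
  rewrite big_cons /=; case: (P x) => //; apply: leq_trans (size_polyMleq _ _) _.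
  have h2 : (size (f x) <= 2)%N by rewrite /f -opprB size_polyN size_XsubC.
  by rewrite -subn1 leq_subLR; apply: leq_trans (leq_add h2 IH) _; rewrite add1n.
apply: leq_trans (h _ _) _; rewrite ltnS -sum1_count.
apply: leq_trans (_ : n i <= _)%N; last by rewrite /dsize (bigD1 i) //= leq_addr.
have -> : \sum_(x : widx v | (x \in initial v n) && (tag x == i)) 1 =
   #|[set x : widx v | (tag x == i) && (wpos x < n i)%N]|.
  by rewrite -sum1_card; apply: eq_bigl => x; rewrite !inE andbC; case: (tag x =P i) => //= ->.
rewrite card_block; have [le|lt] := leqP (n i) (v i); first by rewrite card_ltn.
by apply: leq_trans (max_card _) _; rewrite card_ord ltnW.
Qed.

End Transfer.

Section Transfer.
Variables (Q : quiver) (n m : dimvec Q) (nm : dimvec_le n m).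
Implicit Types (k : comNzRingType) (v : dimvec Q).
Local Notation beta_idx := (beta_idx n).
Local Notation van_size := (van_size n).
Local Notation gamma_size := (gamma_size m).
Local Notation idx := 'X_{1..#|beta_idx| < gamma_size}.

Lemma map_gamma_gen k k' v v' (f : {rmorphism tLam k v -> tLam k' v'}) (g : widx v -> widx v') (Y : {set widx v}) :
  injective g -> (forall x, tag (g x) = tag x) -> (forall y, y \in Y -> f (wvar k y) = wvar k' (g y)) ->
  map_mpoly f (gamma_gen n k Y) = gamma_gen n k' (g @: Y).
Proof.
move=> gi gt fg; rewrite /gamma_gen rmorph_prod big_imset /=; last by move=> ????; apply: gi.
apply: eq_bigr => y yY; rewrite rmorph_sum gt; apply: eq_bigr => a _.
by rewrite /= map_mpolyZ map_mpolyX rmorphXn /= fg.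
Qed.

Lemma gamma_coef_wperm k v (s : {perm widx v}) l (Y : {set widx v}) : Sv s ->
  wperm s (gamma_coef (n := n) k l Y) = gamma_coef k l (s @: Y).
Proof.
move=> hs; rewrite /gamma_coef -(map_gamma_gen (f := wperm s)) ?mcoeff_map_mpoly //; first exact: perm_inj.
  by move=> x; apply: Sv_tag.
by move=> y _; apply: wperm_wvar.
Qed.

Lemma gamma_coef_wzero k v0 v (le : dimvec_le v0 v) l (Y : {set widx v0}) :
  wzero v0 (gamma_coef (n := n) k l (wemb le @: Y)) = gamma_coef k l Y.
Proof.
rewrite /gamma_coef -mcoeff_map_mpoly; congr (_@__).
rewrite /gamma_gen rmorph_prod big_imset /=; last by move=> ????; apply: wemb_inj.
apply: eq_bigr => y yY; rewrite rmorph_sum; apply: eq_bigr => a _.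
by rewrite /= map_mpolyZ map_mpolyX rmorphXn /= wzero_emb.
Qed.

Lemma gamma_coef_bc k v l (Y : {set widx v}) : bc k (gamma_coef (n := n) int l Y) = gamma_coef k l Y.
Proof.
rewrite /gamma_coef -mcoeff_map_mpoly (map_gamma_gen (f := @bc k Q v) (g := id)) ?imset_id //.
by move=> y _; rewrite /= /wvar bc_pvar.
Qed.

Lemma msize_prod_lin (R : comNzRingType) N (T : finType) (Y : {set T}) (f : T -> {mpoly R[N]}) :
  (forall y, y \in Y -> f y \is 1.-homog) -> \prod_(y in Y) f y \is #|Y|.-homog.
Proof.
have [c] := ubnP #|Y|; elim: c Y => // c IH Y; rewrite ltnS => Yc h.
have [->|[y yY]] := set_0Vmem Y; first by rewrite big_set0 cards0 dhomog1.
rewrite (big_setD1 y) //= (cardsD1 y) yY; apply: dhomogM; first exact: h.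
apply: IH => [|z]; first by rewrite (cardsD1 y) yY in Yc.
by rewrite inE => /andP[_ /h].
Qed.

Lemma gamma_gen_homog k v (Y : {set widx v}) : gamma_gen n k Y \is #|Y|.-homog.
Proof.
apply: msize_prod_lin => y _; rewrite rpred_sum // => a _.
by rewrite dhomogZ // dhomogX /= mdeg1.
Qed.

(** Evaluating [gamma_gen] at the coefficients of the [van_poly] turns each inner sum into the value
    of a [van_poly] at w_y. *)
Lemma beta_gamma k v (Y : {set widx v}) : Y \subset initial v m ->
  \sum_(l : idx) beta_mon k v 0 l * gamma_coef k l Y =
  \prod_(y in Y) \prod_(x in initial v n | tag x == tag y) (wvar k x - wvar k y).
Proof.
move=> Ym; pose i : {rmorphism tLam k v -> tLam k v} := idfun.
pose h (j : 'I_#|beta_idx|) := let c : beta_idx := enum_val j in (van_poly n k v 0 c.1)`_c.2.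
have sz : (msize (gamma_gen n k Y) <= gamma_size)%N.
  rewrite msizeE; apply/bigmax_leqP_seq => a ha _.
  by rewrite /gamma_size ltnS (dhomogP _ _ _ (gamma_gen_homog k Y) _ ha) dsize_card.
transitivity (mmap i h (gamma_gen n k Y)).
  by rewrite (mmapE (h := h) (f := i) _ sz); apply: eq_bigr => l _; rewrite mulrC.
rewrite /gamma_gen rmorph_prod; apply: eq_bigr => y _; rewrite rmorph_sum /=.
transitivity (van_poly n k v 0 (tag y)).[wvar k y].
  rewrite (horner_coef_wide _ (size_van_poly _ _ _ _ _)); apply: eq_bigr => a _.
  by rewrite mmapZ mmapX mmap1U /h enum_rankK mulrC.
rewrite /van_poly horner_prod; apply: eq_bigr => x _.
by rewrite hornerD hornerN hornerX hornerC mulr0n mul0r subr0.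
Qed.

Lemma van_poly_map k k' v v' (f : {rmorphism tLam k v -> tLam k' v'}) (g : widx v -> widx v') t t' i :
  injective g -> (forall x, tag (g x) = tag x) -> g @: initial v n = initial v' n ->
  (forall x, x \in initial v n -> f (wvar k x - t%:R * hbar k v) = wvar k' (g x) - t'%:R * hbar k' v') ->
  map_poly f (van_poly n k v t i) = van_poly n k' v' t' i.
Proof.
move=> gi gt gn fx; rewrite /van_poly rmorph_prod -gn big_mkcondr [RHS]big_mkcondr big_imset /=; last first.
  by move=> ????; apply: gi.
apply: eq_bigr => x xn; rewrite gt; case: ifP => // _.
by rewrite -fx // rmorphB /= map_polyX map_polyC.
Qed.

Lemma beta_mon_map k k' v v' (f : {rmorphism tLam k v -> tLam k' v'}) (g : widx v -> widx v') t t' l :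
  injective g -> (forall x, tag (g x) = tag x) -> g @: initial v n = initial v' n ->
  (forall x, x \in initial v n -> f (wvar k x - t%:R * hbar k v) = wvar k' (g x) - t'%:R * hbar k' v') ->
  f (beta_mon (n := n) k v t l) = beta_mon k' v' t' l.
Proof.
move=> gi gt gn fx; rewrite /beta_mon /mmap1 rmorph_prod; apply: eq_bigr => j _.
by rewrite rmorphXn /= -coef_map (van_poly_map _ gi gt gn fx).
Qed.

Lemma beta_mon_lam1 k v t l : inLam1 n (beta_mon (n := n) k v t l).
Proof.
move=> s hs sn; apply: (beta_mon_map (f := wperm s) (g := s)) => //; first exact: perm_inj.
  by move=> x; apply: Sv_tag.
by move=> x _; rewrite rmorphB rmorphM rmorph_nat /= wperm_wvar wperm_hbar.
Qed.

Lemma beta_mon_bc k v t l : bc k (beta_mon (n := n) int v t l) = beta_mon k v t l.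
Proof.
apply: (beta_mon_map (f := @bc k Q v) (g := id)) => //; first by rewrite imset_id.
by move=> x _; rewrite rmorphB rmorphM rmorph_nat /= bc_hbar /wvar bc_pvar.
Qed.

(** The n-block lies in the m-block, so the shift adds hbar to each root and turns t = 1 into t =
    0. *)
Lemma beta_mon_wshift k v l : wshift (indm (initial v m)) (beta_mon (n := n) k v 1 l) = beta_mon k v 0 l.
Proof.
apply: (beta_mon_map (f := wshift (indm (initial v m))) (g := id)) => //; first by rewrite imset_id.
move=> x xn; rewrite rmorphB rmorphM rmorph_nat /= wshift_wvar wshift_hbar indmE (subsetP (initial_sub nm v) _ xn).
by rewrite mul0r addrK subr0.
Qed.

Lemma beta_mon_wzero k v0 v (le : dimvec_le v0 v) t l : dimvec_le n v0 ->
  wzero v0 (beta_mon (n := n) k v t l) = beta_mon k v0 t l.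
Proof.
move=> nv; rewrite /beta_mon /mmap1 rmorph_prod; apply: eq_bigr => j _.
rewrite rmorphXn /= -coef_map; congr ((polyseq _)`_ _ ^+ _).
rewrite /van_poly rmorph_prod -(initial_emb le nv) big_mkcondr [RHS]big_mkcondr big_imset /=; last first.
  by move=> ????; apply: wemb_inj.
apply: eq_bigr => x xn; case: ifP => // _.
by rewrite rmorphB /= map_polyX map_polyC /= rmorphB rmorphM rmorph_nat /= wzero_emb wzero_hbar.
Qed.

Lemma tdeg_wvar k v x t : tdeg 1 (wvar k x - t%:R * hbar k v : tLam k v).
Proof.
apply: wboundB; first exact: wbound_pvar.
rewrite -[1%N]add0n; apply: wboundM; first exact: wbound_nat.
by rewrite -[1%N]add0n; apply: wboundM; [exact: wbound_nat|exact: wbound_pvar].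
Qed.

Lemma tdeg_van_poly k v t i a : tdeg (dsize n) ((van_poly n k v t i)`_a).
Proof.
pose f (x : widx v) : {poly tLam k v} := (wvar k x - t%:R * hbar k v)%:P - 'X.
have h (s : seq (widx v)) (P : pred (widx v)) a' : tdeg (count P s) ((\prod_(x <- s | P x) f x)`_a').
  elim: s a' => [|x s IH] a'; first by rewrite big_nil coef1; apply: wbound_nat.
  rewrite big_cons /=; case: (P x) => //; rewrite /f mulrBl coefB coefCM coefXM.
  apply: wboundB; first exact: (wboundM (n := 1) (@tdeg_wvar k v x t) (IH _)).
  by case: ifP => _; [exact: wbound0|apply: wbound_le (IH _); rewrite leq_addl].
apply: wbound_le (h _ _ _); rewrite -sum1_count.
apply: leq_trans (_ : n i <= _)%N; last by rewrite /dsize (bigD1 i) //= leq_addr.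
have -> : \sum_(x : widx v | (x \in initial v n) && (tag x == i)) 1 =
   #|[set x : widx v | (tag x == i) && (wpos x < n i)%N]|.
  by rewrite -sum1_card; apply: eq_bigl => x; rewrite !inE andbC; case: (tag x =P i) => //= ->.
rewrite card_block; have [le|lt] := leqP (n i) (v i); first by rewrite card_ltn.
by apply: leq_trans (max_card _) _; rewrite card_ord ltnW.
Qed.

Lemma tdeg_beta_mon k v t (l : idx) : tdeg (dsize n * gamma_size) (beta_mon (n := n) k v t l).
Proof.
apply: wbound_le (_ : wbound _ (\sum_j dsize n * l j)%N _); last first.
  by apply: wbound_prod => j _; apply: wboundX; apply: tdeg_van_poly.
rewrite -big_distrr /= leq_mul2l; apply/orP; right; rewrite -mdegE.
exact: ltnW (bmdeg l).
Qed.

Lemma tdeg_gamma_coef k v l (Y : {set widx v}) : Y \subset initial v m -> tdeg (van_size * gamma_size) (gamma_coef (n := n) k l Y).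
Proof.
move=> Ym; rewrite /gamma_coef /gamma_gen.
have h (s : seq (widx v)) (P : pred (widx v)) l' : tdeg (van_size * count P s)
    ((\prod_(y <- s | P y) \sum_(a < van_size) (wvar k y ^+ a) *: 'X_(enum_rank ((tag y, a) : beta_idx)))@_l').
  elim: s l' => [|x s IH] l'; first by rewrite big_nil mcoeff1; apply: wbound_nat.
  rewrite big_cons /=; case: (P x) => //; rewrite mulnDr muln1 mcoeffM.
  apply: wbound_sum => -[a b] _ /=; apply: wboundM; last exact: IH.
  rewrite raddf_sum; apply: wbound_sum => c _ /=; rewrite mcoeffZ mcoeffX.
  apply: wboundMc; last exact: wbound_nat.
  apply: (wbound_le (n := 1 * c)); first by rewrite mul1n ltnW.
  by apply: wboundX; apply: wbound_pvar.
apply: wbound_le (h _ _ _); rewrite leq_mul2l; apply/orP; right.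
rewrite -sum1_count; apply: leq_trans (leqnSn _); rewrite sum1_card; exact: dsize_card.
Qed.

End Transfer.

Lemma tdeg_msize (k : comNzRingType) (Q : quiver) (v : dimvec Q) d (f : tLam k v) :
  tdeg d f <-> (msize f <= d.+1)%N.
Proof.
rewrite msizeE; split=> [h|/bigmax_leqP_seq h a ha].
  by apply/bigmax_leqP_seq => a ha _; rewrite ltnS -wdeg1 h.
by rewrite wdeg1 -ltnS h.
Qed.

(** Over the integers degrees add, so a bound for a product passes to the quotient; base change then
    carries it to k. *)
Lemma tdeg_div (Q : quiver) (v : dimvec Q) d (p q : tLam int v) : p != 0 -> tdeg d (p * q) -> tdeg d q.
Proof.
move=> p0 /tdeg_msize; have [->|q0] := eqVneq q 0; first by move=> _; apply: wbound0.
rewrite msizeM // => h; apply/tdeg_msize; apply: leq_trans h.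
have : (0 < msize p)%N by rewrite lt0n msize_poly_eq0.
by case: (msize p) => // j _; rewrite addSn /= leq_addl.
Qed.

Lemma imset_permD (X : finType) (s : {perm X}) (A B : {set X}) : s @: (A :\: B) = s @: A :\: s @: B.
Proof. by apply/setP => x; rewrite -(permKV s x) !inE !imset_perm_mem inE. Qed.

Section Transfer.
Variables (Q : quiver) (n m : dimvec Q) (nm : dimvec_le n m).
Implicit Types (k : comNzRingType) (v : dimvec Q).
Local Notation beta_idx := (beta_idx n).
Local Notation van_size := (van_size n).
Local Notation gamma_size := (gamma_size m).
Local Notation idx := 'X_{1..#|beta_idx| < gamma_size}.
Local Notation isSub := (isSub n m).
Local Notation rs2 G F := (wperm (sub_perm n m G) F).
Local Notation lab2 := (lab2 n m).
Local Notation gamma_coef k := (gamma_coef (n := n) k).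
Local Notation fixout := (fixout m).

Definition diag_prod k v (I : {set widx v}) : tLam k v :=
  \prod_(x in I) \prod_(y in I) wdiff k (x, y, 0).

(* The cofactor of prod_(x in G, y in I minus G) (w_x - w_y) in [diag_prod I], for
   I = [initial v m]. *)
Definition theta_comp k v (G : {set widx v}) : tLam k v :=
  \prod_(x in initial v m) \prod_(y in initial v m)
    (if (x \in G) && (y \notin G) then 1 else wdiff k (x, y, 0)).

Definition theta_num k v (l : 'X_{1..#|beta_idx|}) (F : tLam k v) : tLam k v :=
  \sum_(G : {set widx v} | isSub G) rs2 G F * gamma_coef k l (initial v m :\: G) * theta_comp k G.

Lemma lreg_diag_prod k v (I : {set widx v}) : GRing.lreg (diag_prod k I).
Proof.
apply: big_ind => [||x _]; [exact: lreg1|exact: lregM|].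
by apply: big_ind => [||y _]; [exact: lreg1|exact: lregM|exact: lreg_wdiff].
Qed.

Lemma diag_prod_wperm k v (s : {perm widx v}) (I : {set widx v}) : Sv s -> s @: I = I ->
  wperm s (diag_prod k I) = diag_prod k I.
Proof.
move=> hs sI; have inj : {in I &, injective s} by move=> ????; apply: perm_inj.
rewrite /diag_prod -[in RHS]sI [RHS]big_imset //= rmorph_prod; apply: eq_bigr => x _.
rewrite [RHS]big_imset //= rmorph_prod; apply: eq_bigr => y _; exact: (wperm_denP k hs (x, y, 0)).
Qed.

Lemma theta_comp_wperm k v (s : {perm widx v}) (G : {set widx v}) : Sv s -> s @: initial v m = initial v m ->
  wperm s (theta_comp k G) = theta_comp k (s @: G).
Proof.
move=> hs sI; have inj : {in initial v m &, injective s} by move=> ????; apply: perm_inj.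
rewrite /theta_comp -[in RHS]sI [RHS]big_imset //= rmorph_prod; apply: eq_bigr => x _.
rewrite [RHS]big_imset //= rmorph_prod; apply: eq_bigr => y _.
rewrite !imset_perm_mem; case: ((x \in G) && (y \notin G)); [exact: rmorph1|]; exact: (wperm_denP k hs (x, y, 0)).
Qed.

Lemma sub_perm_spec v (G : {set widx v}) : dimvec_le m v -> isSub G ->
  exists t : {perm widx v}, [/\ fixout t, Sv t, t @: initial v m = initial v m, t @: initial v n = G &
    forall k (F : tLam k v), labinv lab2 F -> rs2 G F = wperm t F].
Proof.
move=> mv hG; have [t [ft tn]] := isSub_exists nm mv hG; exists t.
have tm := fixout_initial ft; have [ht _] := ft.
by split; [exact: ft|exact: ht|exact: tm|exact: tn|move=> k F hF; exact: sub_permE].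
Qed.

Lemma isSub_perm v (s : {perm widx v}) (G : {set widx v}) : Sv s -> s @: initial v m = initial v m ->
  isSub (s @: G) = isSub G.
Proof.
move=> hs sm; rewrite /isSub isGamma_perm //; congr (_ && _).
rewrite -{1}sm; apply/subsetP/subsetP => h x; last by case/imsetP => y /h yI ->; rewrite imset_perm_mem.
by move=> xG; rewrite -(imset_perm_mem s) h // imset_perm_mem.
Qed.

Lemma theta_num_wperm k v (s : {perm widx v}) l (F : tLam k v) : dimvec_le m v -> labinv lab2 F ->
  Sv s -> s @: initial v m = initial v m -> wperm s (theta_num l F) = theta_num l F.
Proof.
move=> mv hF hs sm; rewrite /theta_num rmorph_sum [RHS](reindex_inj (imset_inj (@perm_inj _ s))) /=.
apply: eq_big => [G|G hG]; first by rewrite isSub_perm.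
have [t [_ ht tm tn tF]] := sub_perm_spec mv hG.
rewrite (tF _ _ hF) !rmorphM /= gamma_coef_wperm // theta_comp_wperm // imset_permD ?sm.
rewrite wperm_comp (sub_permE hF (s := t * s)%g) //; first exact: SvM.
  by rewrite (eq_imset _ (permM t s)) imset_comp tm.
by rewrite (eq_imset _ (permM t s)) imset_comp tn.
Qed.

(** At least one of (x, y) and (y, x) does not go from G to its complement, so the corresponding
    form is a factor, and it vanishes at w_x = w_y. *)
Lemma theta_comp_eq0 k v (x y : widx v) (G : {set widx v}) : x \in initial v m -> y \in initial v m ->
  tag x = tag y -> x != y -> wev (x, y, 0) (theta_comp k G) = 0.
Proof.
move=> xm ym txy xy.
have z a b : a \in initial v m -> b \in initial v m -> ~~ ((a \in G) && (b \notin G)) ->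
   wev (x, y, 0) (wdiff k (a, b, 0)) = 0 -> wev (x, y, 0) (theta_comp k G) = 0.
  move=> am bm /negbTE ab e; rewrite /theta_comp (bigD1 a am) (bigD1 b bm) ab.
  by rewrite rmorphM [X in X * _ = _]rmorphM [X in X * _ * _ = _]e !mul0r.
have [/andP[xG yG]|] := boolP ((x \in G) && (y \notin G)).
  apply: (z y x) => //; first by rewrite negb_and yG.
  rewrite /wdiff txy eqxx eq_sym xy /= mul0r addr0 rmorphB /=.
  by rewrite !wev_wvar eqxx /= eq_sym (negbTE xy) mul0r subr0 subrr.
move=> h; apply: (z x y) => //; apply: wev_wdiff.
by rewrite /wvalid /= txy eqxx.
Qed.

Lemma theta_num_bc k v l (F : tLam int v) : bc k (theta_num l F) = theta_num l (bc k F).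
Proof.
rewrite /theta_num rmorph_sum; apply: eq_bigr => G _.
rewrite !rmorphM /= bc_wperm gamma_coef_bc; congr (_ * _).
rewrite /theta_comp rmorph_prod; apply: eq_bigr => x _; rewrite rmorph_prod; apply: eq_bigr => y _.
by case: ifP => _; [exact: rmorph1|exact: bc_wdiff].
Qed.

Lemma diag_prod_bc k v (I : {set widx v}) : bc k (diag_prod int I) = diag_prod k I.
Proof.
rewrite /diag_prod rmorph_prod; apply: eq_bigr => x _; rewrite rmorph_prod; apply: eq_bigr => y _.
exact: bc_wdiff.
Qed.

Lemma theta_numD k v l (F G : tLam k v) : theta_num l (F + G) = theta_num l F + theta_num l G.
Proof. by rewrite /theta_num -big_split; apply: eq_bigr => H _; rewrite rmorphD !mulrDl. Qed.

Lemma theta_num_sum k v l I (r : seq I) (F : I -> tLam k v) : theta_num l (\sum_(i <- r) F i) = \sum_(i <- r) theta_num l (F i).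
Proof.
elim: r => [|i r IH]; last by rewrite !big_cons theta_numD IH.
by rewrite !big_nil; apply: big1 => H _; rewrite rmorph0 !mul0r.
Qed.

Lemma theta_numZ k v l c (F : tLam k v) : theta_num l (c *: F) = c *: theta_num l F.
Proof.
rewrite /theta_num scaler_sumr; apply: eq_bigr => H _.
have -> : rs2 H (c *: F) = c *: rs2 H F by apply: psubstZ.
by rewrite -!scalerAl.
Qed.

(** A bound for the degree of [gamma_coef] plus the number of ordered pairs in [theta_comp];
    division by [diag_prod] can only lower the degree. *)
Definition theta_deg := (van_size * gamma_size + dsize m * dsize m)%N.

Lemma tdeg_wdiff k v d : tdeg 1 (wdiff k d : tLam k v).
Proof.
case: d => [[x y] t] /=; case: ifP => _; last exact: wbound1.
apply: wboundD; first by apply: wboundB; apply: wbound_pvar.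
rewrite -[1%N]add0n; apply: wboundM; first exact: wbound_int.
by rewrite -[1%N]add0n; apply: wboundM; [exact: wbound_nat|exact: wbound_pvar].
Qed.

Lemma tdeg_wperm k v d s (F : tLam k v) : tdeg d F -> tdeg d (wperm s F).
Proof. by apply: wbound_psubst => -[z|x]; apply: wbound_pvar. Qed.

Lemma tdeg_theta_num k v D l (F : tLam k v) : tdeg D F -> tdeg (D + theta_deg) (theta_num l F).
Proof.
move=> hF; apply: wbound_sum => G hG; rewrite /theta_deg addnA; apply: wboundM; first apply: wboundM.
- exact: tdeg_wperm.
- by apply: tdeg_gamma_coef; apply: subsetDl.
apply: wbound_le (_ : wbound _ (\sum_(x in initial v m) \sum_(y in initial v m) 1) _).
  by rewrite sum1_card sum_nat_const leq_mul // dsize_card.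
apply: wbound_prod => x _; apply: wbound_prod => y _.
by case: ((x \in G) && (y \notin G)); [exact: wbound1|exact: tdeg_wdiff].
Qed.

Lemma theta_num_div_int v l (F : tLam int v) : dimvec_le m v -> labinv lab2 F ->
  exists h, theta_num l F = diag_prod int (initial v m) * h.
Proof.
move=> mv hF; apply: diag_product => x y xm ym txy xy.
  by rewrite /theta_num rmorph_sum big1 // => G _; rewrite rmorphM /= theta_comp_eq0 // mulr0.
apply: theta_num_wperm => //; first exact: Sv_tperm.
apply/setP => z; rewrite -(permKV (tperm x y) z) imset_perm_mem.
by case: tpermP => [->|->|_ _]; rewrite ?xm ?ym.
Qed.

(** The numerator is symmetric and vanishes on the diagonals, so over the integers [diag_product]
    applies. Expansion of F on orbit sums transports the quotient and its degree bound to k. *)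
Lemma theta_num_div k v D l (F : tLam k v) : dimvec_le m v -> labinv lab2 F -> tdeg D F ->
  exists2 h, theta_num l F = diag_prod k (initial v m) * h & tdeg (D + theta_deg) h.
Proof.
move=> mv hF dF; have [cs [hcs ->]] := labinv_span hF dF.
have hc c : c \in cs -> exists2 h, theta_num l c.2 = diag_prod int (initial v m) * h & tdeg (D + theta_deg) h.
  move=> /hcs[lc dc]; have [h e] := theta_num_div_int l mv lc; exists h => //.
  apply: (@tdeg_div _ _ _ (diag_prod int (initial v m))); first by apply/eqP/lreg_neq0_int/lreg_diag_prod.
  by rewrite -e; apply: tdeg_theta_num.
rewrite theta_num_sum; elim: cs hc {hcs} => [|c cs IH] hc.
  by exists 0; rewrite ?big_nil ?mulr0 //; apply: wbound0.
have [|h e dh] := IH; first by move=> c' hc'; apply: hc; rewrite inE hc' orbT.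
have [h' e' dh'] := hc c (mem_head _ _).
exists (c.1 *: bc k h' + h); last first.
  apply: wboundD => //; apply: wboundZ => a; rewrite mcoeff_msupp mcoeff_bc => ha.
  by apply: dh'; rewrite mcoeff_msupp; apply: contraNneq ha => ->.
rewrite big_cons e mulrDr; congr (_ + _).
by rewrite theta_numZ -theta_num_bc e' rmorphM /= diag_prod_bc scalerAr.
Qed.

(* sum_Gamma (F gamma_l(I minus Gamma))|_Gamma / prod_(r in Gamma, s in I minus Gamma) (w_r - w_s),
   over the Gamma of dimension n in I = [initial v m]: the coordinates of F with respect
   to the generators [beta_mon 0 l] of the invariants of S_n x S_(m-n) over those of S_m. *)
Definition theta_part k v l (F : tLam k v) : tLam k v :=
  if pselect (exists h, theta_num l F = diag_prod k (initial v m) * h) is left e then projT1 (cid e) else 0.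

Lemma labinv_tdeg k v (F : tLam k v) : exists D, tdeg D F.
Proof. by exists (msize F); apply/tdeg_msize. Qed.

Lemma theta_partE k v l (F : tLam k v) : dimvec_le m v -> labinv lab2 F ->
  theta_num l F = diag_prod k (initial v m) * theta_part l F.
Proof.
move=> mv hF; rewrite /theta_part; case: pselect => [e|[]]; first exact: (projT2 (cid e)).
by have [D dF] := labinv_tdeg F; have [h e _] := theta_num_div l mv hF dF; exists h.
Qed.

Lemma theta_part_uniq k v l (F h : tLam k v) : dimvec_le m v -> labinv lab2 F ->
  theta_num l F = diag_prod k (initial v m) * h -> theta_part l F = h.
Proof. by move=> mv hF e; apply: (@lreg_diag_prod k v (initial v m)); rewrite -theta_partE. Qed.

Lemma tdeg_theta_part k v D l (F : tLam k v) : dimvec_le m v -> labinv lab2 F -> tdeg D F -> tdeg (D + theta_deg) (theta_part l F).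
Proof. by move=> mv hF dF; have [h e dh] := theta_num_div l mv hF dF; rewrite (theta_part_uniq mv hF e). Qed.

Lemma theta_part_lam1 k v l (F : tLam k v) : dimvec_le m v -> labinv lab2 F -> inLam1 m (theta_part l F).
Proof.
move=> mv hF s hs sm; apply: (@lreg_diag_prod k v (initial v m)).
rewrite -theta_partE // -[in LHS](diag_prod_wperm k hs sm) -(theta_num_wperm l mv hF hs sm) theta_partE //.
by rewrite rmorphM.
Qed.

Lemma theta_part_bc k v l (F : tLam int v) : dimvec_le m v -> labinv lab2 F -> bc k (theta_part l F) = theta_part l (bc k F).
Proof.
move=> mv hF; symmetry; apply: theta_part_uniq => //; last by rewrite -theta_num_bc theta_partE // rmorphM /= diag_prod_bc.
by move=> s hs sl; rewrite -bc_wperm hF.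
Qed.

End Transfer.

Lemma isGamma_card (Q : quiver) (v m : dimvec Q) (G : {set widx v}) : isGamma m G -> #|G| = dsize m.
Proof.
move=> /forallP h; rewrite -sum1_card (partition_big (fun x : widx v => tag x) predT) //=.
apply: eq_bigr => i _; rewrite -(eqP (h i)) -sum1_card.
by apply: eq_bigl => x; rewrite inE.
Qed.

Lemma isGamma_emb (Q : quiver) (v' v m : dimvec Q) (le : dimvec_le v' v) (G : {set widx v'}) :
  isGamma m (wemb le @: G) = isGamma m G.
Proof.
apply: eq_forallb => i; congr (_ == _).
rewrite -(card_imset _ (wemb_inj (le := le))); apply: eq_card => x.
rewrite inE; apply/andP/imsetP => [[/imsetP[y yG ->] yi]|[y]]; first by exists y; rewrite // inE yG.
by rewrite inE => /andP[yG yi] ->; split=> //; apply: imset_f.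
Qed.

Section Transfer.
Variables (Q : quiver) (n m : dimvec Q) (nm : dimvec_le n m).
Implicit Types (k : comNzRingType) (v : dimvec Q).
Local Notation beta_idx := (beta_idx n).
Local Notation van_size := (van_size n).
Local Notation gamma_size := (gamma_size m).
Local Notation idx := 'X_{1..#|beta_idx| < gamma_size}.
Local Notation isSub := (isSub n m).
Local Notation rs2 G F := (wperm (sub_perm n m G) F).
Local Notation lab2 := (lab2 n m).
Local Notation gamma_coef k := (gamma_coef (n := n) k).
Local Notation fixout := (fixout m).

Lemma theta_comp_initial k v : dimvec_le m v ->
  theta_comp m k (initial v n) * \prod_(y in initial v m :\: initial v n)
     \prod_(x in initial v n | tag x == tag y) (wvar k x - wvar k y) = diag_prod k (initial v m).
Proof.
move=> mv.
have -> : \prod_(y in initial v m :\: initial v n)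
     \prod_(x in initial v n | tag x == tag y) (wvar k x - wvar k y) =
   \prod_(x in initial v m) \prod_(y in initial v m)
     (if (x \in initial v n) && (y \notin initial v n) then wdiff k (x, y, 0) else 1).
  rewrite [RHS]exchange_big /= [LHS]big_mkcond [RHS]big_mkcond; apply: eq_bigr => y _.
  rewrite in_setD andbC; case: (y \in initial v m) => //=.
  case yn: (y \in initial v n); first by rewrite [RHS]big1 // => x _; rewrite andbF.
  rewrite [LHS]big_mkcond [RHS]big_mkcond; apply: eq_bigr => x _ /=.
  case xn: (x \in initial v n) => /=; last by case: ifP.
  rewrite (subsetP (initial_sub nm v) _ xn).
  have -> : (x != y) by apply: contraFneq yn => <-.
  by rewrite andbT; case: ifP => // _; rewrite mul0r addr0.
rewrite /theta_comp -big_split; apply: eq_bigr => x _; rewrite -big_split; apply: eq_bigr => y _.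
by case: ((x \in initial v n) && (y \notin initial v n)); [exact: mul1r|exact: mulr1].
Qed.

(** Interpolation: after summation over l the term of G contains the factors w_x - w_y for y in I
    minus G and x in the n-block, and one of them has x = y unless G is the n-block itself. *)
Lemma theta_part_sum k v (F : tLam k v) : dimvec_le m v -> labinv lab2 F ->
  \sum_(l : idx) theta_part m l F * beta_mon k v 0 l = F.
Proof.
move=> mv hF; apply: (@lreg_diag_prod Q k v (initial v m)).
rewrite mulr_sumr.
transitivity (\sum_(G | isSub G) rs2 G F * theta_comp m k G * \prod_(y in initial v m :\: G)
     \prod_(x in initial v n | tag x == tag y) (wvar k x - wvar k y)).
  transitivity (\sum_(l : idx) \sum_(G | isSub G) rs2 G F * theta_comp m k G *
     (beta_mon k v 0 l * gamma_coef k l (initial v m :\: G))).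
    apply: eq_bigr => l _; rewrite mulrA -(theta_partE nm) // /theta_num mulr_suml; apply: eq_bigr => G _.
    by move: (rs2 G F) (gamma_coef k l _) (theta_comp m k G) (beta_mon k v 0 l) => a b c d; ring.
  rewrite exchange_big; apply: eq_bigr => G _ /=; rewrite -mulr_sumr.
  by rewrite beta_gamma // subsetDl.
have sn : isSub (initial v n) by rewrite /isSub initial_sub //= isGamma_initial // (dimvec_trans nm mv).
rewrite (bigD1 (initial v n)) //= [X in _ + X]big1 ?addr0 => [|G /andP[hG Gn]].
  rewrite -mulrA theta_comp_initial // mulrC; congr (_ * _).
  have i1 (A : {set widx v}) : (1%g : {perm widx v}) @: A = A by rewrite (eq_imset _ (@perm1 _)) imset_id.
  by rewrite (sub_permE hF (s := 1%g)) ?wperm1 ?i1 //; apply/forallP => x; rewrite perm1.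
have [y yn yG] : exists2 y, y \in initial v n & y \notin G.
  apply/subsetPn; apply: contra Gn => s; rewrite eq_sym eqEcard s.
  by have /andP[_ /isGamma_card->] := hG; have /andP[_ /isGamma_card->] := sn; rewrite leqnn.
rewrite (bigD1 y) /=; last by rewrite inE yG (subsetP (initial_sub nm v) _ yn).
by rewrite (bigD1 y) /= ?yn ?eqxx // subrr !mul0r mulr0.
Qed.

Lemma wshift_diag_prod k v (a : 'X_{1..#|widx v|}) :
  (forall s, fixout s -> pmnm s a = a) -> wshift a (diag_prod k (initial v m)) = diag_prod k (initial v m).
Proof.
move=> ha; rewrite /diag_prod rmorph_prod; apply: eq_bigr => x xm; rewrite rmorph_prod; apply: eq_bigr => y ym.
have [/andP[/eqP txy xy]|/negbTE h] := boolP ((tag x == tag y) && (x != y)); last first.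
  by rewrite /wdiff h rmorph1.
have e : a (enum_rank x) = a (enum_rank y).
  rewrite -[in LHS](ha (tperm x y)); first by rewrite pmnmE tpermV tpermL.
  split; first exact: Sv_tperm.
  by move=> z zm; rewrite tpermD //; apply: contraNneq zm => <-.
by rewrite [LHS](wshiftP k a (x, y, 0)) /wshift_den e add0r subrr.
Qed.

(** Each summand of [theta_num] is F moved by a permutation of the m-block, times a factor
    independent of F. This permutation fixes the multipliers c and the shift a, hence moves the
    given relation to one between the moved F. *)
Lemma theta_part_lin k v (a : 'X_{1..#|widx v|}) (T : eqType) (r : seq T) (c F : T -> tLam k v) (l : 'X_{1..#|beta_idx|}) :
  dimvec_le m v ->
  (forall s, fixout s -> pmnm s a = a) ->
  (forall t, t \in r -> labinv lab2 (F t)) ->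
  (forall t s, t \in r -> fixout s -> wperm s (c t) = c t) ->
  \sum_(t <- r) c t * wshift a (F t) = 0 -> \sum_(t <- r) c t * wshift a (theta_part m l (F t)) = 0.
Proof.
move=> mv ha hF hc e0; apply: (@lreg_diag_prod Q k v (initial v m)).
rewrite mulr0 mulr_sumr.
transitivity (\sum_(t <- r) \sum_(G | isSub G) c t * wshift a (rs2 G (F t)) *
    wshift a (gamma_coef k l (initial v m :\: G) * theta_comp m k G)).
  rewrite big_seq [RHS]big_seq; apply: eq_bigr => t tr.
  have -> : diag_prod k (initial v m) * (c t * wshift a (theta_part m l (F t))) = c t * wshift a (theta_num m l (F t)).
    rewrite mulrCA; congr (_ * _); rewrite -[X in X * _](wshift_diag_prod k ha) -(rmorphM (wshift a)).
    by congr (wshift a _); apply: esym; apply: (theta_partE nm) => //; apply: hF.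
  rewrite /theta_num [X in _ * X](rmorph_sum (wshift a)) mulr_sumr; apply: eq_bigr => G _.
  by rewrite -[in LHS]mulrA [X in _ * X](rmorphM (wshift a)) mulrA.
rewrite exchange_big big1 // => G hG /=; rewrite -mulr_suml.
have [t [ft ht tm tn tF]] := sub_perm_spec nm mv hG.
transitivity (wperm t (\sum_(i <- r) c i * wshift a (F i)) * wshift a (gamma_coef k l (initial v m :\: G) * theta_comp m k G)).
  congr (_ * _); rewrite [RHS]rmorph_sum big_seq [RHS]big_seq; apply: eq_bigr => i ir.
  transitivity (wperm t (c i) * wperm t (wshift a (F i))); last by apply: esym; apply: (rmorphM (wperm t)).
  by rewrite (hc _ _ ir ft) [X in _ = _ * X]wperm_wshift (ha _ ft) (tF _ _ (hF _ ir)).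
by rewrite e0 rmorph0 mul0r.
Qed.

Lemma labinv_wzero k (L : eqType) (lab : vert Q -> nat -> L) v' v (le : dimvec_le v' v) (F : tLam k v) :
  labinv lab F -> labinv lab (wzero v' F).
Proof.
move=> hF s0 hs0 sl; have [s [hs se sn]] := ext_perm le hs0.
rewrite -(wzero_wperm _ se sn) hF // => x.
case Ex: (wpre v' x) => [y|]; last by rewrite sn.
have wE z : wlab lab (wemb le z) = wlab lab z by rewrite /wlab wpos_emb.
by rewrite -(wpre_some le Ex) se !wE sl.
Qed.

(** The subsets of the m-block are the same for v and v', so the defining equation restricts, and
    its solution is unique. *)
Lemma theta_part_wzero k v' v (le : dimvec_le v' v) (l : 'X_{1..#|beta_idx|}) (F : tLam k v) : dimvec_le m v' -> labinv lab2 F ->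
  wzero v' (theta_part m l F) = theta_part m l (wzero v' F).
Proof.
move=> mv' hF; have mv := dimvec_trans mv' le; symmetry; apply: (theta_part_uniq nm mv'); first exact: labinv_wzero.
have im : wemb le @: initial v' m = initial v m by apply: initial_emb.
have inj (A : {set widx v'}) : {in A &, injective (wemb le)} by move=> ????; apply: wemb_inj.
transitivity (wzero v' (theta_num m l F)); last first.
  rewrite (theta_partE nm) // rmorphM; congr (_ * _).
  rewrite /diag_prod -im big_imset // rmorph_prod; apply: eq_bigr => x _.
  rewrite big_imset // rmorph_prod; apply: eq_bigr => y _; exact: (wzero_wdiff k le (x, y, 0)).
rewrite /theta_num rmorph_sum.
rewrite [RHS](reindex_onto (fun G : {set widx v'} => wemb le @: G) (fun G => wemb le @^-1: G)) /=; last first.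
  move=> G /andP[Gm _]; apply/setP => x; apply/imsetP/idP => [[y + ->]|xG]; first by rewrite inE.
  have := subsetP Gm _ xG; rewrite -im => /imsetP[y _ xy]; exists y => //.
  by rewrite inE -xy.
have K (G : {set widx v'}) : wemb le @^-1: (wemb le @: G) = G.
  by apply/setP => x; rewrite inE (mem_imset _ _ (wemb_inj (le := le))).
have sub (G : {set widx v'}) : isSub (wemb le @: G) = isSub G.
  rewrite /isSub isGamma_emb -im; congr (_ && _); apply/subsetP/subsetP => h x.
    by move=> xG; have := h _ (imset_f _ xG); rewrite (mem_imset _ _ (wemb_inj (le := le))).
  by case/imsetP => y /h ym ->; apply: imset_f.
apply: eq_big => [G|G hG]; first by rewrite K eqxx andbT sub.
rewrite [RHS]rmorphM [X in _ = X * _]rmorphM; congr (_ * _ * _).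
- have [t [_ ht tm tn tF]] := sub_perm_spec nm mv' hG.
  have [s [hs se sn]] := ext_perm le ht.
  have eA (A : {set widx v'}) : s @: (wemb le @: A) = wemb le @: (t @: A).
    by rewrite -!imset_comp; apply: eq_imset.
  rewrite (tF _ _ (labinv_wzero le hF)) (sub_permE hF hs).
  - by apply: esym; apply: wzero_wperm.
  - by rewrite -im eA tm.
  - by rewrite -(initial_emb le (dimvec_trans nm mv')) eA tn.
- rewrite -im -(gamma_coef_wzero _ le); congr (wzero _ (gamma_coef _ _ _)); apply/setP => x; rewrite inE.
  apply/imsetP/andP => [[y + ->]|[xG /imsetP[y ym xy]]].
    by rewrite inE => /andP[yG ym]; rewrite !(mem_imset _ _ (wemb_inj (le := le))).
  by exists y => //; rewrite inE ym andbT; apply: contra xG; rewrite xy; apply: imset_f.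
rewrite /theta_comp -im big_imset // rmorph_prod; apply: eq_bigr => x _.
rewrite big_imset // rmorph_prod; apply: eq_bigr => y _.
rewrite !(mem_imset _ _ (wemb_inj (le := le))).
case: ((x \in G) && (y \notin G)); [by rewrite rmorph1|symmetry; exact: (wzero_wdiff k le (x, y, 0))].
Qed.

End Transfer.

(** * Products of two operators *)

Section Duo.
Variables (k : comNzRingType) (Q : quiver).
Implicit Types (v m n : dimvec Q).
Local Notation "''W_' v" := 'X_{1..#|widx v|} (at level 8, v at level 2).

Lemma acoef_duo v m n (f g : tLam k v) l : acoef l (FMO m f * FMO n g) =
  \sum_(p : {set widx v} * {set widx v} | [&& isGamma m p.1, isGamma n p.2 & (indm p.1 + indm p.2 == l)%MM])
     fcoef m f p.1 * lshift (indm p.1) (fcoef n g p.2).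
Proof.
rewrite !FMO_skewm mulr_suml raddf_sum /=.
transitivity (\sum_(G | isGamma m G) \sum_(H | isGamma n H) (if (indm G + indm H == l)%MM then
    fcoef m f G * lshift (indm G) (fcoef n g H) else 0)).
  apply: eq_bigr => G _; rewrite mulr_sumr raddf_sum /=; apply: eq_bigr => H _.
  rewrite skewmM [LHS]acoef_skewm; case: ifP => _; [exact: mulr1|exact: mulr0].
rewrite pair_big /= -big_mkcondr; apply: eq_bigl => p; exact: esym (andbA _ _ _).
Qed.

Lemma lfracM v (a b : tLam k v) : lfrac (a * b) = lfrac a * lfrac b.
Proof. exact: rmorphM. Qed.

Lemma lfrac1 v : lfrac (1 : tLam k v) = 1.
Proof. exact: rmorph1. Qed.

Lemma lfrac_prod v (I : finType) (P : pred I) (F : I -> tLam k v) :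
  lfrac (\prod_(i | P i) F i) = \prod_(i | P i) lfrac (F i).
Proof. exact: rmorph_prod. Qed.

(** For x in G only and y in H only, the pair contributes [pairf x y 0] through G and, shifted by
    u^(1_G), [pairf y x 1] through H. These are the numerator and denominator of the product. *)
Definition duoE v (x y : widx v) : tLam k v := pairn k x y 0 * pairn k y x 1.
Definition duoq v (x y : widx v) : tLam k v := wdiff k (x, y, 0) * wdiff k (y, x, -1).

Lemma pairf_inv v (x y : widx v) t : x != y -> pairf k x y t * lfrac (wdiff k (x, y, - t)) = lfrac (pairn k x y t).
Proof.
move=> xy; rewrite pairfE -mulrA; case: ifP => txy; last first.
  by rewrite mul1r /wdiff txy /= lfrac1 mulr1.
rewrite [X in _ * X]mulrC [X in _ * X](_ : _ = 1) ?mulr1 //; exact: (frac_den (@wdiff k Q v)).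
Qed.

Lemma pairf_duoE v (x y : widx v) : x != y ->
  pairf k x y 0 * pairf k y x 1 * lfrac (duoq x y) = lfrac (duoE x y).
Proof.
move=> xy; rewrite /duoq /duoE !lfracM -!pairf_inv // 1?eq_sym // oppr0.
by move: (pairf k x y 0) (pairf k y x 1) (lfrac _) (lfrac _) => a b c d; rewrite mulrACA.
Qed.

(** The part of the contribution of (x, y) that depends on B = G ∩ H and on the symmetric difference
    T only, not on T1 = G minus H. *)
Definition duocf v (B T : {set widx v}) (x y : widx v) : LamLoc k v :=
  if x \in B then (if y \in B then 1 else if y \in T then pairf k x y 0 else pairf k x y 0 * pairf k x y (-1))
  else if x \in T then (if (y \in B) || (y \in T) then 1 else pairf k x y 0) else 1.

Definition duoN1 v (T T1 : {set widx v}) : tLam k v :=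
  \prod_(x in T) \prod_(y in T) (if (x \in T1) && (y \notin T1) then duoE x y else duoq x y).

Lemma prod_in2 (R : comPzRingType) (X : finType) (A B : {set X}) (F : X -> X -> R) :
  \prod_(x in A) \prod_(y in B) F x y = \prod_x \prod_y (if (x \in A) && (y \in B) then F x y else 1).
Proof.
rewrite big_mkcond; apply: eq_bigr => x _; case: (x \in A) => /=; first by rewrite big_mkcond.
by rewrite big1.
Qed.

(** The identity is checked on one ordered pair at a time. [P1] comes from G, [P2] and [P3] from H;
    the pairs from T minus T1 to T1 are transposed in [P3] to meet their partners in [P1]. *)
Lemma fcoef_duo v m n (f g : tLam k v) (B T T1 : {set widx v}) : [disjoint B & T] -> T1 \subset T ->
  let G := B :|: T1 in let H := B :|: (T :\: T1) in
  fcoef m f G * lshift (indm G) (fcoef n g H) * lfrac (\prod_(x in T) \prod_(y in T) duoq x y) =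
  (\prod_x \prod_y duocf B T x y) *
    lfrac (restr m G f * wshift (indm G) (restr n H g) * duoN1 T T1).
Proof.
move=> dBT sT G H.
have st (x : widx v) : [\/ [/\ x \in B, (x \in T) = false & (x \in T1) = false],
    [/\ (x \in B) = false, x \in T & x \in T1], [/\ (x \in B) = false, x \in T & (x \in T1) = false] |
    [/\ (x \in B) = false, (x \in T) = false & (x \in T1) = false]].
  have [xB|xB] := boolP (x \in B).
    have xT : (x \in T) = false := disjointFr dBT xB.
    by constructor 1; split=> //; apply: contraFF xT; apply: subsetP.
  have [xT|xT] := boolP (x \in T).
    by case x1: (x \in T1); [constructor 2|constructor 3].
  by constructor 4; split=> //; apply: contraNF xT; apply: subsetP.
pose P1 (x y : widx v) : LamLoc k v := if (x \in G) && (y \in ~: G) then pairf k x y 0 else 1.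
pose P2 (x y : widx v) : LamLoc k v := if (x \in H) && (y \in ~: H) then
   (if (x \in T) && (y \in T1) then 1 else pairf k x y (0 + (y \in G : nat)%:Z - (x \in G : nat)%:Z)) else 1.
pose P3 (x y : widx v) : LamLoc k v := if (y \in T :\: T1) && (x \in T1) then pairf k y x 1 else 1.
pose P4 (x y : widx v) : tLam k v := if (x \in T) && (y \in T) then duoq x y else 1.
pose P5 (x y : widx v) : tLam k v := if (x \in T) && (y \in T) then
  (if (x \in T1) && (y \notin T1) then duoE x y else duoq x y) else 1.
have key x y : P1 x y * (P2 x y * P3 x y) * lfrac (P4 x y) = duocf B T x y * lfrac (P5 x y).
  rewrite /P1 /P2 /P3 /P4 /P5 /duocf /G /H !in_setC !in_setU !in_setD.
  case: (st x) => -[-> -> ex]; case: (st y) => -[-> -> ey]; rewrite ?ex ?ey ?lfrac1 ?mul1r ?mulr1 //.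
  by rewrite pairf_duoE //; apply: contraTneq ex => ->; rewrite ey.
have sM a N P : lshift a (lfrac N * P) = lfrac (wshift a N) * lshift a P :> LamLoc k v.
  by rewrite -[lfrac (wshift a N)](lshift_frac a N [::]) [LHS](rmorphM (lshift a)).
rewrite !fcoefE sM.
have -> : lshift (indm G) (\prod_(x in H) \prod_(y in ~: H) pairf k x y 0) =
   \prod_x \prod_y P2 x y * \prod_x \prod_y P3 x y.
  rewrite [X in _ * X]exchange_big -big_split [LHS]rmorph_prod [LHS]big_mkcond /=; apply: eq_bigr => x _.
  rewrite -big_split; case xH: (x \in H); last first.
    rewrite [RHS]big1 // => y _; rewrite /P2 /P3 xH [X in X * _ = _]/= mul1r.
    by move: xH; rewrite /H in_setU => /norP[_ /negbTE->].
  rewrite [LHS]rmorph_prod [LHS]big_mkcond; apply: eq_bigr => y _.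
  rewrite /P2 /P3 xH /= [lshift _ _]lshift_pairf !indmE; move: xH.
  rewrite /H /G !in_setC !in_setU !in_setD.
  case: (st x) => -[-> -> ->]; case: (st y) => -[-> -> ->]; rewrite ?mulr1 ?mul1r //.
have -> : \prod_(x in G) \prod_(y in ~: G) pairf k x y 0 = \prod_x \prod_y P1 x y by exact: prod_in2.
have -> : \prod_(x in T) \prod_(y in T) duoq x y = \prod_x \prod_y P4 x y by exact: prod_in2.
have -> : duoN1 T T1 = \prod_x \prod_y P5 x y by exact: prod_in2.
transitivity (lfrac (restr m G f) * lfrac (wshift (indm G) (restr n H g)) *
   \prod_x \prod_y (P1 x y * (P2 x y * P3 x y) * lfrac (P4 x y))).
  have -> : \prod_x \prod_y (P1 x y * (P2 x y * P3 x y) * lfrac (P4 x y)) =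
     \prod_x \prod_y P1 x y * (\prod_x \prod_y P2 x y * \prod_x \prod_y P3 x y) * lfrac (\prod_x \prod_y P4 x y).
    rewrite lfrac_prod -!big_split; apply: eq_bigr => x _; rewrite lfrac_prod -!big_split //.
  set a := lfrac _; set b := lfrac (wshift _ _); set c := lfrac (\prod_x _).
  by move: (\prod_x \prod_y P1 x y) (\prod_x _) (\prod_x _) => p1 p2 p3; ring.
rewrite (eq_bigr (fun x => \prod_y (duocf B T x y * lfrac (P5 x y)))); last first.
  by move=> x _; apply: eq_bigr => y _; exact: key.
have -> : \prod_x \prod_y (duocf B T x y * lfrac (P5 x y)) = (\prod_x \prod_y duocf B T x y) * lfrac (\prod_x \prod_y P5 x y).
  by rewrite lfrac_prod -big_split; apply: eq_bigr => x _; rewrite lfrac_prod -big_split.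
rewrite !lfracM.
set a := lfrac _; set b := lfrac (wshift _ _); set c := lfrac (\prod_x _).
by move: (\prod_x _) => p; ring.
Qed.

End Duo.

Section DuoN.
Variables (k : comNzRingType) (Q : quiver).
Implicit Types (v m n : dimvec Q).
Local Notation "''W_' v" := 'X_{1..#|widx v|} (at level 8, v at level 2).

Definition duoidx v m n (B T T1 : {set widx v}) :=
  [&& T1 \subset T, isGamma m (B :|: T1) & isGamma n (B :|: (T :\: T1))].

(* The numerator of the coefficient of u^(1_(B + T) + 1_B) in [FMO m f * FMO n g]. *)
Definition duoN v m n (f g : tLam k v) (B T : {set widx v}) : tLam k v :=
  \sum_(T1 | duoidx m n B T T1) restr m (B :|: T1) f *
     wshift (indm (B :|: T1)) (restr n (B :|: (T :\: T1)) g) * duoN1 k T T1.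

Definition duocoef v (B T : {set widx v}) : 'W_v := (indm (B :|: T) + indm B)%MM.

Lemma duocoefE v (B T G H : {set widx v}) : [disjoint B & T] ->
  ((indm G + indm H)%MM == duocoef B T) = [&& B \subset G, G \subset B :|: T & H == B :|: (T :\: (G :\: B))].
Proof.
move=> dBT; apply/eqP/and3P => [/wmnmP e|[BG GT /eqP->]].
  have h x : ((x \in G) + (x \in H) = ((x \in B) || (x \in T)) + (x \in B))%N.
    by have := e x; rewrite !mnmDE !indmE in_setU.
  have dx x : x \in B -> (x \in T) = false by apply: disjointFr.
  split; first by apply/subsetP => x xB; have := h x; rewrite xB dx //; case: (x \in G); case: (x \in H).
    by apply/subsetP => x xG; have := h x; rewrite xG in_setU; case: (x \in B); case: (x \in T); case: (x \in H).
  apply/eqP/setP => x; rewrite !inE; have := h x; have := dx x.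
  by case: (x \in B); case: (x \in T); case: (x \in G); case: (x \in H) => // /(_ isT).
apply/wmnmP => x; rewrite !mnmDE !indmE !inE.
have bg := subsetP BG x; have gt := subsetP GT x; rewrite in_setU in gt.
have dx : x \in B -> (x \in T) = false by apply: disjointFr.
case: (x \in B) dx bg gt => [/(_ isT)-> /(_ isT)-> //|_ _].
by case: (x \in T) => /=; case: (x \in G) => // /(_ isT).
Qed.

Lemma acoef_duoN v m n (f g : tLam k v) (B T : {set widx v}) : [disjoint B & T] ->
  acoef (duocoef B T) (FMO m f * FMO n g) * lfrac (\prod_(x in T) \prod_(y in T) duoq k x y) =
  (\prod_x \prod_y duocf k B T x y) * lfrac (duoN m n f g B T).
Proof.
move=> dBT; rewrite acoef_duo /duoN.
rewrite (reindex_onto (fun T1 : {set widx v} => (B :|: T1, B :|: (T :\: T1))) (fun p => p.1 :\: B)) /=; last first.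
  move=> [G H] /and3P[_ _]; rewrite duocoefE // => /and3P[/= BG GT /eqP->]; congr (_, _).
  by apply/setP => x; rewrite !inE; have := subsetP BG x; case: (x \in B) => // /(_ isT)->.
rewrite (eq_bigl (duoidx m n B T)) => [|T1]; last first.
  rewrite /duoidx duocoefE //=; apply/andP/and3P => [[/and3P[-> ->]]|[sT -> ->]].
    case/and3P=> _ GT _ /eqP e; split=> //; rewrite -e; apply/subsetP => x; rewrite inE => /andP[xB xG].
    by have := subsetP GT _ xG; rewrite inE (negbTE xB).
  have e : (B :|: T1) :\: B = T1.
    apply/setP => x; rewrite !inE; case xB: (x \in B) => //=; symmetry; apply: contraTF xB => x1.
    by rewrite (disjointFl dBT) ?(subsetP sT).
  by rewrite subsetUl setUS //= e eqxx.
rewrite mulr_suml [lfrac (\sum_(_ | _) _)]rmorph_sum mulr_sumr; apply: eq_bigr => T1 /and3P[sT _ _].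
exact: fcoef_duo.
Qed.

Definition duo v : Type := ((dimvec Q * tLam k v) * (dimvec Q * tLam k v))%type.
Definition sduo v (r : seq (duo v)) : Aloc k v := \sum_(d <- r) FMO d.1.1 d.1.2 * FMO d.2.1 d.2.2.
Definition sduoN v (r : seq (duo v)) B T : tLam k v := \sum_(d <- r) duoN d.1.1 d.2.1 d.1.2 d.2.2 B T.

Lemma lreg_duoq v (x y : widx v) : GRing.lreg (duoq k x y).
Proof. by apply: lregM; exact: lreg_wdiff. Qed.

(** Every exponent 1_G + 1_H equals [duocoef B T] for the intersection B and the symmetric
    difference T, and the denominators are regular. *)
Lemma sduo_eq0 v (r : seq (duo v)) : (forall B T : {set widx v}, [disjoint B & T] -> sduoN r B T = 0) -> sduo r = 0.
Proof.
move=> h; apply: acoefP => l; rewrite raddf0.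
have [[[B T] [dBT ->]]|no] := pselect (exists p : {set widx v} * {set widx v}, [disjoint p.1 & p.2] /\ l = duocoef p.1 p.2).
  have rq : GRing.lreg (lfrac (\prod_(x in T) \prod_(y in T) duoq k x y)).
    apply: lreg_frac; apply: big_ind => [||x _]; [exact: lreg1|exact: lregM|].
    by apply: big_ind => [||y _]; [exact: lreg1|exact: lregM|exact: lreg_duoq].
  apply: (lreg_eq0 rq); rewrite mulrC raddf_sum mulr_suml.
  transitivity ((\prod_x \prod_y duocf k B T x y) * lfrac (sduoN r B T)); last by rewrite h // raddf0 mulr0.
  rewrite /sduoN [lfrac (\sum_(_ <- _) _)]rmorph_sum mulr_sumr; apply: eq_bigr => d _.
  exact: acoef_duoN.
rewrite raddf_sum big1 // => d _; rewrite [LHS]acoef_duo big_pred0 // => -[G H] /=.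
apply/negbTE/and3P => -[_ _ /eqP e]; apply: no; exists (G :&: H, (G :\: H) :|: (H :\: G)); split=> /=.
  by apply/pred0P => x /=; rewrite !inE; case: (x \in G); case: (x \in H).
by rewrite -e; apply/wmnmP => x; rewrite !mnmDE !indmE !inE; case: (x \in G); case: (x \in H).
Qed.

Lemma wpermM v (s : {perm widx v}) (a b : tLam k v) : wperm s (a * b) = wperm s a * wperm s b.
Proof. exact: rmorphM. Qed.

Lemma wevM v (d : vtriple v) (a b : tLam k v) : wev d (a * b) = wev d a * wev d b.
Proof. exact: rmorphM. Qed.

Lemma wperm_pairn v (s : {perm widx v}) (x y : widx v) t : Sv s -> wperm s (pairn k x y t) = pairn k (s x) (s y) t.
Proof.
move=> hs; rewrite /pairn rmorph_prod !(Sv_tag _ hs); apply: eq_bigr => e _.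
rewrite !rmorphD !rmorphN rmorphM rmorph_int /= !wperm_wvar wperm_hbar.
by rewrite /theta /hbar2 !wperm_pvar.
Qed.

Lemma wperm_duoq v (s : {perm widx v}) (x y : widx v) : Sv s -> wperm s (duoq k x y) = duoq k (s x) (s y).
Proof. by move=> hs; rewrite /duoq wpermM (wperm_denP k hs (x, y, 0)) (wperm_denP k hs (y, x, -1)). Qed.

Lemma wperm_duoE v (s : {perm widx v}) (x y : widx v) : Sv s -> wperm s (duoE k x y) = duoE k (s x) (s y).
Proof. by move=> hs; rewrite /duoE wpermM !wperm_pairn. Qed.

Lemma wperm_duoN1 v (s : {perm widx v}) (T T1 : {set widx v}) : Sv s ->
  wperm s (duoN1 k T T1) = duoN1 k (s @: T) (s @: T1).
Proof.
move=> hs; have inj (A : {set widx v}) : {in A &, injective s} by move=> ????; apply: perm_inj.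
rewrite /duoN1 [RHS]big_imset // rmorph_prod; apply: eq_bigr => x _.
rewrite [RHS]big_imset // rmorph_prod; apply: eq_bigr => y _; rewrite !imset_perm_mem.
by case: ((x \in T1) && (y \notin T1)); [exact: wperm_duoE|exact: wperm_duoq].
Qed.

Lemma duoN_wperm v m n (f g : tLam k v) (s : {perm widx v}) (B T : {set widx v}) :
  inLam1 m f -> inLam1 n g -> Sv s ->
  wperm s (duoN m n f g B T) = duoN m n f g (s @: B) (s @: T).
Proof.
move=> hf hg hs; rewrite /duoN rmorph_sum [RHS](reindex_inj (imset_inj (@perm_inj _ s))) /=.
apply: eq_big => [T1|T1 /and3P[sT G1 G2]].
  rewrite /duoidx -imset_permD -!imsetU !isGamma_perm //; congr (_ && _).
  apply/subsetP/subsetP => h x; first by case/imsetP => y /h yI ->; rewrite imset_perm_mem.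
  by move=> xG; rewrite -(imset_perm_mem s) h // imset_perm_mem.
rewrite -imset_permD -!imsetU -!restr_wperm // -pmnm_indm -wperm_wshift -wperm_duoN1 //.
by rewrite -!wpermM.
Qed.

(** At least one of (x, y) and (y, x) carries a factor [duoq], which vanishes at w_x = w_y. *)
Lemma duoN_diag v m n (f g : tLam k v) (B T : {set widx v}) x y : x \in T -> y \in T -> tag x = tag y -> x != y ->
  wev (x, y, 0) (duoN m n f g B T) = 0.
Proof.
move=> xT yT txy xy; rewrite rmorph_sum big1 // => T1 _; rewrite [LHS]wevM.
suff -> : wev (x, y, 0) (duoN1 k T T1) = 0 by rewrite mulr0.
have z a b : a \in T -> b \in T -> ~~ ((a \in T1) && (b \notin T1)) ->
   wev (x, y, 0) (wdiff k (a, b, 0)) = 0 -> wev (x, y, 0) (duoN1 k T T1) = 0.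
  move=> am bm /negbTE ab e; rewrite /duoN1 (bigD1 a am) (bigD1 b bm) ab /duoq.
  by rewrite !wevM e !mul0r.
have [/andP[xG yG]|] := boolP ((x \in T1) && (y \notin T1)).
  apply: (z y x) => //; first by rewrite negb_and yG.
  rewrite /wdiff txy eqxx eq_sym xy /= mul0r addr0 rmorphB /=.
  by rewrite !wev_wvar eqxx /= eq_sym (negbTE xy) mul0r subr0 subrr.
by move=> h; apply: (z x y) => //; apply: wev_wdiff; rewrite /wvalid /= txy eqxx.
Qed.

End DuoN.

(** * Specialization of numerators at w_s = w_r + hbar *)

Section DuoEv.
Variables (k : comNzRingType) (Q : quiver) (v : dimvec Q) (r s : widx v).
Hypotheses (trs : tag r = tag s) (rs : r != s).
Implicit Types (m n : dimvec Q).
Local Notation d := (s, r, -1 : int).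
Local Notation ev := (@wev k Q v d).

Lemma wev_pairn x y t : ev (pairn k x y t) = \prod_(e : edge Q | (src e == tag x) && (tgt e == tag y))
  (ev (wvar k y) - ev (wvar k x) + theta k v e - hbar2 k v + t%:~R * hbar k v).
Proof.
rewrite rmorph_prod; apply: eq_bigr => e _.
rewrite !rmorphD !rmorphN rmorphM rmorph_int /= wev_hbar.
by rewrite /theta /hbar2 !wev_inl.
Qed.

Lemma wev_s : ev (wvar k s) = wvar k r + hbar k v.
Proof. by rewrite wev_wvar /= eqxx mulN1r opprK. Qed.

Lemma wev_ns x : x != s -> ev (wvar k x) = wvar k x.
Proof. by move=> xs; rewrite wev_wvar /= (negbTE xs). Qed.

Lemma wev_wdiffE x y (t : int) : tag x = tag y -> x != y -> ev (wdiff k (x, y, t)) = ev (wvar k x) - ev (wvar k y) + t%:~R * hbar k v.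
Proof.
by move=> e xy; rewrite /wdiff e eqxx xy /= rmorphD rmorphB rmorphM rmorph_int /= wev_hbar.
Qed.

Lemma wev_duoq y : y != s -> y != r -> ev (duoq k y s) = ev (duoq k r y).
Proof.
move=> ys yr; rewrite /duoq [in RHS]mulrC !wevM.
have [tys|/eqP tys] := (tag y =P tag s); last first.
  have tsy : (tag s == tag y) = false by rewrite eq_sym (negbTE tys).
  by rewrite /wdiff trs tsy (negbTE tys) /=.
rewrite !wev_wdiffE ?trs // 1?eq_sym // wev_s !wev_ns //.
by congr (_ * _); ring.
Qed.

Lemma wev_duoE y : y != s -> ev (duoE k y s) = ev (duoE k r y).
Proof.
move=> ys; rewrite /duoE [in RHS]mulrC !wevM !wev_pairn trs wev_s !wev_ns //.
by congr (_ * _); apply: eq_bigr => e _; ring.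
Qed.

(** The shift turns w_r into w_r + hbar, the very value given to w_s, so the exchange of r and s
    becomes invisible. *)
Lemma wev_wshift_tperm (G : {set widx v}) (F : tLam k v) : r \in G -> s \notin G ->
  ev (wshift (indm G) (wperm (tperm r s) F)) = ev (wshift (indm G) F).
Proof.
move=> rG sG.
pose f1 : {rmorphism tLam k v -> tLam k v} := ev \o (wshift (indm G) \o wperm (tperm r s)).
pose f2 : {rmorphism tLam k v -> tLam k v} := ev \o wshift (indm G).
have wvE x : ev (wshift (indm G) (wvar k x)) = ev (wvar k x) + (x \in G)%:R * hbar k v.
  by rewrite wshift_wvar indmE rmorphD rmorphM rmorph_nat /= wev_hbar.
apply: (@psubst_ext _ _ _ _ f1 f2) => [c|[b|x]].
- by rewrite /f1 /f2 /= [wperm _ _]wsubst_const.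
- by rewrite /f1 /f2 /= wperm_pvar.
rewrite /f1 /f2 /= wperm_pvar -/(wvar k _) !wvE.
by case: tpermP => [->|->|//]; rewrite wev_s (wev_ns rs) (negbTE sG) rG /= mulr0n mulr1n mul0r mul1r addr0.
Qed.

Section Rel.
Variables (T : {set widx v}) (rT : r \in T) (sT : s \in T).
Local Notation T' := (T :\ r :\ s).

(** After the specialization, the pairs meeting r or s have the same total contribution for all T1;
    this is one expression for it. *)
Definition duoK : tLam k v := duoE k r s * duoq k s r *
  \prod_(y in T') (duoE k r y * duoq k y r * duoq k s y * duoq k y s).

Lemma duoq_diag x : duoq k x x = 1 :> tLam k v.
Proof. by rewrite /duoq /wdiff !eqxx /= mulr1. Qed.

Lemma wev_duoN1 (T1 : {set widx v}) : T1 \subset T' ->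
  ev (duoN1 k T (r |: T1)) = ev (duoK * duoN1 k T' T1).
Proof.
move=> T1T.
have nin x : x \in T1 -> (x != r) && (x != s).
  by move/(subsetP T1T); rewrite !inE => /and3P[-> ->].
have r1 : r \notin T1 by apply/negP => /nin; rewrite eqxx.
have s1 : s \notin T1 by apply/negP => /nin; rewrite eqxx andbF.
pose c x y := if (x \in r |: T1) && (y \notin r |: T1) then duoE k x y else duoq k x y.
have crr : c r r = 1 by rewrite /c setU11 duoq_diag.
have css : c s s = 1 by rewrite /c !inE eq_sym (negbTE rs) (negbTE s1) duoq_diag.
have crs : c r s = duoE k r s by rewrite /c setU11 !inE eq_sym (negbTE rs) (negbTE s1).
have csr : c s r = duoq k s r by rewrite /c !inE eq_sym (negbTE rs) (negbTE s1).
have sT' : s \in T :\ r by rewrite !inE eq_sym rs.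
have split1 (F : widx v -> tLam k v) : \prod_(x in T) F x = F r * F s * \prod_(x in T') F x.
  by rewrite (big_setD1 r rT) (big_setD1 s sT') /= mulrA.
have -> : duoN1 k T (r |: T1) = duoE k r s * duoq k s r *
   (\prod_(y in T') (c r y * c s y * (c y r * c y s))) * \prod_(x in T') \prod_(y in T') c x y.
  transitivity (\prod_(x in T) \prod_(y in T) c x y); first by [].
  rewrite split1 !split1 crr css crs csr.
  under [X in _ * X]eq_bigr => x _ do rewrite split1.
  rewrite !big_split /=.
  move: (\prod_(x in T') \prod_(y in T') c x y) (\prod_(x in T') c r x) (\prod_(x in T') c s x) (\prod_(x in T') c x r) (\prod_(x in T') c x s).
  move: (duoE k r s) (duoq k s r) => a b p p1 p2 p3 p4; rewrite mul1r mulr1; ring.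
have -> : \prod_(x in T') \prod_(y in T') c x y = duoN1 k T' T1.
  have cin x : x \in T' -> (x \in r |: T1) = (x \in T1) by rewrite !inE => /and3P[_ /negbTE->].
  by apply: eq_bigr => x xT; apply: eq_bigr => y yT; rewrite /c !cin.
have wprod (F : widx v -> tLam k v) : ev (\prod_(y in T') F y) = \prod_(y in T') ev (F y) by apply: rmorph_prod.
rewrite /duoK; move: (duoE k r s * duoq k s r) (duoN1 k T' T1) => A N.
have eM p : ev (A * p * N) = ev A * ev p * ev N by rewrite !wevM.
rewrite !eM !wprod; apply: (congr1 (fun p => ev A * p * ev N)); apply: eq_bigr => y.
rewrite !inE => /and3P[ys yr _].
have e4 a b e f : ev (a * b * (e * f)) = ev a * ev b * (ev e * ev f) by rewrite !wevM.
have e4' a b e f : ev (a * b * e * f) = ev a * ev b * ev e * ev f by rewrite !wevM.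
have sr : (s \in r |: T1) = false by rewrite !inE eq_sym (negbTE rs) (negbTE s1).
have yr1 : (y \in r |: T1) = (y \in T1) by rewrite !inE (negbTE yr).
rewrite e4 e4' /c sr yr1 setU11 andbT !andbF; case: (y \in T1); rewrite [true && _]/= [false && _]/=.
  by rewrite (wev_duoE ys) (wev_duoq ys yr); move: (ev _) (ev _) (ev _) (ev _) => a b e f; ring.
by rewrite (wev_duoq ys yr); move: (ev _) (ev _) (ev _) (ev _) => a b e f; ring.
Qed.

Lemma wev_duoN1_eq0 (T1 : {set widx v}) : ~~ ((r \in T1) && (s \notin T1)) -> ev (duoN1 k T T1) = 0.
Proof.
move=> h; rewrite /duoN1 (bigD1 r rT) (bigD1 s sT) (negbTE h) /duoq !wevM.
rewrite [X in _ * X * _ * _](_ : _ = 0) ?(mulr0, mul0r) //.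
by apply: wev_wdiff; rewrite /wvalid /= -trs eqxx eq_sym rs.
Qed.

(* At w_s = w_r + hbar only the terms with r in T1 and s notin T1 survive; they match
   those of the numerator for (B + r, T - {r, s}). *)
Lemma wev_duoN m n (f g : tLam k v) (B : {set widx v}) : [disjoint B & T] -> inLam1 m f -> inLam1 n g ->
  ev (duoN m n f g B T) = ev (duoK * duoN m n f g (r |: B) T').
Proof.
move=> dBT hf hg.
have rB : (r \in B) = false := disjointFl dBT rT.
have sB : (s \in B) = false := disjointFl dBT sT.
rewrite wevM /duoN [ev (\sum_(_ | _) _)]rmorph_sum [X in _ = _ * X]rmorph_sum mulr_sumr /=.
rewrite (bigID (fun T1 : {set widx v} => (r \in T1) && (s \notin T1))) /= [X in _ + X]big1 ?addr0; last first.
  by move=> T1 /andP[_ h]; rewrite wevM wev_duoN1_eq0 // mulr0.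
rewrite (reindex_onto (fun T1 : {set widx v} => r |: T1) (fun T1 => T1 :\ r)) /=; last first.
  by move=> T1 /andP[_ /andP[r1 _]]; rewrite setD1K.
have Beq (T1 : {set widx v}) : B :|: (r |: T1) = (r |: B) :|: T1.
  by rewrite setUCA setUA.
(* The second subset contains s but not r; it is the subset for (B + r, T - {r, s}) with r and s
   exchanged, which the specialization does not see. *)
have Heq (T1 : {set widx v}) : T1 \subset T' -> B :|: (T :\: (r |: T1)) = tperm r s @: ((r |: B) :|: (T' :\: T1)).
  move=> T1T; apply/setP => x.
  rewrite -[in RHS](tpermK r s x) imset_perm_mem !inE.
  have s1 : s \notin T1 by apply/negP => /(subsetP T1T); rewrite !inE eqxx.
  have r1 : r \notin T1 by apply/negP => /(subsetP T1T); rewrite !inE eqxx andbF.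
  have sr : (s == r) = false by rewrite eq_sym (negbTE rs).
  by case: tpermP => [->|->|/eqP/negbTE-> /eqP/negbTE->] //;
    rewrite ?sr ?eqxx ?(negbTE rs) ?rB ?sB ?(negbTE s1) ?sT ?(negbTE r1) ?eqxx ?andbF.
have sub (T1 : {set widx v}) : r |: T1 \subset T -> s \notin r |: T1 -> (r |: T1) :\ r = T1 -> T1 \subset T'.
  move=> uT s1 r1; apply/subsetP => x x1; rewrite !inE; have xT : x \in T by apply: (subsetP uT); rewrite inE x1 orbT.
  rewrite xT andbT; apply/andP; split; first by apply: contraNneq s1 => <-; rewrite inE x1 orbT.
  by move: x1; rewrite -r1 !inE => /andP[].
apply: eq_big => [T1|T1 /andP[/andP[/and3P[uT G1 G2] /andP[_ s1]] /eqP r1]].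
  rewrite /duoidx Beq; apply/idP/and3P => [/andP[/andP[/and3P[uT G1 G2] /andP[_ s1]] /eqP r1]|[T1T G1 G2]].
    have T1T := sub _ uT s1 r1.
    by split=> //; move: G2; rewrite Heq // isGamma_perm //; apply: Sv_tperm.
  have s1 : s \notin T1 by apply/negP => /(subsetP T1T); rewrite !inE eqxx.
  have r1 : r \notin T1 by apply/negP => /(subsetP T1T); rewrite !inE eqxx andbF.
  rewrite G1 Heq // isGamma_perm ?G2 ?andbT; last exact: Sv_tperm.
  rewrite setU11 !inE eq_sym (negbTE rs) (negbTE s1) /= ?andbT; apply/andP; split.
    rewrite subUset sub1set rT /=; apply: subset_trans T1T _.
    by apply/subsetP => x; rewrite !inE => /and3P[].
  by apply/eqP/setP => x; rewrite !inE; case: (x =P r) => //= ->; rewrite (negbTE r1).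
have T1T := sub _ uT s1 r1; move: G1 G2; rewrite Beq Heq // => G1.
rewrite isGamma_perm => [G2|]; last exact: Sv_tperm.
have e3 a b e : ev (a * b * e) = ev a * ev b * ev e by rewrite !wevM.
rewrite -(restr_wperm hg G2); last exact: Sv_tperm.
apply: etrans (e3 _ _ _) _; rewrite wev_duoN1 // wevM wev_wshift_tperm; last first.
- by move: s1; rewrite !inE sB => /norP[/negbTE-> /negbTE->].
- by rewrite !inE eqxx.
apply: etrans (_ : _ = ev duoK * (ev (restr m (r |: B :|: T1) f) * ev (wshift (indm (r |: B :|: T1)) (restr n (r |: B :|: (T' :\: T1)) g)) * ev (duoN1 k T' T1))) _; last first.
  by congr (_ * _); apply: esym; apply: e3.
exact: mulrCA.
Qed.

End Rel.
End DuoEv.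

Section DuoBound.
Variables (k : comNzRingType) (Q : quiver).
Implicit Types (v m n : dimvec Q).

Lemma tdeg_wshift v D a (f : tLam k v) : tdeg D f -> tdeg D (wshift a f).
Proof.
apply: wbound_psubst => -[z|x]; first exact: wbound_pvar.
apply: wboundD; first exact: wbound_pvar.
rewrite -[1%N]add0n; apply: wboundM; first exact: wbound_nat.
by rewrite -[1%N]add0n; apply: wboundM; [exact: wbound_nat|exact: wbound_pvar].
Qed.

Lemma tdeg_pairn v (x y : widx v) t : tdeg #|edge Q| (pairn k x y t).
Proof.
apply: wbound_le (_ : wbound _ (\sum_(e : edge Q | (src e == tag x) && (tgt e == tag y)) 1) _).
  by rewrite sum1_card max_card.
apply: wbound_prod => e _; apply: wboundD.
  by apply: wboundB; [apply: wboundD; [apply: wboundB|]|]; apply: wbound_pvar.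
rewrite -[1%N]add0n; apply: wboundM; first exact: wbound_int.
by rewrite -[1%N]add0n; apply: wboundM; [exact: wbound_nat|exact: wbound_pvar].
Qed.

Definition duoC c := (c * (c * (2 * #|edge Q| + 2)))%N.

Lemma tdeg_duoN1 v c (T T1 : {set widx v}) : (#|T| <= c)%N -> tdeg (duoC c) (duoN1 k T T1).
Proof.
move=> Tc; apply: wbound_le (_ : wbound _ (\sum_(x in T) \sum_(y in T) (2 * #|edge Q| + 2)) _).
  by rewrite !sum_nat_const /duoC leq_mul // leq_mul.
apply: wbound_prod => x _; apply: wbound_prod => y _.
case: ((x \in T1) && (y \notin T1)).
  by apply: wbound_le (leq_addr _ _) _; rewrite mul2n -addnn; apply: wboundM; exact: tdeg_pairn.
by apply: wbound_le (leq_addl _ _) _; apply: (wboundM (n := 1) (n' := 1)); exact: tdeg_wdiff.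
Qed.

Lemma tdeg_duoN v D c m n (f g : tLam k v) (B T : {set widx v}) : (#|T| <= c)%N -> tdeg D f -> tdeg D g ->
  tdeg (D + D + duoC c) (duoN m n f g B T).
Proof.
move=> Tc hf hg; apply: wbound_sum => T1 _; apply: wboundM; last exact: tdeg_duoN1.
by apply: wboundM; [exact: tdeg_wperm|apply: tdeg_wshift; exact: tdeg_wperm].
Qed.

Definition ddisc v (T : {set widx v}) : tLam k v := \prod_(x in T) \prod_(y in T) duoq k x y.

Lemma lreg_ddisc v (T : {set widx v}) : GRing.lreg (ddisc T).
Proof.
apply: big_ind => [||x _]; [exact: lreg1|exact: lregM|].
by apply: big_ind => [||y _]; [exact: lreg1|exact: lregM|exact: lreg_duoq].
Qed.

Lemma ddisc_wperm v (s : {perm widx v}) (T : {set widx v}) : Sv s -> wperm s (ddisc T) = ddisc (s @: T).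
Proof.
move=> hs; have e (A : {set widx v}) : ddisc A = duoN1 k A A.
  by apply: eq_bigr => x xA; apply: eq_bigr => y yA; rewrite xA yA.
by rewrite !e wperm_duoN1.
Qed.

(** H contains B and has |n| elements, so H = B and T1 = T: at most one term remains. *)
Lemma duoN_top v m n (f g : tLam k v) (B T : {set widx v}) : [disjoint B & T] -> (dsize n <= #|B|)%N ->
  duoN m n f g B T = if isGamma m (B :|: T) && isGamma n B then
    restr m (B :|: T) f * wshift (indm (B :|: T)) (restr n B g) * ddisc T else 0.
Proof.
move=> dBT nB; have key T1 : duoidx m n B T T1 = (T1 == T) && (isGamma m (B :|: T) && isGamma n B).
  rewrite /duoidx; apply/and3P/andP => [[sT G1 G2]|[/eqP-> /andP[-> G2]]]; last by rewrite setDv setU0 subxx.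
  suff e : T1 = T by move: G1 G2; rewrite e setDv setU0 eqxx => -> ->.
  have [_ dB] := leq_card_setU B (T :\: T1).
  have d1 : [disjoint B & T :\: T1] by apply: disjointWr dBT; apply: subsetDl.
  have cE : #|B :|: (T :\: T1)| = (#|B| + #|T :\: T1|)%N by apply/eqP; rewrite dB.
  have := isGamma_card G2; rewrite cE => e; apply/eqP; rewrite eqEsubset sT -setD_eq0 -cards_eq0 /=.
  by rewrite -leqn0 -(leq_add2l #|B|) e addn0.
rewrite /duoN (eq_bigl _ _ key); case: ifP => h; last by rewrite big_pred0 // => T1; rewrite andbF.
rewrite (eq_bigl (pred1 T)) => [|T1]; last by rewrite andbT.
rewrite big_pred1_eq setDv setU0; congr (_ * _).
by apply: eq_bigr => x xA; apply: eq_bigr => y yA; rewrite xA yA.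
Qed.

Lemma duo_transport v m n (B T : {set widx v}) : dimvec_le n m -> [disjoint B & T] ->
  isGamma m (B :|: T) -> isGamma n B ->
  exists s : {perm widx v}, [/\ Sv s, s @: initial v n = B & s @: (initial v m :\: initial v n) = T].
Proof.
move=> nm dBT Gm Gn; have mv := isGamma_le Gm.
have [s1 [hs1 s1m]] := isGamma_exists (isGamma_initial mv) Gm.
have i1 (A : {set widx v}) : s1 @: (s1^-1%g @: A) = A.
  by rewrite -imset_comp (eq_imset _ (g := id)) ?imset_id // => x /=; rewrite permKV.
have sub : isSub n m (s1^-1%g @: B).
  rewrite /isSub isGamma_perm ?Gn ?andbT; last exact: SvV.
  apply/subsetP => x /imsetP[y yB ->]; rewrite -(imset_perm_mem s1) permKV s1m inE yB //.
have [t [ft tn]] := isSub_exists nm mv sub; have tm := fixout_initial ft; have [ht _] := ft.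
have eA (A : {set widx v}) : (t * s1)%g @: A = s1 @: (t @: A) by rewrite -imset_comp; apply: eq_imset => x; rewrite permM.
exists (t * s1)%g; rewrite imset_permD !eA tn tm s1m i1; split=> //; first exact: SvM.
apply/setP => x; rewrite !inE; case xB: (x \in B) => //=; symmetry; exact: disjointFr dBT xB.
Qed.

End DuoBound.

Section DuoDiv.
Variables (Q : quiver).
Implicit Types (v m n : dimvec Q).

Definition lamduo (k : comNzRingType) v (d : duo k v) := inLam1 d.1.1 d.1.2 /\ inLam1 d.2.1 d.2.2.

Lemma sduoN_wperm (k : comNzRingType) v (r : seq (duo k v)) (s : {perm widx v}) (B T : {set widx v}) :
  (forall d, d \in r -> lamduo d) -> Sv s -> wperm s (sduoN r B T) = sduoN r (s @: B) (s @: T).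
Proof.
move=> hr hs; rewrite /sduoN rmorph_sum big_seq [RHS]big_seq; apply: eq_bigr => d /hr[h1 h2].
exact: duoN_wperm.
Qed.

Lemma wev_cancel v (d : vtriple v) (N D p : tLam int v) : N = D * p -> wev d N = 0 -> wev d D <> 0 -> wev d p = 0.
Proof.
move=> NE e h; have e2 : wev d D * wev d p = 0 by rewrite -(wevM d D p) -NE.
case: (tLam_mul0 e2) => e3; [case: (h e3)|exact: e3].
Qed.

Lemma sduoN_wev v (r : seq (duo int v)) (B T : {set widx v}) x y : (forall d, d \in r -> lamduo d) ->
  [disjoint B & T] -> x \in T -> y \in T -> tag x = tag y -> x != y -> sduoN r (x |: B) (T :\ x :\ y) = 0 ->
  wev (y, x, -1 : int) (sduoN r B T) = 0.
Proof.
move=> hr dBT xT yT txy xy h0.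
transitivity (wev (y, x, -1 : int) (duoK int x y T * sduoN r (x |: B) (T :\ x :\ y))); last by rewrite h0 mulr0 rmorph0.
rewrite /sduoN mulr_sumr [LHS]rmorph_sum [RHS]rmorph_sum big_seq [RHS]big_seq; apply: eq_bigr => d' /hr[h1 h2].
exact: wev_duoN.
Qed.

(** There are two kinds of factors in [ddisc]. The w_x - w_y divide by symmetry and vanishing on the
    diagonals; the w_y - w_x - hbar divide because there the numerator becomes a multiple of the one
    for (B + x, T - {x, y}). No two factors of different kinds are associated. *)
Lemma sduoN_div v (r : seq (duo int v)) (B T : {set widx v}) : (forall d, d \in r -> lamduo d) ->
  [disjoint B & T] ->
  (forall x y, x \in T -> y \in T -> tag x = tag y -> x != y -> sduoN r (x |: B) (T :\ x :\ y) = 0) ->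
  exists h, sduoN r B T = ddisc int T * h.
Proof.
move=> hr dBT h0.
have [||p' e] := @diag_product Q v T (sduoN r B T).
- move=> x y xT yT txy xy; rewrite /sduoN rmorph_sum big1 // => d _; exact: duoN_diag.
- move=> x y xT yT txy xy; rewrite sduoN_wperm //; last exact: Sv_tperm.
  have fx (A : {set widx v}) : (x \in A) = (y \in A) -> tperm x y @: A = A.
    move=> xyA; apply/setP => z; rewrite -[in LHS](tpermK x y z) imset_perm_mem.
    by case: tpermP => [->|->|].
  by rewrite !fx // ?xT ?yT // (disjointFl dBT xT) (disjointFl dBT yT).
pose V := [set p : widx v * widx v | [&& p.1 \in T, p.2 \in T, tag p.1 == tag p.2 & p.1 != p.2]].
pose f (p : widx v * widx v) : vtriple v := (p.2, p.1, -1).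
have finj : injective f by move=> [a b] [c d] [-> ->].
have fV p : p \in V -> wvalid (f p).
  by rewrite inE => /and4P[_ _ t n]; rewrite /wvalid /= eq_sym t eq_sym.
have [|||| q eq] := @coprime_product Q v [seq f p | p <- enum V] p'.
- by rewrite map_inj_uniq // enum_uniq.
- by move=> d /mapP[p]; rewrite mem_enum => /fV h ->.
- by move=> d d' /mapP[p _ ->] /mapP[p2 _ ->] ne; rewrite /unassoc eq_sym ne /= !xpair_eqE andbF.
- move=> d /mapP[[x y]]; rewrite mem_enum => hp ->.
  have := hp; rewrite inE => /and4P[/= xT yT /eqP txy xy].
  apply: (wev_cancel e).
    by apply: sduoN_wev => //; apply: h0.
  rewrite rmorph_prod.
  apply: (big_ind (fun p : tLam int v => p <> 0)) => [|a b a0 b0 /tLam_mul0[]//|a _]; first exact/eqP/oner_neq0.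
  rewrite rmorph_prod; apply: (big_ind (fun p : tLam int v => p <> 0)) => [|a' b a0 b0 /tLam_mul0[]//|b _]; first exact/eqP/oner_neq0.
  have [ab|ab] := boolP (wvalid (a, b, 0 : int)); first exact: wev_neq0 (fV _ hp) ab _ _.
  move: ab; rewrite /wvalid /wdiff [(a, b, 0).1.1]/= [(a, b, 0).1.2]/= => /negbTE->; rewrite rmorph1; exact/eqP/oner_neq0.
exists q; rewrite e eq mulrA; congr (_ * _); rewrite big_map big_enum /ddisc /=.
transitivity ((\prod_(x in T) \prod_(y in T) wdiff int (x, y, 0)) * \prod_(x in T) \prod_(y in T) wdiff int (y, x, -1)).
  congr (_ * _); rewrite prod_in2 pair_big big_mkcond; apply: eq_bigr => -[x y] _.
  rewrite /V inE [(x, y).1]/= [(x, y).2]/=; case: (x \in T) => //=; case: (y \in T) => //=.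
  by rewrite [tag y == tag x]eq_sym [y == x]eq_sym; case: ((tag x == tag y) && (x != y)).
by rewrite -big_split; apply: eq_bigr => x _; rewrite -big_split.
Qed.

End DuoDiv.

Section ZZ.
Variables (k : comNzRingType) (Q : quiver).
Implicit Types (v m n p : dimvec Q).

Lemma sduo_cat v (r r' : seq (duo k v)) : sduo (r ++ r') = sduo r + sduo r'.
Proof. exact: big_cat. Qed.

Lemma sduoN_cat v (r r' : seq (duo k v)) B T : sduoN (r ++ r') B T = sduoN r B T + sduoN r' B T.
Proof. exact: big_cat. Qed.

Definition negd v (d : duo k v) : duo k v := ((d.1.1, - d.1.2), d.2).

Lemma sduo_neg v (r : seq (duo k v)) : sduo (map (@negd v) r) = - sduo r.
Proof. by rewrite /sduo big_map -sumrN; apply: eq_bigr => d _; rewrite /= FMON mulNr. Qed.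

Lemma restrN v m (G : {set widx v}) (f : tLam k v) : restr m G (- f) = - restr m G f.
Proof. exact: rmorphN. Qed.

Lemma sduoN_neg v (r : seq (duo k v)) B T : sduoN (map (@negd v) r) B T = - sduoN r B T.
Proof.
rewrite /sduoN big_map -sumrN; apply: eq_bigr => d _; rewrite /duoN -sumrN; apply: eq_bigr => T1 _.
by rewrite /= restrN !mulNr.
Qed.

Lemma lamduo_neg v (d : duo k v) : lamduo d -> lamduo (negd d).
Proof. by case=> h1 h2; split=> //; apply: inLam1N. Qed.

Lemma restr_initial v m (f : tLam k v) : dimvec_le m v -> inLam1 m f -> restr m (initial v m) f = f.
Proof.
move=> mv hf; have i1 : (1%g : {perm widx v}) @: initial v m = initial v m by rewrite (eq_imset _ (@perm1 _)) imset_id.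
by rewrite (restrE hf _ i1) ?wperm1 //; apply/forallP => x; rewrite perm1.
Qed.

Section Zz.
Variables (v n m : dimvec Q) (nm : dimvec_le n m) (mv : dimvec_le m v) (h : tLam k v).
Hypothesis hh : labinv (lab2 n m) h.

(** Products designed to have a prescribed leading numerator h. The second letters use t = 1, so
    that the shift by the first letter brings them to t = 0. *)
Definition theta_duos : seq (duo k v) :=
  [seq ((m, theta_part m l h), (n, beta_mon k v 1 l)) | l : 'X_{1..#|beta_idx n| < gamma_size m}].

Lemma theta_duos_sum (V : zmodType) (F : duo k v -> V) : \sum_(d <- theta_duos) F d =
  \sum_(l : 'X_{1..#|beta_idx n| < gamma_size m}) F ((m, theta_part m l h), (n, beta_mon k v 1 l)).
Proof. by rewrite /theta_duos big_map big_enum. Qed.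

Lemma theta_duos_mem d : d \in theta_duos -> exists l : 'X_{1..#|beta_idx n| < gamma_size m}, d = ((m, theta_part m l h), (n, beta_mon k v 1 l)).
Proof. by case/mapP => l _ ->; exists l. Qed.

Lemma theta_duos_lam d : d \in theta_duos -> lamduo d.
Proof. by case/theta_duos_mem => l ->; split; [exact: theta_part_lam1|exact: beta_mon_lam1]. Qed.

Lemma theta_duos_N0 (B T : {set widx v}) : [disjoint B & T] -> (dsize n <= #|B|)%N ->
  ~~ (isGamma m (B :|: T) && isGamma n B) -> sduoN theta_duos B T = 0.
Proof.
move=> dBT nB /negbTE no; rewrite /sduoN theta_duos_sum big1 // => l _ /=.
by rewrite duoN_top // no.
Qed.

Lemma initial_disj : [disjoint initial v n & initial v m :\: initial v n].
Proof. by apply/pred0P => x /=; rewrite in_setD; case: (x \in initial v n). Qed.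

Lemma initial_join : initial v n :|: (initial v m :\: initial v n) = initial v m.
Proof.
apply/setP => x; have := subsetP (initial_sub nm v) x; rewrite !in_setU !in_setD.
by case: (x \in initial v n) => // /(_ isT)->.
Qed.

(** With B the n-block each numerator has a single term, and after the shift the sum over l is the
    decomposition of h. *)
Lemma theta_duos_initial : sduoN theta_duos (initial v n) (initial v m :\: initial v n) = ddisc k (initial v m :\: initial v n) * h.
Proof.
have nv := dimvec_trans nm mv.
rewrite /sduoN theta_duos_sum -[in RHS](theta_part_sum nm mv hh) mulr_sumr; apply: eq_bigr => l _ /=.
rewrite duoN_top; [|exact: initial_disj|by rewrite (isGamma_card (isGamma_initial nv))].
rewrite initial_join !isGamma_initial //= !restr_initial //; [|exact: beta_mon_lam1|exact: theta_part_lam1].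
by rewrite (beta_mon_wshift nm) mulrC.
Qed.

End Zz.
End ZZ.

(** * Reduction of sums of products of two operators *)

Section Reduce.
Variable (Q : quiver).
Implicit Types (v m n p kp : dimvec Q).

Definition dsub kp p : dimvec Q := [ffun i => (kp i - p i)%N].

Definition gduo (k : comNzRingType) kp D v (d : duo k v) :=
  [/\ forall i, (d.1.1 i + d.2.1 i = kp i)%N, lamduo d, tdeg D d.1.2 & tdeg D d.2.2].

Lemma gduo_le (k : comNzRingType) kp D D' v (d : duo k v) : (D <= D')%N -> gduo kp D d -> gduo kp D' d.
Proof. by move=> le [h1 h2 h3 h4]; split=> //; apply: wbound_le le _. Qed.

Lemma gduo_neg (k : comNzRingType) kp D v (d : duo k v) : gduo kp D d -> gduo kp D (negd d).
Proof. by case=> h1 h2 h3 h4; split=> //; [exact: lamduo_neg|exact: wboundN]. Qed.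

Definition ctag v (U : {set widx v}) i := #|[set x in U | tag x == i]|.

Lemma ctagU v (U V : {set widx v}) i : [disjoint U & V] -> ctag (U :|: V) i = (ctag U i + ctag V i)%N.
Proof.
move=> dUV; rewrite /ctag (_ : [set x in _ | _] = [set x in U | tag x == i] :|: [set x in V | tag x == i]); last first.
  by apply/setP => x; rewrite !inE andb_orl.
have [_ dd] := leq_card_setU [set x in U | tag x == i] [set x in V | tag x == i].
apply/eqP; rewrite dd.
apply/pred0P => x /=; rewrite !inE; case xU: (x \in U) => //=.
by rewrite (disjointFr dUV xU) andbF.
Qed.

Lemma isGammaE v m (U : {set widx v}) : isGamma m U <-> forall i, ctag U i = m i.
Proof. by split=> [/forallP h i|h]; [exact/eqP/h|apply/forallP => i; rewrite [#|_|]h]. Qed.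

Lemma duoidx_dim v m n kp (B T T1 : {set widx v}) : [disjoint B & T] ->
  (forall i, m i + n i = kp i)%N -> duoidx m n B T T1 ->
  forall i, (ctag B i + ctag (B :|: T) i = kp i)%N.
Proof.
move=> dBT mn /and3P[sT /isGammaE G1 /isGammaE G2] i; rewrite -mn -G1 -G2.
have TE : T = T1 :|: (T :\: T1).
  by apply/setP => x; have := subsetP sT x; rewrite !inE; case: (x \in T1) => //= ->.
have d0 : [disjoint T1 & T :\: T1].
  by apply/pred0P => x /=; rewrite !inE; case: (x \in T1).
have d1 : [disjoint B & T1] by apply: disjointWr dBT.
have d2 : [disjoint B & T :\: T1] by apply: disjointWr dBT; apply: subsetDl.
have eT : ctag T i = (ctag T1 i + ctag (T :\: T1) i)%N by rewrite {1}TE ctagU.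
by rewrite !ctagU // eT; lia.
Qed.

Lemma theta_duos_gduo (k : comNzRingType) kp p v D (h : tLam k v) : dimvec_le p (dsub kp p) -> dimvec_le kp v ->
  labinv (lab2 p (dsub kp p)) h -> tdeg D h ->
  forall d, d \in theta_duos p (dsub kp p) h ->
   gduo kp (D + (3 * (dsize kp).+1 * (dsize kp).+1)) d /\ d.2.1 = p.
Proof.
move=> nm kv hh dh d dz; have mv : dimvec_le (dsub kp p) v.
  by apply/forallP => i; rewrite ffunE (leq_trans (leq_subr _ _)) // (forallP kv).
have pk i : (p i <= kp i)%N by have := forallP nm i; rewrite ffunE; lia.
have s1 : (dsize p <= dsize kp)%N by apply: leq_sum => i _; apply: pk.
have s2 : (dsize (dsub kp p) <= dsize kp)%N by apply: leq_sum => i _; rewrite ffunE leq_subr.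
have := theta_duos_lam nm mv hh dz; have [l ->] := theta_duos_mem dz => ld; split=> //=; split=> /=.
- by move=> i; rewrite ffunE subnK.
- exact: ld.
- have dt : tdeg (D + theta_deg p (dsub kp p)) (theta_part (dsub kp p) l h) by apply: (tdeg_theta_part nm).
  apply: (wbound_le _ dt).
  rewrite /theta_deg /van_size /gamma_size leq_add2l; move: (dsize p) (dsize (dsub kp p)) (dsize kp) s1 s2 => a b c s1 s2.
  apply: (@leq_trans (c.+1 * c.+1 + c * c)); first by rewrite leq_add // leq_mul.
  nia.
have dt : tdeg (dsize p * gamma_size (dsub kp p)) (beta_mon k v 1 l) by apply: tdeg_beta_mon.
apply: (wbound_le _ dt).
rewrite /gamma_size; move: (dsize p) (dsize (dsub kp p)) (dsize kp) s1 s2 => a b c s1 s2.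
apply: (@leq_trans (c * c.+1)); first by rewrite leq_mul.
nia.
Qed.

(* If the numerators with |B| > s vanish, those with |B| = s are divisible by
   [ddisc T], and subtracting the products [theta_duos] built on the quotients kills
   them too. *)
Lemma duo_reduce s : forall kp D, exists D', forall v (r : seq (duo int v)), dimvec_le kp v ->
  (forall d, d \in r -> gduo kp D d) ->
  (forall B T : {set widx v}, [disjoint B & T] -> (s <= #|B|)%N -> sduoN r B T = 0) ->
  exists r' : seq (duo int v), (forall d, d \in r' -> gduo kp D' d /\ (dsize d.2.1 < s)%N) /\ sduo r = sduo r'.
Proof.
elim: s => [|s IH] kp D.
  by exists 0%N => v r _ _ h0; exists [::]; split=> //; rewrite sduo_eq0 /sduo ?big_nil // => B T dBT; apply: h0.
(* [D1] bounds the numerators and [D2] the operators built on their quotients; both are fixed before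
   v is introduced. *)
pose c := dsize kp; pose D1 := (D + D + duoC Q c)%N; pose D2 := (D1 + 3 * c.+1 * c.+1)%N.
have [D3 hD3] := IH kp (D2 + D)%N.
exists (D2 + D3)%N => v r kv hr h0.
(* A finite index set for the possible dimensions p of the second letter, whose entries are at most
   |kp|. *)
pose P : finType := {ffun vert Q -> 'I_c.+1}.
pose dv (p : P) : dimvec Q := [ffun i => nat_of_ord (p i)].
have dv_inj : injective dv.
  by move=> p q /ffunP e; apply/ffunP => i; apply: val_inj; have := e i; rewrite !ffunE.
pose cond (p : P) := (dsize (dv p) == s) && dimvec_le (dv p) (dsub kp (dv p)).
pose B0 (p : P) := initial v (dv p); pose T0 (p : P) := initial v (dsub kp (dv p)) :\: initial v (dv p).
have hl d : d \in r -> lamduo d by move=> /hr[].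
have subv p : dimvec_le (dsub kp p) v.
  by apply/forallP => i; rewrite ffunE (leq_trans (leq_subr _ _)) // (forallP kv).
have cB (p : P) : cond p -> #|B0 p| = s.
  move=> /andP[/eqP <- nm]; rewrite (isGamma_card (isGamma_initial (dimvec_trans nm (subv _)))) //.
have /choice[h hh] (p : P) : exists h, cond p -> sduoN r (B0 p) (T0 p) = ddisc int (T0 p) * h.
  have [cp|_] := boolP (cond p); last by exists 0.
  have [x y xT yT txy xy|h e] := sduoN_div hl (@initial_disj Q v (dv p) (dsub kp (dv p))); last by exists h => _; exact: e.
  have xB : x \notin B0 p by move: xT; rewrite in_setD => /andP[].
  apply: h0; last by rewrite cardsU1 xB cB.
  apply/pred0P => z /=; rewrite !inE; case: (z =P x) => //= _; rewrite ?andbF //.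
  by case: (wpos z < _)%N; rewrite ?andbF.
have cT (p : P) : cond p -> (#|T0 p| <= c)%N.
  move=> _; apply: dsize_card; apply/subsetP => x; rewrite !inE => /andP[_ lt].
  by apply: leq_trans lt _; rewrite ffunE leq_subr.
have dN (p : P) : cond p -> tdeg D1 (sduoN r (B0 p) (T0 p)).
  move=> cp; rewrite /sduoN big_seq; apply: wbound_sum => d /hr[_ _ h1 h2].
  exact: tdeg_duoN (cT p cp) h1 h2.
have dh (p : P) : cond p -> tdeg D1 (h p).
  move=> cp; apply: (@tdeg_div _ _ _ (ddisc int (T0 p))); first by apply/eqP/lreg_neq0_int/lreg_ddisc.
  by rewrite -hh //; apply: dN.
have lh (p : P) : cond p -> labinv (lab2 (dv p) (dsub kp (dv p))) (h p).
  move=> cp; have /andP[_ nm] := cp; apply/labinv2 => t ht tn tm.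
  have tT : t @: T0 p = T0 p by rewrite imset_permD tm tn.
  apply: (@lreg_ddisc int Q v (T0 p)); rewrite -hh // -[in LHS]tT -ddisc_wperm // -wpermM -hh //.
  by rewrite sduoN_wperm // tT tn.
pose z (p : P) := theta_duos (dv p) (dsub kp (dv p)) (h p).
pose za := flatten [seq z p | p : P <- enum P & cond p].
have za_mem d : d \in za -> gduo kp D2 d /\ dsize d.2.1 = s.
  case/flattenP => zs /mapP[p]; rewrite mem_filter => /andP[cp _] -> dz.
  have /andP[/eqP ds nm] := cp.
  by have [g ->] := theta_duos_gduo nm kv (lh p cp) (dh p cp) dz.
have za_N B T : sduoN za B T = \sum_(p : P | cond p) sduoN (z p) B T.
  by rewrite /sduoN big_flatten big_map big_filter big_enum_cond.
have [||r' [hr' er']] := hD3 v (r ++ map (@negd _ _ v) za) kv.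
- move=> d; rewrite mem_cat => /orP[/hr|/mapP[e /za_mem[g _] ->]].
    by apply: gduo_le; rewrite leq_addl.
  by apply: gduo_neg; apply: gduo_le g; rewrite leq_addr.
- move=> B T dBT sB; rewrite sduoN_cat sduoN_neg za_N.
  suff -> : sduoN r B T = \sum_(p : P | cond p) sduoN (z p) B T by rewrite subrr.
  have [[p [cp G1 G2]]|no] := pselect (exists p : P, [/\ cond p, isGamma (dsub kp (dv p)) (B :|: T) & isGamma (dv p) B]).
    have /andP[/eqP ds nm] := cp; have [t [ht tB tT]] := duo_transport nm dBT G1 G2.
    rewrite (bigD1 p cp) /= [X in _ + X]big1 ?addr0 => [|q /andP[cq qp]].
      have zl := theta_duos_lam nm (subv _) (lh p cp).
      have e1 : sduoN r B T = wperm t (sduoN r (B0 p) (T0 p)) by rewrite (sduoN_wperm _ _ hl ht) tB tT.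
      have e2 : sduoN (z p) B T = wperm t (sduoN (z p) (B0 p) (T0 p)) by rewrite (sduoN_wperm _ _ zl ht) tB tT.
      rewrite e1 e2; apply: (congr1 (wperm t)); apply: (etrans (hh p cp)); apply: esym.
      exact: (theta_duos_initial nm (subv _) (lh p cp)).
    have /andP[/eqP ds' nm'] := cq; apply: theta_duos_N0 => //; first by rewrite ds'.
    apply/negP => /andP[_ /isGammaE G3]; move/eqP: qp; apply; apply: dv_inj; apply/ffunP => i.
    by have /isGammaE G4 := G2; rewrite -G3 -G4.
  rewrite [RHS]big1 => [|p cp]; last first.
    have /andP[/eqP ds' nm'] := cp; apply: theta_duos_N0 => //; first by rewrite ds'.
    by apply/negP => /andP[G1 G2]; apply: no; exists p.
  (* For |B| = s, a term in the numerator would make the block sizes of B an admissible p; without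
     such a p the sum is empty. *)
  move: sB; rewrite leq_eqVlt => /orP[/eqP sB|]; last exact: h0.
  rewrite /sduoN big_seq big1 // => d /hr[mn _ _ _]; rewrite /duoN big_pred0 // => T1.
  apply/negP => /(duoidx_dim dBT mn) cnt; apply: no.
  have kc i : (kp i <= c)%N by rewrite /c /dsize (bigD1 i) //= leq_addr.
  have dvE i : dv [ffun i => inord (ctag B i)] i = ctag B i.
    by rewrite !ffunE inordK // ltnS; apply: leq_trans (kc i); rewrite -cnt leq_addr.
  have gB : isGamma (dv [ffun i => inord (ctag B i)]) B by apply/isGammaE => i; rewrite dvE.
  exists [ffun i => inord (ctag B i)]; split=> //.
    rewrite /cond -(isGamma_card gB) sB eqxx /=; apply/forallP => i; rewrite [dsub _ _ _]ffunE dvE.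
    by have := cnt i; rewrite ctagU //; lia.
  by apply/isGammaE => i; rewrite ffunE dvE; have := cnt i; lia.
exists (za ++ r'); split=> [d|].
  rewrite mem_cat => /orP[/za_mem[g ->]|/hr'[g lt]].
    by split=> //; apply: gduo_le g; rewrite leq_addr.
  by split; [apply: gduo_le g; rewrite leq_addl|rewrite ltnW // ltnS].
by rewrite sduo_cat -er' sduo_cat sduo_neg addrCA subrr addr0.
Qed.

End Reduce.

(** * Straightening *)

Lemma sum_addE (V : zmodType) (I : finType) (A B C : I -> V) : (forall i, A i = B i + C i) ->
  \sum_i A i = \sum_i B i + \sum_i C i.
Proof. by move=> h; rewrite -big_split; apply: eq_bigr => i _; apply: h. Qed.

Section Straighten.
Variables (Q : quiver) (m n : dimvec Q).
Implicit Types (k : comNzRingType) (v : dimvec Q).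

Definition dadd (a b : dimvec Q) : dimvec Q := [ffun i => (a i + b i)%N].

Lemma daddK : dsub (dadd m n) n = m.
Proof. by apply/ffunP => i; rewrite !ffunE addnK. Qed.

(** If n is not below m, no numerator with |B| >= |n| survives and the product consists of lower
    terms only. *)
Definition theta_sum k v (h : tLam k v) : Aloc k v := if dimvec_le n m then sduo (theta_duos n m h) else 0.

(** For n <= m, this is the numerator at the exponent 1_[m] + 1_[n] without its factor [ddisc]. *)
Definition fshift k v (f g : tLam k v) : tLam k v := f * wshift (indm (initial v m)) g.

Lemma labinv_fshift k v (f g : tLam k v) : inLam1 m f -> inLam1 n g -> labinv (lab2 n m) (fshift f g).
Proof.
move=> hf hg; apply/labinv2 => s hs sn sm; by rewrite /fshift wpermM (hf s hs sm) wperm_wshift pmnm_indm sm (hg s hs sn).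
Qed.

Definition lower k D v (r : seq (duo k v)) :=
  forall d, d \in r -> gduo (dadd m n) D d /\ (dsize d.2.1 < dsize n)%N.

(** Subtracting [theta_duos] cancels the numerators with |B| >= |n|, at the standard position by
    construction and elsewhere by equivariance. Then [duo_reduce] makes the second letter
    smaller. *)
Lemma straighten_int D : exists D', forall v (f g : tLam int v), dimvec_le (dadd m n) v ->
  inLam1 m f -> inLam1 n g -> tdeg D f -> tdeg D g ->
  exists r, lower D' r /\ FMO m f * FMO n g = theta_sum (fshift f g) + sduo r.
Proof.
pose c := dsize (dadd m n).
have [D' hD'] := duo_reduce (dsize n) (dadd m n) (D + D + 3 * c.+1 * c.+1 + D).
exists D' => v f g kv hf hg df dg.
have mv : dimvec_le m v by apply/forallP => i; apply: leq_trans (forallP kv i); rewrite ffunE leq_addr.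
have nv : dimvec_le n v by apply/forallP => i; apply: leq_trans (forallP kv i); rewrite ffunE leq_addl.
pose r0 : seq (duo int v) := [:: ((m, f), (n, g))].
have r0E : FMO m f * FMO n g = sduo r0 by rewrite /sduo big_seq1.
have r0N B T : sduoN r0 B T = duoN m n f g B T by rewrite /sduoN big_seq1.
have lh := labinv_fshift hf hg.
have g0 d : d \in r0 -> gduo (dadd m n) (D + D + 3 * c.+1 * c.+1 + D) d.
  rewrite inE => /eqP->; split=> //=; first by move=> i; rewrite ffunE.
    by apply: (wbound_le _ df); rewrite leq_addl.
  by apply: (wbound_le _ dg); rewrite leq_addl.
rewrite /theta_sum; have [nm|nm] := boolP (dimvec_le n m); last first.
  have [|r [hr er]] := hD' v r0 kv g0.
    move=> B T dBT sB; rewrite r0N duoN_top //; case: ifP => // /andP[/isGammaE G1 /isGammaE G2].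
    case/negP: nm; apply/forallP => i; rewrite -G1 -G2 ctagU //; exact: leq_addr.
  by exists r; rewrite add0r r0E er.
have zg d : d \in theta_duos n m (fshift f g) -> gduo (dadd m n) (D + D + 3 * c.+1 * c.+1 + D) d.
  have nm' : dimvec_le n (dsub (dadd m n) n) by rewrite daddK.
  have dh : tdeg (D + D) (fshift f g) by apply: wboundM => //; apply: tdeg_wshift.
  have := @theta_duos_gduo Q int (dadd m n) n v (D + D) (fshift f g) nm' kv; rewrite daddK => /(_ lh dh) h /h[G _].
  by apply: gduo_le G; rewrite leq_addr.
have [||r [hr er]] := hD' v (r0 ++ map (@negd _ _ v) (theta_duos n m (fshift f g))) kv.
- by move=> d; rewrite mem_cat => /orP[/g0//|/mapP[e /zg G ->]]; apply: gduo_neg.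
- move=> B T dBT sB; rewrite sduoN_cat sduoN_neg r0N.
  have [/andP[G1 G2]|no] := boolP (isGamma m (B :|: T) && isGamma n B); last first.
    by rewrite theta_duos_N0 // duoN_top // (negbTE no) subrr.
  have [t [ht tB tT]] := duo_transport nm dBT G1 G2.
  have e1 : duoN m n f g B T = wperm t (duoN m n f g (initial v n) (initial v m :\: initial v n)).
    by rewrite (duoN_wperm _ _ hf hg ht) tB tT.
  have e2 : sduoN (theta_duos n m (fshift f g)) B T = wperm t (sduoN (theta_duos n m (fshift f g)) (initial v n) (initial v m :\: initial v n)).
    by rewrite (sduoN_wperm _ _ (theta_duos_lam nm mv lh) ht) tB tT.
  rewrite e1 e2 (theta_duos_initial nm mv lh); apply/eqP; rewrite subr_eq0; apply/eqP; apply: (congr1 (wperm t)).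
  rewrite duoN_top; [|exact: initial_disj|by rewrite (isGamma_card (isGamma_initial nv))].
  by rewrite initial_join // !isGamma_initial // !restr_initial // mulrC.
exists r; split=> //; rewrite r0E -er sduo_cat sduo_neg addrCA subrr addr0 //.
Qed.

Lemma theta_partD k v l (F G : tLam k v) : dimvec_le n m -> dimvec_le m v -> labinv (lab2 n m) F -> labinv (lab2 n m) G ->
  @theta_part Q n m k v l (F + G) = theta_part m l F + theta_part m l G.
Proof.
move=> nm mv hF hG; apply: (theta_part_uniq nm mv); first by move=> s hs sl; rewrite rmorphD /= hF ?hG.
by rewrite theta_numD (theta_partE nm) // (theta_partE nm l mv hG) mulrDr.
Qed.

Lemma theta_partZ k v l c (F : tLam k v) : dimvec_le n m -> dimvec_le m v -> labinv (lab2 n m) F ->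
  @theta_part Q n m k v l (c *: F) = c *: theta_part m l F.
Proof.
move=> nm mv hF; apply: (theta_part_uniq nm mv).
  by move=> s hs sl; apply: etrans (psubstZ _ _ _) _; apply: (congr1 (fun x => c *: x)); apply: hF.
by rewrite theta_numZ (theta_partE nm) // scalerAr.
Qed.

Lemma sduo_theta_duos k v (h : tLam k v) : sduo (theta_duos n m h) =
  \sum_(l : 'X_{1..#|beta_idx n| < gamma_size m}) FMO m (theta_part m l h) * FMO n (beta_mon k v 1 l).
Proof. exact: theta_duos_sum. Qed.

Lemma theta_sumD k v (F G : tLam k v) : dimvec_le m v -> labinv (lab2 n m) F -> labinv (lab2 n m) G ->
  theta_sum (F + G) = theta_sum F + theta_sum G.
Proof.
move=> mv hF hG; rewrite /theta_sum; case: (boolP (dimvec_le n m)) => nm; last exact: esym (addr0 _).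
apply: etrans (sduo_theta_duos (F + G)) _; apply: etrans (esym (congr2 +%R (sduo_theta_duos F) (sduo_theta_duos G))).
apply: sum_addE => l; rewrite -mulrDl -FMOD; apply: (congr1 (fun h => FMO m h * _)); exact: theta_partD.
Qed.

Lemma theta_sumZ k v c (F : tLam k v) : dimvec_le m v -> labinv (lab2 n m) F ->
  theta_sum (c *: F) = Apoly c%:MP * theta_sum F.
Proof.
move=> mv hF; rewrite /theta_sum; case: (boolP (dimvec_le n m)) => nm; last exact: esym (mulr0 _).
apply: etrans (sduo_theta_duos (c *: F)) _; apply: etrans (esym (congr1 (fun x => _ * x) (sduo_theta_duos F))).
rewrite mulr_sumr; apply: eq_bigr => l _; rewrite mulrA -FMOZ; apply: (congr1 (fun h => FMO m h * _)); exact: theta_partZ.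
Qed.

Definition straight k D v (f g : tLam k v) := exists r, lower D r /\
  FMO m f * FMO n g = theta_sum (fshift f g) + sduo r.

Lemma straightD k D v (f f' g : tLam k v) : dimvec_le m v -> inLam1 m f -> inLam1 m f' -> inLam1 n g ->
  straight D f g -> straight D f' g -> straight D (f + f') g.
Proof.
move=> mv hf hf' hg [r [hr er]] [r' [hr' er']]; exists (r ++ r'); split.
  by move=> d; rewrite mem_cat => /orP[/hr|/hr'].
have e : fshift (f + f') g = fshift f g + fshift f' g by apply: mulrDl.
apply: etrans (_ : _ = FMO m f * FMO n g + FMO m f' * FMO n g) _; first by rewrite FMOD mulrDl.
apply: etrans (congr2 +%R er er') _; rewrite sduo_cat e theta_sumD; [exact: addrACA|exact: mv|exact: labinv_fshift..].
Qed.

Lemma straightD' k D v (f g g' : tLam k v) : dimvec_le m v -> inLam1 m f -> inLam1 n g -> inLam1 n g' ->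
  straight D f g -> straight D f g' -> straight D f (g + g').
Proof.
move=> mv hf hg hg' [r [hr er]] [r' [hr' er']]; exists (r ++ r'); split.
  by move=> d; rewrite mem_cat => /orP[/hr|/hr'].
have e : fshift f (g + g') = fshift f g + fshift f g'.
  by apply: etrans (mulrDr _ _ _); apply: (congr1 (fun x => f * x)); apply: rmorphD.
apply: etrans (_ : _ = FMO m f * FMO n g + FMO m f * FMO n g') _; first by rewrite FMOD mulrDr.
apply: etrans (congr2 +%R er er') _; rewrite sduo_cat e theta_sumD; [exact: addrACA|exact: mv|exact: labinv_fshift..].
Qed.

Definition scd k c v (d : duo k v) : duo k v := ((d.1.1, c *: d.1.2), d.2).

Lemma inLam1Z k v p c (f : tLam k v) : inLam1 p f -> inLam1 p (c *: f).
Proof. by move=> hf s hs sp; apply: etrans (psubstZ _ _ _) _; apply: (congr1 (fun x => c *: x)); apply: hf. Qed.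

Lemma lower_scd k D c v (r : seq (duo k v)) : lower D r ->
  lower D (map (@scd k c v) r) /\ sduo (map (@scd k c v) r) = Apoly c%:MP * sduo r.
Proof.
move=> hr; split.
  move=> d /mapP[e /hr[[h1 [h2 h3] h4 h5] lt] ->]; split=> //; split=> //; last exact: wboundZ.
  by split=> //; apply: inLam1Z.
by rewrite /sduo big_map mulr_sumr; apply: eq_bigr => d _; rewrite /= FMOZ mulrA.
Qed.

Lemma straightZ k D v c (f g : tLam k v) : dimvec_le m v -> inLam1 m f -> inLam1 n g ->
  straight D f g -> straight D (c *: f) g.
Proof.
move=> mv hf hg [r [hr er]]; have [hr' er'] := lower_scd c hr; exists (map (@scd k c v) r); split=> //.
have e : fshift (c *: f) g = c *: fshift f g by apply: esym; apply: scalerAl.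
apply: etrans (_ : _ = Apoly c%:MP * (FMO m f * FMO n g)) _; first by rewrite FMOZ mulrA.
apply: etrans (congr1 (fun x => _ * x) er) _; rewrite er' e theta_sumZ; [exact: mulrDr|exact: mv|exact: labinv_fshift].
Qed.

Lemma straightZ' k D v c (f g : tLam k v) : dimvec_le m v -> inLam1 m f -> inLam1 n g ->
  straight D f g -> straight D f (c *: g).
Proof.
move=> mv hf hg [r [hr er]]; have [hr' er'] := lower_scd c hr; exists (map (@scd k c v) r); split=> //.
have e : fshift f (c *: g) = c *: fshift f g.
  by apply: etrans (esym (scalerAr _ _ _)); apply: (congr1 (fun x => f * x)); apply: psubstZ.
apply: etrans (_ : _ = Apoly c%:MP * (FMO m f * FMO n g)) _; first by rewrite FMOZ mulrA FMO_Apoly mulrA.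
apply: etrans (congr1 (fun x => _ * x) er) _; rewrite er' e theta_sumZ; [exact: mulrDr|exact: mv|exact: labinv_fshift].
Qed.

Lemma theta_sum0 k v : dimvec_le m v -> theta_sum (0 : tLam k v) = 0.
Proof.
move=> mv; rewrite /theta_sum; case: (boolP (dimvec_le n m)) => nm; last by [].
have h0 : labinv (lab2 n m) (0 : tLam k v) by move=> s _ _; apply: rmorph0.
apply: etrans (sduo_theta_duos 0) _; apply: big1 => l _.
have -> : theta_part m l 0 = 0 :> tLam k v by rewrite -{1}(scale0r (0 : tLam k v)) (theta_partZ l 0 nm mv h0) scale0r.
by rewrite FMO_0 mul0r.
Qed.

Lemma straight0 k D v (f : tLam k v) : dimvec_le m v -> straight D 0 f.
Proof.
move=> mv; exists [::]; split; first by [].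
have e : fshift 0 f = 0 by apply: mul0r.
by rewrite e theta_sum0 // FMO_0 mul0r /sduo big_nil addr0.
Qed.

Lemma straight0' k D v (f : tLam k v) : dimvec_le m v -> straight D f 0.
Proof.
move=> mv; exists [::]; split; first by [].
have e : fshift f 0 = 0.
  by apply: etrans (mulr0 f); apply: (congr1 (fun x => f * x)); apply: rmorph0.
by rewrite e theta_sum0 // FMO_0 mulr0 /sduo big_nil addr0.
Qed.

Definition bcd k v (d : duo int v) : duo k v := ((d.1.1, bc k d.1.2), (d.2.1, bc k d.2.2)).

Lemma tdeg_bc k v D (f : tLam int v) : tdeg D f -> tdeg D (bc k f).
Proof.
move=> df a; rewrite mcoeff_msupp mcoeff_bc => ha; apply: df; rewrite mcoeff_msupp.
by apply: contraNneq ha => ->.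
Qed.

Lemma inLam1_bc k v p (f : tLam int v) : inLam1 p f -> inLam1 p (bc k f).
Proof. by move=> hf s hs sp; rewrite -bc_wperm hf. Qed.

Lemma straight_bc k D v (f g : tLam int v) : dimvec_le m v -> inLam1 m f -> inLam1 n g ->
  straight D f g -> straight D (bc k f) (bc k g).
Proof.
move=> mv hf hg [r [hr er]]; exists (map (@bcd k v) r); split.
  move=> d /mapP[e /hr[[h1 [h2 h3] h4 h5] lt] ->]; split=> //; split=> //; try exact: tdeg_bc.
  by split; apply: inLam1_bc.
have [F FE] := bcA_exists k v.
have FS (s : seq (duo int v)) : F (sduo s) = sduo (map (@bcd k v) s).
  transitivity (\sum_(d <- s) F (FMO d.1.1 d.1.2 * FMO d.2.1 d.2.2)); first exact: rmorph_sum.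
  rewrite /sduo big_map; apply: eq_bigr => d _; apply: etrans (rmorphM F _ _) _; apply: congr2; exact: FE.
apply: etrans (_ : _ = F (FMO m f * FMO n g)) _.
  by apply: esym; apply: etrans (rmorphM F _ _) _; apply: congr2; exact: FE.
apply: etrans (congr1 F er) _; apply: etrans (rmorphD F _ _) _; apply: congr2; last exact: FS.
rewrite /theta_sum; case: (boolP (dimvec_le n m)) => nm; last exact: rmorph0.
apply: etrans (FS _) _; apply: congr1; rewrite /theta_duos -map_comp; apply: eq_map => l.
have lh := labinv_fshift hf hg.
have e : fshift (bc k f) (bc k g) = bc k (fshift f g).
  by apply: esym; apply: etrans (rmorphM (bc k (v := v)) _ _) _; apply: (congr1 (fun x => _ * x)); apply: bc_wshift.
by rewrite [LHS]/= /bcd [LHS]/= e -(theta_part_bc nm k l mv lh) beta_mon_bc.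
Qed.

(** The integral case suffices: the statement is additive and compatible with scalars in f and in g,
    and invariants of degree at most D are combinations of integral ones with the same bound. *)
Lemma straighten k D : exists D', forall v (f g : tLam k v), dimvec_le (dadd m n) v ->
  inLam1 m f -> inLam1 n g -> tdeg D f -> tdeg D g -> straight D' f g.
Proof.
have [D' hD'] := straighten_int D; exists D' => v f g kv hf hg df dg.
have mv : dimvec_le m v by apply/forallP => i; apply: leq_trans (forallP kv i); rewrite ffunE leq_addr.
have [cs [hcs ->]] := labinv_span (iffLR (inLam1_labinv _ _) hf) df.
have [ds [hds ->]] := labinv_span (iffLR (inLam1_labinv _ _) hg) dg.
have lc c : c \in cs -> inLam1 m c.2 /\ tdeg D c.2 by move=> /hcs[/inLam1_labinv].
have ld c : c \in ds -> inLam1 n c.2 /\ tdeg D c.2 by move=> /hds[/inLam1_labinv].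
have sd (r : seq (k * tLam int v)) p : (forall c, c \in r -> inLam1 p c.2) -> inLam1 p (\sum_(c <- r) c.1 *: bc k c.2).
  move=> hr; rewrite big_seq; apply: inLam1_sum => c /hr h; apply: inLam1Z; exact: inLam1_bc.
have hG : inLam1 n (\sum_(c <- ds) c.1 *: bc k c.2) by apply: sd => c /ld[].
elim: cs lc {hcs} => [|c cs IH] lc; first by rewrite big_nil; apply: straight0.
have [h1 h2] := lc c (mem_head _ _).
have lc' e : e \in cs -> inLam1 m e.2 /\ tdeg D e.2 by move=> he; apply: lc; rewrite inE he orbT.
rewrite big_cons; apply: straightD => //; last exact: IH.
- by apply: inLam1Z; apply: inLam1_bc.
- by apply: sd => e /lc'[].
apply: straightZ => //; first exact: inLam1_bc.
elim: ds ld {hds hG IH} => [|d ds IH] ld; first by rewrite big_nil; apply: straight0'.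
have [h3 h4] := ld d (mem_head _ _).
have ld' e : e \in ds -> inLam1 n e.2 /\ tdeg D e.2 by move=> he; apply: ld; rewrite inE he orbT.
rewrite big_cons; apply: straightD' => //; last exact: IH.
- exact: inLam1_bc.
- by apply: inLam1Z; apply: inLam1_bc.
- by apply: sd => e /ld'[].
apply: straightZ' => //; [exact: inLam1_bc|exact: inLam1_bc|].
by apply: straight_bc => //; apply: hD'.
Qed.

End Straighten.

(** * Straightening in the limit *)

Section Fam.
Variables (k : comNzRingType) (Q : quiver).
Implicit Types (v m n : dimvec Q).
Local Notation "''V_' v" := 'X_{1..#|var v|} (at level 8, v at level 2).

(** A degree bound uniform in v survives the constructions below, and suffices both for stability
    and for membership in the graded limit. *)
Definition bfam D m (F : Lamfam k Q) := compfam m F /\ forall v, dimvec_le m v -> tdeg D (F v).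

Lemma bfam_le D D' m F : (D <= D')%N -> bfam D m F -> bfam D' m F.
Proof. by move=> le [c h]; split=> // v mv; apply: wbound_le le (h v mv). Qed.

Lemma bfamD D m F G : bfam D m F -> bfam D m G -> bfam D m (F + G).
Proof.
move=> [[c1 c2] h] [[c1' c2'] h']; split; last by move=> v mv; apply: wboundD; [exact: h|exact: h'].
split=> [v mv|v v' mv' le]; first by apply: inLam1D; [exact: c1|exact: c1'].
by apply: etrans (rmorphD _ _ _) _; apply: congr2; [exact: c2|exact: c2'].
Qed.

Lemma bfam0 D m : bfam D m 0.
Proof.
split; last by move=> v _; apply: wbound0.
by split=> [v mv|v v' mv' le]; [exact: inLam1_0|exact: rmorph0].
Qed.

Lemma bfam_sum D m (I : Type) (r : seq I) (F : I -> Lamfam k Q) : (forall i, bfam D m (F i)) -> bfam D m (\sum_(i <- r) F i).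
Proof. by move=> h; apply: big_ind => [||i _]; [exact: bfam0|exact: bfamD|exact: h]. Qed.

Lemma homog_bfam m d F : homogLam1lim m d F -> bfam d m F.
Proof.
move=> [h1 h2]; split; first by split=> // v /h1[].
by move=> v /h1[_ hd] a ha; rewrite wdeg1 (dhomogP _ _ _ hd _ ha).
Qed.

Lemma inLam1lim_sum m (I : Type) (r : seq I) (F : I -> Lamfam k Q) : (forall i, inLam1lim m (F i)) -> inLam1lim m (\sum_(i <- r) F i).
Proof.
move=> h; apply: big_ind => [||i _]; [exact: sum_gen0|exact: sum_genD|exact: h].
Qed.

Lemma lamfam_sumE (I : Type) (r : seq I) (F : I -> Lamfam k Q) v : (\sum_(i <- r) F i) v = \sum_(i <- r) F i v.
Proof. by elim: r => [|i r IH]; rewrite ?big_nil // !big_cons -IH. Qed.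

Lemma afam_sumE (I : Type) (r : seq I) (F : I -> Afam k Q) v : (\sum_(i <- r) F i) v = \sum_(i <- r) F i v.
Proof. by elim: r => [|i r IH]; rewrite ?big_nil // !big_cons -IH. Qed.

Lemma bfam_inLam1lim D m F : bfam D m F -> inLam1lim m F.
Proof.
move=> [[c1 c2] hD].
(* At v not above m the component of F is arbitrary; it is put wholly in degree 0, so that the parts
   add up to F as a family. *)
pose Fd (d : 'I_D.+1) : Lamfam k Q := fun v => if dimvec_le m v then pihomog mdeg d (F v) else if d == ord0 then F v else 0.
have -> : F = \sum_d Fd d.
  apply: functional_extensionality_dep => v; rewrite lamfam_sumE /Fd.
  have [mv|mv] := boolP (dimvec_le m v); first by apply: pihomog_partitionE; apply/tdeg_msize; apply: hD.
  by rewrite (bigD1 ord0) //= big1 ?addr0 // => d /negbTE->.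
apply: inLam1lim_sum => d; apply: sum_gen_in; exists d; split=> [v mv|v v' mv' le].
  by rewrite /Fd mv; split; [apply: inLam1_pihomog; apply: c1|exact: pihomogP].
rewrite /Fd mv' (dimvec_trans mv' le) -(c2 _ _ mv' le).
apply/mpolyP => b; rewrite (mcoeff_wzero le) !pihomog_mcoeff (mcoeff_wzero le).
by rewrite mdeg_mext.
Qed.

Lemma bfam_lift D m v (f : tLam k v) : dimvec_le m v -> inLam1 m f -> tdeg D f -> exists F, bfam D m F /\ F v = f.
Proof.
move=> mv hf df.
have /choice[F hF] (d : 'I_D.+1) : exists F, homogLam1lim m d F /\ F v = pihomog mdeg d f.
  by apply: lift_lam1 => //; [exact: inLam1_pihomog|exact: pihomogP].
exists (\sum_d F d); split.
  by apply: bfam_sum => d; apply: (@bfam_le d); [rewrite -ltnS|apply: homog_bfam; case: (hF d)].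
rewrite lamfam_sumE [RHS](@pihomog_partitionE _ _ mdeg D.+1); last by apply/tdeg_msize.
by apply: eq_bigr => d _; case: (hF d).
Qed.

Definition bword D (w : fword k Q) := forall p, p \in w -> bfam D p.1 p.2.

Lemma bword_cons D p w : bword D (p :: w) <-> bfam D p.1 p.2 /\ bword D w.
Proof.
split=> [h|[h1 h2] q]; first by split=> [|q hq]; apply: h; rewrite inE ?eqxx // hq orbT.
by rewrite inE => /orP[/eqP->|/h2].
Qed.

Lemma bword_compf D w : bword D w -> compf w.
Proof. by move=> h p /h[]. Qed.

Lemma bword_size D w v : bword D w -> (wsize (fev v w) <= size w * D)%N.
Proof.
elim: w => [|p w IH]; first by rewrite /wsize big_nil.
rewrite bword_cons => -[[_ h] /IH hw]; rewrite /wsize /= big_cons mulSn leq_add //=.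
case: ifP => [/h/tdeg_msize|_]; last by rewrite msize0.
by case: (msize _).
Qed.

(** Stability carries the relation up to a common upper bound of v0 and v, and relations restrict
    from there to v. *)
Lemma sumf_zero v0 (K : dimvec Q) (n : nat) (ws : seq (fword k Q)) : (forall i, K i + n <= v0 i)%N ->
  (forall w, w \in ws -> compf w) ->
  (forall w v, w \in ws -> (wsize (fev v w) <= n)%N) ->
  (forall w i, w \in ws -> (\sum_(p <- w) p.1 i = K i)%N) ->
  sumf ws v0 = 0 -> sumf ws = 0.
Proof.
move=> Kn hc hn hK h0; apply: functional_extensionality_dep => v.
pose v1 : dimvec Q := [ffun i => maxn (v i) (v0 i)].
have le1 : dimvec_le v v1 by apply/forallP => i; rewrite ffunE leq_maxl.
have le0 : dimvec_le v0 v1 by apply/forallP => i; rewrite ffunE leq_maxr.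
apply: (sumf_restr le1 hc); apply: (stable_sumf le0 Kn hc) => // w hw; exact: hn.
Qed.

Lemma pfword2 (p q : dimvec Q * Lamfam k Q) : pfword [:: p; q] = FMOlim p.1 p.2 * FMOlim q.1 q.2.
Proof.
rewrite pfword_cons; apply: (congr1 (fun x => FMOlim p.1 p.2 * x)).
by rewrite pfword_cons /pfword big_nil; exact: mulr1.
Qed.

Section Straight.
Variables (m n : dimvec Q).

Definition theta_fam (l : 'X_{1..#|beta_idx n|}) (F G : Lamfam k Q) : Lamfam k Q :=
  fun v => if dimvec_le m v then theta_part m l (fshift m (F v) (G v)) else 0.

Definition beta_fam (l : 'X_{1..#|beta_idx n|}) : Lamfam k Q := fun v => beta_mon k v 1 l.

Lemma wext_indm v0 v (le : dimvec_le v0 v) : dimvec_le m v0 -> wext v (indm (initial v0 m)) = indm (initial v m).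
Proof.
move=> mv; apply/wmnmP => x; rewrite indmE; case Ex: (wpre v0 x) => [y|].
  by rewrite -(wpre_some le Ex) wextE indmE emb_initial.
rewrite wextE_none // inE ltnNge (leq_trans (forallP mv _)) //; exact: wpre_none.
Qed.

Lemma theta_fam_bfam D l F G : dimvec_le n m -> bfam D m F -> bfam D n G -> bfam (D + D + theta_deg n m) m (theta_fam l F G).
Proof.
move=> nm [[c1 c2] hF] [[c1' c2'] hG].
have lh v : dimvec_le m v -> labinv (lab2 n m) (fshift m (F v) (G v)).
  by move=> mv; apply: labinv_fshift; [exact: c1|apply: c1'; exact: dimvec_trans nm mv].
split; first split=> [v mv|v v' mv' le].
- by rewrite /theta_fam mv; apply: (theta_part_lam1 nm) => //; exact: lh.
- have mv := dimvec_trans mv' le; rewrite /theta_fam mv' mv; apply: etrans (theta_part_wzero nm le l mv' (lh v mv)) _.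
  apply: (congr1 (theta_part m l)); rewrite /fshift; apply: etrans (rmorphM (wzero v') _ _) _.
  apply: congr2; first exact: c2.
  rewrite -(wext_indm le mv') [LHS](wzero_wshift le); apply: congr1; apply: c2' => //; exact: dimvec_trans nm mv'.
move=> v mv; rewrite /theta_fam mv; apply: (tdeg_theta_part nm) => //; first exact: lh.
by apply: wboundM; [exact: hF|apply: tdeg_wshift; apply: hG; exact: dimvec_trans nm mv].
Qed.

Lemma beta_fam_bfam (l : 'X_{1..#|beta_idx n| < gamma_size m}) : bfam (dsize n * gamma_size m) n (beta_fam l).
Proof.
split; last by move=> v nv; exact: tdeg_beta_mon.
by split=> [v nv|v v' nv' le]; [exact: beta_mon_lam1|exact: beta_mon_wzero].
Qed.

(** The product is straightened at one v0 and the lower terms are lifted to families; the lifted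
    relation holds at v0, hence in the limit. The bound [D'] does not depend on v, so v0 can be
    chosen after it. *)
Lemma straight_fam D (F G : Lamfam k Q) : bfam D m F -> bfam D n G ->
  exists E (r : seq (fword k Q)),
    (forall w, w \in r -> exists m' n' F' G', [/\ w = [:: (m', F'); (n', G')], bword E w,
       dadd m' n' = dadd m n & (dsize n' < dsize n)%N]) /\
    FMOlim m F * FMOlim n G =
     (if dimvec_le n m then \sum_(l : 'X_{1..#|beta_idx n| < gamma_size m}) FMOlim m (theta_fam l F G) * FMOlim n (beta_fam l) else 0) + sumf r.
Proof.
move=> hF hG; have [D' hD'] := @straighten Q m n k D.
pose E := (D' + (D + D + theta_deg n m) + dsize n * gamma_size m + D)%N.
(* At most three letters of degree at most E: two operators and the sign letter of [negf]. *)
pose N := (3 * E)%N; pose v0 : dimvec Q := [ffun i => (dadd m n i + N)%N].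
have kv0 : dimvec_le (dadd m n) v0 by apply/forallP => i; rewrite [v0 i]ffunE leq_addr.
have mv0 : dimvec_le m v0 by apply: dimvec_trans kv0; apply/forallP => i; rewrite ffunE leq_addr.
have nv0 : dimvec_le n v0 by apply: dimvec_trans kv0; apply/forallP => i; rewrite ffunE leq_addl.
have [[c1 c2] dF] := hF; have [[c1' c2'] dG] := hG.
have [r0 [hr0 er0]] := hD' v0 (F v0) (G v0) kv0 (c1 _ mv0) (c1' _ nv0) (dF _ mv0) (dG _ nv0).
pose isl (w : fword k Q) := exists m' n' F' G', [/\ w = [:: (m', F'); (n', G')], bword E w,
       dadd m' n' = dadd m n & (dsize n' < dsize n)%N].
have [r [hr er]] : exists r : seq (fword k Q), (forall w, w \in r -> isl w) /\ sumf r v0 = sduo r0.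
  elim: r0 hr0 {er0} => [|d r0 IH] hr0; first by exists [::]; rewrite /sumf /sduo !big_nil.
  have [r [hr er]] := IH (fun d' hd' => hr0 d' (mem_behead (s := d :: r0) hd')).
  have [[dk [l1 l2] t1 t2] lt] := hr0 d (mem_head _ _).
  have le1 : dimvec_le d.1.1 v0 by apply: dimvec_trans kv0; apply/forallP => i; rewrite -dk leq_addr.
  have le2 : dimvec_le d.2.1 v0 by apply: dimvec_trans kv0; apply/forallP => i; rewrite -dk leq_addl.
  have [F' [bF eF]] := bfam_lift le1 l1 t1; have [G' [bG eG]] := bfam_lift le2 l2 t2.
  exists ([:: (d.1.1, F'); (d.2.1, G')] :: r); split.
    move=> w; rewrite inE => /orP[/eqP->|/hr//]; exists d.1.1, d.2.1, F', G'; split=> //.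
      have DE : (D' <= E)%N by rewrite /E -!addnA leq_addr.
      by move=> p; rewrite !inE => /orP[/eqP->|/eqP->] /=; [exact: bfam_le DE bF|exact: bfam_le DE bG].
    by apply/ffunP => i; rewrite [LHS]ffunE dk.
  have e1 : pfword [:: (d.1.1, F'); (d.2.1, G')] v0 = FMO d.1.1 d.1.2 * FMO d.2.1 d.2.2.
    by rewrite pfword2 famM !FMOlimE; apply: congr2; [exact: (congr1 (FMO _) eF)|exact: (congr1 (FMO _) eG)].
  rewrite sumf_cons famD; apply: etrans (congr2 +%R e1 er) _; apply: esym; exact: big_cons.
exists E, r; split=> //.
pose zs : seq (fword k Q) := if dimvec_le n m then [seq [:: (m, theta_fam l F G); (n, beta_fam l)] | l : 'X_{1..#|beta_idx n| < gamma_size m}] else [::].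
have zsE : sumf zs = if dimvec_le n m then \sum_(l : 'X_{1..#|beta_idx n| < gamma_size m}) FMOlim m (theta_fam l F G) * FMOlim n (beta_fam l) else 0.
  rewrite /zs; case: ifP => _; last by rewrite /sumf big_nil.
  rewrite /sumf big_map big_enum; apply: eq_bigr => l _; exact: pfword2.
rewrite -zsE; apply/eqP; rewrite -subr_eq0 -sumf_cat; apply/eqP.
have -> : FMOlim m F * FMOlim n G - sumf (zs ++ r) = sumf ([:: (m, F); (n, G)] :: map (@negf _ _) (zs ++ r)).
  by rewrite sumf_cons sumf_neg pfword2.
have good w : w \in zs ++ r -> bword E w /\ exists m' n' F' G', w = [:: (m', F'); (n', G')] /\ dadd m' n' = dadd m n.
  rewrite mem_cat => /orP[|/hr[m' [n' [F' [G' [-> h1 h2 _]]]]]]; last by split=> //; exists m', n', F', G'.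
  rewrite /zs; case: (boolP (dimvec_le n m)) => // nm /mapP[l _ ->]; split; last by exists m, n, (theta_fam l F G), (beta_fam l).
  move=> p; rewrite !inE => /orP[/eqP->|/eqP->] /=.
    by apply: bfam_le (theta_fam_bfam l nm hF hG); rewrite /E; lia.
  by apply: bfam_le (beta_fam_bfam l); rewrite /E; lia.
have good' w : w \in [:: (m, F); (n, G)] :: map (@negf _ _) (zs ++ r) ->
    [/\ bword E w, (size w <= 3)%N & forall i, (\sum_(p <- w) p.1 i = dadd m n i)%N].
  rewrite inE => /orP[/eqP->|/mapP[u /good[hu [m' [n' [F' [G' [eu e]]]]]] ->]].
    split=> //; last by move=> i; rewrite !big_cons big_nil addn0 ffunE.
    by move=> p; rewrite !inE => /orP[/eqP->|/eqP->] /=; [apply: bfam_le hF|apply: bfam_le hG]; rewrite /E leq_addl.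
  split; last by move=> i; rewrite /negf eu !big_cons big_nil addn0 /= -e !ffunE.
    apply/bword_cons; split=> //=; apply: (@bfam_le 0) => //.
    by apply: homog_bfam; exact: homogLam1lim_N1.
  by rewrite eu.
apply: (@sumf_zero v0 (dadd m n) N).
- by move=> i; rewrite [v0 i]ffunE.
- by move=> w /good'[/bword_compf].
- move=> w v /good'[hw sw _]; apply: leq_trans (bword_size v hw) _.
  by rewrite /N leq_mul2r sw orbT.
- by move=> w i /good'[].
have e0 : sumf zs v0 = theta_sum m n (fshift m (F v0) (G v0)).
  rewrite zsE /theta_sum; case: (boolP (dimvec_le n m)) => nm; last by [].
  rewrite afam_sumE; apply: (etrans _ (esym (sduo_theta_duos m n _))); apply: eq_bigr => l _.
  by rewrite famM !FMOlimE /theta_fam mv0.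
have e1 : pfword [:: (m, F); (n, G)] v0 = FMO m (F v0) * FMO n (G v0) by rewrite pfword2 famM !FMOlimE.
have eN (a : Afam k Q) : (- a) v0 = - a v0 by [].
by rewrite sumf_cons famD sumf_neg eN sumf_cat famD e0 e1 er er0 subrr.
Qed.

End Straight.
End Fam.

(** * Leading coefficients of words *)

Section Dims.
Variable Q : quiver.
Implicit Types (m n : dimvec Q) (ms ds : seq (dimvec Q)).

Definition dims_size ds : nat := \sum_(d <- ds) dsize d.

(* sum_j j |m_j|, which decreases when n does in a pair of adjacent letters m, n of
   constant sum. *)
Fixpoint dims_weight ds : nat := if ds is d :: ds' then dsize d + dims_size ds' + dims_weight ds' else 0.

Fixpoint chain ds : bool := if ds is d :: ds' then all (fun n => dimvec_le n d) ds' && chain ds' else true.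

Lemma dims_size_cons d ds : dims_size (d :: ds) = (dsize d + dims_size ds)%N.
Proof. exact: big_cons. Qed.

End Dims.

Lemma sum_only (V : zmodType) (I : finType) i (F : I -> V) : (forall j, j != i -> F j = 0) -> \sum_j F j = F i.
Proof. by move=> h; rewrite (bigD1 i) //= big1 ?addr0. Qed.

Section Coef.
Variables (k : comNzRingType) (Q : quiver) (v : dimvec Q).
Implicit Types (m n : dimvec Q) (ms : seq (dimvec Q)) (w : word k v).
Local Notation W := 'X_{1..#|widx v|}.
Implicit Types l : W.

(* The smallest weight of a word having u^l in its expansion: a variable x of
   exponent l_x occurs in l_x distinct letters. *)
Definition exp_weight l : nat := \sum_(x : widx v) 'C((l (enum_rank x)).+1, 2).
Definition exp_size l : nat := \sum_(x : widx v) l (enum_rank x).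

Lemma acoef_exp_size w l : exp_size l != dims_size (map fst w) -> acoef l (pword w) = 0.
Proof.
move=> ne; have [/existsP[i ni]|/existsPn h] := boolP [exists i, (\sum_(x : widx v | tag x == i) l (enum_rank x) != \sum_(p <- w) p.1 i)%N].
  exact: acoef_total ni.
case/eqP: ne; rewrite /exp_size /dims_size big_map (partition_big (fun x : widx v => tag x) predT) //=.
rewrite exchange_big /=; apply: eq_bigr => i _; exact/eqP/negPn/h.
Qed.

Lemma binS2 a : 'C(a.+1, 2) = (a + 'C(a, 2))%N.
Proof. by rewrite binS bin1 addnC. Qed.

Lemma bin2_le a b : (a <= b)%N -> ('C(a, 2) <= 'C(b, 2))%N.
Proof. exact: leq_bin2l. Qed.

Lemma exp_weight_sub l (G : {set widx v}) : (exp_weight l <= exp_size l + exp_weight (l - indm G)%MM)%N.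
Proof.
rewrite /exp_weight /exp_size -big_split; apply: leq_sum => x _ /=; rewrite mnmBE indmE binS2 leq_add2l.
by apply: bin2_le; case: (x \in G); lia.
Qed.

Lemma exp_weight_sub_lt l (G : {set widx v}) x : x \notin G -> (0 < l (enum_rank x))%N ->
  (exp_weight l < exp_size l + exp_weight (l - indm G)%MM)%N.
Proof.
move=> xG lx; rewrite /exp_weight /exp_size -big_split (bigD1 x) //= [X in (_ < X)%N](bigD1 x) //=.
rewrite -addSn leq_add //.
  by rewrite mnmBE indmE (negbTE xG) subn0 -[X in (X < _)%N]add0n ltn_add2r.
apply: leq_sum => y _; rewrite mnmBE indmE binS2 leq_add2l.
by apply: bin2_le; case: (y \in G); lia.
Qed.

(** Removing the first letter lowers [exp_weight] by at most [exp_size], that is by at most the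
    total dimension of the word, and it lowers [dims_weight] by exactly this dimension. *)
Lemma acoef_exp_weight w l : (dims_weight (map fst w) < exp_weight l)%N -> acoef l (pword w) = 0.
Proof.
elim: w l => [|p w IH] l /= lt.
  rewrite /pword big_nil acoef1; case: eqP => // l0; move: lt; rewrite l0 /exp_weight big1 // => x _.
  by rewrite mnm0E.
have [e|ne] := eqVneq (exp_size l) (dims_size (map fst (p :: w))); last exact: acoef_exp_size.
rewrite pword_cons acoef_FMOM big1 // => G _; rewrite IH ?raddf0 ?mulr0 //.
have := exp_weight_sub l G; move: lt e; rewrite /= dims_size_cons; lia.
Qed.

Definition chain_exp ms : W := foldr (fun m a => (indm (initial v m) + a)%MM) 0%MM ms.

Definition chain_coef ms : LamLoc k v := foldr (fun m C =>
  (\prod_(x in initial v m) \prod_(y in ~: initial v m) pairf k x y 0) * lshift (indm (initial v m)) C) 1 ms.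

(** Each letter is shifted by all the u on its left; this is the leading numerator of a word. *)
Definition chain_num w : tLam k v := foldr (fun p F => p.2 * wshift (indm (initial v p.1)) F) 1 w.

Lemma chain_exp0 m ms x : all (fun n => dimvec_le n m) ms -> x \notin initial v m -> chain_exp ms (enum_rank x) = 0%N.
Proof.
move=> + xm; elim: ms => [|n ms IH] /=; first by rewrite mnm0E.
move=> /andP[nm /IH h]; rewrite mnmDE h indmE addn0.
case xn: (x \in initial v n) => //; by rewrite (subsetP (initial_sub nm v) _ xn) in xm.
Qed.

Lemma exp_size_chain ms : all (fun n => dimvec_le n v) ms -> exp_size (chain_exp ms) = dims_size ms.
Proof.
elim: ms => [|m ms IH] /=; first by rewrite /exp_size /dims_size big_nil big1 // => x _; rewrite mnm0E.
move=> /andP[mv /IH h]; rewrite dims_size_cons -h -(isGamma_card (isGamma_initial mv)) -sum1_card /exp_size.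
rewrite [X in _ = (X + _)%N]big_mkcond -big_split; apply: eq_bigr => x _.
by rewrite mnmDE indmE; case: (x \in _).
Qed.

Lemma exp_weight_chain ms : chain ms -> all (fun n => dimvec_le n v) ms -> exp_weight (chain_exp ms) = dims_weight ms.
Proof.
elim: ms => [|m ms IH] /=; first by rewrite /exp_weight big1 // => x _; rewrite mnm0E.
move=> /andP[mm cm] /andP[mv mvs]; rewrite -(IH cm mvs) -dims_size_cons -(@exp_size_chain (m :: ms)) /= ?mv //.
rewrite /exp_weight /exp_size -big_split; apply: eq_bigr => x _ /=.
rewrite mnmDE indmE binS2; congr (_ + _)%N.
have [xm|xm] := boolP (x \in initial v m); first by rewrite add1n.
by rewrite (chain_exp0 mm xm).
Qed.

Lemma lreg_lshift_chain_coef ms a : GRing.lreg (lshift a (chain_coef ms)).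
Proof.
elim: ms a => [|m ms IH] a; first by rewrite rmorph1; apply: lreg1.
have -> : lshift a (chain_coef (m :: ms)) = lshift a (\prod_(x in initial v m) \prod_(y in ~: initial v m) pairf k x y 0) *
    lshift (a + indm (initial v m))%MM (chain_coef ms).
  by apply: etrans (rmorphM (lshift a) _ _) _; apply: (congr1 (fun x => _ * x)); exact: esym (lshiftD _ _ _).
apply: lregM; last exact: IH.
apply: (big_rec (fun p => GRing.lreg (lshift a p))) => [|x p _ hp]; first by rewrite rmorph1; apply: lreg1.
rewrite rmorphM; apply: lregM; last exact: hp.
apply: (big_rec (fun p => GRing.lreg (lshift a p))) => [|y q _ hq]; first by rewrite rmorph1; apply: lreg1.
rewrite rmorphM; apply: lregM; last exact: hq.
by have := @lreg_pairf k Q v x y (0 + (a (enum_rank y))%:Z - (a (enum_rank x))%:Z); rewrite -lshift_pairf.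
Qed.

Lemma lreg_chain_coef ms : GRing.lreg (chain_coef ms).
Proof. by rewrite -[chain_coef ms]lshift0; apply: lreg_lshift_chain_coef. Qed.

(** If the first subset were smaller than the support m_1-block, the remaining exponent would be too
    heavy for the rest of the word. So every subset is forced, and a single product remains. *)
Lemma acoef_chain ms w : chain ms -> all (fun n => dimvec_le n v) ms -> good w -> size w = size ms ->
  (dims_weight (map fst w) <= dims_weight ms)%N ->
  acoef (chain_exp ms) (pword w) = if map fst w == ms then chain_coef ms * lfrac (chain_num w) else 0.
Proof.
elim: ms w => [|m ms IH] [|p w] // cm mv gw sz le.
  by rewrite /pword big_nil acoef1 !eqxx /= mul1r lfrac1.
have [e|ne] := eqVneq (exp_size (chain_exp (m :: ms))) (dims_size (map fst (p :: w))); last first.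
  rewrite acoef_exp_size //; case: eqP => // e; case/eqP: ne; rewrite e; exact: exp_size_chain.
have tl := exp_weight_chain cm mv.
have [gp gw'] := (good_cons p w).1 gw.
move: (cm) (mv) => /andP[mm cm'] /andP[mv0 mv'].
have supp x : (0 < chain_exp (m :: ms) (enum_rank x))%N = (x \in initial v m).
  rewrite [chain_exp _]/= mnmDE indmE; case xm: (x \in initial v m) => //.
  by rewrite (chain_exp0 mm (negbT xm)).
have lE : (chain_exp (m :: ms) - indm (initial v m))%MM = chain_exp ms by rewrite [chain_exp _]/= addmC addmK.
have eT : (dsize p.1 + dims_size (map fst w) = dsize m + dims_size ms)%N.
  by rewrite -!dims_size_cons -(@exp_size_chain (m :: ms)) //.
have z G : (indm G <= chain_exp (m :: ms))%MM -> G != initial v m -> acoef (chain_exp (m :: ms) - indm G)%MM (pword w) = 0.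
  move=> /wmnm_lepP Gl Gm; apply: acoef_exp_weight.
  have Gs : G \subset initial v m.
    by apply/subsetP => x xG; rewrite -supp; apply: leq_trans (Gl x); rewrite indmE xG.
  have [x xm xG] : exists2 x, x \in initial v m & x \notin G.
    by apply/subsetPn; apply: contra Gm => s; rewrite eqEsubset Gs.
  have := @exp_weight_sub_lt (chain_exp (m :: ms)) G x xG; rewrite supp tl => /(_ xm).
  move: (exp_weight _) (exp_size _) le e => a b; rewrite [map fst _]/= [dims_weight _]/= [dims_weight (_ :: _)]/= !dims_size_cons; lia.
rewrite pword_cons acoef_FMOM big_mkcond (sum_only (i := initial v m)); last first.
  by move=> G Gm; case: ifP => // /andP[_ Gl]; rewrite z // raddf0 mulr0.
have le1 : (indm (initial v m) <= chain_exp (m :: ms))%MM.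
  by apply/wmnm_lepP => x; rewrite indmE -supp; case: (chain_exp _ _).
rewrite le1 andbT lE; have [pm|pm] := eqVneq p.1 m; last first.
  rewrite [map fst _]/= eqseq_cons (negbTE pm); case: ifP => // /isGammaE G1.
  have /isGammaE G2 := isGamma_initial mv0.
  by case/eqP: pm; apply/ffunP => i; rewrite -G1 -G2.
rewrite pm isGamma_initial // [map fst _]/= eqseq_cons pm eqxx.
rewrite IH //; last 2 first.
- by case: sz.
- by move: le; rewrite /= pm; move: eT; rewrite pm; lia.
case: ifP => _; last by rewrite raddf0 mulr0.
have gp' : inLam1 m p.2 by rewrite -pm.
rewrite fcoefE (restr_initial mv0 gp').
have -> : lshift (indm (initial v m)) (chain_coef ms * lfrac (chain_num w)) =
   lshift (indm (initial v m)) (chain_coef ms) * lfrac (wshift (indm (initial v m)) (chain_num w)).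
  apply: etrans (rmorphM (lshift _) _ _) _; apply: (congr1 (fun x => _ * x)).
  exact: (lshift_frac (indm (initial v m)) (chain_num w) [::]).
have FE : chain_num (p :: w) = p.2 * wshift (indm (initial v m)) (chain_num w) by rewrite [LHS]/= pm.
have CE : chain_coef (m :: ms) = (\prod_(x in initial v m) \prod_(y in ~: initial v m) pairf k x y 0) *
  lshift (indm (initial v m)) (chain_coef ms) by [].
rewrite FE CE lfracM.
move: (lfrac _) (lfrac _) (lshift _ _) (\prod_(x in _) _) => A B C D.
by ring.
Qed.

End Coef.

(** * Normal form of words modulo words of smaller weight *)

Section Lows.
Variables (k : comNzRingType) (Q : quiver).
Implicit Types (v m n : dimvec Q) (ms ds : seq (dimvec Q)) (w : fword k Q) (r : seq (fword k Q)).

Definition fdims w := map fst w.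
Definition bounded w := exists D, bword D w.

Lemma bounded_cons p w : bounded (p :: w) <-> (exists D, bfam D p.1 p.2) /\ bounded w.
Proof.
split=> [[D /bword_cons[h1 h2]]|[[D h] [D' h']]]; first by split; exists D.
exists (D + D')%N; apply/bword_cons; split; first by apply: bfam_le h; rewrite leq_addr.
by move=> q /h'; apply: bfam_le; rewrite leq_addl.
Qed.

Lemma bounded_cat w w' : bounded w -> bounded w' -> bounded (w ++ w').
Proof. by elim: w => [|p w IH] //= /bounded_cons[hp hw] hw'; apply/bounded_cons; split=> //; apply: IH. Qed.

(** The length is kept because leading coefficients are compared between words of equal length. *)
Definition lower_words ds r := forall u, u \in r ->
  [/\ bounded u, size u = size ds, dims_size (fdims u) = dims_size ds & (dims_weight (fdims u) < dims_weight ds)%N].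

Lemma lower_words_cat ds r r' : lower_words ds r -> lower_words ds r' -> lower_words ds (r ++ r').
Proof. by move=> h h' u; rewrite mem_cat => /orP[/h|/h']. Qed.

Lemma lower_words_flatten (T : eqType) ds (s : seq T) (f : T -> seq (fword k Q)) :
  (forall t, t \in s -> lower_words ds (f t)) -> lower_words ds (flatten (map f s)).
Proof. by move=> h u /flattenP[x /mapP[t ts ->]]; apply: h. Qed.

Lemma sumf_flatten (T : Type) (s : seq T) (f : T -> seq (fword k Q)) :
  sumf (flatten (map f s)) = \sum_(t <- s) sumf (f t).
Proof.
elim: s => [|t s IH]; first by rewrite /sumf !big_nil.
by rewrite big_cons -IH -sumf_cat.
Qed.

Lemma lower_words_cons p ds r : (exists D, bfam D p.1 p.2) -> lower_words ds r -> lower_words (p.1 :: ds) (map (cons p) r).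
Proof.
move=> hp hr u /mapP[w /hr[h1 h2 h3 h4] ->]; split; first exact/bounded_cons.
- by rewrite /= h2.
- by rewrite /= !dims_size_cons h3.
by rewrite /= h3 ltn_add2l.
Qed.

Lemma sumf_map_cons p r : sumf (map (cons p) r) = FMOlim p.1 p.2 * sumf r.
Proof. by rewrite /sumf big_map mulr_sumr; apply: eq_bigr => w _; exact: pfword_cons. Qed.

Lemma pfword_cat w w' : pfword (w ++ w') = pfword w * pfword w'.
Proof. exact: big_cat. Qed.

Lemma sumf_map_cat r w : sumf (map (cat^~ w) r) = sumf r * pfword w.
Proof. by rewrite /sumf big_map mulr_suml; apply: eq_bigr => u _; exact: pfword_cat. Qed.

Lemma straight_fam' m n (F G : Lamfam k Q) B : (exists D, bfam D m F) -> (exists D, bfam D n G) -> bounded B ->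
  exists r, lower_words (m :: n :: fdims B) r /\
    FMOlim m F * (FMOlim n G * pfword B) =
     (if dimvec_le n m then \sum_(l : 'X_{1..#|beta_idx n| < gamma_size m}) pfword ((m, theta_fam m l F G) :: (n, beta_fam k l) :: B) else 0) + sumf r.
Proof.
move=> [D hF] [D' hG] hB.
have [|| E [r [hr er]]] := @straight_fam k Q m n (D + D')%N F G; [by apply: bfam_le hF; rewrite leq_addr|by apply: bfam_le hG; rewrite leq_addl|].
exists (map (cat^~ B) r); split.
  move=> u /mapP[w /hr[m' [n' [F' [G' [-> hw e lt]]]]] ->]; split; first by apply: bounded_cat => //; exists E.
  - by rewrite /= size_map.
  - have e2 : (dsize m' + dsize n' = dsize m + dsize n)%N.
      by rewrite /dsize -!big_split; apply: eq_bigr => i _; have /ffunP/(_ i) := e; rewrite !ffunE.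
    by rewrite /= !dims_size_cons !addnA e2.
  have e2 : (dsize m' + dsize n' = dsize m + dsize n)%N.
    by rewrite /dsize -!big_split; apply: eq_bigr => i _; have /ffunP/(_ i) := e; rewrite !ffunE.
  by rewrite /= -/(fdims B) !dims_size_cons; move: (dims_size _) (dims_weight _) => a b; lia.
rewrite sumf_map_cat; apply: etrans (mulrA _ _ _) _; rewrite er; apply: etrans (mulrDl _ _ _) _.
apply: (congr1 (fun x => x + _)); case: (dimvec_le n m); last exact: mul0r.
apply: etrans (mulr_suml _ _ _ _) _; apply: eq_bigr => l _.
by rewrite !pfword_cons; exact: esym (mulrA _ _ _).
Qed.

Lemma wshift_comp v (a b : 'X_{1..#|widx v|}) (f : tLam k v) : wshift a (wshift b f) = wshift (a + b)%MM f.
Proof.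
pose F : {rmorphism tLam k v -> tLam k v} := wshift a \o wshift b.
apply: (psubst_ext (f := F) (g := wshift (a + b)%MM)) => [d|[z|x]] /=.
- by rewrite /wshift !wsubst_const.
- by rewrite !wshift_pvar.
rewrite !wshift_pvar -/(wvar k x) rmorphD rmorphM rmorph_nat /= wshift_hbar wshift_wvar mnmDE natrD.
by ring.
Qed.

Lemma wshift0 v (f : tLam k v) : wshift 0%MM f = f.
Proof.
apply: (psubst_ext (f := wshift 0%MM) (g := idfun)) => [d|[z|x]] /=.
- by rewrite /wshift wsubst_const.
- by rewrite wshift_pvar.
by rewrite wshift_pvar mnm0E mul0r addr0.
Qed.

Lemma pmnmD v (s : {perm widx v}) (a b : 'X_{1..#|widx v|}) : pmnm s (a + b)%MM = (pmnm s a + pmnm s b)%MM.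
Proof. by apply/wmnmP => x; rewrite !(mnmDE, pmnmE). Qed.

Definition chain_numf v w : tLam k v := chain_num (fev v w).

(* [TH] depends linearly on the leading numerator [chain_numf]; the multipliers c and
   the shift a make the statement inductive. *)
Definition top_lin m ms (I : Type) (TH : fword k Q -> I -> Lamfam k Q) :=
  forall v (a : 'X_{1..#|widx v|}) (T : eqType) (rr : seq T) (c : T -> tLam k v) (W : T -> fword k Q),
    dimvec_le m v -> (forall s, fixout m s -> pmnm s a = a) ->
    (forall t s, t \in rr -> fixout m s -> wperm s (c t) = c t) ->
    (forall t, t \in rr -> bounded (W t) /\ fdims (W t) = m :: ms) ->
    \sum_(t <- rr) c t * wshift a (chain_numf v (W t)) = 0 ->
    forall i, \sum_(t <- rr) c t * wshift a (TH (W t) i v) = 0.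

(** Recursion from the right: the tail is reduced to combinations of (n, TH) followed by fixed
    words, and the first two letters are then straightened. The new second letters [beta_fam] do not
    depend on w, so w survives in the first letter only. *)
Lemma top_words ms m : chain (m :: ms) ->
  exists (I : finType) (BB : I -> fword k Q) (TH : fword k Q -> I -> Lamfam k Q),
  [/\ forall i, bounded (BB i) /\ fdims (BB i) = ms,
      forall w, bounded w -> fdims w = m :: ms -> (forall i, exists E, bfam E m (TH w i)) /\
        exists r, lower_words (m :: ms) r /\ pfword w = \sum_i pfword ((m, TH w i) :: BB i) + sumf r &
      top_lin m ms TH].
Proof.
elim: ms m => [|n ms IH] m cm.
  exists unit, (fun=> [::]), (fun w _ => (head (m, 0) w).2); split.
  - by move=> _; split=> //; exists 0%N.
  - move=> [|[m' F] [|q w]] // hw [em]; subst m'; split; first by move=> _; have [] := (bounded_cons _ _).1 hw.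
    exists [::]; split=> //; rewrite (sum_only (i := tt)); last by case.
    by rewrite /sumf big_nil; exact: esym (addr0 _).
  move=> v a T rr c W mv ha hc hW e i; rewrite -[RHS]e big_seq [RHS]big_seq; apply: eq_bigr => t tr.
  have [_] := hW t tr; case: (W t) => [|[m' F] [|q w]] // [->]; rewrite /chain_numf /= mv.
  by rewrite rmorph1 mulr1.
move: (cm) => /andP[/andP[nm mm] cn].
have [I [BB [TH [hBB hex hlin]]]] := IH n cn.
exists (I * 'X_{1..#|beta_idx n| < gamma_size m})%type, (fun il : I * 'X_{1..#|beta_idx n| < gamma_size m} => (n, beta_fam k il.2) :: BB il.1),
  (fun w (il : I * 'X_{1..#|beta_idx n| < gamma_size m}) => theta_fam m il.2 (head (m, 0) w).2 (TH (behead w) il.1)); split.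
- move=> [i l] /=; have [h1 h2] := hBB i; split; last by rewrite /= h2.
  by apply/bounded_cons; split=> //; exists (dsize n * gamma_size m)%N; apply: beta_fam_bfam.
- move=> [|[m' F] w] // hw [em dw]; subst m'; have [[D hF] hw'] := (bounded_cons _ _).1 hw.
  have [hT [r' [hr' er']]] := hex w hw' dw; split.
    move=> [i l] /=; have [E hE] := hT i; exists ((D + E) + (D + E) + theta_deg n m)%N; apply: theta_fam_bfam => //.
      by apply: bfam_le hF; rewrite leq_addr.
    by apply: bfam_le hE; rewrite leq_addl.
  have /choice[ro hro] (i : I) : exists r, lower_words (m :: n :: ms) r /\
     FMOlim m F * (FMOlim n (TH w i) * pfword (BB i)) =
     (\sum_(l : 'X_{1..#|beta_idx n| < gamma_size m}) pfword ((m, theta_fam m l F (TH w i)) :: (n, beta_fam k l) :: BB i)) + sumf r.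
    have [hB dB] := hBB i; have := straight_fam' (ex_intro _ D hF) (hT i) hB.
    by rewrite nm dB.
  exists (flatten (map ro (enum I)) ++ map (cons (m, F)) r'); split.
    apply: lower_words_cat; first by apply: lower_words_flatten => i _; case: (hro i).
    by apply: (@lower_words_cons (m, F)) => //; exists D.
  rewrite pfword_cons er' sumf_cat sumf_map_cons sumf_flatten big_enum /=.
  apply: etrans (mulrDr _ _ _) _; apply: (etrans _ (esym (addrA _ _ _))); apply: (congr1 (fun x => x + _)).
  have e3 i : FMOlim m F * pfword ((n, TH w i) :: BB i) =
      (\sum_(l : 'X_{1..#|beta_idx n| < gamma_size m}) pfword ((m, theta_fam m l F (TH w i)) :: (n, beta_fam k l) :: BB i)) + sumf (ro i).
    by rewrite pfword_cons; exact: (proj2 (hro i)).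
  rewrite mulr_sumr; apply: etrans (eq_bigr _ (fun i _ => e3 i)) _.
  apply: etrans (big_split _ _ _ _ _) _; apply: (congr1 (fun x => x + _)).
  exact: pair_big.
(* The first letter joins the multiplier and 1_[m] joins the shift, so the induction hypothesis
   applies to the tails; [theta_part_lin] then treats the straightened first letter. *)
move=> v a T rr c W mv ha hc hW e [i l] /=.
have nv : dimvec_le n v := dimvec_trans nm mv.
have fixm s : fixout n s -> fixout (v := v) m s.
  by move=> [hs so]; split=> // x xm; apply: so; apply: contra xm; apply: subsetP (initial_sub nm v) x.
have hW' t : t \in rr -> exists F w, [/\ W t = (m, F) :: w, (exists D, bfam D m F), bounded w & fdims w = n :: ms].
  move=> tr; have [hw] := hW t tr; case: (W t) hw => [|[m' F] w] // /bounded_cons[hF hw] [<- dw].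
  by exists F, w.
pose Fh t := (head (m, 0) (W t)).2; pose Wb t := behead (W t).
have lamF t : t \in rr -> inLam1 m (Fh t v).
  by move=> /hW'[F [w [eW [D [[c1 _] _]] _ _]]]; rewrite /Fh eW; apply: c1.
have fixF t s : t \in rr -> fixout m s -> wperm s (Fh t v) = Fh t v.
  by move=> tr fs; apply: lamF => //; [case: fs|exact: fixout_initial].
have bwb t : t \in rr -> bounded (Wb t) /\ fdims (Wb t) = n :: ms.
  by move=> /hW'[F [w [eW _ hw dw]]]; rewrite /Wb eW.
have e' : \sum_(t <- rr) (c t * wshift a (Fh t v)) * wshift (a + indm (initial v m))%MM (chain_numf v (Wb t)) = 0.
  rewrite -[RHS]e big_seq [RHS]big_seq; apply: eq_bigr => t tr.
  have [F [w [eW _ _ _]]] := hW' t tr; rewrite /Fh /Wb eW /chain_numf [fev v ((m, F) :: w)]/= mv -mulrA; congr (_ * _).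
  by rewrite -wshift_comp; apply: esym; exact: (rmorphM (wshift a)).
have ha' s : fixout n s -> pmnm s (a + indm (initial v m))%MM = (a + indm (initial v m))%MM.
  by move=> /fixm fs; rewrite pmnmD ha // pmnm_indm fixout_initial.
have hc' t s : t \in rr -> fixout n s -> wperm s (c t * wshift a (Fh t v)) = c t * wshift a (Fh t v).
  by move=> tr /fixm fs; rewrite wpermM (hc t s tr fs) wperm_wshift (ha s fs) (fixF t s tr fs).
have := hlin v _ T rr _ Wb nv ha' hc' bwb e' i => {}e'.
have hL t : t \in rr -> labinv (lab2 n m) (fshift m (Fh t v) (TH (Wb t) i v)).
  move=> tr; apply: labinv_fshift; first exact: lamF.
  have [hb db] := bwb t tr; have [hT _] := hex _ hb db; have [E [[c1 _] _]] := hT i; exact: c1.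
have := @theta_part_lin Q n m nm k v a T rr c (fun t => fshift m (Fh t v) (TH (Wb t) i v)) l mv ha hL hc.
rewrite /theta_fam mv; apply; rewrite -[RHS]e' ; apply: eq_bigr => t _.
by rewrite -[RHS]mulrA; apply: (congr1 (fun x => c t * x)); rewrite -wshift_comp; exact: (rmorphM (wshift a)).
Qed.

(** At the rightmost defect the tail is a chain, reducible to words starting with its first
    dimension n. As n is not below the preceding dimension, the product of these two letters
    consists of lower terms. *)
Lemma nonchain_words w : bounded w -> ~~ chain (fdims w) -> exists r, lower_words (fdims w) r /\ pfword w = sumf r.
Proof.
elim: w => [|p w IH] // /bounded_cons[hp hw] nc.
have [cw|ncw] := boolP (chain (fdims w)); last first.
  have [r [hr er]] := IH hw ncw; exists (map (cons p) r); split; first exact: lower_words_cons.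
  by rewrite pfword_cons er sumf_map_cons.
case dw: (fdims w) cw nc => [|n ms] cw nc; first by rewrite /= dw in nc.
have [I [BB [TH [hBB hex _]]]] := top_words cw; have [hT [r' [hr' er']]] := hex w hw dw.
have nm : dimvec_le n p.1 = false.
  apply: contraNF nc => np; rewrite /= dw /= np; move: cw => /= /andP[an ->]; rewrite an !andbT.
  by apply/allP => d /(allP an) h; apply: dimvec_trans h np.
have /choice[ro hro] (i : I) : exists r, lower_words (p.1 :: n :: ms) r /\
   FMOlim p.1 p.2 * (FMOlim n (TH w i) * pfword (BB i)) = sumf r.
  have [hB dB] := hBB i; have [r [h e]] := straight_fam' hp (hT i) hB; exists r; split; first by rewrite -dB.
  by rewrite e nm; exact: add0r.
exists (flatten (map ro (enum I)) ++ map (cons p) r'); split.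
  rewrite /= dw; apply: lower_words_cat; first by apply: lower_words_flatten => i _; case: (hro i).
  exact: lower_words_cons.
rewrite pfword_cons er' sumf_cat sumf_map_cons sumf_flatten big_enum /=.
apply: etrans (mulrDr _ _ _) _; apply: (congr1 (fun x => x + _)).
rewrite mulr_sumr; apply: eq_bigr => i _; rewrite pfword_cons; exact: (proj2 (hro i)).
Qed.

End Lows.

(** * The kernel *)

Section Kernel.
Variables (k : comNzRingType) (Q : quiver) (v : dimvec Q).
Implicit Types (m n : dimvec Q) (ms ds : seq (dimvec Q)) (w : fword k Q) (r : seq (fword k Q)).

Definition kernel_ideal : Afam k Q -> Prop := ideal_gen (@inAlim k Q) (fun g => isFMO g /\ inKer v g).

Lemma bfam_isFMO D m F : bfam D m F -> isFMO (FMOlim m F : Afam k Q).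
Proof. by move=> h; exists m, F; split=> //; apply: bfam_inLam1lim h. Qed.

Lemma inAlim_pfword w : bounded w -> inAlim (pfword w).
Proof.
elim: w => [|p w IH]; first by move=> _; rewrite /pfword big_nil; exact: inAlim1.
move=> /bounded_cons[[D h] /IH hw]; rewrite pfword_cons; apply: inAlimM => //.
by apply: inAlim_FMO; apply: bfam_isFMO h.
Qed.

Lemma kernel_ideal_inKer (a : Afam k Q) : kernel_ideal a -> inKer v a.
Proof.
elim=> [x y g hx [_ [hg g0]] hy||x y _ [hx x0] _ [hy y0]].
- split; first by apply: inAlimM => //; apply: inAlimM.
  have -> : (x * g * y) v = x v * g v * y v by [].
  by rewrite g0 mulr0 mul0r.
- by split; [exact: sum_gen0|].
by split; [exact: inAlimD|rewrite famD x0 y0 addr0].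
Qed.

Lemma kernel_ideal_FMO D m F B : bfam D m F -> FMOlim m F v = 0 -> bounded B -> kernel_ideal (FMOlim m F * pfword B).
Proof.
move=> hF F0 hB; have e : 1 * FMOlim m F * pfword B = FMOlim m F * pfword B.
  exact: (congr1 (fun x => x * pfword B) (mul1r (FMOlim m F))).
rewrite -e; apply: ideal_gen_in; [exact: inAlim1|split|exact: inAlim_pfword].
  exact: bfam_isFMO hF.
by split=> //; apply: inAlim_FMO; apply: bfam_isFMO hF.
Qed.

Lemma FMOlim_sum (I : Type) (s : seq I) m (F : I -> Lamfam k Q) : FMOlim m (\sum_(i <- s) F i) = \sum_(i <- s) FMOlim m (F i).
Proof. by elim: s => [|i s IH]; rewrite ?big_nil ?FMOlim0 // !big_cons FMOlimD IH. Qed.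

Lemma kernel_ideal_sum (I : Type) (s : seq I) (F : I -> Afam k Q) : (forall i, kernel_ideal (F i)) -> kernel_ideal (\sum_(i <- s) F i).
Proof. by move=> h; apply: big_ind => [||i _]; [exact: ideal_gen0|exact: ideal_genD|exact: h]. Qed.

Lemma bfam_seq_sum (T : eqType) m (s : seq T) (F : T -> Lamfam k Q) : (forall t, t \in s -> exists D, bfam D m (F t)) ->
  exists D, bfam D m (\sum_(t <- s) F t).
Proof.
elim: s => [|t s IH] h; first by exists 0%N; rewrite big_nil; exact: bfam0.
have [D hD] := h t (mem_head _ _); have [|E hE] := IH; first by move=> u us; apply: h; rewrite inE us orbT.
exists (D + E)%N; rewrite big_cons; apply: bfamD; [apply: bfam_le hD|apply: bfam_le hE]; [exact: leq_addr|exact: leq_addl].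
Qed.

(** Words of one type share their tails [BB] modulo lower words, so they sum to one operator per
    tail. When the leading numerators cancel at v, [top_lin] makes each such operator vanish at
    v. *)
Lemma type_reduce ds ws : (0 < size ds)%N -> (forall w, w \in ws -> bounded w /\ fdims w = ds) ->
  (chain ds -> all (fun n => dimvec_le n v) ds -> \sum_(w <- ws) chain_numf v w = 0) ->
  exists x r, [/\ kernel_ideal x, lower_words ds r & sumf ws = x + sumf r].
Proof.
move=> sd hws h0; have [cd|nc] := boolP (chain ds); last first.
  have /choice[ro hro] (w : fword k Q) : exists r, w \in ws -> lower_words ds r /\ pfword w = sumf r.
    have [/hws[hw dw]|_] := boolP (w \in ws); last by exists [::].
    by have := nonchain_words hw; rewrite dw => /(_ nc)[r hr]; exists r.
  exists 0, (flatten (map ro ws)); split; first exact: ideal_gen0.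
    by apply: lower_words_flatten => w hw; case: (hro w hw).
  apply: (etrans _ (esym (add0r _))); rewrite sumf_flatten /sumf big_seq [RHS]big_seq.
  by apply: eq_bigr => w hw; case: (hro w hw).
case: ds sd hws h0 cd => // m ms _ hws h0 cd.
have [I [BB [TH [hBB hex hlin]]]] := top_words k cd.
have /choice[ro hro] (w : fword k Q) : exists r, w \in ws -> lower_words (m :: ms) r /\
    pfword w = \sum_i pfword ((m, TH w i) :: BB i) + sumf r.
  have [/hws[hw dw]|_] := boolP (w \in ws); last by exists [::].
  by have [_ [r hr]] := hex w hw dw; exists r.
exists (\sum_i FMOlim m (\sum_(w <- ws) TH w i) * pfword (BB i)), (flatten (map ro ws)); split.
- apply: kernel_ideal_sum => i; have [hB _] := hBB i.
  have [|D hD] := @bfam_seq_sum _ m ws (fun w => TH w i).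
    by move=> w /hws[hw dw]; have [hT _] := hex w hw dw.
  apply: kernel_ideal_FMO hD _ hB; rewrite FMOlimE.
  have [mv|mv] := boolP (dimvec_le m v); last exact: FMO0.
  have mvs : all (fun n => dimvec_le n v) (m :: ms).
    rewrite /= mv; move: cd => /= /andP[an _]; apply/allP => d /(allP an) h; exact: dimvec_trans h mv.
  have := hlin v 0%MM _ ws (fun=> 1) id mv _ _ hws _ i.
  have e (F : fword k Q -> tLam k v) : \sum_(w <- ws) 1 * wshift 0%MM (F w) = \sum_(w <- ws) F w.
    by apply: eq_bigr => w _; rewrite wshift0 mul1r.
  rewrite !e lamfam_sumE => ->; first exact: FMO_0.
  + by move=> s _; apply/wmnmP => x; rewrite pmnmE !mnm0E.
  + by move=> w s _ _; apply: rmorph1.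
  exact: h0.
- by apply: lower_words_flatten => w hw; case: (hro w hw).
rewrite sumf_flatten.
have -> : sumf ws = \sum_(w <- ws) \sum_i pfword ((m, TH w i) :: BB i) + \sum_(w <- ws) sumf (ro w).
  transitivity (\sum_(w <- ws) (\sum_i pfword ((m, TH w i) :: BB i) + sumf (ro w))); last exact: big_split.
  rewrite [sumf ws]/sumf big_seq [RHS]big_seq; apply: eq_bigr => w hw; exact: (proj2 (hro w hw)).
apply: (congr1 (fun x => x + _)); rewrite exchange_big; apply: eq_bigr => i _ /=.
rewrite FMOlim_sum mulr_suml; apply: eq_bigr => w _; exact: pfword_cons.
Qed.

Lemma fdims_fev w : map fst (fev v w) = fdims w.
Proof. by rewrite /fev /fdims -map_comp. Qed.

(** Among words of this length and of at most this weight, only those of type ds contribute to u^a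
    with a = [chain_exp v ds], and their common factor [chain_coef] is regular. *)
Lemma top_vanish ds ws : chain ds -> all (fun n => dimvec_le n v) ds ->
  (forall w, w \in ws -> [/\ bounded w, size w = size ds & (dims_weight (fdims w) <= dims_weight ds)%N]) ->
  sumf ws v = 0 -> \sum_(w <- ws | fdims w == ds) chain_numf v w = 0.
Proof.
move=> cd dv hws s0; have : acoef (chain_exp v ds) (sumf ws v) = 0 by rewrite s0 raddf0.
rewrite sumfE /sumw big_map raddf_sum.
have -> : \sum_(w <- ws) acoef (chain_exp v ds) (pword (fev v w)) = chain_coef k v ds * lfrac (\sum_(w <- ws | fdims w == ds) chain_numf v w).
  rewrite [lfrac (\sum_(_ <- _ | _) _)]rmorph_sum mulr_sumr [RHS]big_mkcond [LHS]big_seq [RHS]big_seq.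
  apply: eq_bigr => w /hws[[D hw] sw mw]; rewrite acoef_chain //.
  - by rewrite fdims_fev.
  - by apply: good_fev; apply: bword_compf hw.
  - by rewrite /fev size_map.
  by rewrite fdims_fev.
by move=> e; have := lreg_eq0 (@lreg_chain_coef k Q v ds) e => /(LamLoc_eq0 _ [::]).
Qed.

(** Double induction, on the weight bound and on the number of words reaching it: all words of one
    type of maximal weight are traded for an element of the ideal and words of smaller weight, so
    the remaining sum still vanishes at v. *)
Lemma kernel_words N s ws : (0 < s)%N ->
  (forall w, w \in ws -> [/\ bounded w, size w = s & (dims_weight (fdims w) < N)%N]) -> sumf ws v = 0 -> kernel_ideal (sumf ws).
Proof.
move=> s0; elim: N ws => [|N IHN] ws hws.
  case: ws hws => [|w ws] hws; last by have [] := hws w (mem_head _ _).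
  by move=> _; rewrite /sumf big_nil; exact: ideal_gen0.
have [c] := ubnP (count (fun w => dims_weight (fdims w) == N) ws).
elim: c ws hws => // c IHc ws hws cnt z.
have [/hasP[w0 w0s /eqP mw0]|/hasPn none] := boolP (has (fun w => dims_weight (fdims w) == N) ws); last first.
  apply: IHN => // w hw; have [h1 h2 h3] := hws w hw; split=> //.
  by have := none w hw; move: h3; rewrite ltnS leq_eqVlt => /orP[->|].
pose ds := fdims w0; pose w1 := [seq w <- ws | fdims w == ds]; pose w2 := [seq w <- ws | fdims w != ds].
have mds : dims_weight ds = N := mw0; have [_ sw0 _] := hws w0 w0s.
have sds : size ds = s by rewrite /ds size_map.
have wsE : sumf ws = sumf w1 + sumf w2.
  by rewrite /sumf /w1 /w2 !big_filter [LHS](bigID (fun w => fdims w == ds)).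
have [|||x [r [hx hr er]]] := @type_reduce ds w1.
- by rewrite sds.
- by move=> w; rewrite mem_filter => /andP[/eqP dw /hws[hw _ _]].
- move=> cd dv; rewrite /w1 big_filter; apply: top_vanish => // w /hws[h1 h2 h3]; split=> //.
    by rewrite h2.
  by rewrite mds -ltnS.
have e : sumf ws = x + sumf (r ++ w2) by rewrite wsE er sumf_cat; exact: esym (addrA _ _ _).
have [_ x0] := kernel_ideal_inKer hx.
have z2 : sumf (r ++ w2) v = 0.
  by move: z; rewrite e famD x0 add0r.
rewrite e; apply: ideal_genD => //; apply: IHc z2.
  move=> w; rewrite mem_cat => /orP[/hr[h1 h2 _ h4]|]; last by rewrite mem_filter => /andP[_ /hws].
  by split=> //; [rewrite h2|move: h4; rewrite mds => /ltnW].
rewrite count_cat (_ : count _ r = 0%N) ?add0n; last first.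
  apply/eqP; rewrite -leqn0 leqNgt -has_count; apply/hasPn => w /hr[_ _ _].
  by rewrite mds => lt; rewrite neq_ltn lt.
apply: leq_trans _ (_ : count (fun w => dims_weight (fdims w) == N) ws <= c)%N; last by rewrite -ltnS.
rewrite /w2 count_filter -!sum1_count [X in (_ < X)%N](bigID (fun w => fdims w != ds)) /=.
rewrite -[X in (X < _)%N]addn0 ltn_add2l sum1_count -has_count; apply/hasP; exists w0 => //=.
by rewrite mw0 eqxx negbK /ds eqxx.
Qed.

Lemma inKer_ideal (a : Afam k Q) : inKer v a <-> kernel_ideal a.
Proof.
split; last exact: kernel_ideal_inKer.
move=> [/inAlim_words[ws [hws ->]] z].
(* Unit letters of dimension 0 give all words one positive length, as the comparison of leading
   coefficients requires. *)
pose s := (\max_(w <- ws) size w).+1; pose one : dimvec Q * Lamfam k Q := (dim0 Q, 1).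
pose pad w := w ++ nseq (s - size w) one.
have one1 : FMOlim (dim0 Q) 1 = 1 :> Afam k Q.
  by apply: functional_extensionality_dep => u; rewrite FMOlimE; exact: FMO1.
have pf j : pfword (nseq j one) = 1.
  elim: j => [|j IH]; first by rewrite /pfword big_nil.
  by rewrite [nseq _ _]/= pfword_cons IH one1; exact: mulr1.
have padE w : pfword (pad w) = pfword w by rewrite pfword_cat pf; exact: mulr1.
have sE : sumf ws = sumf (map pad ws).
  by rewrite /sumf big_map; apply: eq_bigr => w _; rewrite padE.
rewrite sE in z *.
apply: (@kernel_words (\max_(w <- map pad ws) dims_weight (fdims w)).+1 s) => // w hw; split.
- case/mapP: hw => u hu ->; apply: bounded_cat.
    elim: u {hu} (hws u hu) => [|p u' IH] hg; first by exists 0%N.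
    have [[d hd] hg'] := (goodf_cons _ _).1 hg; apply/bounded_cons; split; last exact: IH.
    by exists d; exact: homog_bfam hd.
  exists 0%N => p /nseqP[-> _]; split; last by move=> ? _; exact: wbound1.
  by split=> [? _|? ? _ _]; [move=> t _ _; exact: rmorph1|exact: rmorph1].
- case/mapP: hw => u hu ->; rewrite size_cat size_nseq subnKC // /s ltnW // ltnS.
  by rewrite (big_rem _ hu) /= leq_maxl.
by rewrite ltnS (big_rem _ hw) /= leq_maxl.
Qed.

End Kernel.

Theorem theorem1p5 (k : comNzRingType) (Q : quiver) :
  (forall a : Afam k Q, inAlim a <-> subring_gen (@isFMO k Q) a) /\
  (forall v : dimvec Q,
    (forall b : Aloc k v, inA b <-> exists2 a : Afam k Q, inAlim a & a v = b) /\
    (forall a : Afam k Q,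
       inKer v a <->
       ideal_gen (@inAlim k Q) (fun g => isFMO g /\ inKer v g) a)).
Proof.
split=> [a|v]; first exact: inAlim_subring_gen.
by split=> [b|a]; [exact: inA_inAlim|exact: inKer_ideal].
Qed.
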